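(* Let $R>0$ and let $\Omega=\mathcal B_R$, so that $\mathcal H$ is the magnetic Neumann Laplacian on the exterior $\mathcal B_R^{\mathrm{ext}}$ of the disk of radius $R$. Then for every $b>0$ the ground state of $\mathcal H$ is non-radial. Moreover, for every integer $k\ge 1$, $$\lambda_k(b,\mathcal B_R^{\mathrm{ext}})=b-\frac{R^{2k}}{2^{k-1}(k-1)!}\,b^{k+1}+\mathcal O\bigl(b^{k+\frac32}\bigr)\qquad (b\to0^+).$$
   Context: $\mathcal B_R=\{x\in\mathbb R^2:|x|<R\}$ and, for a bounded simply connected domain $\Omega\subset\mathbb R^2$ with $C^\infty$-smooth boundary and outer unit normal $\nu$, $\Omega^{\mathrm{ext}}=\mathbb R^2\setminus\overline\Omega$. Let $\mathbf A(x)=\frac12(-x_2,x_1)^\top$ and $b>0$. Put $H^1_{\mathbf A}(\Omega^{\mathrm{ext}})=\{u\in L^2(\Omega^{\mathrm{ext}}):(-\mathrm i\nabla-b\mathbf A)u\in [L^2(\Omega^{\mathrm{ext}})]^2\}$ and $\mathsf q_b(u)=\int_{\Omega^{\mathrm{ext}}}|(-\mathrm i\nabla-b\mathbf A)u|^2\,\mathrm dx$ for $u\in H^1_{\mathbf A}(\Omega^{\mathrm{ext}})$. The magnetic Neumann Laplacian $\mathcal H$ in $L^2(\Omega^{\mathrm{ext}})$ is the self-adjoint operator associated with $\mathsf q_b$, i.e. $\mathcal Hu=(-\mathrm i\nabla-b\mathbf A)^2u$ with domain $\{u\in H^1_{\mathbf A}(\Omega^{\mathrm{ext}}):(-\mathrm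 i\nabla-b\mathbf A)^2u\in L^2(\Omega^{\mathrm{ext}}),\ \nu\cdot(\nabla-\mathrm ib\mathbf A)u=0\text{ on }\partial\Omega\}$. Its essential spectrum is $\{(2n-1)b:n\in\mathbb N\}$, and its spectrum below $b$ consists of an infinite sequence of discrete eigenvalues $\lambda_1(b,\Omega^{\mathrm{ext}})\le\lambda_2(b,\Omega^{\mathrm{ext}})\le\dots<b$, counted with multiplicity, given by the min-max principle $\lambda_k(b,\Omega^{\mathrm{ext}})=\inf_{M\subset H^1_{\mathbf A}(\Omega^{\mathrm{ext}}),\,\dim M=k}\ \max_{u\in M\setminus\{0\}}\mathsf q_b(u)/\|u\|^2_{L^2(\Omega^{\mathrm{ext}})}$. A ground state is an eigenfunction of $\mathcal H$ for the eigenvalue $\lambda_1(b,\Omega^{\mathrm{ext}})$; it is non-radial if it is not a function of $|x|$ only. *)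

(* Defs.v *)
From mathcomp Require Import all_boot all_order all_algebra.
From mathcomp Require Import all_classical all_reals all_analysis.
From mathcomp Require Import complex.

Set Implicit Arguments.
Unset Strict Implicit.
Unset Printing Implicit Defensive.

Import Order.TTheory GRing.Theory Num.Theory.
Import numFieldNormedType.Exports.

Local Open Scope classical_set_scope.
Local Open Scope ring_scope.
Local Open Scope complex_scope.

(* The library's norm on [R * R] is the max norm; it is used below only through
   the topology it induces.  The Euclidean norm is [enorm]. *)
Definition enorm (R : realType) (x : R * R) : R :=
  Num.sqrt (x.1 ^+ 2 + x.2 ^+ 2).

Definition disk (R : realType) (r : R) : set (R * R) := [set x | enorm x < r].

Definition exterior (R : realType) (Om : set (R * R)) : set (R * R) :=
  ~` closure Om.

Section MagneticNeumann.
Variable R : realType.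

Local Notation point := (R * R)%type.
Local Notation mu := (@lebesgue_measure R \x @lebesgue_measure R)%E.

Definition basis_vec (j : 'I_2) : point := if j == 0 then (1, 0) else (0, 1).

Definition pderiv (j : 'I_2) (f : point -> R) : point -> R :=
  'D_(basis_vec j) f.

(* C^oo: all iterated partial derivatives, of any order and in any sequence of
   directions, exist everywhere and are continuous. *)
Definition smooth (f : point -> R) : Prop :=
  forall w : seq 'I_2, let g := foldr pderiv f w in
    continuous g /\ forall j x, derivable g x (basis_vec j).

Definition test_function (D : set point) (phi : point -> R) : Prop :=
  let supp := closure [set x | phi x != 0] in
  [/\ smooth phi, compact supp & supp `<=` D].

Definition sqnormC (z : R[i]) : R := complex.Re z ^+ 2 + complex.Im z ^+ 2.

Definition cintegral (D : set point) (f : point -> R[i]) : R[i] :=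
  (\int[mu]_(x in D) complex.Re (f x)) +i* (\int[mu]_(x in D) complex.Im (f x)).

(* Elements of L^2(D) are represented by functions; they are identified when
   equal almost everywhere on D, see [ae_zero]. *)
Definition L2 (D : set point) (u : point -> R[i]) : Prop :=
  [/\ measurable_fun D (fun x => complex.Re (u x)),
      measurable_fun D (fun x => complex.Im (u x)) &
      mu.-integrable D (fun x => (sqnormC (u x))%:E)].

Definition ae_zero (D : set point) (u : point -> R[i]) : Prop :=
  {ae mu, forall x, D x -> u x = 0}.

Definition L2inner (D : set point) (u v : point -> R[i]) : R[i] :=
  cintegral D (fun x => u x * (v x)^*).

Definition L2sqnorm (D : set point) (u : point -> R[i]) : R :=
  \int[mu]_(x in D) sqnormC (u x).

(* A(x) = (1/2) (- x_2, x_1) *)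
Definition vecpot (j : 'I_2) (x : point) : R :=
  if j == 0 then - x.2 / 2 else x.1 / 2.

(* (- i d_j - b A_j) u = v in the sense of distributions on D.  The derivative
   is moved onto the test function, whence the sign of the term in i; real test
   functions suffice by linearity. *)
Definition weak_momentum (D : set point) (b : R) (j : 'I_2)
    (u v : point -> R[i]) : Prop :=
  forall phi, test_function D phi ->
    cintegral D (fun x => u x * ('i * (pderiv j phi x)%:C
                                 - (b * vecpot j x * phi x)%:C))
    = cintegral D (fun x => v x * (phi x)%:C).

Definition H1A (D : set point) (b : R) (u : point -> R[i]) : Prop :=
  L2 D u /\ forall j, exists v, L2 D v /\ weak_momentum D b j u v.

(* (- i d_j - b A_j) u as an L^2 function, for u in [H1A D b]; it is determined
   up to equality almost everywhere on D. *)
Definition momentum (D : set point) (b : R) (j : 'I_2) (u : point -> R[i]) :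
    point -> R[i] :=
  @xget (point -> R[i])%type (fun=> 0)
    [set v | L2 D v /\ weak_momentum D b j u v].

Definition qform (D : set point) (b : R) (u : point -> R[i]) : R :=
  \sum_(j < 2) L2sqnorm D (momentum D b j u).

Definition qform_polar (D : set point) (b : R) (u v : point -> R[i]) : R[i] :=
  \sum_(j < 2) L2inner D (momentum D b j u) (momentum D b j v).

(* [magnetic_neumann D b u f]: u belongs to the domain of the self-adjoint
   operator H associated with the closed form [qform D b], and H u = f (first
   representation theorem; the Neumann condition is the natural boundary
   condition of the form). *)
Definition magnetic_neumann (D : set point) (b : R) (u f : point -> R[i]) :
    Prop :=
  [/\ H1A D b u, L2 D f &
      forall v, H1A D b v -> qform_polar D b u v = L2inner D f v].

(* M is a complex linear space of functions whose image in L^2(D) has dimension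
   k: it is spanned by k functions independent modulo null sets of D. *)
Definition subspace_of_dim (D : set point) (k : nat)
    (M : set (point -> R[i])) : Prop :=
  exists w : 'I_k -> point -> R[i],
    (forall c : 'I_k -> R[i],
       ae_zero D (fun x => \sum_(i < k) c i * w i x) -> forall i, c i = 0) /\
    M = range (fun (c : 'I_k -> R[i]) (x : point) => \sum_(i < k) c i * w i x).

Definition rayleigh (D : set point) (b : R) (u : point -> R[i]) : R :=
  qform D b u / L2sqnorm D u.

(* Min-max values.  For 1 <= k the inner supremum is a maximum over a nonempty
   bounded set because M is finite-dimensional, and the infimum is over a
   nonempty set bounded below by 0. *)
Definition lambda (D : set point) (b : R) (k : nat) : R :=
  inf [set s | exists M : set (point -> R[i]),
    [/\ M `<=` H1A D b, subspace_of_dim D k M &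
        s = sup [set rayleigh D b u | u in M `\` ae_zero D]]].

Definition ground_state (D : set point) (b : R) (u : point -> R[i]) : Prop :=
  ~ ae_zero D u /\
  magnetic_neumann D b u (fun x => (lambda D b 1)%:C * u x).

Definition radial (D : set point) (u : point -> R[i]) : Prop :=
  exists g : R -> R[i], {ae mu, forall x, D x -> u x = g (enorm x)}.

End MagneticNeumann.

(* Main.v *)
(* Write a = r^2, s = |x|^2 and D for the exterior domain s > a. In D, decompose u
   into angular modes f_m(s) e^(i m t), m in Z. The form becomes a sum of the
   one-dimensional energies
     E_m(f) = \int_a^oo (4 s f'^2 + (m - b s / 2)^2 f^2 / s) ds,
   and its density is b f^2 plus a square plus (2 (m - b s / 2) f^2)'. Hence
   E_m(f) >= b \int f^2 whenever m <= b a / 2, in particular for radial functions,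
   while for m > b a / 2 only the boundary term - 2 (m - b a / 2) f(a)^2 can lower
   the energy. The trace f(a) is controlled by the square and by eps \int f^2 with
   eps = 2 b (b a / 2)^k / (k - 1)! (1 + O(sqrt b)) when m >= k, and without the
   second term when f is orthogonal to the Landau state s^(m/2) e^(- b s / 4). So
   k - 1 orthogonality conditions force q(u) >= (b - eps) |u|^2, which is the lower
   bound in the min-max principle. The upper bound comes from the span of
   z^m (1 + a^m |x|^(-2m)) e^(- b |x|^2 / 4), 1 <= m <= k. The single function
   z^m e^(- b |x|^2 / 4) with m > b a / 2 shows lambda_1 < b, whence a ground state
   cannot be radial. *)
From HB Require Import structures.
From mathcomp Require Import all_boot all_order all_algebra.
From mathcomp Require Import all_classical all_reals all_analysis measurable_realfun.
From mathcomp Require Import complex ring lra.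
Require Import Defs.
Set Implicit Arguments.
Unset Strict Implicit.
Unset Printing Implicit Defensive.
Import Order.TTheory GRing.Theory Num.Theory.
Import numFieldNormedType.Exports.
Local Open Scope classical_set_scope.
Local Open Scope ring_scope.

(** * Change of variables and polar coordinates *)

Section pointwise_derivatives.
Context {R : realType}.
Implicit Types (f g : R -> R) (x a b c : R).

(** Elements of the form domain are only weakly differentiable, so no eigenvalue equation is solved
    and no special function appears. Each angular mode is reached by testing the weak momentum with
    z^m times a cutoff in |x|^2. Only then does it get an absolutely continuous representative,
    whose value at a is the trace. Parseval's identity on circles reassembles the modes.

    The trace f(a) is minus the integral of (f s)' for a weight with s(a) = 1. This weight is the
    reciprocal of the Landau state, cut down by e^(-t) times a partial sum of the exponential
    series, where t = b x / 2. The square in the energy then pays the integral of s^2 / (4 x), which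
    is about 1 / (4 m). Since the boundary term has weight about 2 m, this uses one half of the
    budget; to leading order, eps is the number for which the other half is exactly used when m = k.
    The relative error is sqrt b rather than b because of slowly decaying weights: already for m = 1
    the factor (a / x)^m leaves no room for a full power of x. *)

Lemma is_derive_congr f x a b : is_derive x 1 f a -> a = b -> is_derive x 1 f b.
Proof. by move=> ? <-. Qed.

Lemma is_derive_near f g x a : (\near x, f x = g x) -> is_derive x 1 f a ->
  is_derive x 1 g a.
Proof.
move=> fg [df <-]; split; first exact: near_eq_derivable fg df.
by apply/esym; exact: near_eq_derive.
Qed.

Lemma is_derive_continuous f x a : is_derive x 1 f a -> {for x, continuous f}.
Proof.
by move=> df; apply/differentiable_continuous/derivable1_diffP/ex_derive.
Qed.

Lemma der_cst c x : is_derive x 1 (fun _ : R => c) 0.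
Proof. exact: is_derive_cst. Qed.

Lemma der_id x : is_derive x 1 (fun t : R => t) 1.
Proof. exact: is_derive_id. Qed.

Lemma der_add f g x a b : is_derive x 1 f a -> is_derive x 1 g b ->
  is_derive x 1 (fun t => f t + g t) (a + b).
Proof. by move=> df dg; exact: is_deriveD. Qed.

Lemma der_opp f x a : is_derive x 1 f a -> is_derive x 1 (fun t => - f t) (- a).
Proof. by move=> df; exact: is_deriveN. Qed.

Lemma der_sub f g x a b : is_derive x 1 f a -> is_derive x 1 g b ->
  is_derive x 1 (fun t => f t - g t) (a - b).
Proof. by move=> df dg; apply: der_add => //; exact: der_opp. Qed.

Lemma der_mul f g x a b : is_derive x 1 f a -> is_derive x 1 g b ->
  is_derive x 1 (fun t => f t * g t) (a * g x + f x * b).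
Proof.
move=> df dg; apply: (is_derive_congr (is_deriveM df dg)).
by rewrite /GRing.scale/= addrC [g x * a]mulrC.
Qed.

Lemma der_scale c f x a : is_derive x 1 f a -> is_derive x 1 (fun t => c * f t) (c * a).
Proof.
move=> df; apply: (is_derive_congr (der_mul (der_cst c x) df)); by rewrite mul0r add0r.
Qed.

Lemma der_scaler c f x a : is_derive x 1 f a -> is_derive x 1 (fun t => f t * c) (a * c).
Proof.
by move=> df; apply: (is_derive_congr (der_mul df (der_cst c x))); rewrite mulr0 addr0.
Qed.

Lemma der_comp f g x a b : is_derive x 1 f a -> is_derive (f x) 1 g b ->
  is_derive x 1 (fun t => g (f t)) (a * b).
Proof.
move=> df dg; have := @is_derive1_comp _ g f x b a dg df.
by rewrite mulrC.
Qed.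

Lemma der_expn f x a n : is_derive x 1 f a ->
  is_derive x 1 (fun t => f t ^+ n) (n%:R * f x ^+ n.-1 * a).
Proof.
move=> df; elim: n => [|n IH].
  by rewrite mul0r mul0r; under eq_fun do rewrite expr0; exact: der_cst.
under eq_fun do rewrite exprS.
apply: (is_derive_congr (der_mul df IH)); rewrite /=.
case: n {IH} => [|n]; first by rewrite !expr0; ring.
by rewrite /= [f x ^+ n.+1]exprS -!natr1; ring.
Qed.

Lemma der_inv f x a : f x != 0 -> is_derive x 1 f a ->
  is_derive x 1 (fun t => (f t)^-1) (- a / (f x) ^+ 2).
Proof.
move=> fx0 df; apply: (is_derive_congr (is_deriveV fx0 df)).
by rewrite /GRing.scale/= !mulNr mulrC.
Qed.

Lemma der_expR f x a : is_derive x 1 f a ->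
  is_derive x 1 (fun t => expR (f t)) (a * expR (f x)).
Proof. by move=> df; apply: (der_comp df); exact: is_derive_expR. Qed.

Lemma der_ln f x a : 0 < f x -> is_derive x 1 f a ->
  is_derive x 1 (fun t => ln (f t)) (a / f x).
Proof. by move=> fx df; apply: (der_comp df); exact: is_derive1_ln. Qed.

Lemma der_sqrt f x a : 0 < f x -> is_derive x 1 f a ->
  is_derive x 1 (fun t => Num.sqrt (f t)) (a / (2 * Num.sqrt (f x))).
Proof. by move=> fx df; apply: (der_comp df); exact: is_derive1_sqrt. Qed.

Lemma der_sin f x a : is_derive x 1 f a -> is_derive x 1 (fun t => sin (f t)) (a * cos (f x)).
Proof. by move=> df; apply: (der_comp df); exact: is_derive_sin. Qed.

Lemma der_cos f x a : is_derive x 1 f a -> is_derive x 1 (fun t => cos (f t)) (- a * sin (f x)).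
Proof.
move=> df; apply: (is_derive_congr (der_comp df (is_derive_cos (f x)))).
by rewrite mulrN mulNr.
Qed.

End pointwise_derivatives.

(** * Measures with a nonnegative density *)

Section density.
Local Open Scope ereal_scope.
Context d (T : measurableType d) (R : realType) (mu : {measure set T -> \bar R}).
Variable g : T -> R.
Hypothesis mg : measurable_fun setT g.
Hypothesis g_ge0 : forall x, (0 <= g x)%R.

(** The two proofs are arguments so that the measure structure, which depends on them, can be
    recovered from the term itself. *)
Definition density of measurable_fun setT g & (forall x, (0 <= g x)%R) :=
  fun A : set T => \int[mu]_(x in A) (g x)%:E.

Local Notation nu := (density mg g_ge0).

Let density0 : nu set0 = 0.
Proof. exact: integral_set0. Qed.

Let density_ge0 A : 0 <= nu A.
Proof. by apply: integral_ge0 => x _; rewrite lee_fin. Qed.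

Let density_sigma_additive : semi_sigma_additive nu.
Proof.
move=> /= A mA tA mUA; rewrite /density/= ge0_integral_bigcup//=.
- apply: is_cvg_ereal_nneg_natsum_cond => n _ _; exact: density_ge0.
- by apply/measurable_EFinP; exact: measurable_funTS.
- by move=> x _; rewrite lee_fin.
Qed.

HB.instance Definition _ := isMeasure.Build _ _ _ nu
  density0 density_ge0 density_sigma_additive.

Import HBNNSimple.

(** Monotone convergence reduces the claim to simple functions, and linearity to multiples of
    indicators, for which both sides integrate [g] over the set. *)
Lemma ge0_integral_density (f : T -> \bar R) :
  measurable_fun setT f -> (forall x, 0 <= f x) ->
  \int[nu]_x f x = \int[mu]_x (f x * (g x)%:E).
Proof.
move=> mf f0.
have mg' : measurable_fun setT (EFin \o g) by apply/measurable_EFinP.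
pose h := nnsfun_approx measurableT mf.
have -> : \int[nu]_x f x = lim (\int[nu]_x (EFin \o h n) x @[n --> \oo]).
  have fE x : setT x -> f x = lim ((EFin \o h n) x @[n --> \oo]).
    by move=> Ex; apply/esym/cvg_lim => //; exact: cvg_nnsfun_approx.
  under eq_integral => x /[!inE] /fE -> //.
  apply: monotone_convergence => //.
  - by move=> n; apply/measurable_EFinP.
  - by move=> n x Ex //=; rewrite lee_fin.
  - by move=> x Ex a b ab; rewrite lee_fin; exact/lefP/nd_nnsfun_approx.
have -> : \int[mu]_x (f x * (g x)%:E) =
    lim (\int[mu]_x ((EFin \o h n) x * (g x)%:E) @[n --> \oo]).
  have fg x : setT x -> f x * (g x)%:E = lim (((EFin \o h n) x * (g x)%:E) @[n --> \oo]).
    by move=> Ex; apply/esym/cvg_lim => //; apply: cvgeZr => //;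
      exact: cvg_nnsfun_approx.
  under eq_integral => x /[!inE] /fg -> //.
  apply: monotone_convergence => [//| | |].
  - by move=> n; apply/emeasurable_funM => //; exact/measurable_EFinP.
  - by move=> n x Ex /=; rewrite mule_ge0 ?lee_fin ?f_ge0.
  - by move=> x Ex a b ab/=; rewrite lee_wpmul2r ?lee_fin//;
      exact/lefP/nd_nnsfun_approx.
suff suf n : \int[mu]_x ((EFin \o h n) x * (g x)%:E) =
    \int[nu]_x (EFin \o h n) x.
  by under [in RHS]eq_fun do rewrite suf.
transitivity (\int[nu]_x
   (\sum_(y \in range (h n)) (y * \1_(h n @^-1` [set y]) x)%:E)); last first.
  by apply: eq_integral => t tE; rewrite /= fimfunE -fsumEFin.
have indich m r : measurable_fun setT (fun x => (r * \1_(h m @^-1` [set r]) x)%:E).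
  by apply: (measurable_comp measurableT) => //; exact: measurable_funM.
rewrite ge0_integral_fsum//; last by move=> m y Ey; exact: nnfun_muleindic_ge0.
transitivity (\int[mu]_x (\sum_(y \in range (h n))
    (y * \1_(h n @^-1` [set y]) x)%:E * (g x)%:E)).
  under [RHS]eq_integral => x xE.
    rewrite -ge0_mule_fsuml => [|y]; last exact: nnfun_muleindic_ge0.
    rewrite fsumEFin // -(fimfunE _ x); over.
  by [].
rewrite ge0_integral_fsum//; last 2 first.
  - by move=> y; apply: emeasurable_funM.
  - by move=> m y Ey; rewrite mule_ge0 ?lee_fin//; exact: nnfun_muleindic_ge0.
apply: eq_fsbigr => r rhn.
under [RHS]eq_integral do rewrite EFinM.
rewrite integralZl_indic_nnsfun => //.
under eq_integral do rewrite EFinM -muleA.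
rewrite ge0_integralZl//.
- under eq_integral do rewrite muleC.
  rewrite (eq_integral ((EFin \o g) \_ (h n @^-1` [set r]))); last first.
    by move=> x xE; rewrite epatch_indic.
  by rewrite -integral_mkcondr setTI integral_indic// setIT.
- by apply: emeasurable_funM => //; exact/measurable_EFinP.
- by move=> t Et; rewrite mule_ge0 ?lee_fin.
- by move: rhn; rewrite inE => -[t _ <-]; rewrite lee_fin.
Qed.

End density.

(** * Fundamental theorem of calculus and substitution on the line *)

Section calculus.
Context {R : realType}.
Local Notation leb := (@lebesgue_measure R).
Implicit Types (F f phi : R -> R) (a b x t : R).

Lemma FTC2_cc F f a b : a < b ->
  (forall t, a <= t <= b -> is_derive t 1 F (f t)) ->
  (forall t, a <= t <= b -> {for t, continuous f}) ->
  (\int[leb]_(x in `[a, b]) (f x)%:E = (F b - F a)%:E)%E.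
Proof.
move=> ab dF cf.
have cF t : a <= t <= b -> {for t, continuous F}.
  move=> /dF tF; apply/differentiable_continuous/derivable1_diffP.
  exact: ex_derive.
rewrite EFinB (@continuous_FTC2 _ f F a b)//.
- apply: continuous_in_subspaceT => x; rewrite inE/= in_itv/=; exact: cf.
- split.
  + by move=> t; rewrite in_itv/= => /andP[? ?]; apply: ex_derive; apply: dF;
      rewrite !ltW.
  + by apply: cvg_at_right_filter; apply: cF; rewrite lexx ltW.
  + by apply: cvg_at_left_filter; apply: cF; rewrite lexx ltW.
- move=> t; rewrite in_itv/= => /andP[? ?]; rewrite derive1E.
  by have /@derive_val -> : is_derive t 1 F (f t) by apply: dF; rewrite !ltW.
Qed.

Lemma FTC2_oc F f a b : a <= b ->
  (forall t, a <= t <= b -> is_derive t 1 F (f t)) ->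
  (forall t, a <= t <= b -> {for t, continuous f}) ->
  (\int[leb]_(x in `]a, b]) (f x)%:E = (F b - F a)%:E)%E.
Proof.
rewrite le_eqVlt => /predU1P[<- _ _|ab dF cf].
  by rewrite set_itvoc0 integral_set0 subrr.
rewrite integral_itv_obnd_cbnd ?(FTC2_cc ab dF cf)//.
apply/measurable_EFinP; apply: subspace_continuous_measurable_fun => //.
apply: continuous_in_subspaceT => x; rewrite inE/= in_itv/= => /andP[? ?].
by apply: cf; rewrite [a <= x]ltW.
Qed.

(** Half-open intervals are stable under intersection, generate the Borel sets and exhaust the line,
    so two measures that are finite and equal on them coincide. *)
Lemma eq_integral_ocitv (m1 m2 : {measure set (measurableTypeR R) -> \bar R})
    (h : R -> \bar R) :
  (forall a b, m1 `]a, b]%classic = m2 `]a, b]%classic) ->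
  (forall a b, (m1 `]a, b]%classic < +oo)%E) ->
  (\int[m1]_x h x = \int[m2]_x h x)%E.
Proof.
move=> m12 m1oo; apply: eq_measure_integral => A mA _.
have H := @measure_unique _ R (measurableTypeR R) (@ocitv R)
  (fun k : nat => `](- k%:R), k%:R]%classic : set R) erefl _ _ _ m1 m2 _ _ A mA.
apply: H => //.
- move=> _ _ [x _ <-] [y _ <-]; exists (Num.max x.1 y.1, Num.min x.2 y.2) => //.
  rewrite /= predeqE => z; rewrite /= !in_itv/= le_min gt_max.
  by split; [case/andP => /andP[-> ->] /andP[-> ->]|
    case=> /andP[-> ->] /andP[-> ->]].
- by move=> i; exists (- i%:R, i%:R).
- rewrite -subTset => x _; have := archi_boundP (normr_ge0 x).
  set n := Num.bound _ => xn; exists n => //=; rewrite in_itv/=.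
  by move: xn; rewrite ltr_norml => /andP[-> /ltW].
- by move=> _ [[x y] _ <-] /=.
Qed.

(** Both sides integrate [h]: against Lebesgue measure restricted to the image, and against the
    image under [phi] of the measure with density [phi']. By the fundamental theorem of calculus
    these measures agree on half-open intervals, so no continuity of [h] enters. *)
Lemma ge0_subst_oc phi phi' al be (h : R -> \bar R) : al < be ->
  (forall t, al <= t <= be -> is_derive t 1 phi (phi' t)) ->
  (forall t, al <= t <= be -> {for t, continuous phi'}) ->
  (forall t, al <= t <= be -> 0 <= phi' t) ->
  {in `[al, be] &, {mono phi : x y / x < y}} ->
  measurable_fun setT phi -> measurable_fun setT phi' ->
  measurable_fun setT h -> (forall x, 0 <= h x)%E ->
  (\int[leb]_(x in `]phi al, phi be]) h x =
   \int[leb]_(t in `]al, be]) (h (phi t) * (phi' t)%:E))%E.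
Proof.
move=> albe dphi cphi' phi'0 mphi mp mp' mh h0.
pose g := phi' \_ `]al, be]%classic.
have mg : measurable_fun setT g.
  by apply/(measurable_restrictT phi') => //; exact: measurable_funTS.
have g0 x : 0 <= g x.
  rewrite /g patchE; case: ifPn => // /set_mem/=; rewrite in_itv/= => /andP[? ?].
  by apply: phi'0; rewrite ltW.
pose nu := pushforward (density leb mg g0) (phi : _ -> measurableTypeR R).
have -> : (\int[leb]_(t in `]al, be]) (h (phi t) * (phi' t)%:E) =
           \int[nu]_x h x)%E.
  rewrite ge0_integral_pushforward// preimage_setT ge0_integral_density//=.
  - rewrite integral_mkcond; apply: eq_integral => x _.
    by rewrite /g !patchE; case: ifPn => //; rewrite mule0.
  - exact: measurableT_comp.
rewrite integral_mkcond.
pose B : set R := `]phi al, phi be]%classic.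
have mB : measurable B by exact: measurable_itv.
have m1B : measurable_fun setT (\1_B : R -> R) by exact: measurable_indic.
have B0 x : 0 <= (\1_B x : R) by rewrite indicE.
have -> : (\int[leb]_x (h \_ `]phi al, phi be]) x = \int[density leb m1B B0]_x h x)%E.
  rewrite ge0_integral_density//; apply: eq_integral => x _.
  by rewrite -/B epatch_indic.
pose nuM : {measure set (measurableTypeR R) -> \bar R} :=
  measure_function_pushforward__canonical__measure_function_Measure (density leb mg g0) (mp : measurable_fun setT (phi : measurableTypeR R -> measurableTypeR R)).
apply: (eq_integral_ocitv (m1 := density leb m1B B0 : {measure set (measurableTypeR R) -> \bar R}) (m2 := nuM)) => x y.
- rewrite /= /density integral_indic//= /pushforward/= /density.
  suff E : leb (B `&` `]x, y]) =
      (\int[leb]_(t in phi @^-1` `]x, y]) (g t)%:E)%E by exact: E.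
  transitivity (\int[leb]_(t in phi @^-1` `]x, y] `&` `]al, be]) (phi' t)%:E)%E; last first.
    rewrite integral_mkcondr; apply: eq_integral => t _.
    by rewrite restrict_EFin.
  rewrite setIC.
  have mle : {in `[al, be] &, {mono phi : x y / x <= y}} by move=> s t si ti; rewrite !leNgt mphi.
  have ai : al \in `[al, be] by rewrite in_itv/= lexx ltW.
  have bi : be \in `[al, be] by rewrite in_itv/= lexx ltW.
  have BE : `]x, y]%classic `&` B =
      `](Num.max x (phi al)), (Num.min y (phi be))]%classic.
    rewrite predeqE => z; rewrite /B/= !in_itv/= le_min gt_max.
    by split; [case=> /andP[-> ->] /andP[-> ->]|
      case/andP => /andP[-> ->] /andP[-> ->]].
  have [y'x'|] := leP (Num.min y (phi be)) (Num.max x (phi al)).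
    rewrite [X in leb X](_ : _ = set0) ?measure0; last first.
      by rewrite BE set_itv_ge// bnd_simp -leNgt.
    rewrite [X in integral _ X](_ : _ = set0) ?integral_set0//.
    rewrite -subset0 => t []/=; rewrite !in_itv/= => /andP[xt ty] /andP[at1 tb].
    have ti : t \in `[al, be] by rewrite in_itv/= tb ltW.
    have : Num.max x (phi al) < Num.min y (phi be).
      apply: (@lt_le_trans _ _ (phi t)).
        by rewrite gt_max xt mphi.
      by rewrite le_min ty mle.
    by rewrite ltNge y'x'.
  set x' := Num.max _ _; set y' := Num.min _ _ => x'y'.
  have cphi : {within `[al, be], continuous phi}.
    apply: continuous_in_subspaceT => t; rewrite inE/= in_itv/= => /dphi tF.
    by apply/differentiable_continuous/derivable1_diffP; exact: ex_derive.
  have phiab : phi al <= phi be by rewrite mle// ltW.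
  have x'B : phi al <= x' <= phi be.
    by rewrite /x' le_max lexx orbT/= (le_trans (ltW x'y'))// ge_min lexx orbT.
  have y'B : phi al <= y' <= phi be.
    by rewrite /y' ge_min lexx orbT andbT (le_trans _ (ltW x'y'))// le_max lexx orbT.
  (* The truncated endpoints lie in the range of [phi]; their preimages cut out the interval on
     which the fundamental theorem applies. *)
  have [t1 t1i t1E] : exists2 c, c \in `[al, be] & phi c = x'.
    apply: IVT => //; first exact: ltW.
    by rewrite (min_idPl phiab) (max_idPr phiab).
  have [t2 t2i t2E] : exists2 c, c \in `[al, be] & phi c = y'.
    apply: IVT => //; first exact: ltW.
    by rewrite (min_idPl phiab) (max_idPr phiab).
  have t12 : t1 < t2 by rewrite -(mphi t1 t2)// t1E t2E.
  have [t1a t1b] : al <= t1 /\ t1 <= be by move: t1i; rewrite in_itv/= => /andP.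
  have [t2a t2b] : al <= t2 /\ t2 <= be by move: t2i; rewrite in_itv/= => /andP.
  rewrite [X in integral _ X](_ : _ = `]t1, t2]%classic); last first.
    rewrite predeqE => t; rewrite /= !in_itv/=; split.
      move=> [/andP[xt ty]] /andP[at1 tb].
      have ti : t \in `[al, be] by rewrite in_itv/= tb ltW.
      rewrite -(mphi t1 t)// -(mle t t2)// t1E t2E /x' /y' gt_max le_min xt ty.
      by rewrite mphi// mle// at1.
    move=> /andP[t1t tt2].
    have ti : t \in `[al, be].
      by rewrite in_itv/= (le_trans t1a (ltW t1t)) (le_trans tt2 t2b).
    move: (t1t) (tt2); rewrite -(mphi t1 t)// -(mle t t2)// t1E t2E /x' /y'.
    rewrite gt_max le_min => /andP[-> _] /andP[-> _].
    by rewrite (le_lt_trans t1a t1t) (le_trans tt2 t2b).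
  have dF t : t1 <= t <= t2 -> is_derive t 1 phi (phi' t).
    by move=> /andP[tt1 tt2]; apply: dphi; rewrite (le_trans t1a)// (le_trans tt2).
  have cF t : t1 <= t <= t2 -> {for t, continuous phi'}.
    by move=> /andP[tt1 tt2]; apply: cphi'; rewrite (le_trans t1a)// (le_trans tt2).
  rewrite (FTC2_oc (ltW t12) dF cF) BE -/x' -/y' lebesgue_measure_itv/= lte_fin x'y'.
  by rewrite t1E t2E.
- rewrite /= /density integral_indic//.
  apply: (@le_lt_trans _ _ (leb (`]x, y] : set R))).
    by apply: le_measure; rewrite ?inE//; exact: measurableI.
  by rewrite /= lebesgue_measure_itv/=; case: ifPn => // _; rewrite -EFinD ltry.
Qed.

(** Exhaustion by half-open intervals and monotone convergence extend the substitution to open or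
    unbounded sets, where [phi'] may blow up at an end. *)
Lemma ge0_subst phi phi' (I K : set R) (al be : nat -> R) (h : R -> \bar R) :
  (forall n, al n < be n) ->
  {homo al : m n / (m <= n)%N >-> n <= m} ->
  {homo be : m n / (m <= n)%N >-> m <= n} ->
  (forall n t, al n <= t <= be n -> I t) ->
  (forall t, I t -> exists n, al n < t <= be n) ->
  (forall t, I t -> is_derive t 1 phi (phi' t)) ->
  (forall t, I t -> {for t, continuous phi'}) ->
  (forall t, I t -> 0 <= phi' t) ->
  (forall s t, I s -> I t -> (phi s < phi t) = (s < t)) ->
  (forall y, K y <-> exists2 t, I t & phi t = y) ->
  measurable_fun setT phi -> measurable_fun setT phi' ->
  measurable_fun setT h -> (forall x, 0 <= h x)%E ->
  (\int[leb]_(x in K) h x = \int[leb]_(t in I) (h (phi t) * (phi' t)%:E))%E.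
Proof.
move=> albe nial ndbe abI Iab dphi cphi' phi'0 mphi KE mp mp' mh h0.
have aI n : I (al n) by apply: (abI n); rewrite lexx ltW.
have bI n : I (be n) by apply: (abI n); rewrite lexx ltW.
have mle s t : I s -> I t -> (phi s <= phi t) = (s <= t).
  by move=> Is It; rewrite !leNgt mphi.
have IE : I = \bigcup_n `]al n, be n]%classic.
  rewrite predeqE => t; split.
    by move=> /Iab[n nt]; exists n => //=; rewrite in_itv.
  by move=> [n _ /=]; rewrite in_itv/= => /andP[tn tn']; apply: (abI n); rewrite ltW.
have KEE : K = \bigcup_n `](phi (al n)), (phi (be n))]%classic.
  rewrite predeqE => y; split.
    move=> /KE[t It <-]; have [n /andP[nt tn]] := Iab t It.
    by exists n => //=; rewrite in_itv/= mphi// mle// nt.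
  move=> [n _ /=]; rewrite in_itv/= => /andP[yn yn']; apply/KE.
  have phiab : phi (al n) <= phi (be n) by rewrite mle// ltW.
  have cphi : {within `[al n, be n], continuous phi}.
    apply: continuous_in_subspaceT => t; rewrite inE/= in_itv/= => /abI/dphi tF.
    by apply/differentiable_continuous/derivable1_diffP; exact: ex_derive.
  have [t tn ty] : exists2 c, c \in `[al n, be n] & phi c = y.
    apply: IVT => //; first exact: ltW.
    by rewrite (min_idPl phiab) (max_idPr phiab) yn' ltW.
  by exists t => //; apply: (abI n); move: tn; rewrite in_itv.
have E n : (\int[leb]_(x in `](phi (al n)), (phi (be n))]) h x =
   \int[leb]_(t in `]al n, be n]) (h (phi t) * (phi' t)%:E))%E.
  apply: ge0_subst_oc => //; [by move=> t /abI; auto..|].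
  by move=> s t; rewrite !in_itv/= => /abI si /abI ti; exact: mphi.
have mI : measurable I by rewrite IE; apply: bigcup_measurable.
have := @ge0_nondecreasing_set_cvg_integral _ (measurableTypeR R) R
  (fun n => `]al n, be n]%classic) (fun t => (h (phi t) * (phi' t)%:E)%E) leb.
rewrite -IE => cvI.
have := @ge0_nondecreasing_set_cvg_integral _ (measurableTypeR R) R
  (fun n => `](phi (al n)), (phi (be n))]%classic) h leb.
rewrite -KEE => cvK.
have -> : (\int[leb]_(t in I) (h (phi t) * (phi' t)%:E) =
  limn (fun n => \int[leb]_(t in `]al n, be n]) (h (phi t) * (phi' t)%:E)))%E.
  apply/esym/cvg_lim => //; apply: cvI => //.
  - move=> m n mn; apply/subsetPset => t /=; rewrite !in_itv/= => /andP[mt tm].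
    by rewrite (le_lt_trans (nial _ _ mn) mt) (le_trans tm (ndbe _ _ mn)).
  - move=> n; apply: measurable_funTS; apply: emeasurable_funM.
      exact: measurableT_comp.
    exact/measurable_EFinP.
  - move=> n t /=; rewrite in_itv/= => /andP[? ?]; apply: mule_ge0 => //.
    by rewrite lee_fin phi'0//; apply: (abI n); rewrite ltW.
apply/esym/cvg_lim => //; rewrite -(eq_cvg _ _ E); apply: cvK => //.
- move=> m n mn; apply/subsetPset => t /=; rewrite !in_itv/= => /andP[mt tm].
  rewrite (@le_lt_trans _ _ (phi (al m))) ?mle ?nial//=.
  by rewrite (le_trans tm)// mle// ndbe.
- by move=> n; exact: measurable_funTS.
Qed.

End calculus.

(** * Tonelli's theorem on rectangles and reflection of the line *)

Section polar.
Context {R : realType}.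
Local Notation leb := (@lebesgue_measure R).
Local Notation leb2 := (leb \x leb)%E.
Implicit Types (F : R * R -> \bar R) (A B : set R).

Lemma ge0_integral_setX A B F : measurable A -> measurable B ->
  measurable_fun setT F -> (forall x, 0 <= F x)%E ->
  (\int[leb2]_(z in A `*` B) F z = \int[leb]_(x in A) \int[leb]_(y in B) F (x, y))%E.
Proof.
move=> mA mB mF F0.
have mAB : measurable (A `*` B) by exact: measurableX.
rewrite integral_mkcond fubini_tonelli1; last 2 first.
- by apply/(measurable_restrictT F) => //; exact: measurable_funTS.
- by move=> z; rewrite patchE; case: ifPn.
rewrite [RHS]integral_mkcond; apply: eq_integral => x _.
rewrite /fubini_F patchE; case: ifPn => [/set_mem|/negP] xA.
  rewrite [RHS]integral_mkcond; apply: eq_integral => y _.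
  rewrite !patchE; congr (if _ then _ else _); apply/idP/idP.
    by move=> /set_mem[_ /=] ?; exact/mem_set.
  by move=> /set_mem ?; apply/mem_set.
apply: integral0_eq => y _; rewrite patchE; case: ifPn => // /set_mem[/= xA' _].
by case: xA; exact/mem_set.
Qed.

Lemma ge0_integral_setX_swap A B F : measurable A -> measurable B ->
  measurable_fun setT F -> (forall x, 0 <= F x)%E ->
  (\int[leb]_(x in A) \int[leb]_(y in B) F (x, y) =
   \int[leb]_(y in B) \int[leb]_(x in A) F (x, y))%E.
Proof.
move=> mA mB mF F0.
have mAB : measurable (A `*` B) by exact: measurableX.
rewrite -ge0_integral_setX// integral_mkcond fubini_tonelli2; last 2 first.
- by apply/(measurable_restrictT F) => //; exact: measurable_funTS.
- by move=> z; rewrite patchE; case: ifPn.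
rewrite [RHS]integral_mkcond; apply: eq_integral => y _.
rewrite /fubini_G patchE; case: ifPn => [/set_mem|/negP] yB.
  rewrite [RHS]integral_mkcond; apply: eq_integral => x _.
  rewrite !patchE; congr (if _ then _ else _); apply/idP/idP.
    by move=> /set_mem[? _]; exact/mem_set.
  by move=> /set_mem ?; apply/mem_set.
apply: integral0_eq => x _; rewrite patchE; case: ifPn => // /set_mem[/= _ yB'].
by case: yB; exact/mem_set.
Qed.

Lemma ge0_integralN A (h : R -> \bar R) : measurable A ->
  measurable_fun setT h -> (forall x, 0 <= h x)%E ->
  (\int[leb]_(x in A) h x = \int[leb]_(x in -%R @^-1` A) h (- x)%R)%E.
Proof.
move=> mA mh h0.
have mN : measurable_fun setT (-%R : measurableTypeR R -> measurableTypeR R).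
  exact: oppr_measurable.
have := @ge0_integral_pushforward _ _ _ _ _ _ mN leb A h mA
  (measurable_funTS mh) (fun x _ => h0 x).
move=> /= <-; apply/esym.
apply: eq_measure_integral => B mB _; exact: lebesgue_measureN.
Qed.

End polar.

(** * Polar coordinates in the plane *)

Section polar2.
Context {R : realType}.
Local Notation leb := (@lebesgue_measure R).
Local Notation leb2 := (leb \x leb)%E.
Implicit Types (F : R * R -> \bar R) (A B : set R).

(** Inversion is discontinuous at 0, so it is rewritten through [powR]; at 0 both expressions take
    the value 0. *)
Lemma measurable_invr : measurable_fun setT (fun x : R => x^-1).
Proof.
rewrite (_ : (fun x => _) = (fun x => x * (x ^+ 2) `^ (-1))); last first.
  apply/funext => x; rewrite powR_inv1 ?sqr_ge0// expr2 invfM mulrA.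
  by have [->|x0] := eqVneq x 0; rewrite ?invr0 ?mulr0// divff// mul1r.
apply: measurable_funM => //.
by apply: (measurableT_comp (measurable_powR (-1))).
Qed.

Lemma measurable_cos : measurable_fun setT (@cos R).
Proof. by apply: continuous_measurable_fun => x; exact: continuous_cos. Qed.

Lemma measurable_sin : measurable_fun setT (@sin R).
Proof. by apply: continuous_measurable_fun => x; exact: continuous_sin. Qed.

Lemma measurable_sqrt : measurable_fun setT (@Num.sqrt R).
Proof. by apply: continuous_measurable_fun => x; exact: sqrt_continuous. Qed.

Lemma measurable_tan : measurable_fun setT (@tan R).
Proof.
rewrite (_ : tan = fun x : R => sin x * (cos x)^-1)//.
apply: measurable_funM; first exact: measurable_sin.
exact: (measurableT_comp measurable_invr measurable_cos).
Qed.

(* The radial coordinate is the squared radius, so that the Jacobian is the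
   constant 1/2. Angles range over [- pi/2, 3 pi/2[, the union of two intervals
   on which [tan] is injective. *)
Definition polar_map (z : R * R) : R * R :=
  (Num.sqrt z.1 * cos z.2, Num.sqrt z.1 * sin z.2).

Lemma measurable_polar_map : measurable_fun setT polar_map.
Proof.
apply: measurable_fun_pair; apply: measurable_funM.
- exact: (measurableT_comp measurable_sqrt measurable_fst).
- exact: (measurableT_comp measurable_cos measurable_snd).
- exact: (measurableT_comp measurable_sqrt measurable_fst).
- exact: (measurableT_comp measurable_sin measurable_snd).
Qed.

Lemma measurable_integral_setX2 A F : measurable A ->
  measurable_fun setT F -> (forall x, 0 <= F x)%E ->
  measurable_fun setT (fun y => \int[leb]_(x in A) F (x, y))%E.
Proof.
move=> mA mF F0.
rewrite (_ : (fun y => _) = (fun y => \int[leb]_x (F \_ (A `*` setT)) (x, y))%E).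
  apply: measurable_fun_fubini_tonelli_G.
    apply/(measurable_restrictT F); first exact: measurableX.
    exact: measurable_funTS.
  by move=> z; rewrite patchE; case: ifPn.
apply/funext => y; rewrite integral_mkcond; apply: eq_integral => x _.
rewrite !patchE; congr (if _ then _ else _); apply/idP/idP.
  by move=> /set_mem ?; exact/mem_set.
by move=> /set_mem[? _]; apply/mem_set.
Qed.

Lemma lt_atan : {mono @atan R : x y / x < y}.
Proof.
move=> x y; rewrite -[in RHS](atanK x) -[in RHS](atanK y) ltr_tan//.
  by rewrite in_itv/= atan_gtNpi2 atan_ltpi2.
by rewrite in_itv/= atan_gtNpi2 atan_ltpi2.
Qed.

Lemma le_atan : {mono @atan R : x y / x <= y}.
Proof. by move=> x y; rewrite !leNgt lt_atan. Qed.

Local Notation I := (`](- (pi / 2)), (pi / 2)[%classic : set R).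

(** The intervals from [al n] to [be n] exhaust ]- pi / 2, pi / 2[. With arctangents of integers
    this is the Archimedean property applied to [tan t]. *)
Let al n : R := - atan n.+1%:R.
Let be n : R := atan n.+1%:R.

Let be_lt n : be n < pi / 2. Proof. exact: atan_ltpi2. Qed.

Let be_gt0 n : 0 < be n.
Proof. by rewrite /be -(@atan0 R) lt_atan ltr0n. Qed.

Let albe n : al n < be n.
Proof. by rewrite /al gtrN// be_gt0. Qed.

Let ndbe : {homo be : m n / (m <= n)%N >-> m <= n}.
Proof. by move=> m n mn; rewrite /be le_atan ler_nat. Qed.

Let nial : {homo al : m n / (m <= n)%N >-> n <= m}.
Proof. by move=> m n mn; rewrite /al lerN2; exact: ndbe. Qed.

Let abI n t : al n <= t <= be n -> I t.
Proof.
move=> /andP[nt tn]; rewrite /= in_itv/= (le_lt_trans tn)// andbT.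
by rewrite (lt_le_trans _ nt)// /al ltrN2 be_lt.
Qed.

Let Iab t : I t -> exists n, al n < t <= be n.
Proof.
rewrite /= => tI; have := archi_boundP (normr_ge0 (tan t)).
set n := Num.bound _ => tn; exists n.
have : `|tan t| < n.+1%:R by rewrite (lt_le_trans tn)// ler_nat.
rewrite ltr_norml => /andP[nt tn'].
by rewrite /al /be -atanN -(tanK tI) lt_atan le_atan nt ltW.
Qed.

Let cosI t : I t -> 0 < cos t.
Proof. by rewrite /= in_itv/=; exact: cos_gt0_pihalf. Qed.

(** On a vertical line of the right half-plane, at abscissa [x], the angle replaces the ordinate. *)
Lemma subst_tan (x : R) (h : R -> \bar R) : 0 < x ->
  measurable_fun setT h -> (forall y, 0 <= h y)%E ->
  (\int[leb]_y h y =
   \int[leb]_(t in I) (h (x * tan t)%R * (x * cos t ^- 2)%:E))%E.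
Proof.
move=> x0 mh h0.
apply: (@ge0_subst _ (fun t : R => x * tan t) (fun t : R => x * cos t ^- 2) I setT al be) => //.
- move=> t /cosI ct; have ct0 : cos t != 0 by rewrite gt_eqF.
  by have := @is_deriveZ _ _ _ _ x t 1 _ (is_derive_tan ct0).
- move=> t /cosI ct; apply: is_derive_continuous; apply: der_scale; apply: der_inv.
  by rewrite expf_eq0/= gt_eqF.
- by move=> t /cosI ct; rewrite mulr_ge0 ?ltW// invr_gt0 exprn_gt0.
- by move=> s t sI tI; rewrite ltr_pM2l// ltr_tan.
- move=> y; split=> // _; exists (atan (y / x)).
    by rewrite /= in_itv/= atan_gtNpi2 atan_ltpi2.
  by rewrite atanK mulrCA divff ?mulr1// gt_eqF.
- by apply: measurable_funM => //; exact: measurable_tan.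
- apply: measurable_funM => //; apply: (measurableT_comp measurable_invr).
  by apply: measurable_funX; exact: measurable_cos.
Qed.

Lemma subst_shift_pi (h : R -> \bar R) :
  measurable_fun setT h -> (forall y, 0 <= h y)%E ->
  (\int[leb]_(t in `](pi / 2)%R, (3 * pi / 2)%R[) h t = \int[leb]_(t in I) h (t + pi)%R)%E.
Proof.
move=> mh h0.
transitivity (\int[leb]_(t in I) (h (t + pi)%R * (1%:E)))%E; last first.
  by apply: eq_integral => t _; rewrite mule1.
apply: (@ge0_subst _ (fun t => t + pi) (fun=> 1) I _ al be) => //.
- by move=> t _; have := der_add (der_id t) (der_cst pi t); rewrite addr0.
- by move=> t _; exact: cvg_cst.
- by move=> s t _ _; rewrite ltrD2r.
- move=> y; rewrite /= in_itv/=; split.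
    move=> /andP[y1 y2]; exists (y - pi); last by rewrite subrK.
    rewrite in_itv/=; apply/andP; split; lra.
  by move=> [t]; rewrite in_itv/= => /andP[t1 t2] <-; apply/andP; split; lra.
- by apply: measurable_funD.
Qed.

(** On a ray the squared radius replaces the abscissa, [c] being the cosine of the angle. The
    Jacobian is singular at 0, hence the exhaustion by intervals from [n.+1%:R^-1] to [n.+2%:R]. *)
Lemma subst_sqrt (c : R) (h : R -> \bar R) : 0 < c ->
  measurable_fun setT h -> (forall y, 0 <= h y)%E ->
  (\int[leb]_(x in `]0%R, +oo[) h x =
   \int[leb]_(s in `]0%R, +oo[) (h (Num.sqrt s * c)%R * (c * (2 * Num.sqrt s)^-1)%:E))%E.
Proof.
move=> c0 mh h0.
have H0 n : 0 < n.+1%:R^-1 :> R by rewrite invr_gt0.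
apply: (@ge0_subst _ (fun s : R => Num.sqrt s * c) (fun s : R => c * (2 * Num.sqrt s)^-1) _ _
  (fun n => n.+1%:R^-1) (fun n => n.+2%:R)) => //.
- by move=> n; rewrite (@le_lt_trans _ _ 1) ?invf_le1 ?ltr1n// ler1n.
- by move=> m n mn; rewrite lef_pV2 ?posrE// ler_nat.
- by move=> m n mn; rewrite ler_nat.
- by move=> n t /andP[nt tn]; rewrite /= in_itv/= (lt_le_trans _ nt).
- move=> t; rewrite /= in_itv/= andbT => t0.
  have := archi_boundP (ltW t0); set n := Num.bound _ => tn.
  have := archi_boundP (ltW (eq_ind_r (fun x => 0 < x) t0 (invrK t))).
  have : 0 <= t^-1 by rewrite invr_ge0 ltW.
  move=> /archi_boundP; set m := Num.bound _ => tm _.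
  exists (maxn n m); apply/andP; split.
    rewrite invf_plt ?posrE// (lt_le_trans tm)// ler_nat.
    by rewrite (leq_trans (leq_maxr n m)).
  rewrite ltW// (lt_le_trans tn)// ler_nat.
  by rewrite (leq_trans (leq_maxl n m))// -addn2 leq_addr.
- move=> t; rewrite /= in_itv/= andbT => t0.
  have dt := der_sqrt t0 (der_id t).
  by apply: (is_derive_congr (der_scaler c dt)); rewrite mul1r mulrC.
- move=> t; rewrite /= in_itv/= andbT => t0; apply: is_derive_continuous.
  apply: der_scale; apply: der_inv; first by rewrite mulf_neq0// gt_eqF// sqrtr_gt0.
  by apply: der_scale; exact: der_sqrt t0 (der_id t).
- move=> t; rewrite /= in_itv/= andbT => t0.
  by rewrite mulr_ge0 ?ltW// invr_gt0 mulr_gt0// sqrtr_gt0.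
- move=> s t; rewrite /= !in_itv/= !andbT => s0 t0.
  by rewrite ltr_pM2r// ltr_sqrt.
- move=> y; rewrite /= in_itv/= andbT; split.
    move=> y0; exists ((y / c) ^+ 2).
      by rewrite /= in_itv/= exprn_gt0// divr_gt0.
    by rewrite sqrtr_sqr gtr0_norm ?divr_gt0// divfK// gt_eqF.
  move=> [t]; rewrite in_itv/= andbT => t0 <-.
  by rewrite mulr_gt0// sqrtr_gt0.
- by apply: measurable_funM => //; exact: measurable_sqrt.
- apply: measurable_funM => //; apply: (measurableT_comp measurable_invr).
  by apply: measurable_funM => //; exact: measurable_sqrt.
Qed.

(** The substitution y = x tan t at fixed x, and after an exchange of the integrals x = sqrt s cos t
    at fixed t, have Jacobians whose product is the constant 1 / 2. *)
Lemma halfplane_polar F : measurable_fun setT F -> (forall x, 0 <= F x)%E ->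
  (\int[leb]_(x in `]0%R, +oo[) \int[leb]_y F (x, y) =
   \int[leb]_(t in I) \int[leb]_(s in `]0%R, +oo[) (F (polar_map (s, t)) * (2^-1)%:E))%E.
Proof.
move=> mF F0.
(* The absolute value makes [G] nonnegative on the whole plane, as the exchange of the integrals
   demands. *)
pose G (z : R * R) : \bar R :=
  (F (z.1, z.1 * tan z.2)%R * (`|z.1| * cos z.2 ^- 2)%:E)%E.
have mG : measurable_fun setT G.
  apply: emeasurable_funM.
    apply: (measurableT_comp mF); apply: measurable_fun_pair => //.
    by apply: measurable_funM => //; exact: (measurableT_comp measurable_tan).
  apply/measurable_EFinP; apply: measurable_funM.
    exact: (measurableT_comp (@normr_measurable R setT)).
  apply: (measurableT_comp measurable_invr); apply: measurable_funX.
  exact: (measurableT_comp measurable_cos).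
have G0 z : (0 <= G z)%E.
  by apply: mule_ge0 => //; rewrite lee_fin mulr_ge0// invr_ge0 sqr_ge0.
transitivity (\int[leb]_(x in `]0%R, +oo[) \int[leb]_(t in I) G (x, t))%E.
  apply: eq_integral => x; rewrite inE/= in_itv/= andbT => x0.
  rewrite (subst_tan x0)//; last exact: measurableT_comp mF _.
  by apply: eq_integral => t _; rewrite /G/= gtr0_norm.
rewrite (ge0_integral_setX_swap (measurable_itv _) (measurable_itv _) mG G0).
apply: eq_integral => t /set_mem tI.
have ct := cosI tI.
rewrite (@subst_sqrt _ (fun x => G (x, t)) ct)//; last first.
  by apply: (measurableT_comp mG); exact: measurable_fun_pair.
apply: eq_integral => s; rewrite inE/= in_itv/= andbT => s0.
have ss : 0 < Num.sqrt s by rewrite sqrtr_gt0.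
rewrite /G/= /polar_map/= -muleA -EFinM; congr (F (_, _) * _%:E)%E.
  by rewrite /tan -!mulrA; congr (_ * _); rewrite mulrCA mulfV ?mulr1// gt_eqF.
rewrite gtr0_norm ?mulr_gt0//.
by field; rewrite !gt_eqF.
Qed.

Local Notation J := (`](- (pi / 2)), (3 * pi / 2)[%classic : set R).

(** Reflection through the origin maps the left half-plane onto the right one and adds pi to the
    angle, so the half-plane formula is used twice. The vertical axis and the angle pi / 2 are null
    sets. *)
Lemma ge0_polarT F : measurable_fun setT F -> (forall x, 0 <= F x)%E ->
  (\int[leb2]_z F z =
   \int[leb2]_(z in `]0%R, +oo[%classic `*` J) (F (polar_map z) * (2^-1)%:E))%E.
Proof.
move=> mF F0.
have mFN : measurable_fun setT (fun z : R * R => F (- z.1, - z.2)).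
  apply: (measurableT_comp mF); apply: measurable_fun_pair.
    exact: measurableT_comp.
  exact: measurableT_comp.
have mP : measurable_fun setT (fun z => F (polar_map z) * (2^-1)%:E)%E.
  apply: emeasurable_funM => //; exact: (measurableT_comp mF measurable_polar_map).
have P0 z : (0 <= F (polar_map z) * (2^-1)%:E)%E.
  by apply: mule_ge0 => //; rewrite lee_fin.
pose K x := (\int[leb]_y F (x, y))%E.
have K0 x : (0 <= K x)%E by exact: integral_ge0.
have mK : measurable_fun setT K by exact: measurable_fun_fubini_tonelli_F.
pose k t := (\int[leb]_(s in `]0%R, +oo[) (F (polar_map (s, t)) * (2^-1)%:E))%E.
have k0 t : (0 <= k t)%E by exact: integral_ge0.
have mk : measurable_fun setT k by exact: (measurable_integral_setX2 (measurable_itv _) mP P0).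
rewrite fubini_tonelli1//.
transitivity (\int[leb]_(x in `]-oo, 0%R]) K x + \int[leb]_(x in `]0%R, +oo[) K x)%E.
  rewrite -ge0_integral_setU//=.
  - by rewrite -itv_bndbnd_setU// set_itvNyy.
  - exact: measurable_funTS.
  - apply/disj_setPS => x [] /=; rewrite !in_itv/= => x0.
    by rewrite andbT ltNge x0.
have -> : (\int[leb]_(x in `]0%R, +oo[) K x = \int[leb]_(t in I) k t)%E.
  exact: halfplane_polar.
have -> : (\int[leb]_(x in `]-oo, 0%R]) K x = \int[leb]_(t in I) k (t + pi)%R)%E.
  rewrite -integral_itv_bndo_bndc; last exact: measurable_funTS.
  rewrite ge0_integralN//.
  rewrite [X in integral _ X](_ : _ = `]0, +oo[%classic); last first.
    by rewrite predeqE => x; rewrite /= !in_itv/= oppr_lt0 andbT.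
  transitivity (\int[leb]_(x in `]0%R, +oo[) \int[leb]_y F (- x, - y)%R)%E.
    apply: eq_integral => x _; rewrite /K ge0_integralN ?preimage_setT//.
    exact: measurableT_comp mF _.
  have FN0 z : (0 <= F (- z.1, - z.2)%R)%E by [].
  rewrite (halfplane_polar mFN FN0); apply: eq_integral => t _.
  apply: eq_integral => s _ /=.
  by rewrite /polar_map/= cosDpi sinDpi !mulrN.
rewrite -subst_shift_pi//.
rewrite (ge0_integral_setX (measurable_itv _) (measurable_itv _) mP P0).
rewrite (ge0_integral_setX_swap (measurable_itv _) (measurable_itv _) mP P0) -/k.
have -> : J = `](- (pi / 2)), (pi / 2)]%classic `|` `](pi / 2), (3 * pi / 2)[%classic.
  rewrite -itv_bndbnd_setU// bnd_simp; have := @pi_gt0 R; lra.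
rewrite ge0_integral_setU//=.
- rewrite addeC; congr (_ + _)%E.
  by rewrite -integral_itv_bndo_bndc//; exact: measurable_funTS.
- exact: measurable_funTS.
- by move=> x _; exact: k0.
- apply/disj_setPS => x [] /=; rewrite !in_itv/= => /andP[_ x0].
  by rewrite ltNge x0.
Qed.

Lemma polar_map_normsq (z : R * R) : 0 <= z.1 ->
  (polar_map z).1 ^+ 2 + (polar_map z).2 ^+ 2 = z.1.
Proof.
move=> z0; rewrite /polar_map/= !exprMn -mulrDr cos2Dsin2 mulr1.
by rewrite sqr_sqrtr.
Qed.

Lemma ge0_polar (a : R) F : 0 <= a ->
  measurable_fun setT F -> (forall x, 0 <= F x)%E ->
  (\int[leb2]_(z in [set z | (a < z.1 ^+ 2 + z.2 ^+ 2)%R]) F z =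
   \int[leb2]_(z in `]a, +oo[%classic `*` J) (F (polar_map z) * (2^-1)%:E))%E.
Proof.
move=> a0 mF F0; set D := [set z | _].
have mD : measurable D.
  have mn : measurable_fun setT (fun z : R * R => z.1 ^+ 2 + z.2 ^+ 2).
    by apply: measurable_funD; apply: measurable_funX.
  have := mn measurableT `]a, +oo[%classic (measurable_itv _).
  rewrite setTI; congr measurable; rewrite predeqE => z.
  by rewrite /D/= in_itv/= andbT.
rewrite integral_mkcond ge0_polarT; last 2 first.
- by apply/(measurable_restrictT F) => //; exact: measurable_funTS.
- by move=> z; rewrite patchE; case: ifPn.
rewrite [LHS]integral_mkcond [RHS]integral_mkcond; apply: eq_integral => z _.
rewrite !patchE; case: ifPn => [/set_mem|/negP zJ].
  move=> -[/=]; rewrite in_itv/= andbT => z0 zJ.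
  have -> : (polar_map z \in D) = (a < z.1).
    by apply/idP/idP; rewrite inE /D/= polar_map_normsq ?ltW.
  have -> : (z \in `]a, +oo[%classic `*` J) = (a < z.1).
    apply/idP/idP; first by move=> /set_mem[/=]; rewrite in_itv/= andbT.
    by move=> az; apply/mem_set; split => //=; rewrite in_itv/= az.
  by case: ifP => // _; rewrite mul0e.
rewrite memNset// => -[/=]; rewrite in_itv/= andbT => az zJ'.
by apply: zJ; apply/mem_set; split => //=; rewrite in_itv/= (le_lt_trans a0).
Qed.

End polar2.

(** * Fourier coefficients and Parseval's identity *)

Section real_integrals.
Context d (T : measurableType d) (R : realType).
Implicit Types (mu : {measure set T -> \bar R}) (D E : set T) (f g : T -> R).

(* The measurability of the domain is part of the predicate: this keeps the
   measurable structure on [T] determined by the measure when the calculus rules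
   below are applied. *)
Definition itg mu D f : Prop := measurable D /\ mu.-integrable D (EFin \o f).

Variable mu : {measure set T -> \bar R}.

Lemma itg_measurable D f : itg mu D f -> measurable_fun D f.
Proof. by move=> [_ /integrableP[/measurable_EFinP]]. Qed.

Lemma itg_ext D f g : (forall x, D x -> f x = g x) -> itg mu D f -> itg mu D g.
Proof.
move=> fg [mD fi]; split=> //; apply: eq_integrable fi => //.
by move=> x /set_mem Dx; rewrite /= fg.
Qed.

Lemma itg0 D : measurable D -> itg mu D (fun=> 0).
Proof. by move=> mD; split => //; exact: integrable0. Qed.

Lemma itgZ D c f : itg mu D f -> itg mu D (fun x => c * f x).
Proof. by move=> [mD fi]; split => //; exact: (integrableZl mD c fi). Qed.

Lemma itgD D f g : itg mu D f -> itg mu D g -> itg mu D (fun x => f x + g x).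
Proof. by move=> [mD fi] [_ gi]; split => //; exact: (integrableD mD fi gi). Qed.

Lemma itgN D f : itg mu D f -> itg mu D (fun x => - f x).
Proof.
by move=> fi; apply: (itg_ext _ (itgZ (-1) fi)) => x _; rewrite mulN1r.
Qed.

Lemma itgB D f g : itg mu D f -> itg mu D g -> itg mu D (fun x => f x - g x).
Proof. by move=> fi gi; apply: itgD => //; exact: itgN. Qed.

Lemma itg_sum D m (f : 'I_m -> T -> R) : measurable D ->
  (forall j, itg mu D (f j)) -> itg mu D (fun x => \sum_(j < m) f j x).
Proof.
move=> mD fi; elim: m f fi => [|m IH] f fi.
  by apply: itg_ext (itg0 mD) => x _; rewrite big_ord0.
apply: (@itg_ext _ (fun x => \sum_(j < m) f (widen_ord (leqnSn m) j) x + f ord_max x)).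
  by move=> x _; rewrite big_ord_recr.
by apply: itgD; [apply: IH|exact: fi].
Qed.

Lemma itg_le D f g : measurable_fun D f -> itg mu D g ->
  (forall x, D x -> `|f x| <= g x) -> itg mu D f.
Proof.
move=> mf [mD gi] fg; split => //; apply: (le_integrable mD _ _ gi).
  exact/measurable_EFinP.
by move=> x Dx; rewrite lee_fin (le_trans (fg x Dx))// ler_norm.
Qed.

Lemma itgS D E f : itg mu D f -> E `<=` D -> measurable E -> itg mu E f.
Proof. by move=> [mD fi] ED mE; split => //; exact: (integrableS mD). Qed.

Lemma itg_norm D f : itg mu D f -> itg mu D (fun x => `|f x|).
Proof. by move=> [mD fi]; split => //; exact: integrable_norm. Qed.

Lemma itg_ge0P D f : measurable D -> measurable_fun D f ->
  (forall x, D x -> 0 <= f x) -> (\int[mu]_(x in D) (f x)%:E < +oo)%E -> itg mu D f.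
Proof.
move=> mD mf f0 foo; split => //; apply/integrableP; split.
  exact/measurable_EFinP.
rewrite (eq_integral (EFin \o f))// => x /set_mem Dx.
by rewrite /= ger0_norm ?f0.
Qed.

Lemma itg_mul D f g : measurable_fun D f -> measurable_fun D g ->
  itg mu D (fun x => f x ^+ 2) -> itg mu D (fun x => g x ^+ 2) ->
  itg mu D (fun x => f x * g x).
Proof.
move=> mf mg fi gi; apply: (itg_le _ (itgD fi gi)); first exact: measurable_funM.
move=> x _; rewrite normrM -[f x ^+ 2]real_normK ?num_real//.
rewrite -[g x ^+ 2]real_normK ?num_real//.
have := sqr_ge0 (`|f x| - `|g x|); rewrite sqrrB.
have := mulr_ge0 (normr_ge0 (f x)) (normr_ge0 (g x)).
lra.
Qed.

Lemma EFin_Rint D f : itg mu D f ->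
  (\int[mu]_(x in D) f x)%:E = (\int[mu]_(x in D) (f x)%:E)%E.
Proof. by move=> [mD fi]; rewrite fineK//; exact: integrable_fin_num. Qed.

Lemma Rint_ext D f g : (forall x, D x -> f x = g x) ->
  \int[mu]_(x in D) f x = \int[mu]_(x in D) g x.
Proof. by move=> fg; apply: eq_Rintegral => x /set_mem; exact: fg. Qed.

Lemma RintZ D c f : itg mu D f ->
  \int[mu]_(x in D) (c * f x) = c * \int[mu]_(x in D) f x.
Proof. by move=> [mD fi]; exact: RintegralZl. Qed.

Lemma RintD D f g : itg mu D f -> itg mu D g ->
  \int[mu]_(x in D) (f x + g x) = \int[mu]_(x in D) f x + \int[mu]_(x in D) g x.
Proof. by move=> [mD fi] [_ gi]; exact: RintegralD. Qed.

Lemma RintN D f : itg mu D f ->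
  \int[mu]_(x in D) (- f x) = - \int[mu]_(x in D) f x.
Proof.
move=> fi; rewrite -mulN1r -RintZ//.
by apply: Rint_ext => x _; rewrite mulN1r.
Qed.

Lemma RintB D f g : itg mu D f -> itg mu D g ->
  \int[mu]_(x in D) (f x - g x) = \int[mu]_(x in D) f x - \int[mu]_(x in D) g x.
Proof. by move=> fi gi; rewrite RintD ?RintN//; exact: itgN. Qed.

Lemma RintN_lin D (c : R) f g : itg mu D f -> itg mu D g ->
  (\int[mu]_(x in D) f x) + c * (- (\int[mu]_(x in D) g x)) =
  - (\int[mu]_(x in D) (- f x + c * g x)).
Proof.
by move=> fi gi; rewrite (RintD (itgN fi) (itgZ c gi)) (RintN fi) (RintZ c gi) opprD opprK mulrN.
Qed.

Lemma Rint0 D : \int[mu]_(x in D) (0 : R) = 0.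
Proof. by rewrite /Rintegral integral0. Qed.

Lemma Rint_sum D m (f : 'I_m -> T -> R) : measurable D ->
  (forall j, itg mu D (f j)) ->
  \int[mu]_(x in D) (\sum_(j < m) f j x) = \sum_(j < m) \int[mu]_(x in D) f j x.
Proof.
move=> mD fi; elim: m f fi => [|m IH] f fi.
  transitivity (\int[mu]_(x in D) (0 : R)).
    by apply: Rint_ext => x _; rewrite big_ord0.
  by rewrite Rint0 big_ord0.
rewrite big_ord_recr /= -IH// -RintD//; last exact: itg_sum.
by apply: Rint_ext => x _; rewrite big_ord_recr.
Qed.

Lemma Rint_le D f g : itg mu D f -> itg mu D g ->
  (forall x, D x -> f x <= g x) -> \int[mu]_(x in D) f x <= \int[mu]_(x in D) g x.
Proof. by move=> [mD fi] [_ gi] fg; exact: le_Rintegral. Qed.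

Lemma Rint_ge0 D f : (forall x, D x -> 0 <= f x) -> 0 <= \int[mu]_(x in D) f x.
Proof. exact: Rintegral_ge0. Qed.

Lemma Rint_norm D f : itg mu D f ->
  `|\int[mu]_(x in D) f x| <= \int[mu]_(x in D) `|f x|.
Proof. by move=> [mD fi]; exact: le_normr_Rintegral. Qed.

Lemma Rint_subset D E f : measurable E -> E `<=` D -> itg mu D f ->
  (forall x, D x -> 0 <= f x) -> \int[mu]_(x in E) f x <= \int[mu]_(x in D) f x.
Proof.
move=> mE ED fi f0; rewrite -lee_fin !EFin_Rint//; last exact: (itgS fi).
apply: ge0_subset_integral => //; first by case: fi.
by case: fi => _ /integrableP[].
Qed.

Lemma Rint_eq0_ae D f : itg mu D f -> (forall x, D x -> 0 <= f x) ->
  \int[mu]_(x in D) f x = 0 -> {ae mu, forall x, D x -> f x = 0}.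
Proof.
move=> fi f0 If0; have [mD /integrableP[mf _]] := fi.
have /(ae_eq_integral_abs mu mD mf) H : (\int[mu]_(x in D) `|(EFin \o f) x| = 0)%E.
  rewrite (eq_integral (EFin \o f)); last first.
    by move=> x /set_mem Dx; rewrite /= ger0_norm ?f0.
  by rewrite -EFin_Rint// If0.
by apply: filterS H => x /= H Dx; have [] := H Dx.
Qed.

Lemma ae_imp (P Q : T -> Prop) : (forall x, P x -> Q x) ->
  {ae mu, forall x, P x} -> {ae mu, forall x, Q x}.
Proof. by move=> PQ; exact: filterS. Qed.

Lemma ae_imp2 (P Q S : T -> Prop) : (forall x, P x -> Q x -> S x) ->
  {ae mu, forall x, P x} -> {ae mu, forall x, Q x} -> {ae mu, forall x, S x}.
Proof. by move=> PQS; exact: filterS2. Qed.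

Lemma ae_forall (P : nat -> T -> Prop) : (forall n, {ae mu, forall x, P n x}) ->
  {ae mu, forall x, forall n, P n x}.
Proof.
move=> aP; have := @ae_foralln _ _ _ mu P.
by apply.
Qed.

Lemma Rint_ae D f g : measurable D -> measurable_fun D f -> measurable_fun D g ->
  {ae mu, forall x, D x -> f x = g x} ->
  \int[mu]_(x in D) f x = \int[mu]_(x in D) g x.
Proof.
move=> mD mf mg fg; congr fine; apply: ae_eq_integral => //.
- exact/measurable_EFinP.
- exact/measurable_EFinP.
- by apply: filterS fg => x H Dx; rewrite /= H.
Qed.

End real_integrals.

(** * Trigonometric integrals over one period and Bessel's inequality *)

Section trigonometric_integrals.
Context {R : realType}.
Local Notation leb := (@lebesgue_measure R).
Local Notation J := (`](- (pi / 2)), (3 * pi / 2)[%classic : set R).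
Local Notation Jc := (`[(- (pi / 2)), (3 * pi / 2)]%classic : set R).
Implicit Types (f g F : R -> R) (i j n : nat) (t x : R).

Lemma J_lt : - (pi / 2) < 3 * pi / 2 :> R.
Proof. have := @pi_gt0 R; lra. Qed.

Lemma measurable_J : measurable J.
Proof. exact: measurable_itv. Qed.

Lemma leb_J : leb J = (2 * pi)%:E.
Proof.
rewrite lebesgue_measure_itv/= lte_fin J_lt -EFinD; congr EFin; lra.
Qed.

Lemma J_sub : J `<=` Jc.
Proof. exact: subset_itv_oo_cc. Qed.

Lemma continuous_integrable_J f : continuous f -> itg leb J f.
Proof.
move=> cf; have H : itg leb Jc f.
  split; first exact: measurable_itv.
  apply: continuous_compact_integrable; first exact: segment_compact.
  exact: continuous_subspaceT.
by apply: (itgS H); [exact: J_sub|exact: measurable_itv].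
Qed.

Lemma continuous_bounded_J f : continuous f -> exists2 M, 0 <= M & forall t, J t -> `|f t| <= M.
Proof.
move=> cf; have [//|M M0 fM] := @EVT_max _ (fun t => `|f t|) _ _ (ltW J_lt).
  by apply: continuous_subspaceT => t; apply: continuous_comp; [exact: cf|exact: norm_continuous].
exists (`|f M|) => // t /J_sub tJ; exact: fM.
Qed.

Lemma integrable_J_mul g f : itg leb J g -> continuous f ->
  itg leb J (fun t => g t * f t).
Proof.
move=> ig cf; have [M M0 fM] := continuous_bounded_J cf.
have mf : measurable_fun J f.
  by apply: measurable_funTS; exact: continuous_measurable_fun.
apply: itg_le (itgZ M (itg_norm ig)) _.
  by apply: measurable_funM => //; exact: (itg_measurable ig).
by move=> t Jt; rewrite normrM mulrC ler_wpM2r// fM.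
Qed.

Lemma Rintegral_J_FTC F f : (forall t, is_derive t 1 F (f t)) -> continuous f ->
  \int[leb]_(t in J) f t = F (3 * pi / 2) - F (- (pi / 2)).
Proof.
move=> dF cf; rewrite /Rintegral.
have <- : (\int[leb]_(t in Jc) (f t)%:E = \int[leb]_(t in J) (f t)%:E)%E.
  apply: integral_itv_bndoo; apply/measurable_EFinP/measurable_funTS.
  exact: continuous_measurable_fun.
by rewrite (FTC2_cc J_lt (fun t _ => dF t) (fun t _ => cf t)).
Qed.

Lemma cosDn x n : cos (x + n%:R * (2 * pi)) = cos x.
Proof.
elim: n => [|n IH]; first by rewrite mul0r addr0.
rewrite -natr1 mulrDl mul1r addrA (_ : 2 * pi = pi *+ 2); last by rewrite mulr_natl.
by rewrite cosD2pi -[pi *+ 2]mulr_natl IH.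
Qed.

Lemma sinDn x n : sin (x + n%:R * (2 * pi)) = sin x.
Proof.
elim: n => [|n IH]; first by rewrite mul0r addr0.
rewrite -natr1 mulrDl mul1r addrA (_ : 2 * pi = pi *+ 2); last by rewrite mulr_natl.
by rewrite sinD2pi -[pi *+ 2]mulr_natl IH.
Qed.

(** The ends of the period differ by 2 pi. Adding [i] periods on one side and [j] on the other makes
    the arguments equal without negative multiples. *)
Lemma cos_J_ends i j : cos ((i%:R - j%:R) * (3 * pi / 2)) =
  cos ((i%:R - j%:R) * (- (pi / 2))) :> R.
Proof.
rewrite -[RHS](cosDn _ i) -[LHS](cosDn _ j); congr cos; lra.
Qed.

Lemma sin_J_ends i j : sin ((i%:R - j%:R) * (3 * pi / 2)) =
  sin ((i%:R - j%:R) * (- (pi / 2))) :> R.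
Proof.
rewrite -[RHS](sinDn _ i) -[LHS](sinDn _ j); congr sin; lra.
Qed.

Lemma continuous_cosM (k : R) : continuous (fun t => cos (k * t)).
Proof.
by move=> t; apply: is_derive_continuous; apply: der_cos; apply: der_scale.
Qed.

Lemma continuous_sinM (k : R) : continuous (fun t => sin (k * t)).
Proof.
by move=> t; apply: is_derive_continuous; apply: der_sin; apply: der_scale.
Qed.

Lemma Rintegral_J_cst (c : R) : \int[leb]_(t in J) c = 2 * pi * c.
Proof.
rewrite Rintegral_cst; last exact: measurable_J.
by rewrite /= leb_J/= mulrC.
Qed.

Lemma Rintegral_J_cosB i j :
  \int[leb]_(t in J) cos ((i%:R - j%:R) * t) = if i == j then 2 * pi else 0.
Proof.
case: eqVneq => [->|ij].
  under eq_Rintegral do rewrite subrr mul0r cos0.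
  by rewrite Rintegral_J_cst mulr1.
have k0 : i%:R - j%:R != 0 :> R by rewrite subr_eq0 eqr_nat.
have dF t : is_derive t 1 (fun t => (i%:R - j%:R)^-1 * sin ((i%:R - j%:R) * t))
    (cos ((i%:R - j%:R) * t)).
  apply: (is_derive_congr (der_scale _ (der_sin (der_scale _ (der_id t))))).
  by rewrite mulr1 mulrA mulVf// mul1r.
by rewrite (Rintegral_J_FTC dF (@continuous_cosM _)) sin_J_ends subrr.
Qed.

Lemma Rintegral_J_sinB i j :
  \int[leb]_(t in J) sin ((i%:R - j%:R) * t) = 0.
Proof.
have [->|ij] := eqVneq i j.
  under eq_Rintegral do rewrite subrr mul0r sin0.
  by rewrite Rintegral_J_cst mulr0.
have k0 : i%:R - j%:R != 0 :> R by rewrite subr_eq0 eqr_nat.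
have dF t : is_derive t 1 (fun t => - (i%:R - j%:R)^-1 * cos ((i%:R - j%:R) * t))
    (sin ((i%:R - j%:R) * t)).
  apply: (is_derive_congr (der_scale _ (der_cos (der_scale _ (der_id t))))).
  by rewrite mulr1 !mulNr mulrN opprK mulrA mulVf// mul1r.
by rewrite (Rintegral_J_FTC dF (@continuous_sinM _)) cos_J_ends subrr.
Qed.

Lemma Rintegral_J_cosD i j :
  \int[leb]_(t in J) cos ((i%:R + j%:R) * t) = if (i + j)%N == 0%N then 2 * pi else 0.
Proof.
rewrite -(Rintegral_J_cosB (i + j) 0).
by apply: eq_Rintegral => t _; rewrite subr0 natrD.
Qed.

Lemma Rintegral_J_sinD i j :
  \int[leb]_(t in J) sin ((i%:R + j%:R) * t) = 0.
Proof.
rewrite -(Rintegral_J_sinB (i + j) 0).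
by apply: eq_Rintegral => t _; rewrite subr0 natrD.
Qed.

(** The squared L^2 norms over a period of cos (j t) and, for [ws], of sin (j t). *)
Definition wc j : R := if j == 0%N then 2 * pi else pi.
Definition ws j : R := if j == 0%N then 0 else pi.

Let lin2 f g (a b : R) : continuous f -> continuous g ->
  \int[leb]_(t in J) (a * f t + b * g t) =
  a * \int[leb]_(t in J) f t + b * \int[leb]_(t in J) g t.
Proof.
move=> /continuous_integrable_J fi /continuous_integrable_J gi.
by rewrite RintD ?RintZ//; exact: itgZ.
Qed.

Lemma Rintegral_J_coscos i j :
  \int[leb]_(t in J) (cos (i%:R * t) * cos (j%:R * t)) = if i == j then wc j else 0.
Proof.
transitivity (\int[leb]_(t in J)
   (2^-1 * cos ((i%:R - j%:R) * t) + 2^-1 * cos ((i%:R + j%:R) * t))).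
  by apply: eq_Rintegral => t _; rewrite mulrBl mulrDl cosB cosD; field.
rewrite lin2; [|exact: continuous_cosM|exact: continuous_cosM].
rewrite Rintegral_J_cosB Rintegral_J_cosD /wc addn_eq0.
case: eqVneq => [->|ij]; first by rewrite andbb; case: ifP => _; field.
case: ifPn => [/andP[/eqP i0 /eqP j0]|_]; last by rewrite !mulr0 addr0.
by rewrite i0 j0 eqxx in ij.
Qed.

Lemma Rintegral_J_sinsin i j :
  \int[leb]_(t in J) (sin (i%:R * t) * sin (j%:R * t)) = if i == j then ws j else 0.
Proof.
transitivity (\int[leb]_(t in J)
   (2^-1 * cos ((i%:R - j%:R) * t) + (- 2^-1) * cos ((i%:R + j%:R) * t))).
  by apply: eq_Rintegral => t _; rewrite mulrBl mulrDl cosB cosD; field.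
rewrite lin2; [|exact: continuous_cosM|exact: continuous_cosM].
rewrite Rintegral_J_cosB Rintegral_J_cosD /ws addn_eq0.
case: eqVneq => [->|ij]; first by rewrite andbb; case: ifP => _; field.
case: ifPn => [/andP[/eqP i0 /eqP j0]|_]; last by rewrite !mulr0 addr0.
by rewrite i0 j0 eqxx in ij.
Qed.

Lemma Rintegral_J_sincos i j :
  \int[leb]_(t in J) (sin (i%:R * t) * cos (j%:R * t)) = 0.
Proof.
transitivity (\int[leb]_(t in J)
   (2^-1 * sin ((i%:R - j%:R) * t) + 2^-1 * sin ((i%:R + j%:R) * t))).
  by apply: eq_Rintegral => t _; rewrite mulrBl mulrDl sinB sinD; field.
rewrite lin2; [|exact: continuous_sinM|exact: continuous_sinM].
by rewrite Rintegral_J_sinB Rintegral_J_sinD !mulr0 addr0.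
Qed.

Lemma continuous_fsum (m : nat) (f : nat -> R -> R) : (forall j, continuous (f j)) ->
  continuous (fun t => \sum_(j < m) f j t).
Proof.
move=> cf; elim: m => [|m IH] t.
  under eq_fun do rewrite big_ord0; exact: cvg_cst.
rewrite (_ : (fun t => _) = (fun t => \sum_(j < m) f j t + f m t)).
  by apply: cvgD; [exact: IH|exact: cf].
by apply/funext => x; rewrite big_ord_recr.
Qed.

Definition trigp (m : nat) (A B : nat -> R) t :=
  \sum_(j < m) (A j * cos (j%:R * t) + B j * sin (j%:R * t)).

Lemma continuous_trigp m A B : continuous (trigp m A B).
Proof.
apply: (@continuous_fsum m (fun j t => A j * cos (j%:R * t) + B j * sin (j%:R * t))) => j t.
apply: cvgD; apply: cvgM;
  [exact: cvg_cst|exact: continuous_cosM|exact: cvg_cst|exact: continuous_sinM].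
Qed.

Definition fc g j := \int[leb]_(t in J) (g t * cos (j%:R * t)).
Definition fs g j := \int[leb]_(t in J) (g t * sin (j%:R * t)).

Lemma Rintegral_J_trigp m A B g : itg leb J g ->
  \int[leb]_(t in J) (g t * trigp m A B t) = \sum_(j < m) (A j * fc g j + B j * fs g j).
Proof.
move=> ig.
have ic j := integrable_J_mul ig (@continuous_cosM j%:R).
have is_ j := integrable_J_mul ig (@continuous_sinM j%:R).
transitivity (\int[leb]_(t in J) \sum_(j < m)
    (A j * (g t * cos (j%:R * t)) + B j * (g t * sin (j%:R * t)))).
  apply: eq_Rintegral => t _; rewrite mulr_sumr; apply: eq_bigr => j _.
  by rewrite mulrDr; congr (_ + _); ring.
have mJ := measurable_J.
rewrite Rint_sum//; last by move=> j; apply: itgD; exact: itgZ.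
by apply: eq_bigr => j _; rewrite RintD ?RintZ//; exact: itgZ.
Qed.

Lemma fc_trigp m A B j : fc (trigp m A B) j = if (j < m)%N then A j * wc j else 0.
Proof.
rewrite /fc; under eq_Rintegral do rewrite mulrC.
rewrite Rintegral_J_trigp; last by apply: continuous_integrable_J; exact: continuous_cosM.
transitivity (\sum_(i < m | i == j :> nat) A i * wc j).
  rewrite [RHS]big_mkcond; apply: eq_bigr => i _; rewrite /fc /fs Rintegral_J_coscos.
  under [X in _ + _ * X]eq_Rintegral do rewrite mulrC.
  rewrite Rintegral_J_sincos mulr0 addr0 eq_sym.
  by case: eqVneq => [->//|]; rewrite mulr0.
case: ltnP => jm; first by rewrite (big_pred1 (Ordinal jm)).
by rewrite big_pred0// => i; apply/negbTE; rewrite neq_ltn (leq_trans (ltn_ord i) jm).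
Qed.

Lemma fs_trigp m A B j : fs (trigp m A B) j = if (j < m)%N then B j * ws j else 0.
Proof.
rewrite /fs; under eq_Rintegral do rewrite mulrC.
rewrite Rintegral_J_trigp; last by apply: continuous_integrable_J; exact: continuous_sinM.
transitivity (\sum_(i < m | i == j :> nat) B i * ws j).
  rewrite [RHS]big_mkcond; apply: eq_bigr => i _; rewrite /fc /fs Rintegral_J_sinsin.
  rewrite Rintegral_J_sincos mulr0 add0r eq_sym.
  by case: eqVneq => [->//|]; rewrite mulr0.
case: ltnP => jm; first by rewrite (big_pred1 (Ordinal jm)).
by rewrite big_pred0// => i; apply/negbTE; rewrite neq_ltn (leq_trans (ltn_ord i) jm).
Qed.

Lemma Rintegral_J_trigp_sqr m A B :
  \int[leb]_(t in J) (trigp m A B t ^+ 2) = \sum_(j < m) (A j ^+ 2 * wc j + B j ^+ 2 * ws j).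
Proof.
under eq_Rintegral do rewrite expr2.
rewrite Rintegral_J_trigp; last by apply: continuous_integrable_J; exact: continuous_trigp.
by apply: eq_bigr => j _; rewrite fc_trigp fs_trigp ltn_ord; ring.
Qed.

(** A partial sum of Parseval's series. The weight [wc] serves the sine coefficients as well,
    because [fs g 0] vanishes and [wc] and [ws] agree for positive [j]. *)
Definition fE g (m : nat) : R := \sum_(j < m) (wc j)^-1 * (fc g j ^+ 2 + fs g j ^+ 2).

Lemma wc_gt0 j : 0 < wc j.
Proof. by rewrite /wc; case: ifP => _; rewrite ?mulr_gt0// pi_gt0. Qed.

Lemma ws_le j : ws j <= wc j.
Proof. by rewrite /wc /ws; case: ifP => _ //; rewrite mulr_ge0// pi_ge0. Qed.

(** Expand the integral of the square of [g] minus its Fourier partial sum, which is nonnegative. *)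
Lemma bessel g m : itg leb J g ->
  itg leb J (fun t => g t ^+ 2) ->
  fE g m <= \int[leb]_(t in J) (g t ^+ 2).
Proof.
move=> ig ig2.
pose A j := (wc j)^-1 * fc g j; pose B j := (wc j)^-1 * fs g j.
have cp := @continuous_trigp m A B.
have ip2 : itg leb J (fun t => trigp m A B t ^+ 2).
  by apply: continuous_integrable_J => t; apply: cvgM; exact: cp.
have igp := integrable_J_mul ig cp.
have : 0 <= \int[leb]_(t in J) ((g t - trigp m A B t) ^+ 2).
  by apply: Rintegral_ge0 => t _; exact: sqr_ge0.
have -> : \int[leb]_(t in J) ((g t - trigp m A B t) ^+ 2) =
    \int[leb]_(t in J) (g t ^+ 2 + (- 2 * (g t * trigp m A B t) + trigp m A B t ^+ 2)).
  by apply: eq_Rintegral => t _; ring.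
have i2 := itgZ (- 2) igp.
rewrite RintD//; last exact: itgD.
rewrite RintD//; rewrite RintZ// Rintegral_J_trigp// Rintegral_J_trigp_sqr.
have -> : \sum_(j < m) (A j * fc g j + B j * fs g j) = fE g m.
  by apply: eq_bigr => j _; rewrite /A /B; ring.
have : \sum_(j < m) (A j ^+ 2 * wc j + B j ^+ 2 * ws j) <= fE g m.
  apply: ler_sum => j _.
  have -> : (wc j)^-1 * (fc g j ^+ 2 + fs g j ^+ 2) = A j ^+ 2 * wc j + B j ^+ 2 * wc j.
    by rewrite /A /B; field; rewrite gt_eqF// wc_gt0.
  by rewrite lerD2l ler_wpM2l ?sqr_ge0// ws_le.
lra.
Qed.

End trigonometric_integrals.

(** * A positive trigonometric kernel and its distribution function *)

Section fejer_kernel.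
Context {R : realType}.
Local Notation leb := (@lebesgue_measure R).
Local Notation J := (`](- (pi / 2)), (3 * pi / 2)[%classic : set R).
Implicit Types (f g : R -> R) (i j n m : nat) (t x : R).

Definition cospoly n f := exists h : nat -> R,
  forall t, f t = \sum_(j < n.+1) h j * cos (j%:R * t).

Lemma cospolyD n f g : cospoly n f -> cospoly n g -> cospoly n (fun t => f t + g t).
Proof.
move=> [h hE] [k kE]; exists (fun j => h j + k j) => t.
by rewrite hE kE -big_split; apply: eq_bigr => j _; rewrite mulrDl.
Qed.

Lemma cospolyZ n c f : cospoly n f -> cospoly n (fun t => c * f t).
Proof.
move=> [h hE]; exists (fun j => c * h j) => t.
by rewrite hE mulr_sumr; apply: eq_bigr => j _; rewrite mulrA.
Qed.

Lemma cospoly_cos n j : (j <= n)%N -> cospoly n (fun t => cos (j%:R * t)).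
Proof.
move=> jn; exists (fun i => (i == j)%:R) => t.
rewrite (bigD1 (Ordinal (jn : (j < n.+1)%N)))//= eqxx mul1r big1 ?addr0// => i ij.
rewrite (_ : (i == j :> nat) = false) ?mul0r//.
by apply/negbTE; move: ij; apply: contra => /eqP ij; apply/eqP/val_inj.
Qed.

Lemma cospoly_sum n m (f : 'I_m -> R -> R) : (forall j : 'I_m, cospoly n (f j)) ->
  cospoly n (fun t => \sum_(j < m) f j t).
Proof.
elim: m f => [|m IH] f fC.
  exists (fun=> 0) => t; rewrite big_ord0 big1// => j _; by rewrite mul0r.
have [h hE] := cospolyD (IH (fun j : 'I_m => f (widen_ord (leqnSn m) j)) (fun j : 'I_m => fC _)) (fC ord_max).
by exists h => t; rewrite -hE big_ord_recr.
Qed.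

(* A trigonometric polynomial concentrating at the origin as [n] grows. *)
Definition kap n t : R := ((1 + cos t) / 2) ^+ n.

Lemma cospoly_kap n : cospoly n (kap n).
Proof.
elim: n => [|n [h hE]].
  have [h hE] := @cospoly_cos 0 0 isT.
  by exists h => t; rewrite -hE /kap expr0 mul0r cos0.
(* [pj j] is |j - 1|: multiplying cos (j t) by cos t produces the frequencies j + 1 and j - 1, and
   for [j = 0] the frequency - 1 is replaced by 1. *)
pose pj (j : nat) : R := if j == 0%N then 1 else j.-1%:R.
have H (j : 'I_n.+1) : cospoly n.+1 (fun t => h j * (cos (j%:R * t) / 2 +
    (cos (j.+1%:R * t) + cos (pj j * t)) / 4)).
  apply: cospolyZ; apply: cospolyD.
    have [k kE] := cospolyZ 2^-1 (@cospoly_cos n.+1 j (ltnW (ltn_ord j))).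
    by exists k => t; rewrite -kE mulrC.
  have Hp : cospoly n.+1 (fun t => cos (pj j * t)).
    rewrite /pj; case: eqP => _; first by exact: (@cospoly_cos n.+1 1).
    exact: (@cospoly_cos n.+1 j.-1 (leq_trans (leq_pred j) (ltnW (ltn_ord j)))).
  have [k kE] := cospolyZ 4^-1 (cospolyD (@cospoly_cos n.+1 j.+1 (ltn_ord j)) Hp).
  by exists k => t; rewrite -kE mulrC.
have [k kE] := cospoly_sum H; exists k => t; rewrite -kE /kap exprSr -/(kap n t) hE.
rewrite mulr_suml; apply: eq_bigr => j _; rewrite -mulrA; congr (_ * _).
rewrite /pj; case: j => -[|j] /= _; first by rewrite mul0r cos0 !mul1r; field.
have -> : j.+2%:R * t = j.+1%:R * t + t by rewrite -[j.+2%:R]natr1; ring.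
have -> : j%:R * t = j.+1%:R * t - t by rewrite -[j.+1%:R]natr1; ring.
by rewrite cosD cosB; field.
Qed.

Definition kapc n : nat -> R := sval (cid (cospoly_kap n)).

Lemma kapE n t : kap n t = \sum_(j < n.+1) kapc n j * cos (j%:R * t).
Proof. by rewrite /kapc; case: cid. Qed.

Lemma kap_trigp n t : kap n t = trigp n.+1 (kapc n) (fun=> 0) t.
Proof. by rewrite kapE; apply: eq_bigr => j _; rewrite mul0r addr0. Qed.

Lemma continuous_kap n : continuous (kap n).
Proof.
rewrite (_ : kap n = trigp n.+1 (kapc n) (fun=> 0)); first exact: continuous_trigp.
by apply/funext => t; exact: kap_trigp.
Qed.

Lemma kap_ge0 n t : 0 <= kap n t.
Proof. by rewrite exprn_ge0// divr_ge0//; have := cos_geN1 t; lra. Qed.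

Definition kapZ n : R := 2 * pi * kapc n 0%N.

Lemma fc_kap n j : (j < n.+1)%N -> fc (kap n) j = kapc n j * wc j.
Proof.
move=> jn; transitivity (fc (trigp n.+1 (kapc n) (fun=> 0)) j).
  by apply: eq_Rintegral => t _; rewrite kap_trigp.
by rewrite fc_trigp jn.
Qed.

Lemma kapZE n : kapZ n = \int[leb]_(t in J) kap n t.
Proof.
have := @fc_kap n 0 isT; rewrite /fc /wc /= [X in _ = X]mulrC /kapZ => <-.
by apply: eq_Rintegral => t _; rewrite mul0r cos0 mulr1.
Qed.

(** [kap] is nonnegative, so none of its cosine integrals exceeds its total mass. *)
Lemma kapc_le n j : (j < n.+1)%N -> `|kapc n j| * wc j <= kapZ n.
Proof.
move=> jn; rewrite kapZE -[wc j]gtr0_norm ?wc_gt0// -normrM -fc_kap//.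
have ik : itg leb J (kap n) by apply: continuous_integrable_J; exact: continuous_kap.
have ikc := integrable_J_mul ik (@continuous_cosM _ j%:R).
apply: (le_trans (Rint_norm ikc)); apply: Rint_le => //; first exact: itg_norm.
move=> t _; rewrite normrM ger0_norm ?kap_ge0// ler_piMr ?kap_ge0//.
by rewrite ler_norml cos_geN1 cos_le1.
Qed.

Definition sint j x : R := if j == 0%N then x else (j%:R)^-1 * sin (j%:R * x).

Lemma der_sint j x : is_derive x 1 (sint j) (cos (j%:R * x)).
Proof.
rewrite /sint; case: eqVneq => [->|j0].
  by rewrite mul0r cos0; exact: der_id.
apply: (is_derive_congr (der_scale _ (der_sin (der_scale _ (der_id x))))).
by rewrite mulr1 mulrA mulVf ?mul1r// pnatr_eq0.
Qed.

(** The primitive, vanishing at 0, of the kernel normalised to mass one. As [n] grows it tends to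
    half the sign function on ]- 2 pi, 2 pi[, so that differences of its values approximate
    indicators of intervals. *)
Definition kapK n x : R := (kapZ n)^-1 * \sum_(j < n.+1) kapc n j * sint j x.

Lemma der_sum m (f f' : nat -> R -> R) x : (forall j, is_derive x 1 (f j) (f' j x)) ->
  is_derive x 1 (fun t => \sum_(j < m) f j t) (\sum_(j < m) f' j x).
Proof.
move=> df; elim: m => [|m IH].
  rewrite big_ord0; under eq_fun do rewrite big_ord0; exact: der_cst.
rewrite big_ord_recr; under eq_fun do rewrite big_ord_recr.
exact: der_add.
Qed.

Lemma der_kapK n x : is_derive x 1 (kapK n) ((kapZ n)^-1 * kap n x).
Proof.
rewrite kapE; apply: der_scale.
apply: (@der_sum n.+1 (fun j t => kapc n j * sint j t) (fun j t => kapc n j * cos (j%:R * t))).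
by move=> j; apply: der_scale; exact: der_sint.
Qed.

(** If the mass were zero, all coefficients would vanish by [kapc_le], whereas the kernel has the
    value 1 at the origin. *)
Lemma kapZ_gt0 n : 0 < kapZ n.
Proof.
have H0 : 0 <= kapZ n by rewrite kapZE; apply: Rintegral_ge0 => t _; exact: kap_ge0.
rewrite lt_neqAle H0 andbT eq_sym; apply/eqP => Z0.
have c0 j : (j < n.+1)%N -> kapc n j = 0.
  move=> /kapc_le; rewrite Z0 => H.
  have : `|kapc n j| * wc j == 0.
    by rewrite eq_le H mulr_ge0// ltW// wc_gt0.
  by rewrite mulf_eq0 normr_eq0 (gt_eqF (wc_gt0 j)) orbF => /eqP.
have : kap n 0 = 0 by rewrite kapE big1// => j _; rewrite c0 ?mul0r.
rewrite /kap cos0 (_ : (1 + 1) / 2 = 1 :> R); last by field.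
by rewrite expr1n => /eqP; rewrite oner_eq0.
Qed.

Lemma kapK0 n : kapK n 0 = 0.
Proof.
rewrite /kapK big1 ?mulr0// => j _; rewrite /sint; case: ifP => _.
  by rewrite mulr0.
by rewrite mulr0 sin0 !mulr0.
Qed.

Lemma kapKN n x : kapK n (- x) = - kapK n x.
Proof.
rewrite /kapK -mulrN -sumrN; congr (_ * _); apply: eq_bigr => j _.
rewrite -mulrN; congr (_ * _); rewrite /sint; case: ifP => // _.
by rewrite mulrN sinN mulrN.
Qed.

(** [kapK n] is x / (2 pi) plus a combination of sines, which is odd and 2 pi-periodic. *)
Lemma kapK_2pi n x : kapK n (2 * pi - x) = 1 - kapK n x.
Proof.
have Z0 := kapZ_gt0 n; have := Z0; rewrite {1}/kapZ => Z1.
have c0 : kapc n 0 != 0 by apply/eqP => c0; move: Z1; rewrite c0 mulr0 ltxx.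
have pi0 := @pi_gt0 R.
apply: (mulfI (lt0r_neq0 Z0)).
rewrite mulrBr mulr1 /kapK !mulrA !mulfV ?gt_eqF// !mul1r.
rewrite !big_ord_recl /= /sint/= /kapZ.
have -> : \sum_(i < n) kapc n (lift ord0 i) * ((lift ord0 i)%:R^-1 * sin ((lift ord0 i)%:R * (2 * pi - x)))
  = - \sum_(i < n) kapc n (lift ord0 i) * ((lift ord0 i)%:R^-1 * sin ((lift ord0 i)%:R * x)).
  rewrite -sumrN; apply: eq_bigr => i _.
  rewrite -mulrN -mulrN -sinN; congr (_ * (_ * _)).
  rewrite -[RHS](sinDn _ (lift ord0 i)); congr sin; ring.
ring.
Qed.

Lemma kapK_pi n : kapK n pi = 2^-1.
Proof.
have := kapK_2pi n pi; rewrite (_ : 2 * pi - pi = pi :> R); last by ring.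
by move=> H; lra.
Qed.

Lemma kapK_mvt n x y : x < y -> exists2 c, x < c < y &
  kapK n y - kapK n x = (kapZ n)^-1 * kap n c * (y - x).
Proof.
move=> xy; have [|c cI E] := MVT xy (fun t _ => der_kapK n t).
  by apply: continuous_subspaceT => t; apply: is_derive_continuous; exact: der_kapK.
by exists c => //; move: cI; rewrite in_itv.
Qed.

Lemma kapK_nd n x y : x <= y -> kapK n x <= kapK n y.
Proof.
rewrite le_eqVlt => /predU1P[->//|xy]; have [c _ E] := kapK_mvt n xy.
by rewrite -subr_ge0 E !mulr_ge0 ?kap_ge0 ?invr_ge0 ?subr_ge0 ?ltW// kapZ_gt0.
Qed.

Lemma kap_ninc n x y : 0 <= x -> x <= y -> y <= pi -> kap n y <= kap n x.
Proof.
move=> x0 xy yp.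
have y1 := cos_geN1 y; have x1 := cos_geN1 x.
apply: lerXn2r; rewrite ?nnegrE; [lra|lra|].
suff : cos y <= cos x by lra.
rewrite leNgt; apply/negP => H.
have : y < x by rewrite -ltr_cos// in_itv/= ?x0 ?(le_trans xy)// (le_trans x0 xy).
by rewrite ltNge xy.
Qed.

(** The kernel decreases on [0, pi]. Hence the mass missing at [x] is at most pi times the kernel at
    [x], while x / 2 times the kernel at x / 2 is at most the mass of [0, x / 2], which is at most 1
    / 2. The quotient of the two kernel values is [q ^+ n] with [q < 1]. *)
Lemma kapK_cvg_pi x : 0 < x -> x <= pi -> kapK n x @[n --> \oo] --> (2^-1 : R).
Proof.
move=> x0 xp.
pose q := (1 + cos x) / (1 + cos (x / 2)).
have c2 : 0 < 1 + cos (x / 2).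
  suff : cos x < cos (x / 2) by have := cos_geN1 x; lra.
  by rewrite ltr_cos ?in_itv/=; [lra|apply/andP; split; lra|apply/andP; split; lra].
have q0 : 0 <= q by rewrite divr_ge0 ?(ltW c2)//; have := cos_geN1 x; lra.
have q1 : q < 1.
  rewrite ltr_pdivrMr// mul1r ltrD2l.
  by rewrite ltr_cos ?in_itv/=; [lra|apply/andP; split; lra|apply/andP; split; lra].
have bnd n : `|2^-1 - kapK n x| <= (pi / x) * q ^+ n.
  have h0 : 0 <= 2^-1 - kapK n x by rewrite subr_ge0 -(kapK_pi n) kapK_nd.
  rewrite ger0_norm//.
  have Z0 := kapZ_gt0 n.
  have k2 : 0 < kap n (x / 2) by rewrite exprn_gt0// divr_gt0.
  have A1 : (kapZ n)^-1 * kap n (x / 2) * x <= 1.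
    have x2 : 0 < x / 2 by lra.
    have [c /andP[c0 cx]] := kapK_mvt n x2.
    rewrite kapK0 !subr0 => E.
    have : kapK n (x / 2) <= 2^-1 by rewrite -[leRHS](kapK_pi n) kapK_nd//; lra.
    rewrite E => H.
    have : (kapZ n)^-1 * kap n (x / 2) * (x / 2) <= (kapZ n)^-1 * kap n c * (x / 2).
      rewrite ler_pM2r// ler_pM2l ?invr_gt0//; apply: kap_ninc; lra.
    lra.
  have A2 : 2^-1 - kapK n x <= (kapZ n)^-1 * kap n x * pi.
    move: xp; rewrite le_eqVlt => /predU1P[->|xp].
      rewrite kapK_pi subrr !mulr_ge0 ?kap_ge0 ?invr_ge0 ?ltW//; exact: pi_gt0.
    have [c /andP[c0 cx]] := kapK_mvt n xp; rewrite kapK_pi => ->.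
    apply: ler_pM; rewrite ?mulr_ge0 ?kap_ge0 ?invr_ge0 ?(ltW Z0)//.
    - by rewrite subr_ge0 ltW.
    - by rewrite ler_pM2l ?invr_gt0//; apply: kap_ninc; lra.
    - by lra.
  have -> : (pi / x) * q ^+ n = (x * kap n (x / 2))^-1 * (kap n x * pi).
    rewrite /q /kap !expr_div_n; field.
    by rewrite !gt_eqF ?exprn_gt0.
  apply: (le_trans A2); rewrite -mulrA ler_wpM2r//.
    by rewrite mulr_ge0 ?kap_ge0 ?pi_ge0.
  rewrite -[leRHS]mul1r ler_pdivlMr ?mulr_gt0// [x * _]mulrC mulrA//.
have cvgq : (pi / x) * q ^+ n @[n --> \oo] --> (0 : R).
  by apply: (@cvg_geometric _ (pi / x) q); rewrite ger0_norm.
apply/subr_cvg0; rewrite -(oppr0 (R)); under eq_fun do rewrite -opprB.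
apply: cvgN; apply/norm_cvg0P.
apply: (squeeze_cvgr _ (cvg_cst 0) cvgq); near=> n.
by rewrite normr_ge0 bnd.
Unshelve. all: by end_near. Qed.

Definition hsg x : R := if x == 0 then 0 else if 0 < x then 2^-1 else - 2^-1.

(** Arguments between pi and 2 pi are reduced by [kapK_2pi], negative ones by oddness. *)
Lemma kapK_cvg x : `|x| < 2 * pi -> kapK n x @[n --> \oo] --> hsg x.
Proof.
have pos y : 0 < y -> y < 2 * pi -> kapK n y @[n --> \oo] --> (2^-1 : R).
  move=> y0 yp; have [yp'|yp'] := leP y pi; first exact: kapK_cvg_pi.
  rewrite (_ : (fun n => _) = (fun n => 1 - kapK n (2 * pi - y))); last first.
    by apply/funext => n; rewrite kapK_2pi; ring.
  rewrite [X in _ --> X](_ : _ = 1 - 2^-1); last by field.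
  apply: cvgB; first exact: cvg_cst.
  by apply: kapK_cvg_pi; lra.
rewrite /hsg ltr_norml => /andP[x1 x2].
case: eqVneq => [->|x0].
  by under eq_fun do rewrite kapK0; exact: cvg_cst.
case: ltP => x00; first exact: pos.
rewrite (_ : (fun n => _) = (fun n => - kapK n (- x))); last first.
  by apply/funext => n; rewrite kapKN opprK.
by apply: cvgN; apply: pos; [rewrite oppr_gt0 lt_neqAle x0|lra].
Qed.

Lemma kapK_le1 n x : `|x| <= 2 * pi -> `|kapK n x| <= 1.
Proof.
rewrite ler_norml => /andP[x1 x2].
have E : kapK n (2 * pi) = 1 by have := kapK_2pi n 0; rewrite subr0 kapK0 subr0.
rewrite ler_norml; apply/andP; split.
  by rewrite -E -kapKN kapK_nd.
by rewrite -E kapK_nd.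
Qed.

End fejer_kernel.

(** * From Fourier coefficients back to the function *)

Section parseval.
Context {R : realType}.
Local Notation leb := (@lebesgue_measure R).
Local Notation J := (`](- (pi / 2)), (3 * pi / 2)[%classic : set R).
Implicit Types (f g : R -> R) (i j n m : nat) (t x : R).

(** Fatou's lemma in the form used throughout: a uniform bound on integrals of squares passes to an
    almost everywhere limit, without any integrability of the limit being known beforehand. *)
Lemma fatou_sqr (D : set R) (p : nat -> R -> R) (q : R -> R) (M : R) :
  measurable D -> (forall n, measurable_fun D (p n)) -> measurable_fun D q ->
  {ae leb, forall x, D x -> p n x @[n --> \oo] --> q x} ->
  (forall n, \int[leb]_(x in D) (p n x ^+ 2)%:E <= M%:E)%E ->
  (\int[leb]_(x in D) (q x ^+ 2)%:E <= M%:E)%E.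
Proof.
move=> mD mp mq pq pM.
have mp2 n : measurable_fun D (fun x => (p n x ^+ 2)%:E).
  by apply/measurable_EFinP; exact: measurable_funX.
have p20 n x : D x -> (0 <= (p n x ^+ 2)%:E)%E by move=> _; rewrite lee_fin sqr_ge0.
have <- : (\int[leb]_(x in D) limn_einf (fun n => (p n x ^+ 2)%:E) =
    \int[leb]_(x in D) (q x ^+ 2)%:E)%E.
  apply: ae_eq_integral => //.
  - apply: measurableT_comp => //; apply: measurable_fun_limn_esup => n.
    exact: (measurableT_comp (@oppe_measurable R setT) (mp2 n)).
  - by apply/measurable_EFinP; exact: measurable_funX.
  apply: (ae_imp _ pq) => x H Dx; have {}H := H Dx.
  apply: (cvg_limn_einf_sup _).1; apply: cvg_EFin; first by near=> n.
  by under eq_fun do rewrite expr2; rewrite expr2; exact: cvgM.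
apply: (le_trans (fatou leb mD mp2 p20)).
rewrite limn_einf_lim; apply: lime_le; first exact: is_cvg_einfs.
near=> n; apply: (le_trans _ (pM n)); apply: ereal_inf_lbound.
by exists n => /=.
Unshelve. all: by end_near. Qed.

Lemma sin_norm_le x : `|sin x| <= `|x|.
Proof.
have pos (y : R) : 0 <= y -> `|sin y| <= y.
  rewrite le_eqVlt => /predU1P[<-|y0]; first by rewrite sin0 normr0.
  have [|c _ E] := MVT y0 (fun (t : R) _ => is_derive_sin t).
    by apply: continuous_subspaceT => t; exact: continuous_sin.
  have -> : sin y = cos c * y by have := E; rewrite sin0 !subr0.
  rewrite normrM [`|y|]gtr0_norm// ler_piMl ?(ltW y0)//.
  by rewrite ler_norml cos_geN1 cos_le1.
have [x0|/ltW x0] := leP 0 x; first by rewrite [`|x|]ger0_norm// pos.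
by rewrite -normrN -sinN -[leRHS]normrN [leRHS]ger0_norm ?pos// oppr_ge0.
Qed.

(** The Fourier multipliers of the convolution with [avH], the normalised kernel averaged over an
    interval of radius [dl]. The averaging contributes sin (j dl) / (j dl), whose value at j = 0 is
    1. *)
Definition avk (dl : R) n j : R := (kapZ n)^-1 * kapc n j *
  (if j == 0%N then 1 else (j%:R * dl)^-1 * sin (j%:R * dl)).

Definition avH (dl : R) n x : R := (2 * dl)^-1 * (kapK n (x + dl) - kapK n (x - dl)).

Lemma avHE dl n x : 0 < dl -> avH dl n x = \sum_(j < n.+1) avk dl n j * cos (j%:R * x).
Proof.
move=> dl0; rewrite /avH /kapK -mulrBr -sumrB mulrCA !mulr_sumr.
apply: eq_bigr => j _; rewrite /avk -!mulrA; congr (_ * _).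
rewrite -mulrBr mulrCA; congr (_ * _); rewrite /sint; case: eqP => [->|/eqP j0].
  by rewrite mul0r cos0; field; rewrite gt_eqF.
have j0' : j%:R != 0 :> R by rewrite pnatr_eq0.
rewrite (mulrBr j%:R x) (mulrDr j%:R x) sinB sinD; field.
by rewrite j0' gt_eqF.
Qed.

(** The kernel coefficient divided by the mass is at most [(wc j)^-1], and the averaging factor at
    most 1 in absolute value. Consequently smoothing does not increase the quadratic sum of the
    coefficients. *)
Lemma avk_le dl n j : 0 < dl -> (j < n.+1)%N -> avk dl n j ^+ 2 * wc j <= (wc j)^-1.
Proof.
move=> dl0 jn; have Z0 : (0 : R) < kapZ n := kapZ_gt0 n; have w0 := @wc_gt0 R j.
have : `|avk dl n j| <= (wc j)^-1.
  rewrite /avk normrM -[leRHS]mulr1; apply: ler_pM => //.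
    rewrite normrM normfV (gtr0_norm Z0) mulrC ler_pdivrMr//.
    by rewrite mulrC ler_pdivlMr// kapc_le.
  case: eqP => [_|/eqP j0]; first by rewrite normr1.
  have jd : 0 < j%:R * dl by rewrite mulr_gt0// ltr0n lt0n.
  rewrite normrM normfV mulrC ler_pdivrMr ?normr_gt0 ?gt_eqF// mul1r.
  exact: sin_norm_le.
move=> H; have : `|avk dl n j| ^+ 2 <= (wc j)^-1 ^+ 2.
  by apply: lerXn2r => //; rewrite nnegrE ?invr_ge0 ?(ltW w0).
rewrite real_normK ?num_real// -(ler_pM2r w0) => /le_trans; apply.
by rewrite expr2 -mulrA mulVf ?mulr1// gt_eqF.
Qed.

(** A smoothing of [g] computed from its Fourier coefficients alone, so that a bound on the
    coefficients bounds it; [avpE] identifies it with a convolution. *)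
Definition avp (dl : R) g n t : R :=
  trigp n.+1 (fun j => avk dl n j * fc g j) (fun j => avk dl n j * fs g j) t.

Lemma avH_trigp dl n x t : 0 < dl ->
  avH dl n (t - x) = trigp n.+1 (fun j => avk dl n j * cos (j%:R * x))
    (fun j => avk dl n j * sin (j%:R * x)) t.
Proof.
move=> dl0; rewrite avHE//; apply: eq_bigr => j _; rewrite mulrBr cosB; ring.
Qed.

Lemma avpE dl g n x : 0 < dl -> itg leb J g ->
  avp dl g n x = \int[leb]_(t in J) (g t * avH dl n (t - x)).
Proof.
move=> dl0 ig.
under eq_Rintegral do rewrite avH_trigp//.
rewrite Rintegral_J_trigp//; apply: eq_bigr => j _; ring.
Qed.

Lemma avp_sqr dl g n (M : R) : 0 < dl -> (forall m, fE g m <= M) ->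
  \int[leb]_(t in J) (avp dl g n t ^+ 2) <= M.
Proof.
move=> dl0 gM; apply: le_trans (gM n.+1).
rewrite Rintegral_J_trigp_sqr; apply: ler_sum => j _.
have : (avk dl n j * fs g j) ^+ 2 * ws j <= (avk dl n j * fs g j) ^+ 2 * wc j.
  by rewrite ler_wpM2l ?sqr_ge0// ws_le.
have := avk_le dl0 (ltn_ord j).
move: (avk dl n j) => k; rewrite !exprMn mulrDr => H1 H2; apply: lerD.
  by rewrite mulrAC ler_wpM2r ?sqr_ge0.
by apply: (le_trans H2); rewrite mulrAC ler_wpM2r ?sqr_ge0.
Qed.

(** For [x] in this smaller interval and [t] in the period, both [t - x + dl] and [t - x - dl] stay
    in ]- 2 pi, 2 pi[, where [kapK] converges. *)
Definition Jd (dl : R) : set R := `](- (pi / 2) + dl), (3 * pi / 2 - dl)[%classic.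

(** [avH] tends boundedly to the normalised indicator of the ball, so dominated convergence turns
    the convolution into the average of [g] over the ball. *)
Lemma avp_cvg dl g x : 0 < dl -> itg leb J g -> Jd dl x ->
  avp dl g n x @[n --> \oo] --> (2 * dl)^-1 * \int[leb]_(t in ball x dl) (g \_ J) t.
Proof.
move=> dl0 ig; rewrite /Jd/= in_itv/= => /andP[x1 x2].
pose L t := (2 * dl)^-1 * (hsg (t - x + dl) - hsg (t - x - dl)).
have pw t : J t -> avH dl n (t - x) @[n --> \oo] --> L t.
  rewrite /= in_itv/= => /andP[t1 t2].
  have p2 : `|t - x + dl| < 2 * pi by rewrite ltr_norml; apply/andP; split; lra.
  have p3 : `|t - x - dl| < 2 * pi by rewrite ltr_norml; apply/andP; split; lra.
  apply: cvgM; first exact: cvg_cst.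
  by apply: cvgB; exact: kapK_cvg.
have bd n t : J t -> `|avH dl n (t - x)| <= dl^-1.
  rewrite /= in_itv/= => /andP[t1 t2].
  have p2 : `|t - x + dl| <= 2 * pi by rewrite ler_norml; apply/andP; split; lra.
  have p3 : `|t - x - dl| <= 2 * pi by rewrite ler_norml; apply/andP; split; lra.
  rewrite normrM gtr0_norm ?invr_gt0 ?mulr_gt0//.
  have -> : dl^-1 = (2 * dl)^-1 * 2 by field; rewrite gt_eqF.
  rewrite ler_pM2l ?invr_gt0 ?mulr_gt0//.
  apply: (le_trans (ler_normB _ _)).
  by have := kapK_le1 n p2; have := kapK_le1 n p3; lra.
have mg := itg_measurable ig.
have cH n : continuous (fun t => avH dl n (t - x)).
  under eq_fun do rewrite avH_trigp//; exact: continuous_trigp.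
have igH n := integrable_J_mul ig (cH n).
have gL t : J t -> g t * avH dl n (t - x) @[n --> \oo] --> g t * L t.
  by move=> Jt; apply: cvgM; [exact: cvg_cst|exact: pw].
have mgL : measurable_fun J (fun t => g t * L t).
  apply: (measurable_fun_cvg (h := fun n t => g t * avH dl n (t - x))) => //.
  by move=> n; exact: (itg_measurable (igH n)).
have [] := @dominated_convergence _ (measurableTypeR R) R leb J (measurable_itv _)
  (fun n t => (g t * avH dl n (t - x))%:E) (fun t => (g t * L t)%:E)
  (fun t => (dl^-1 * `|g t|)%:E).
- by move=> n; apply/measurable_EFinP; exact: (itg_measurable (igH n)).
- exact/measurable_EFinP.
- by apply: aeW => t Jt; apply: cvg_EFin; [near=> n|exact: gL].
- by have [] := itgZ dl^-1 (itg_norm ig).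
- apply: aeW => t n Jt; rewrite lee_fin normrM mulrC ler_wpM2r//; exact: bd.
move=> igL _ /= cvI.
have igL' : itg leb J (fun t => g t * L t) by split => //; exact: measurable_itv.
have -> : (2 * dl)^-1 * \int[leb]_(t in ball x dl) (g \_ J) t =
    \int[leb]_(t in J) (g t * L t).
  rewrite -Rintegral_mkcondr setIC Rintegral_mkcondr.
  transitivity (\int[leb]_(t in J) ((2 * dl)^-1 * (g \_ (ball x dl)) t)).
    have mb : measurable (ball x dl : set R) by exact: measurable_ball.
    have igb : itg leb J (g \_ (ball x dl)).
      apply: (itg_le _ (itg_norm ig)).
        apply/(measurable_restrict g) => //; exact: measurable_funS mg.
      by move=> t _; rewrite patchE; case: ifP => // _; rewrite normr0.
    by rewrite RintZ.
  apply: Rint_ae.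
  - exact: measurable_itv.
  - apply: measurable_funM => //; apply/(measurable_restrict g) => //.
      exact: measurable_ball.
    by apply: measurable_funS mg => //; exact: measurable_itv.
  - exact: mgL.
  (* The limit differs from the normalised indicator only at the two ends of the ball, where half
     the sign function takes its middle value. *)
  exists [set x + dl; x - dl]; split.
  - by apply: measurableU; exact: measurable_set1.
  - apply: countable_lebesgue_measure0; apply: finite_set_countable; exact: finite_set2.
  move=> t /= /not_implyP[Jt]; apply: contra_notP => /not_orP[t1 t2].
  rewrite patchE /L /hsg.
  have n1 : t - x + dl != 0 by apply/eqP => e; apply: t2; lra.
  have n2 : t - x - dl != 0 by apply/eqP => e; apply: t1; lra.
  rewrite (negbTE n1) (negbTE n2).
  case: ifPn => [/set_mem|/negP].
    rewrite /ball/= distrC ltr_norml => /andP[b1 b2].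
    have -> : 0 < t - x + dl by lra.
    have -> : (0 < t - x - dl) = false by apply/negbTE; rewrite -leNgt; lra.
    lra.
  (* Outside the ball the restriction takes the default point of [R], which is 0. *)
  move=> nb; have -> : (point : R) = 0 by [].
  rewrite mulr0; have [h1|h1] := ltP 0 (t - x - dl).
    have -> : 0 < t - x + dl by lra.
    by rewrite subrr !mulr0.
  have [h2|h2] := ltP 0 (t - x + dl).
    exfalso; apply: nb; apply/mem_set; rewrite /ball/= distrC ltr_norml.
    apply/andP; split; first lra.
    by rewrite lt_neqAle; apply/andP; split; [apply/eqP => e; apply: t1; lra|lra].
  by rewrite subrr !mulr0.
have E n : (avp dl g n x)%:E = (\int[leb]_(t in J) (g t * avH dl n (t - x))%:E)%E.
  by rewrite avpE// EFin_Rint.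
move: cvI; rewrite /sequence -(eq_cvg _ _ E) -EFin_Rint//.
by move/fine_cvgP => [].
Unshelve. all: by end_near. Qed.

(** A double limit. At fixed radius the smoothings converge to ball averages of [g], which inherit
    the bound by Fatou; as the radius shrinks the averages converge to [g] by Lebesgue's
    differentiation theorem, and Fatou applies again. Square integrability of [g] is a consequence,
    not a hypothesis. *)
Lemma fE_le_integral g (M : R) : itg leb J g -> (forall m, fE g m <= M) ->
  (\int[leb]_(t in J) (g t ^+ 2)%:E <= M%:E)%E.
Proof.
move=> ig gM.
pose dl k : R := k.+1%:R^-1.
have dl0 k : 0 < dl k by rewrite invr_gt0.
pose G k x := (2 * dl k)^-1 * \int[leb]_(t in ball x (dl k)) (g \_ J) t.
have mJd k : measurable (Jd (dl k)) by exact: measurable_itv.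
have mg := itg_measurable ig.
have mG k : measurable_fun (Jd (dl k)) (G k).
  apply: (measurable_fun_cvg (h := fun n => avp (dl k) g n)).
    by move=> n; apply: measurable_funTS; apply: continuous_measurable_fun; exact: continuous_trigp.
  by move=> x Jx; exact: avp_cvg.
have JdJ k : Jd (dl k) `<=` J.
  move=> x; rewrite /Jd/= !in_itv/= => /andP[x1 x2].
  by have := dl0 k; move=> ?; apply/andP; split; lra.
have step1 k : (\int[leb]_(x in Jd (dl k)) (G k x ^+ 2)%:E <= M%:E)%E.
  apply: (@fatou_sqr _ (fun n => avp (dl k) g n)) => //.
  - by move=> n; apply: measurable_funTS; apply: continuous_measurable_fun; exact: continuous_trigp.
  - by apply: aeW => x; exact: avp_cvg.
  move=> n; have ip : itg leb J (fun x => avp (dl k) g n x ^+ 2).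
    by apply: continuous_integrable_J => x; apply: cvgM; exact: continuous_trigp.
  apply: (@le_trans _ _ (\int[leb]_(x in J) (avp (dl k) g n x ^+ 2)%:E)%E).
    apply: ge0_subset_integral => //; first exact: measurable_itv.
      by apply/measurable_EFinP; exact: (itg_measurable ip).
    by move=> x _; rewrite lee_fin sqr_ge0.
  by rewrite -EFin_Rint// lee_fin; exact: avp_sqr.
apply: (@fatou_sqr _ (fun k => G k \_ (Jd (dl k)))) => //.
- move=> k; apply: measurable_funTS; exact/(measurable_restrictT (G k)).
- have lg : locally_integrable setT (g \_ J).
    by apply: integrable_locally_restrict; [exact: measurable_itv|case: ig].
  have := lebesgue_differentiation lg.
  have igJ (A : set R) : measurable A -> itg leb A (g \_ J).
    move=> mA; have H : itg leb setT (g \_ J).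
      split => //; have [mJ iJ] := ig.
      have := (integrable_mkcond _ mJ).1 iJ.
      by apply: eq_integrable => // y _; rewrite /= !patchE; case: ifP.
    exact: (itgS H).
  apply: ae_imp => x xL Jx.
  have [H1 H2] : 0 < x + pi / 2 /\ 0 < 3 * pi / 2 - x.
    by move: Jx; rewrite /= in_itv/= => /andP[? ?]; split; lra.
  have N1 := near_infty_natSinv_lt (PosNum H1).
  have N2 := near_infty_natSinv_lt (PosNum H2).
  have hE (y : R) : nicely_shrinking y (fun k => ball y (dl k)).
    split; first by move=> k; exact: measurable_ball.
    exists (1, fun k => PosNum (dl0 k)) => /=; split => //.
    - exact: cvg_harmonic.
    - by move=> k z.
    - by move=> k; rewrite mul1e.
  have := nice_lebesgue_differentiation hE lg xL.
  rewrite patchE mem_set// => /fine_cvgP[_ H].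
  have : \forall k \near \oo, (G k \_ (Jd (dl k))) x = (fine \o
    (fun n => (leb (ball x (dl n)))^-1 * \int[leb]_(y in ball x (dl n)) ((g \_ J) y)%:E)%E) k.
    near=> k.
    rewrite patchE mem_set; last first.
      move: Jx; rewrite /Jd/= !in_itv/= => /andP[x1 x2].
      have : dl k < x + pi / 2.
        by near: k; exact: N1.
      have : dl k < 3 * pi / 2 - x by near: k; exact: N2.
      by move=> ? ?; apply/andP; split; lra.
    have d2 : 2 * dl k != 0 by rewrite gt_eqF// mulr_gt0.
    rewrite /= -EFin_Rint; last by apply: igJ; exact: measurable_ball.
    have E : dl k *+ 2 = 2 * dl k by rewrite mulr_natl.
    rewrite lebesgue_measure_ball ?ltW// /G E inver (negbTE d2).
    by rewrite -EFinM.
  by move=> H9; apply: cvg_trans H; apply: near_eq_cvg; apply: filterS H9 => k ->.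
- move=> k; apply: le_trans (step1 k).
  rewrite [leLHS](_ : _ = \int[leb]_(x in J) (((fun x => (G k x ^+ 2)%:E) \_ (Jd (dl k))) x))%E; last first.
    apply: eq_integral => x _; rewrite !patchE; case: ifP => // _.
    by rewrite expr0n.
  by rewrite -integral_mkcondr setIidr.
Unshelve. all: by end_near. Qed.

Lemma bessel_parseval g (M : R) : itg leb J g -> 
  (\int[leb]_(t in J) (g t ^+ 2)%:E <= M%:E)%E <-> (forall m, fE g m <= M).
Proof.
move=> ig; split; last exact: fE_le_integral.
move=> gM m; have ig2 : itg leb J (fun t => g t ^+ 2).
  apply: itg_ge0P.
  - exact: measurable_itv.
  - by apply: measurable_funX; exact: (itg_measurable ig).
  - by move=> t _; exact: sqr_ge0.
  - exact: le_lt_trans gM (ltry _).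
by apply: le_trans (bessel m ig ig2) _; rewrite -lee_fin EFin_Rint.
Qed.

End parseval.

(** * Absolutely continuous functions on a half-line *)

Section smooth_functions.
Context {R : realType}.
Implicit Types (f g h : R -> R) (x c d : R) (n k : nat).

(** Continuous differentiability of order [n], with each derivative kept as a witness; closure
    properties then follow by plain induction on the order. *)
Fixpoint sm n f : Prop := if n is n'.+1 then
  exists f', (forall x, is_derive x 1 f (f' x)) /\ sm n' f' else continuous f.

Lemma sm_continuous n f : sm n f -> continuous f.
Proof. by case: n => // n [f' [df _]] x; exact: is_derive_continuous (df x). Qed.

Lemma smW n f : sm n.+1 f -> sm n f.
Proof.
elim: n f => [|n IH] f; first exact: (@sm_continuous 1).
by move=> [f' [df sf]]; exists f'; split => //; exact: IH.
Qed.

Lemma smD n f g : sm n f -> sm n g -> sm n (fun x => f x + g x).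
Proof.
elim: n f g => [|n IH] f g; first by move=> cf cg x; apply: cvgD; [exact: cf|exact: cg].
move=> [f' [df sf]] [g' [dg sg]]; exists (fun x => f' x + g' x); split; last exact: IH.
by move=> x; exact: der_add.
Qed.

Lemma sm_cst n c : sm n (fun=> c).
Proof.
elim: n c => [|n IH] c; first by move=> x; exact: cvg_cst.
by exists (fun=> 0); split => // x; exact: der_cst.
Qed.

Lemma smM n f g : sm n f -> sm n g -> sm n (fun x => f x * g x).
Proof.
elim: n f g => [|n IH] f g; first by move=> cf cg x; apply: cvgM; [exact: cf|exact: cg].
move=> sf sg; have [f' [df sf']] := sf; have [g' [dg sg']] := sg.
exists (fun x => f' x * g x + f x * g' x); split.
  by move=> x; exact: der_mul.
by apply: smD; apply: IH => //; exact: smW.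
Qed.

Lemma smZ n c f : sm n f -> sm n (fun x => c * f x).
Proof. by move=> sf; apply: smM => //; exact: sm_cst. Qed.

Lemma sm_affine n f c d : sm n f -> sm n (fun x => f (c * x + d)).
Proof.
have da x : is_derive x 1 (fun x => c * x + d) c.
  by apply: (is_derive_congr (der_add (der_scale c (der_id x)) (der_cst d x))); rewrite mulr1 addr0.
elim: n f => [|n IH] f.
  move=> cf x; apply: (continuous_comp (f := fun x => c * x + d)); last exact: cf.
  exact: is_derive_continuous (da x).
move=> [f' [df sf]]; exists (fun x => c * f' (c * x + d)); split.
  by move=> x; exact: der_comp (da x) (df _).
by apply: smZ; exact: IH.
Qed.

Lemma is_derive_quadratic f (C : R) : (forall t, `|f t| <= C * t ^+ 2) -> is_derive (0 : R) (1 : R) f (0 : R).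
Proof.
move=> fC.
have f0 : f 0 = 0.
  by apply/normr0_eq0/eqP; rewrite eq_le normr_ge0 andbT (le_trans (fC 0))// expr0n mulr0.
have C0 : 0 <= C by have := le_trans (normr_ge0 _) (fC 1); rewrite expr1n mulr1.
have H : h^-1 *: (f (h *: 1 + 0) - f 0) @[h --> 0^'] --> (0 : R).
  apply/norm_cvg0P.
  have cv : C * `|h| @[h --> (0:R)^'] --> (0 : R).
    apply: cvg_within_filter.
    suff : C * `|h| @[h --> (0 : R)] --> C * `|0 : R| by rewrite normr0 mulr0.
    apply: cvgM; first exact: cvg_cst.
    exact: norm_continuous.
  apply: (squeeze_cvgr _ (cvg_cst 0) cv); near=> h; rewrite normr_ge0/=.
  have h0 : h != 0 by near: h; exact: nbhs_dnbhs_neq.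
  rewrite f0 subr0 addr0 /GRing.scale/= mulr1 normrM normfV.
  rewrite ler_pdivrMl ?normr_gt0//.
  apply: (le_trans (fC h)); rewrite -[h ^+ 2]real_normK ?num_real// expr2.
  by rewrite [leRHS]mulrCA.
by split; [apply/cvg_ex; exists 0|apply/cvg_lim].
Unshelve. all: by end_near. Qed.

(* [psi k x = x^-k exp (- 1 / x)] for [0 < x]; the family is stable under
   derivation. *)
Definition psi k x : R := if 0 < x then x^-1 ^+ k * expR (- x^-1) else 0.

(** With y = 1 / t, the exponential e^y dominates (y / (k + 2))^(k + 2), so [psi k] vanishes to
    second order at the origin. This is what makes it differentiable there. *)
Lemma psi_quadratic k : exists C, forall t, `|psi k t| <= C * t ^+ 2.
Proof.
exists (k.+2%:R ^+ k.+2) => t; rewrite /psi; case: ltP => t0; last first.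
  by rewrite normr0 mulr_ge0 ?sqr_ge0// exprn_ge0.
have y0 : 0 < t^-1 by rewrite invr_gt0.
rewrite ger0_norm ?mulr_ge0 ?expR_ge0 ?exprn_ge0 ?(ltW y0)//.
have H : (t^-1 / k.+2%:R) ^+ k.+2 <= expR t^-1.
  have -> : expR t^-1 = expR (t^-1 / k.+2%:R) ^+ k.+2.
    by rewrite -expRM_natl; congr expR; rewrite mulrCA mulfV ?mulr1// pnatr_eq0.
  apply: lerXn2r; rewrite ?nnegrE ?expR_ge0// ?divr_ge0 ?(ltW y0)//.
  by apply: le_trans (expR_ge1Dx _); rewrite lerDr.
rewrite expRN mulrC ler_pdivrMl ?expR_gt0//.
have -> : t^-1 ^+ k = (k.+2%:R ^+ k.+2 * t ^+ 2) * (t^-1 / k.+2%:R) ^+ k.+2.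
  have K0 : (k.+2%:R : R) ^+ k.+2 != 0 by rewrite expf_neq0// pnatr_eq0.
  have tk : t ^+ k != 0 by rewrite expf_neq0// gt_eqF.
  have t0' : t != 0 by rewrite gt_eqF.
  rewrite expr_div_n; move: K0; move: (_ ^+ k.+2 : R) => K K0.
  by rewrite !exprVn -[in RHS](addn2 k) exprD; field; rewrite K0 t0' tk.
by rewrite mulrC ler_wpM2r// mulr_ge0 ?exprn_ge0 ?(ltW t0).
Qed.

Lemma der_psi k x : is_derive x 1 (psi k) (psi k.+2 x - k%:R * psi k.+1 x).
Proof.
have [x0|x0|->] := ltgtP x 0.
- have -> : psi k.+2 x - k%:R * psi k.+1 x = 0.
    by rewrite /psi ltNge (ltW x0)/= mulr0 subr0.
  apply: (@is_derive_near _ (fun=> 0)).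
  near=> t; rewrite /psi ltNge ltW//=.
  by near: t; exact: lt_nbhsl.
- have xn0 : x != 0 by rewrite gt_eqF.
  apply: (@is_derive_near _ (fun t => t^-1 ^+ k * expR (- t^-1))).
    near=> t; rewrite /psi ifT//; near: t; exact: lt_nbhsr.
  have dV := der_inv xn0 (der_id x).
  apply: (is_derive_congr (der_mul (der_expn k dV) (der_expR (der_opp dV)))).
  rewrite /psi x0 !exprVn; case: k => [|k] /=.
    by rewrite !expr0 !expr1; field.
  by rewrite -!exprVn !exprS -(natr1 k); field.
- have -> : psi k.+2 0 - k%:R * psi k.+1 0 = 0 :> R.
    by rewrite /psi ltxx mulr0 subr0.
  by have [C HC] := psi_quadratic k; exact: is_derive_quadratic HC.
Unshelve. all: by end_near. Qed.

Lemma sm_psi n k : sm n (psi k).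
Proof.
elim: n k => [|n IH] k.
  by move=> x; exact: is_derive_continuous (der_psi k x).
exists (fun x => psi k.+2 x - k%:R * psi k.+1 x); split; first exact: der_psi.
apply: smD; first exact: IH.
have := smZ (- k%:R) (IH k.+1).
by under eq_fun do rewrite mulNr.
Qed.

Lemma psi0_ge0 x : 0 <= psi 0 x.
Proof. by rewrite /psi; case: ifP => // _; rewrite mul1r expR_ge0. Qed.

Lemma psi0_le1 x : psi 0 x <= 1.
Proof.
rewrite /psi; case: ltP => // x0; rewrite mul1r -expR0 ler_expR oppr_le0.
by rewrite invr_ge0 ltW.
Qed.

(** The factor [n.+1] steepens both flanks while the support stays in [c, d], so that these smooth
    functions converge to the indicator of ]c, d[. *)
Definition bump c d n x : R := psi 0 (n.+1%:R * (x - c)) * psi 0 (n.+1%:R * (d - x)).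

Lemma sm_bump m c d n : sm m (bump c d n).
Proof.
apply: smM.
  have := sm_affine n.+1%:R (- (n.+1%:R * c)) (sm_psi m 0).
  by under eq_fun do rewrite -mulrBr.
have := sm_affine (- n.+1%:R) (n.+1%:R * d) (sm_psi m 0).
by under eq_fun do rewrite mulNr addrC -mulrBr.
Qed.

Lemma bump_ge0 c d n x : 0 <= bump c d n x.
Proof. by rewrite mulr_ge0// psi0_ge0. Qed.

Lemma bump_le1 c d n x : bump c d n x <= 1.
Proof. by rewrite mulr_ile1// ?psi0_ge0 ?psi0_le1. Qed.

Lemma bump_out c d n x : ~ (c < x < d) -> bump c d n x = 0.
Proof.
move=> /negP; rewrite negb_and /bump /psi => /orP[]/negbTE H.
  by rewrite pmulr_rgt0// subr_gt0 H mul0r.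
by rewrite [X in _ * X](_ : _ = 0) ?mulr0// pmulr_rgt0// subr_gt0 H.
Qed.

Lemma psi0_cvg1 x : 0 < x -> psi 0 (n.+1%:R * x) @[n --> \oo] --> (1 : R).
Proof.
move=> x0; have E n : psi 0 (n.+1%:R * x) = expR (- (x^-1 * n.+1%:R^-1)).
  by rewrite /psi pmulr_rgt0// x0 mul1r invfM mulrC.
rewrite (_ : (fun n => _) = fun n : nat => expR (- (x^-1 * n.+1%:R^-1))); last exact/funext.
rewrite -[X in _ --> X]expR0; apply: continuous_cvg; first exact: continuous_expR.
rewrite -[X in _ --> X]oppr0 -[X in _ --> - X](mulr0 x^-1).
by apply: cvgN; apply: cvgM; [exact: cvg_cst|exact: (@cvg_harmonic R)].
Qed.

Lemma bump_cvg c d x : bump c d n x @[n --> \oo] --> (\1_(`]c, d[%classic : set R) x : R).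
Proof.
rewrite indicE; case: (boolP (x \in _)) => [/set_mem|/negP].
  rewrite /= in_itv/= => /andP[cx xd].
  rewrite -[X in _ --> X](mulr1 (1 : R)).
  by apply: cvgM; apply: psi0_cvg1; rewrite subr_gt0.
move=> xcd; rewrite (_ : (fun n => _) = fun=> 0); first exact: cvg_cst.
apply/funext => n; apply: bump_out => cxd; apply: xcd; apply/mem_set.
by rewrite /= in_itv.
Qed.

Definition test1 (a : R) (f : R -> R) : Prop := (forall n, sm n f) /\
  exists c d, [/\ a < c, c < d & forall x, ~ (c <= x <= d) -> f x = 0].

Lemma test1_bump (a c d : R) n : a < c -> c < d -> test1 a (bump c d n).
Proof.
move=> ac cd; split; first by move=> m; exact: sm_bump.
exists c, d; split => // x xcd; apply: bump_out => /andP[cx xd]; apply: xcd.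
by rewrite !ltW.
Qed.

Lemma test1_continuous a f : test1 a f -> continuous f.
Proof. by move=> [/(_ 0%N)]. Qed.

Lemma zero_off_derive f f' c d : (forall x, ~ (c <= x <= d) -> f x = 0) ->
  (forall x, is_derive x 1 f (f' x)) -> forall x, ~ (c <= x <= d) -> f' x = 0.
Proof.
move=> f0 df x xcd.
have : is_derive x 1 f 0.
  apply: (@is_derive_near _ (fun=> 0)).
  move/negP: xcd; rewrite negb_and -!ltNge => /orP[xc|dx]; near=> t.
    rewrite f0// => /andP[ct _].
    have : t < c by near: t; exact: lt_nbhsl.
    by rewrite ltNge ct.
  rewrite f0// => /andP[_ td].
  have : d < t by near: t; exact: lt_nbhsr.
  by rewrite ltNge td.
by move=> [_ <-]; have [_ ->] := df x.
Unshelve. all: by end_near. Qed.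

Lemma test1_derive a f : test1 a f -> exists f', [/\ test1 a f',
   forall x, is_derive x 1 f (f' x) & exists c d, [/\ a < c, c < d,
   forall x, ~ (c <= x <= d) -> f x = 0 & forall x, ~ (c <= x <= d) -> f' x = 0]].
Proof.
move=> [sf [c [d [ac cd f0]]]]; have [f' [df _]] := sf 1%N.
have f'0 := zero_off_derive f0 df.
exists f'; split => //; last by exists c, d.
split; last by exists c, d.
move=> n; have [g [dg sg]] := sf n.+1.
suff -> : f' = g by [].
by apply/funext => x; have [_ <-] := df x; have [_ <-] := dg x.
Qed.

Lemma test1Z a c f : test1 a f -> test1 a (fun x => c * f x).
Proof.
move=> [sf [c' [d [ac cd f0]]]]; split; first by move=> n; exact: smZ.
by exists c', d; split => // x /f0 ->; rewrite mulr0.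
Qed.

Lemma test1D a f g : test1 a f -> test1 a g -> test1 a (fun x => f x + g x).
Proof.
move=> [sf [c [d [ac cd f0]]]] [sg [c' [d' [ac' cd' g0]]]].
split; first by move=> n; exact: smD.
exists (Num.min c c'), (Num.max d d'); split.
- by rewrite lt_min ac.
- by rewrite gt_min lt_max cd.
- move=> x xx; rewrite f0 ?g0 ?addr0// => /andP[h1 h2]; apply: xx;
  by rewrite ge_min le_max h1 h2 ?orbT.
Qed.

(** Multiplication by the real power x^k. For nonpositive x the logarithm is a default value, but
    [f] vanishes there because its support starts to the right of [a >= 0]. The derivative consists
    of x^(k - 1) f and x^k f', which the induction on the order covers. *)
Lemma test1_pow a (k : R) f : 0 <= a -> test1 a f ->
  test1 a (fun x => expR (k * ln x) * f x).
Proof.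
move=> a0 [sf [c [d [ac cd f0]]]]; split; last first.
  by exists c, d; split => // x /f0 ->; rewrite mulr0.
have c0 : 0 < c by rewrite (le_lt_trans a0).
move=> n; elim: n k f sf f0 => [|n IH] k f sf f0.
  move=> x; have [f' [df _]] := sf 1%N.
  have [x0|x0] := ltP 0 x.
    apply: cvgM; last exact: is_derive_continuous (df x).
    have := is_derive_continuous (der_expR (der_scale k (der_ln x0 (der_id x)))).
    exact.
  apply: is_derive_continuous.
  apply: (@is_derive_near _ (fun=> 0)).
  near=> t; rewrite f0 ?mulr0// => /andP[ct _].
  have : t < c by near: t; apply: lt_nbhsl; rewrite (le_lt_trans x0).
  by rewrite ltNge ct.
have [f' [df _]] := sf 1%N.
have sf' m : sm m f'.
  have [g [dg sg]] := sf m.+1; suff -> : f' = g by [].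
  by apply/funext => x; have [_ <-] := df x; have [_ <-] := dg x.
have f'0 := zero_off_derive f0 df.
exists (fun x => k * (expR ((k - 1) * ln x) * f x) + expR (k * ln x) * f' x); split; last first.
  by apply: smD; [apply: smZ|]; exact: IH.
move=> x; have [x0|x0] := ltP 0 x.
  have dl := der_expR (der_scale k (der_ln x0 (der_id x))).
  apply: (is_derive_congr (der_mul dl (df x))).
  have -> : expR ((k - 1) * ln x) = expR (k * ln x) / x.
    by rewrite mulrBl mul1r expRD expRN lnK ?posrE.
  congr (_ + _); field.
  by rewrite gt_eqF.
have nx : ~ (c <= x <= d) by move=> /andP[cx _]; have := lt_le_trans c0 cx; rewrite ltNge x0.
rewrite (f0 x nx) (f'0 x nx) !mulr0 addr0.
apply: (@is_derive_near _ (fun=> 0)).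
near=> t; rewrite f0 ?mulr0// => /andP[ct _].
have : t < c by near: t; apply: lt_nbhsl; rewrite (le_lt_trans x0).
by rewrite ltNge ct.
Unshelve. all: by end_near. Qed.

End smooth_functions.

(** * Dominated convergence and Fubini's theorem for real-valued integrals *)

Section dominated.
Context d (T : measurableType d) (R : realType) (mu : {measure set T -> \bar R}).

Lemma Rint_dominated (D : set T) (h : nat -> T -> R) (f g : T -> R) :
  (forall n, measurable_fun D (h n)) -> itg mu D g ->
  (forall n x, D x -> `|h n x| <= g x) ->
  (forall x, D x -> h n x @[n --> \oo] --> f x) ->
  itg mu D f /\
  \int[mu]_(x in D) h n x @[n --> \oo] --> \int[mu]_(x in D) f x.
Proof.
move=> mh ig hg hf; have [mD iD] := ig.
have mf : measurable_fun D f by exact: (measurable_fun_cvg mh hf).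
have [fi _ H] : [/\ mu.-integrable D (EFin \o f),
    [sequence \int[mu]_(x in D) `|(EFin \o h n) x - (EFin \o f) x|]_n @ \oo --> 0 &
    [sequence \int[mu]_(x in D) (EFin \o h n) x]_n @ \oo --> \int[mu]_(x in D) (EFin \o f) x]%E.
  apply: (@dominated_convergence _ _ _ mu D mD _ _ (EFin \o g)) => //.
  - by move=> n; exact/measurable_EFinP.
  - exact/measurable_EFinP.
  - by apply: aeW => x Dx; apply: cvg_EFin; [exact: nearW|exact: hf].
  - by apply: aeW => x n Dx; rewrite /= lee_fin; exact: hg.
have fi' : itg mu D f by [].
split => //; have ih n : itg mu D (h n) by exact: itg_le (mh n) ig (hg n).
have : (\int[mu]_(x in D) h n x)%:E @[n --> \oo] --> (\int[mu]_(x in D) f x)%:E.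
  rewrite EFin_Rint//; apply: cvg_trans H; apply: near_eq_cvg; near=> n.
  by rewrite EFin_Rint.
by move/fine_cvgP => [_].
Unshelve. all: by end_near. Qed.

Lemma itg_mkcond (D : set T) (f : T -> R) : measurable D ->
  itg mu D f <-> itg mu setT (f \_ D).
Proof.
move=> mD; have E : (EFin \o f) \_ D = EFin \o (f \_ D).
  by apply/funext => x; rewrite /= !patchE; case: ifP.
have H := @integrable_mkcond _ _ _ mu D (EFin \o f) mD.
by split=> -[_ fi]; split => //; move: fi; rewrite -E => /H.
Qed.

Lemma itg_bounded (D : set T) (f g : T -> R) (M : R) : itg mu D f ->
  measurable_fun D g -> (forall x, D x -> `|g x| <= M) -> itg mu D (fun x => f x * g x).
Proof.
move=> fi mg gM; apply: (itg_le _ (itgZ M (itg_norm fi))).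
  by apply: measurable_funM => //; exact: itg_measurable fi.
by move=> x Dx; rewrite normrM mulrC ler_wpM2r// gM.
Qed.

Lemma fine_integrable (g : T -> \bar R) : mu.-integrable setT g ->
  itg mu setT (fine \o g) /\ \int[mu]_x fine (g x) = fine (\int[mu]_x g x)%E.
Proof.
move=> ig; have mg := measurable_int _ ig.
have gae : ae_eq mu setT (EFin \o (fine \o g)) g.
  by have := integrable_ae measurableT ig; apply: ae_imp => x H /H /fineK.
have mf : measurable_fun setT (EFin \o (fine \o g)).
  by apply/measurable_EFinP; exact: measurableT_comp mg.
split; last by congr fine; exact: ae_eq_integral.
split => //; apply: (le_integrable measurableT mf _ ig) => x _ /=.
by case: (g x) => [y| |] //=; rewrite normr0 leey.
Qed.

End dominated.

Section Fubini_real.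
Context d1 d2 (T1 : measurableType d1) (T2 : measurableType d2) (R : realType).
Variables (m1 : {sigma_finite_measure set T1 -> \bar R}).
Variables (m2 : {sigma_finite_measure set T2 -> \bar R}).

Lemma itg_prod (f : T1 -> R) (g : T2 -> R) : itg m1 setT f -> itg m2 setT g ->
  itg (m1 \x m2)%E setT (fun z => f z.1 * g z.2).
Proof.
move=> fi gi; split => //.
have mf : measurable_fun setT (fun z : T1 * T2 => f z.1).
  by apply: (measurableT_comp (itg_measurable fi)).
have mg : measurable_fun setT (fun z : T1 * T2 => g z.2).
  by apply: (measurableT_comp (itg_measurable gi)).
apply/integrable12ltyP.
  by apply/measurable_EFinP; exact: measurable_funM.
rewrite (eq_integral (fun x => (\int[m2]_y `|g y| * `|f x|)%:E)); last first.
  move=> x _; rewrite mulrC -RintZ; last exact: itg_norm.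
  rewrite EFin_Rint; last by apply: itgZ; exact: itg_norm.
  by apply: eq_integral => y _; rewrite /= normrM.
by rewrite -EFin_Rint ?ltry//; apply: itgZ; exact: itg_norm.
Qed.

Lemma integrable_fubini_G (F : T1 * T2 -> \bar R) :
  (m1 \x m2)%E.-integrable setT F -> m2.-integrable setT (fubini_G m1 F).
Proof.
move=> Fi; have mF := measurable_int _ Fi.
have mG := measurable_fubini_G Fi.
apply/integrableP; split => //.
apply: le_lt_trans ((integrable21ltyP m1 m2 mF).1 Fi).
apply: ge0_le_integral => //.
- exact: measurableT_comp.
- apply: (measurable_fun_fubini_tonelli_G (fun z => `|F z|%E)) => //.
  exact: measurableT_comp.
- move=> y _; apply: le_abse_integral => //.
  exact: measurableT_comp mF (pair2_measurable y).
Qed.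

Lemma Rint_Fubini (F : T1 * T2 -> R) : itg (m1 \x m2)%E setT F ->
  [/\ itg m1 setT (fun x => \int[m2]_y F (x, y)),
      itg m2 setT (fun y => \int[m1]_x F (x, y)),
      \int[(m1 \x m2)%E]_z F z = \int[m1]_x \int[m2]_y F (x, y) &
      \int[(m1 \x m2)%E]_z F z = \int[m2]_y \int[m1]_x F (x, y)].
Proof.
move=> [_ Fi].
have [H1 E1] := fine_integrable (integrable_fubini_F Fi).
have [H2 E2] := fine_integrable (integrable_fubini_G Fi).
split => //.
- by rewrite [RHS]E1; congr fine; rewrite -(integral12_prod_meas1 Fi).
- by rewrite [RHS]E2; congr fine; rewrite -(integral21_prod_meas1 Fi).
Qed.

End Fubini_real.

(** * Primitives of integrable functions *)

Section primitives.
Context {R : realType}.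
Local Notation leb := (@lebesgue_measure R).
Local Notation leb2 := (leb \x leb)%E.
Implicit Types (f g h p q : R -> R) (a c T x : R).

Local Notation "'I[ a , T ]" := (`]a, T]%classic : set R) (at level 0, format "''I[' a ,  T ]").

Lemma measurable_oc a T : measurable 'I[a, T].
Proof. exact: measurable_itv. Qed.

Lemma itg_oc_cst a T (c : R) : itg leb 'I[a, T] (fun=> c).
Proof.
split; first exact: measurable_oc.
have := @continuous_compact_integrable R (fun=> c) `[a, T] (@segment_compact _ _ _)
  (continuous_subspaceT (@cst_continuous _ _ c)).
by apply: integrableS; [exact: measurable_itv|exact: measurable_itv|exact: subset_itv_oc_cc].
Qed.

(** Fubini's theorem on the triangle a < s < t <= T. Every integration by parts for primitives below
    rests on it, so no pointwise differentiability is needed. *)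
Lemma triangle_Fubini p q a T : itg leb 'I[a, T] p -> itg leb 'I[a, T] q ->
  [/\ itg leb 'I[a, T] (fun s => p s * \int[leb]_(t in 'I[s, T]) q t),
      itg leb 'I[a, T] (fun t => q t * \int[leb]_(s in 'I[a, t]) p s) &
      \int[leb]_(s in 'I[a, T]) (p s * \int[leb]_(t in 'I[s, T]) q t) =
      \int[leb]_(t in 'I[a, T]) (q t * \int[leb]_(s in 'I[a, t]) p s)].
Proof.
move=> ip iq; have mI := measurable_oc a T.
set p1 := p \_ 'I[a, T]; set q1 := q \_ 'I[a, T].
have ip1 : itg leb setT p1 := (itg_mkcond leb p mI).1 ip.
have iq1 : itg leb setT q1 := (itg_mkcond leb q mI).1 iq.
pose K (z : R * R) : R := p1 z.1 * q1 z.2 * \1_[set z : R * R | z.1 < z.2] z.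
have iK : itg leb2 setT K.
  apply: (itg_le _ (itg_norm (itg_prod ip1 iq1))).
    apply: measurable_funM; first exact: (itg_measurable (itg_prod ip1 iq1)).
    apply: measurable_indic; rewrite -[X in measurable X]setTI.
    have -> : [set z : R * R | z.1 < z.2] = (fun z => z.2 - z.1) @^-1` `]0, +oo[%classic.
      by apply/seteqP; split => z /=; rewrite in_itv/= andbT subr_gt0.
    by apply: measurable_funB => //; exact: measurable_itv.
  move=> z _; rewrite /K normrM ler_piMr//.
  by rewrite indicE; case: (_ \in _); rewrite ?normr1 ?normr0.
have [K1 K2 KE KE'] := Rint_Fubini iK; rewrite {}KE in KE'.
have E1 s : \int[leb]_t K (s, t) = ((fun s => p s * \int[leb]_(t in 'I[s, T]) q t) \_ 'I[a, T]) s.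
  rewrite patchE; case: ifPn => [/set_mem sI|sI]; last first.
    rewrite -[RHS](@Rint0 _ _ _ leb setT); apply: Rint_ext => t _.
    by rewrite /K/= /p1 patchE (negbTE sI) !mul0r.
  have sa : a < s by move: sI; rewrite /= in_itv/= => /andP[].
  have sub : 'I[s, T] `<=` 'I[a, T].
    by move=> t; rewrite /= !in_itv/= => /andP[st ->]; rewrite (lt_trans sa).
  rewrite -RintZ; last by apply: (itgS iq sub); exact: measurable_oc.
  rewrite [RHS]Rintegral_mkcond; apply: Rint_ext => t _.
  rewrite /K/= /p1 /q1 !patchE mem_set// indicE.
  have -> : (t \in 'I[s, T]) = (t \in 'I[a, T]) && ((s, t) \in [set z : R * R | z.1 < z.2]).
    apply/idP/andP => [/set_mem tI|[/set_mem tI /set_mem/= st]].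
      by split; apply/mem_set; [exact: sub|move: tI; rewrite /= in_itv/= => /andP[]].
    by apply/mem_set; move: tI; rewrite /= !in_itv/= st => /andP[_ ->].
  by case: (_ \in _) => /=; case: (_ \in _); rewrite ?mulr1 ?mulr0 ?mul0r.
have E2 t : \int[leb]_s K (s, t) = ((fun t => q t * \int[leb]_(s in 'I[a, t]) p s) \_ 'I[a, T]) t.
  rewrite patchE; case: ifPn => [/set_mem tI|tI]; last first.
    rewrite -[RHS](@Rint0 _ _ _ leb setT); apply: Rint_ext => s _.
    by rewrite /K/= /q1 patchE (negbTE tI) mulr0 !mul0r.
  have tT : t <= T by move: tI; rewrite /= in_itv/= => /andP[].
  have sub : `]a, t[%classic `<=` 'I[a, T].
    by move=> s; rewrite /= !in_itv/= => /andP[-> st]; rewrite (le_trans (ltW st)).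
  have ipt : itg leb `]a, t[%classic p by apply: (itgS ip sub); exact: measurable_itv.
  rewrite -Rintegral_itv_bndo_bndc; last by case: ipt.
  rewrite -(RintZ _ ipt) [RHS]Rintegral_mkcond; apply: Rint_ext => s _.
  rewrite /K/= /p1 /q1 !patchE (mem_set tI) indicE.
  have -> : (s \in `]a, t[%classic) = (s \in 'I[a, T]) && ((s, t) \in [set z : R * R | z.1 < z.2]).
    apply/idP/andP => [/set_mem sI|[/set_mem sI /set_mem/= st]].
      by split; apply/mem_set; [exact: sub|move: sI; rewrite /= in_itv/= => /andP[]].
    by apply/mem_set; move: sI; rewrite /= !in_itv/= st => /andP[-> _].
  by case: (_ \in _) => /=; case: (_ \in _); rewrite ?mulr1 ?mulr0 ?mul0r// mulrC.
split.
- by apply/(itg_mkcond leb _ mI); apply: itg_ext K1 => s _; exact: E1.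
- by apply/(itg_mkcond leb _ mI); apply: itg_ext K2 => s _; exact: E2.
- rewrite [LHS]Rintegral_mkcond [RHS]Rintegral_mkcond.
  transitivity (\int[leb]_s \int[leb]_t K (s, t)); first by apply: Rint_ext => s _.
  by rewrite KE'; apply: Rint_ext => s _.
Qed.

Definition prim p a x := \int[leb]_(t in 'I[a, x]) p t.

Lemma Rint_oc_cat a c T p : itg leb 'I[a, T] p -> a <= c -> c <= T ->
  \int[leb]_(t in 'I[a, T]) p t = prim p a c + \int[leb]_(t in 'I[c, T]) p t.
Proof.
move=> [_ ip] ac cT; rewrite -(Rintegral_itvB ip (x := c)) ?bnd_simp//.
by rewrite /prim addrC subrK.
Qed.

Lemma primaa p a : prim p a a = 0.
Proof. by rewrite /prim set_itvoc0 Rintegral_set0. Qed.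

Lemma prim_norm p a x T : itg leb 'I[a, T] p -> x <= T ->
  `|prim p a x| <= \int[leb]_(t in 'I[a, T]) `|p t|.
Proof.
move=> ip xT.
have sub : 'I[a, x] `<=` 'I[a, T].
  by move=> t; rewrite /= !in_itv/= => /andP[-> /le_trans->].
apply: le_trans (Rint_norm (itgS ip sub (measurable_oc _ _))) _.
apply: (@Rint_subset _ _ _ leb 'I[a, T] 'I[a, x] (fun t => `|p t|)) => //.
exact: itg_norm.
Qed.

Lemma measurable_prim p a T : itg leb 'I[a, T] p -> measurable_fun 'I[a, T] (prim p a).
Proof.
move=> ip; have i1 := itg_oc_cst a T 1.
have [_ H _] := triangle_Fubini ip i1.
have := itg_measurable H; apply: eq_measurable_fun => x _.
by rewrite mul1r.
Qed.

Lemma itg_mul_prim p q a T A : itg leb 'I[a, T] p -> itg leb 'I[a, T] q ->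
  itg leb 'I[a, T] (fun t => q t * (A + prim p a t)).
Proof.
move=> ip iq; apply: (itg_bounded (M := `|A| + \int[leb]_(t in 'I[a, T]) `|p t|)) => //.
  by apply: measurable_funD => //; exact: measurable_prim.
move=> x; rewrite /= in_itv/= => /andP[_ xT]; apply: le_trans (ler_normD _ _) _.
by rewrite lerD2l prim_norm.
Qed.

(** The product rule for absolutely continuous functions, in integrated form. *)
Lemma prim_mul p q a T A B : a <= T -> itg leb 'I[a, T] p -> itg leb 'I[a, T] q ->
  (A + prim p a T) * (B + prim q a T) = A * B +
  \int[leb]_(t in 'I[a, T]) (p t * (B + prim q a t) + q t * (A + prim p a t)).
Proof.
move=> aT ip iq; have [H1 H2 E] := triangle_Fubini ip iq.
rewrite RintD; try exact: itg_mul_prim.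
have iqp : itg leb 'I[a, T] (fun t => p t * prim q a t).
  apply: itg_ext (itg_mul_prim 0 iq ip) => t _; by rewrite add0r.
have ipq : itg leb 'I[a, T] (fun t => q t * prim p a t) by exact: H2.
have EM h k (C : R) : itg leb 'I[a, T] h -> itg leb 'I[a, T] (fun t => h t * prim k a t) ->
    \int[leb]_(t in 'I[a, T]) (h t * (C + prim k a t)) =
    C * prim h a T + \int[leb]_(t in 'I[a, T]) (h t * prim k a t).
  move=> ih ihk; rewrite -(RintZ C ih) -(RintD (itgZ C ih) ihk).
  by apply: Rint_ext => t _; ring.
rewrite !EM// -E.
have -> : \int[leb]_(t in 'I[a, T]) (p t * prim q a t) =
    prim p a T * prim q a T - \int[leb]_(s in 'I[a, T]) (p s * \int[leb]_(t in 'I[s, T]) q t).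
  rewrite [prim p a T * _]mulrC -(RintZ _ ip) -(RintB (itgZ _ ip) H1).
  apply: Rint_ext => s; rewrite /= in_itv/= => /andP[/ltW as1 sT].
  by rewrite {2}/prim (Rint_oc_cat iq as1 sT); ring.
by ring.
Qed.

End primitives.

(** * Weak derivatives and absolutely continuous representatives *)

Section absolute_continuity.
Context {R : realType}.
Local Notation leb := (@lebesgue_measure R).
Implicit Types (f g h p q : R -> R) (a b c d x T : R).
Local Notation "'I[ a , T ]" := (`]a, T]%classic : set R) (at level 0, format "''I[' a ,  T ]").
Local Notation "'I[ a ,oo]" := (`]a, +oo[%classic : set R) (at level 0, format "''I[' a ,oo]").

(** Integrability reaches down to the endpoint [a], so that primitives can start there and traces at
    [a] make sense. *)
Definition loc1 a f := forall T, itg leb 'I[a, T] f.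

Lemma continuous_bounded f c d : continuous f ->
  exists2 M, 0 <= M & forall x, c <= x <= d -> `|f x| <= M.
Proof.
move=> cf; have [cd|dc] := leP c d; last first.
  by exists 0 => // x /andP[cx xd]; have := le_lt_trans (le_trans cx xd) dc; rewrite ltxx.
have [|M _ fM] := @EVT_max R (fun t => `|f t|) c d cd.
  by apply: continuous_subspaceT => t; apply: continuous_comp; [exact: cf|exact: norm_continuous].
by exists `|f M| => // x xcd; apply: fM; rewrite in_itv.
Qed.

Lemma Rint_supp a c d h : a < c -> (forall x, ~ (c <= x <= d) -> h x = 0) ->
  \int[leb]_(x in 'I[a,oo]) h x = \int[leb]_(x in 'I[a, d]) h x.
Proof.
move=> ac h0; rewrite [LHS]Rintegral_mkcond [RHS]Rintegral_mkcond.
apply: Rint_ext => x _; rewrite !patchE.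
have [xd|dx] := leP x d.
  have -> // : (x \in 'I[a,oo]) = (x \in 'I[a, d]).
  by rewrite !mem_setE !in_itv/= xd andbT.
rewrite h0 ?if_same//.
by move=> /andP[_]; rewrite leNgt dx.
Qed.

Lemma itg_supp a c d h : a < c -> (forall x, ~ (c <= x <= d) -> h x = 0) ->
  itg leb 'I[a, d] h -> itg leb 'I[a,oo] h.
Proof.
move=> ac h0 /(itg_mkcond leb h (measurable_oc a d)).1 ih.
apply: (itg_mkcond leb h (measurable_itv `]a, +oo[)).2.
apply: itg_ext ih => x _; rewrite !patchE.
have [xd|dx] := leP x d.
  have -> // : (x \in 'I[a,oo]) = (x \in 'I[a, d]).
  by rewrite !mem_setE !in_itv/= xd andbT.
rewrite h0 ?if_same//.
by move=> /andP[_]; rewrite leNgt dx.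
Qed.

Lemma loc1_continuousM a f g : loc1 a f -> continuous g -> loc1 a (fun x => f x * g x).
Proof.
move=> lf cg T; have [M M0 gM] := continuous_bounded a T cg.
apply: (itg_bounded (lf T)); last first.
  by move=> x; rewrite /= in_itv/= => /andP[/ltW ax xT]; apply: gM; rewrite ax.
by apply: measurable_funTS; exact: continuous_measurable_fun.
Qed.

Lemma itg_test a f eta : loc1 a f -> test1 a eta -> itg leb 'I[a,oo] (fun x => f x * eta x).
Proof.
move=> lf te; have [se [c [d [ac cd e0]]]] := te.
apply: (@itg_supp a c d) => //; first by move=> x /e0 ->; rewrite mulr0.
exact: (loc1_continuousM lf (test1_continuous te)).
Qed.

Lemma bump_Rint a c d f : a < c -> c < d -> loc1 a f ->
  \int[leb]_(x in 'I[a,oo]) (f x * bump c d n x) @[n --> \oo] -->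
  \int[leb]_(x in `]c, d[) f x.
Proof.
move=> ac cd lf.
have -> : \int[leb]_(x in `]c, d[) f x =
    \int[leb]_(x in 'I[a, d]) (f x * (\1_(`]c, d[%classic : set R) x : R)).
  rewrite [LHS]Rintegral_mkcond [RHS]Rintegral_mkcond; apply: Rint_ext => x _.
  rewrite !patchE indicE; have [xcd|xcd] := boolP (x \in `]c, d[%classic).
    rewrite mulr1 ifT//; move: xcd; rewrite !mem_setE !in_itv/= => /andP[cx /ltW->].
    by rewrite (lt_trans ac cx).
  by rewrite mulr0 if_same.
have E n : \int[leb]_(x in 'I[a,oo]) (f x * bump c d n x) =
           \int[leb]_(x in 'I[a, d]) (f x * bump c d n x).
  apply: (Rint_supp ac) => x xcd; rewrite bump_out ?mulr0// => /andP[cx xd].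
  by apply: xcd; rewrite !ltW.
under eq_fun do rewrite E.
apply: (proj2 (@Rint_dominated _ _ _ leb 'I[a, d] _ _ (fun x => `|f x|) _ (itg_norm (lf d)) _ _)).
- move=> n; have cb : continuous (bump c d n) by exact: (sm_continuous (sm_bump 0 c d n)).
  exact: (itg_measurable (loc1_continuousM lf cb d)).
- by move=> n x _; rewrite normrM ler_piMr// ger0_norm ?bump_ge0// bump_le1.
- by move=> x _; apply: cvgM; [exact: cvg_cst|exact: bump_cvg].
Qed.

Lemma lt_near2 x c d : c < x -> x < d -> \forall t \near x, c < t < d.
Proof.
move=> cx xd; have := @near_in_itvoo R c d x; rewrite in_itv/= cx xd => /(_ isT).
by apply: filterS => t; rewrite in_itv.
Qed.

(** The lemma of du Bois-Reymond. Bumps converge to indicators, so [f] has integral zero over every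
    interval ]c, d[ with a < c; Lebesgue differentiation of the primitive then gives [f = 0] almost
    everywhere. *)
Lemma dbr0 a f : loc1 a f ->
  (forall eta, test1 a eta -> \int[leb]_(x in 'I[a,oo]) (f x * eta x) = 0) ->
  {ae leb, forall x, a < x -> f x = 0}.
Proof.
move=> lf f0.
have H c d : a < c -> c < d -> \int[leb]_(x in `]c, d[) f x = 0.
  move=> ac cd; have := bump_Rint ac cd lf.
  rewrite (_ : (fun n => _) = fun=> 0); last by apply/funext => n; apply: f0; exact: test1_bump.
  by move=> /(cvg_unique (@Rhausdorff R) (cvg_cst 0)).
(* The function is cut off at a + n + 1, because its primitive is differentiated under integrability
   on the whole line. *)
have step n : {ae leb, forall x, a < x < a + n.+1%:R -> f x = 0}.
  pose g := f \_ 'I[a, a + n.+1%:R].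
  have ig : itg leb setT g := (itg_mkcond leb f (measurable_oc _ _)).1 (lf (a + n.+1%:R)).
  have igy y : leb.-integrable 'I[a, y] (EFin \o g).
    by have [] := itgS ig (@subsetT _ 'I[a, y]) (measurable_oc a y).
  have lg : locally_integrable [set: R] g.
    by apply: open_integrable_locally; [exact: openT|case: ig].
  have := FTC1 igy lg; apply: ae_imp => x Hx /andP[ax xn].
  have {Hx} [dF Fx] := Hx ax.
  have gE y : a < y < a + n.+1%:R -> g y = f y.
    by move=> /andP[ay yn]; rewrite /g patchE ifT// mem_setE in_itv/= ay ltW.
  rewrite -gE ?ax// -Fx derive1E.
  set c := (a + x) / 2.
  have [ac cx] : a < c /\ c < x by rewrite /c; split; lra.
  have cst0 : is_derive x 1 (fun y => \int[leb]_(t in 'I[a, y]) g t) 0.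
    apply: (@is_derive_near _ (fun=> prim g a c)).
    near=> y; have /andP[cy yn] : c < y < a + n.+1%:R by near: y; exact: lt_near2.
    have iy : itg leb 'I[a, y] g by split; [exact: measurable_oc|].
    rewrite (Rint_oc_cat iy (ltW ac) (ltW cy)).
    have -> : \int[leb]_(t in 'I[c, y]) g t = \int[leb]_(t in 'I[c, y]) f t.
      apply: Rint_ext => t; rewrite /= in_itv/= => /andP[ct ty].
      by rewrite gE// (lt_trans ac ct) (le_lt_trans ty yn).
    have icy : itg leb `]c, y[%classic f.
      apply: (itgS (lf y)); last exact: measurable_itv.
      by move=> t; rewrite /= !in_itv/= => /andP[ct /ltW->]; rewrite (lt_trans ac).
    by rewrite -Rintegral_itv_bndo_bndc ?H ?addr0//; case: icy.
  by have [_ ->] := cst0.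
have := ae_forall step; apply: ae_imp => x Hx ax.
apply: (Hx (Num.bound (x - a))); rewrite ax/= -ltrBlDl.
have xa : 0 <= x - a by rewrite subr_ge0 ltW.
by rewrite (lt_trans (archi_boundP xa))// ltr_nat.
Unshelve. all: by end_near. Qed.

(** The primitive from [a] vanishes to the left of the support trivially and to the right of it
    because the integral is zero. *)
Lemma test1_prim a psi : test1 a psi -> \int[leb]_(x in 'I[a,oo]) psi x = 0 ->
  exists2 eta, test1 a eta & forall x, is_derive x 1 eta (psi x).
Proof.
move=> tp I0; have [sp [c [d [ac cd p0]]]] := tp; have cp := test1_continuous tp.
have lp : loc1 a psi.
  move=> T; apply: itg_ext (loc1_continuousM (fun T => itg_oc_cst a T 1) cp T) => x _.
  exact: mul1r.
have below x : x < c -> prim psi a x = 0.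
  move=> xc; rewrite -[RHS](@Rint0 _ _ _ leb 'I[a, x]); apply: Rint_ext => t.
  rewrite /= in_itv/= => /andP[_ tx]; apply: p0 => /andP[ct _].
  by have := le_lt_trans (le_trans ct tx) xc; rewrite ltxx.
have deta x : is_derive x 1 (prim psi a) (psi x).
  have [xc|cx] := ltP x c.
    rewrite p0; last by move=> /andP[cx _]; have := le_lt_trans cx xc; rewrite ltxx.
    apply: (@is_derive_near _ (fun=> 0)); near=> t; rewrite below//.
    by near: t; exact: lt_nbhsl.
  have x1 : x < x + 1 by rewrite ltrDl.
  have ax : a < x by exact: lt_le_trans ac cx.
  have [_ ix] := lp (x + 1).
  have [dF Fx] := @continuous_FTC1 R psi (BRight a) x (x + 1) x1 ix ax (cp x).
  rewrite derive1E in Fx; exact: (DeriveDef dF Fx).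
exists (prim psi a) => //; split.
  case=> [|n]; first by move=> x; exact: is_derive_continuous (deta x).
  by exists psi; split.
exists c, d; split => // x /negP; rewrite negb_and -!ltNge => /orP[/below//|dx].
rewrite -I0; apply/esym/(Rint_supp ac) => t ct; apply: p0 => /andP[ct' td].
by apply: ct; rewrite ct' (le_trans td (ltW dx)).
Unshelve. all: by end_near. Qed.

Lemma Rint_test_prim a p eta eta' : loc1 a p -> test1 a eta ->
  (forall x, is_derive x 1 eta (eta' x)) ->
  loc1 a (fun x => prim p a x) /\
  \int[leb]_(x in 'I[a,oo]) (prim p a x * eta' x) = - \int[leb]_(x in 'I[a,oo]) (p x * eta x).
Proof.
move=> lp te de; have [se [c [d [ac cd e0]]]] := te.
have lF : loc1 a (prim p a).
  move=> T; have [_ H _] := triangle_Fubini (lp T) (itg_oc_cst a T 1).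
  by apply: itg_ext H => x _; rewrite mul1r.
split => //.
have e'0 := zero_off_derive e0 de.
(* The integrals run up to [d + 1] rather than [d], where [eta] is known to vanish. *)
have off x : ~ (c <= x <= d + 1) -> ~ (c <= x <= d).
  by move=> H /andP[cx xd]; apply: H; rewrite cx (le_trans xd)// lerDl.
have cont' : continuous eta'.
  have [g [[sg _] dg _]] := test1_derive te.
  suff -> : eta' = g by exact: (sm_continuous (sg 0%N)).
  by apply/funext => x; have [_ <-] := de x; have [_ <-] := dg x.
have l' : loc1 a eta'.
  move=> T; apply: itg_ext (loc1_continuousM (fun T => itg_oc_cst a T 1) cont' T) => x _.
  exact: mul1r.
rewrite (@Rint_supp a c (d + 1))//; last by move=> x /off/e'0 ->; rewrite mulr0.
rewrite (@Rint_supp a c (d + 1))//; last by move=> x /off/e0 ->; rewrite mulr0.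
have [H1 _ E] := triangle_Fubini (lp (d + 1)) (l' (d + 1)).
transitivity (\int[leb]_(t in 'I[a, d + 1]) (eta' t * \int[leb]_(s in 'I[a, t]) p s)).
  by apply: Rint_ext => x _; rewrite mulrC.
rewrite -E -RintN; last exact: (loc1_continuousM lp (test1_continuous te)).
apply: Rint_ext => s; rewrite /= in_itv/= => /andP[as1 sd].
have := @FTC2_oc R eta eta' s (d + 1) sd (fun t _ => de t) (fun t _ => cont' t).
rewrite /Rintegral => -> /=; rewrite [eta (d + 1)]e0 ?sub0r ?mulrN//.
by move=> /andP[_]; rewrite leNgt ltrDl ltr01.
Qed.

(** The difference of [f] and the primitive of [p] has zero weak derivative. A test function minus
    the right multiple of a fixed bump has integral zero, hence is a derivative; this identifies the
    difference with the constant [C]. *)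
Lemma ac_rep a f p : loc1 a f -> loc1 a p ->
  (forall eta eta', test1 a eta -> (forall x, is_derive x 1 eta (eta' x)) ->
    \int[leb]_(x in 'I[a,oo]) (f x * eta' x) = - \int[leb]_(x in 'I[a,oo]) (p x * eta x)) ->
  exists C, {ae leb, forall x, a < x -> f x = C + prim p a x}.
Proof.
move=> lf lp fp.
have l1 : loc1 a (fun=> 1) by move=> T; exact: itg_oc_cst.
have [c ac] : exists c, a < c by exists (a + 1); rewrite ltrDl.
have c1 : c < c + 1 by rewrite ltrDl.
(* Some bump has nonzero mass, since the masses converge to the length 1 of the interval. *)
have [n n0] : exists n, \int[leb]_(x in 'I[a,oo]) (1 * bump c (c + 1) n x) != 0.
  apply/not_existsP => H; have := bump_Rint ac c1 l1.
  have E n : \int[leb]_(x in 'I[a,oo]) (1 * bump c (c + 1) n x) = 0.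
    by apply/eqP/negPn/negP; exact: H.
  under eq_fun do rewrite E.
  move=> /(cvg_unique (@Rhausdorff R) (cvg_cst 0)).
  rewrite Rintegral_cst; last exact: measurable_itv.
  rewrite mul1r /= lebesgue_measure_itv/= lte_fin c1 -EFinD/=; lra.
have lF : loc1 a (fun x => prim p a x).
  move=> T; have [_ H _] := triangle_Fubini (lp T) (itg_oc_cst a T 1).
  by apply: itg_ext H => x _; rewrite mul1r.
pose g x := f x - prim p a x.
have lg : loc1 a g by move=> T; apply: itgB; [exact: lf|exact: lF].
have g0 eta eta' : test1 a eta -> (forall x, is_derive x 1 eta (eta' x)) -> test1 a eta' ->
    \int[leb]_(x in 'I[a,oo]) (g x * eta' x) = 0.
  move=> te de te'; have [_ E] := Rint_test_prim lp te de.
  transitivity (\int[leb]_(x in 'I[a,oo]) (f x * eta' x - prim p a x * eta' x)).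
    by apply: Rint_ext => x _; rewrite mulrBl.
  by rewrite RintB; [rewrite E fp// subrr|exact: itg_test|exact: itg_test].
set I1 := \int[leb]_(x in 'I[a,oo]) (1 * bump c (c + 1) n x) in n0.
have tb := test1_bump n ac c1.
pose C := I1^-1 * \int[leb]_(x in 'I[a,oo]) (g x * bump c (c + 1) n x).
have lgC : loc1 a (fun x => g x - C) by move=> T; apply: itgB; [exact: lg|exact: itg_oc_cst].
exists C; have := dbr0 lgC; move=> H.
suff : forall eta, test1 a eta -> \int[leb]_(x in 'I[a,oo]) ((g x - C) * eta x) = 0.
  by move=> /H; apply: ae_imp => x Hx /Hx; rewrite /g => /eqP; rewrite subr_eq0 subr_eq => /eqP.
move=> psi tp; pose I2 := \int[leb]_(x in 'I[a,oo]) psi x.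
have t0 : test1 a (fun x => psi x + (- (I2 / I1)) * bump c (c + 1) n x).
  by apply: test1D => //; exact: test1Z.
have i1 (eta : R -> R) : test1 a eta -> itg leb 'I[a,oo] eta.
  by move=> te; apply: itg_ext (itg_test l1 te) => x _; rewrite mul1r.
have I0 : \int[leb]_(x in 'I[a,oo]) (psi x + (- (I2 / I1)) * bump c (c + 1) n x) = 0.
  rewrite RintD; [|exact: i1|apply: itgZ; exact: i1].
  rewrite RintZ; last exact: i1.
  have -> : \int[leb]_(x in 'I[a,oo]) bump c (c + 1) n x = I1.
    by apply: Rint_ext => x _; rewrite mul1r.
  by rewrite -/I2; field.
have [eta te de] := test1_prim t0 I0.
have := g0 _ _ te de t0.
have -> : \int[leb]_(x in 'I[a,oo]) (g x * (psi x + - (I2 / I1) * bump c (c + 1) n x)) =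
   \int[leb]_(x in 'I[a,oo]) (g x * psi x) - I2 * C.
  transitivity (\int[leb]_(x in 'I[a,oo]) (g x * psi x + (- (I2 / I1)) * (g x * bump c (c + 1) n x))).
    by apply: Rint_ext => x _; ring.
  rewrite RintD; [|exact: itg_test|apply: itgZ; exact: itg_test].
  by rewrite RintZ; [rewrite /C; field|exact: itg_test].
move=> E.
transitivity (\int[leb]_(x in 'I[a,oo]) (g x * psi x + (- C) * psi x)).
  by apply: Rint_ext => x _; ring.
rewrite RintD; [|exact: itg_test|apply: itgZ; exact: i1].
by rewrite RintZ; [rewrite -/I2 mulNr mulrC|exact: i1].
Qed.

End absolute_continuity.

(** * One-dimensional energies *)

Section energy.
Context {R : realType}.
Local Notation leb := (@lebesgue_measure R).
Implicit Types (f g h p q : R -> R) (a b c d x T : R).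
Local Notation "'I[ a , T ]" := (`]a, T]%classic : set R) (at level 0, format "''I[' a ,  T ]").
Local Notation "'I[ a ,oo]" := (`]a, +oo[%classic : set R) (at level 0, format "''I[' a ,oo]").

(** The pair of a function and its density. The representation starts at [a], so [f a] is the trace,
    while values to the left of [a] are left free. *)
Definition ac a f f' := loc1 a f' /\ forall x, a <= x -> f x = f a + prim f' a x.

Lemma ac_int a f f' T : ac a f f' -> a <= T ->
  \int[leb]_(x in 'I[a, T]) f' x = f T - f a.
Proof. by move=> [_ fE] aT; rewrite (fE T aT) addrC addKr. Qed.

Lemma ac_loc1M a f f' g : ac a f f' -> loc1 a g -> loc1 a (fun x => g x * f x).
Proof.
move=> [lf fE] lg T; apply: itg_ext (itg_mul_prim (f a) (lf T) (lg T)) => x.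
by rewrite /= in_itv/= => /andP[/ltW ax _]; rewrite -fE.
Qed.

Lemma ac_mul a f f' g g' : ac a f f' -> ac a g g' ->
  ac a (fun x => f x * g x) (fun x => f' x * g x + g' x * f x).
Proof.
move=> af ag; have [lf fE] := af; have [lg gE] := ag; split.
  by move=> T; apply: itgD; [exact: (ac_loc1M ag lf)|exact: (ac_loc1M af lg)].
move=> x ax; rewrite (fE x ax) (gE x ax) (prim_mul _ _ ax (lf x) (lg x)); congr (_ + _).
by apply: Rint_ext => t; rewrite /= in_itv/= => /andP[/ltW at1 _]; rewrite -fE// -gE.
Qed.

Lemma ac_add a f f' g g' : ac a f f' -> ac a g g' ->
  ac a (fun x => f x + g x) (fun x => f' x + g' x).
Proof.
move=> [lf fE] [lg gE]; split.
  by move=> T; apply: itgD; [exact: lf|exact: lg].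
move=> x ax; rewrite (fE x ax) (gE x ax) /prim RintD; [ring|exact: lf|exact: lg].
Qed.

Lemma ac_C1 a f f' : (forall x, a <= x -> is_derive x 1 f (f' x)) ->
  (forall x, a <= x -> {for x, continuous f'}) -> ac a f f'.
Proof.
move=> df cf; have sub x : 'I[a, x] `<=` `[a, x]%classic by exact: subset_itv_oc_cc.
split.
  move=> T; split; first exact: measurable_oc.
  have ci : {within `[a, T], continuous f'}.
    apply: continuous_in_subspaceT => x; rewrite mem_setE in_itv/= => /andP[ax _].
    exact: cf.
  have := @continuous_compact_integrable R f' `[a, T] (@segment_compact _ _ _) ci.
  by apply: integrableS => //; exact: measurable_itv.
move=> x ax; rewrite /prim /Rintegral.
have -> := @FTC2_oc R f f' a x ax (fun t H => df t (proj1 (andP H))) (fun t H => cf t (proj1 (andP H))).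
by rewrite /= addrC subrK.
Qed.

Lemma itg_y_loc1 a f : itg leb 'I[a,oo] f -> loc1 a f.
Proof.
move=> fi T; apply: (itgS fi); last exact: measurable_oc.
by move=> x; rewrite /= !in_itv/= => /andP[->].
Qed.

Lemma Rint_oc_cvg a f (T : nat -> R) : itg leb 'I[a,oo] f -> (forall n, n%:R <= T n) ->
  \int[leb]_(x in 'I[a, T n]) f x @[n --> \oo] --> \int[leb]_(x in 'I[a,oo]) f x.
Proof.
move=> fi nT.
have E n : \int[leb]_(x in 'I[a, T n]) f x =
    \int[leb]_(x in 'I[a,oo]) (f x * (\1_('I[a, T n]) x : R)).
  rewrite [LHS]Rintegral_mkcond [RHS]Rintegral_mkcond; apply: Rint_ext => x _.
  rewrite !patchE indicE; have [xcd|xcd] := boolP (x \in 'I[a, T n]).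
    by rewrite mulr1 ifT//; move: xcd; rewrite !mem_setE !in_itv/= => /andP[-> _].
  by rewrite mulr0 if_same.
under eq_fun do rewrite E.
apply: (proj2 (@Rint_dominated _ _ _ leb 'I[a,oo] _ _ (fun x => `|f x|) _ (itg_norm fi) _ _)).
- move=> n; apply: measurable_funM; first exact: (itg_measurable fi).
  by apply: measurable_indic; exact: measurable_oc.
- by move=> n x _; rewrite normrM ler_piMr// indicE; case: (_ \in _); rewrite ?normr1 ?normr0.
- move=> x; rewrite /= in_itv/= andbT => ax.
  rewrite -[X in _ --> X](mulr1 (f x)); apply: cvgM; first exact: cvg_cst.
  apply: (@cvg_trans _ ((1 : R) @[n --> \oo])); last exact: cvg_cst.
  apply: near_eq_cvg; near=> n; rewrite indicE mem_setE in_itv/= ax/=.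
  have -> // : x <= T n; apply: le_trans (nT n).
  by near: n; exact: nbhs_infty_ger.
Unshelve. all: by end_near. Qed.

(** A lower bound of an energy by a total derivative. Square integrability gives no pointwise decay,
    so nonnegativity of [G] at infinity is asked for only approximately and along points [T] that
    tend to infinity. *)
Lemma energy_limit a e G G' : itg leb 'I[a,oo] e -> ac a G G' ->
  (forall x, a < x -> G' x <= e x) ->
  (forall dl N, 0 < dl -> exists2 T, N <= T & - dl <= G T) ->
  - G a <= \int[leb]_(x in 'I[a,oo]) e x.
Proof.
move=> ie aG Ge GT; have [lG GE] := aG.
pose dl (n : nat) : R := n.+1%:R^-1.
have dl0 n : 0 < dl n by rewrite invr_gt0.
have TP (n : nat) : {T : R | Num.max a n%:R <= T /\ - dl n <= G T}.
  by apply: cid; have [T ? ?] := GT (dl n) (Num.max a n%:R) (dl0 n); exists T.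
pose T n := sval (TP n).
have Ta n : a <= T n by have [+ _] := svalP (TP n); rewrite ge_max => /andP[].
have Tn (n : nat) : n%:R <= T n by have [+ _] := svalP (TP n); rewrite ge_max => /andP[].
have GTn n : - dl n <= G (T n) by have [] := svalP (TP n).
have lim := Rint_oc_cvg ie Tn.
have lim2 : - dl n - G a @[n --> \oo] --> - G a.
  rewrite -[X in _ --> X]add0r; apply: cvgB; last exact: cvg_cst.
  by rewrite -[X in _ --> X]oppr0; apply: cvgN; exact: (@cvg_harmonic R).
apply: (ler_cvg_to lim2 lim); near=> n.
apply: (@le_trans _ _ (G (T n) - G a)); first by rewrite lerD2r.
rewrite -(ac_int aG (Ta n)); apply: Rint_le; [exact: lG|exact: itg_y_loc1|].
by move=> x; rewrite /= in_itv/= => /andP[ax _]; exact: Ge.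
Unshelve. all: by end_near. Qed.

(** Otherwise [f x ^+ 2] would be at least [dl / x] from some point on, and 1 / x is not integrable
    at infinity. *)
Lemma small_tail a f dl N : 0 < a -> itg leb 'I[a,oo] (fun x => f x ^+ 2) ->
  0 < dl -> exists2 T, N <= T & T * f T ^+ 2 <= dl.
Proof.
move=> a0 fi dl0; apply/not_exists2P => H.
pose M := Num.max a N; have M0 : 0 < M by rewrite lt_max a0.
have aM : a <= M by rewrite le_max lexx.
have big x : M < x -> dl / x <= f x ^+ 2.
  move=> Mx; have [|/negP] := H x.
    by move=> []; rewrite (le_trans _ (ltW Mx))// le_max lexx orbT.
  by rewrite -ltNge => /ltW; rewrite ler_pdivrMr ?(lt_trans M0 Mx)// mulrC.
set K := \int[leb]_(x in 'I[a,oo]) (f x ^+ 2).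
have K0 : 0 <= K by apply: Rint_ge0 => x _; exact: sqr_ge0.
(* Chosen so that the integral of [dl / x] over []M, T]] is [K + 1], more than the whole integral of
   the square. *)
pose T := M * expR ((K + 1) / dl).
have e1 : 1 <= expR ((K + 1) / dl).
  by rewrite -expR0 ler_expR divr_ge0// ?addr_ge0// ltW.
have MT : M <= T by rewrite ler_peMr// ltW.
have dl1 x : M <= x -> is_derive x 1 (fun x => dl * ln x) (dl / x).
  move=> Mx; have x0 : 0 < x := lt_le_trans M0 Mx.
  by apply: (is_derive_congr (der_scale dl (der_ln x0 (der_id x)))); rewrite mul1r.
have cl x : M <= x -> {for x, continuous (fun x => dl / x)}.
  move=> Mx; have x0 : x != 0 by rewrite gt_eqF// (lt_le_trans M0 Mx).
  by apply: cvgM; [exact: cvg_cst|exact: cvgV].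
have al := ac_C1 dl1 cl.
have := ac_int al MT.
have sub : 'I[M, T] `<=` 'I[a,oo].
  by move=> x; rewrite /= !in_itv/= andbT => /andP[Mx _]; exact: le_lt_trans aM Mx.
have : \int[leb]_(x in 'I[M, T]) (dl / x) <= K.
  apply: (@le_trans _ _ (\int[leb]_(x in 'I[M, T]) (f x ^+ 2))).
    apply: Rint_le; first by case: al => lG _; exact: lG.
      by apply: (itgS fi sub); exact: measurable_oc.
    by move=> x; rewrite /= in_itv/= => /andP[Mx _]; exact: big.
  apply: (@Rint_subset _ _ _ leb 'I[a,oo] 'I[M, T] (fun x => f x ^+ 2)) => //.
  by move=> x _; exact: sqr_ge0.
move=> leK E; move: leK; rewrite {}E -mulrBr -ln_div ?posrE//; last first.
  by rewrite mulr_gt0// expR_gt0.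
rewrite /T mulrAC mulfV ?gt_eqF// mul1r expRK mulrC divfK ?gt_eqF//.
lra.
Qed.

Lemma ac_sqr a f p : ac a f p -> ac a (fun x => f x ^+ 2) (fun x => 2 * (f x * p x)).
Proof.
move=> af; have [l2 E2] := ac_mul af af; split.
  by move=> T; apply: itg_ext (l2 T) => x _; ring.
move=> x ax; rewrite !expr2 (E2 x ax); congr (_ + _).
by apply: Rint_ext => t _; ring.
Qed.

Definition edens b m f p x := 4 * x * p x ^+ 2 + (m - b * x / 2) ^+ 2 / x * f x ^+ 2.

Section one_mode.
Variables (a b m : R) (f p : R -> R).
Hypotheses (a0 : 0 < a) (b0 : 0 < b) (acf : ac a f p).
Hypotheses (if2 : itg leb 'I[a,oo] (fun x => f x ^+ 2)).
Hypotheses (ie : itg leb 'I[a,oo] (edens b m f p)).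

Let W x := 2 * (m - b * x / 2).

Let acW : ac a W (fun=> - b).
Proof.
apply: ac_C1 => x _; last exact: cst_continuous.
apply: (is_derive_congr (der_scale 2 (der_sub (der_cst m x) (der_scaler 2^-1 (der_scale b (der_id x)))))).
by field.
Qed.

Let pos x : a < x -> 0 < x. Proof. exact: lt_trans. Qed.

(* Completing the square; the last bracket is the derivative of [f ^+ 2 * W]. *)
Lemma edensE x : a < x -> edens b m f p x - b * f x ^+ 2 =
  4 * x * (p x - (m - b * x / 2) / (2 * x) * f x) ^+ 2
  + (- b * f x ^+ 2 + 2 * (f x * p x) * W x).
Proof. by move=> /pos x0; rewrite /edens /W; field; rewrite gt_eqF. Qed.

(** [W] grows linearly, so [W * f ^+ 2] is controlled by [T * f T ^+ 2], which [small_tail] makes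
    small at arbitrarily large [T]. *)
Lemma W_tail N dl : 0 < dl -> exists T, [/\ N <= T, a < T, f T ^+ 2 <= dl & - dl <= W T * f T ^+ 2].
Proof.
move=> dl0; pose c := 2 * `|m| + b + 1 .
have c0 : 0 < c by rewrite ltr_wpDl// addr_ge0// ?mulr_ge0// ltW.
have [T NT fT] := small_tail (Num.max N (a + 1)) a0 if2 (divr_gt0 dl0 c0).
move: NT; rewrite ge_max => /andP[NT aT1].
have aT : a < T by rewrite (lt_le_trans _ aT1)// ltrDl.
have T0 : 0 < T := pos aT.
have T1 : 1 <= T by rewrite (le_trans _ aT1)// lerDr ltW.
have s0 := sqr_ge0 (f T).
have fT1 : c * (T * f T ^+ 2) <= dl by rewrite mulrC -ler_pdivlMr.
have fle : f T ^+ 2 <= T * f T ^+ 2 by rewrite ler_peMl.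
have H0 := mulr_ge0 (ltW T0) s0.
have H1 : `|m| * f T ^+ 2 <= `|m| * (T * f T ^+ 2) by rewrite ler_wpM2l.
have H2 := mulr_ge0 (ltW b0) H0.
have H3 := mulr_ge0 (normr_ge0 m) H0.
exists T; split => //.
  apply: le_trans fT1; apply: le_trans fle _.
  by rewrite ler_peMl// /c; have := normr_ge0 m; have := b0; lra.
have H4 : - `|m| * f T ^+ 2 <= m * f T ^+ 2.
  by rewrite ler_wpM2r// lerNl -normrN ler_norm.
have -> : W T * f T ^+ 2 = 2 * (m * f T ^+ 2) - b * (T * f T ^+ 2) by rewrite /W; field.
move: fT1; rewrite /c !mulrDl mul1r.
rewrite mulNr in H4.
have : 0 <= T * f T ^+ 2 by []. 
lra.
Qed.

Lemma mode_energy_le : m <= b * a / 2 ->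
  b * \int[leb]_(x in 'I[a,oo]) (f x ^+ 2) <= \int[leb]_(x in 'I[a,oo]) edens b m f p x.
Proof.
move=> mba; rewrite -subr_ge0 -RintZ// -RintB//; last exact: itgZ.
have aG := ac_mul (ac_sqr acf) acW.
have := @energy_limit a (fun x => edens b m f p x - b * f x ^+ 2) _ _ _ aG.
move=> H; apply: le_trans (H _ _ _).
- rewrite oppr_ge0 mulr_ge0_le0 ?sqr_ge0// /W; lra.
- by apply: itgB => //; exact: itgZ.
- move=> x ax; rewrite edensE// -[leLHS]addrC lerDr.
  by rewrite mulr_ge0 ?sqr_ge0// mulr_ge0// ltW// pos.
- move=> dl N dl0; have [T [NT aT _ WT]] := W_tail N dl0.
  by exists T => //; rewrite mulrC.
Qed.

(** The abstract trace inequality. Since [s a = 1], the trace is minus the integral of (f s)'; in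
    terms of the completed square its integrand pairs [s] with the square and [w1 + w2] with [f].
    The part [w1] is orthogonal to [f]; the two remaining pairings are absorbed by the square and by
    [eps * f ^+ 2], at a price collected in [th]. The last hypothesis says that the total price
    stays within the budget left by the boundary term. *)
Lemma mode_energy_gt (eps S : R) (s s' w1 w2 th th' : R -> R) :
  b * a / 2 <= m -> 0 < eps ->
  (forall x, a <= x -> is_derive x 1 s (s' x)) ->
  (forall x, a <= x -> {for x, continuous s'}) ->
  (forall x, a <= x -> is_derive x 1 th (th' x)) ->
  (forall x, a <= x -> {for x, continuous th'}) ->
  s a = 1 -> (forall x, a <= x -> `|s x| <= S) -> (forall x, a <= x -> 0 <= th x) ->
  (forall x, a < x -> s' x + (m - b * x / 2) / (2 * x) * s x = w1 x + w2 x) ->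
  itg leb 'I[a,oo] (fun x => w1 x * f x) ->
  \int[leb]_(x in 'I[a,oo]) (w1 x * f x) = 0 ->
  (forall x, a < x -> s x ^+ 2 / (4 * x) + w2 x ^+ 2 / eps <= - th' x) ->
  2 * (m - b * a / 2) * th a <= 1 ->
  (b - eps) * \int[leb]_(x in 'I[a,oo]) (f x ^+ 2) <= \int[leb]_(x in 'I[a,oo]) edens b m f p x.
Proof.
move=> mba eps0 ds cs dth cth sa sS th0 sw iw Iw thE etath.
(* With [z] frozen the trace enters linearly, as [2 * z * f a]. The value [eta * f a] is the optimal
   multiplier when [eta * th a = 1]. *)
pose eta := 2 * (m - b * a / 2); pose z := eta * f a.
have eta0 : 0 <= eta by rewrite /eta; lra.
rewrite -subr_ge0.
have -> : \int[leb]_(x in 'I[a,oo]) edens b m f p x -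
    (b - eps) * \int[leb]_(x in 'I[a,oo]) (f x ^+ 2) =
    \int[leb]_(x in 'I[a,oo]) (edens b m f p x - (b - eps) * f x ^+ 2 - 2 * z * (w1 x * f x)).
  rewrite RintB; [|by apply: itgB => //; exact: itgZ|exact: itgZ].
  rewrite RintB//; last exact: itgZ.
  by rewrite !RintZ// Iw mulr0 subr0.
have aG := ac_add (ac_add (ac_mul (ac_sqr acf) acW)
  (ac_mul (ac_mul (ac_C1 (fun x _ => der_cst (- 2 * z) x) (fun x _ => @cst_continuous _ _ 0 x)) (ac_C1 ds cs)) acf))
  (ac_mul (ac_C1 (fun x _ => der_cst (z ^+ 2) x) (fun x _ => @cst_continuous _ _ 0 x)) (ac_C1 dth cth)).
have := @energy_limit a (fun x => edens b m f p x - (b - eps) * f x ^+ 2 - 2 * z * (w1 x * f x)) _ _ _ aG.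
move=> H; apply: le_trans (H _ _ _).
- rewrite sa /W -/eta mulr1.
  have -> : - (f a ^+ 2 * eta + - 2 * z * f a + z ^+ 2 * th a) =
    eta * f a ^+ 2 * (1 - eta * th a) by rewrite /z; ring.
  apply: mulr_ge0; last by rewrite subr_ge0.
  by rewrite mulr_ge0 ?sqr_ge0.
- by apply: itgB; [apply: itgB => //; exact: itgZ|exact: itgZ].
- move=> x ax; have x0 := pos ax.
  have := edensE ax; set P := p x - _ => Ex.
  have Pp : p x = P + (m - b * x / 2) / (2 * x) * f x by rewrite /P subrK.
  rewrite -subr_ge0.
  set lhs := (X in 0 <= X).
  (* The first two groups are perfect squares, in [P] and in [f x]; the third is the slack in the
     differential inequality for [th]. *)
  have E : lhs = (4 * x * P ^+ 2 + 2 * z * s x * P + z ^+ 2 * (s x ^+ 2 / (4 * x)))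
     + (eps * f x ^+ 2 + 2 * z * w2 x * f x + z ^+ 2 * (w2 x ^+ 2 / eps))
     + z ^+ 2 * (- th' x - (s x ^+ 2 / (4 * x) + w2 x ^+ 2 / eps)).
    have w2E : w2 x = s' x + (m - b * x / 2) / (2 * x) * s x - w1 x by rewrite sw//; ring.
    have -> : lhs = (edens b m f p x - b * f x ^+ 2) - (- b * f x ^+ 2 + 2 * (f x * p x) * W x)
       + eps * f x ^+ 2 - 2 * z * (w1 x * f x) + 2 * z * (s' x * f x + s x * p x) - z ^+ 2 * th' x.
      by rewrite /lhs; ring.
    rewrite Ex Pp w2E; ring.
  rewrite E addr_ge0//; first rewrite addr_ge0//.
  + have -> : 4 * x * P ^+ 2 + 2 * z * s x * P + z ^+ 2 * (s x ^+ 2 / (4 * x)) =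
      (4 * x * P + z * s x) ^+ 2 / (4 * x) by field; rewrite gt_eqF.
    by rewrite divr_ge0 ?sqr_ge0// mulr_ge0// ltW.
  + have -> : eps * f x ^+ 2 + 2 * z * w2 x * f x + z ^+ 2 * (w2 x ^+ 2 / eps) =
      (eps * f x + z * w2 x) ^+ 2 / eps by field; rewrite gt_eqF.
    by rewrite divr_ge0 ?sqr_ge0// ltW.
  + by rewrite mulr_ge0 ?sqr_ge0// subr_ge0; exact: thE.
(* [d2] is small enough that at [T] the term [f ^+ 2 * W] is at least [- (dl / 2)] and the linear
   term at most [dl / 2] in size; [c] bounds the factor of [f T], and [d1] is chosen with
   [c * d1 = dl / 2]. The term with [th] is nonnegative. *)
- move=> dl N dl0; pose c := 2 * `|z| * `|S| + 1.
  have c0 : 0 < c by rewrite ltr_wpDl// mulr_ge0// mulr_ge0.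
  pose d1 := dl / (2 * c).
  have d10 : 0 < d1 by rewrite divr_gt0// mulr_gt0.
  pose d2 := Num.min (dl / 2) (d1 ^+ 2).
  have d20 : 0 < d2 by rewrite lt_min exprn_gt0// andbT divr_gt0.
  have [T [NT aT fT WT]] := W_tail N d20.
  exists T => //.
  have fT1 : `|f T| <= d1.
    have : `|f T| ^+ 2 <= d1 ^+ 2.
      by rewrite real_normK ?num_real// (le_trans fT)// ge_min lexx orbT.
    by rewrite ler_sqr ?nnegrE// ltW.
  have WT1 : - (dl / 2) <= f T ^+ 2 * W T.
    by rewrite [leRHS]mulrC; apply: le_trans WT; rewrite lerN2 ge_min lexx.
  have H1 : `|2 * z * s T * f T| <= dl / 2.
    rewrite 2!normrM (normrM 2 z) (_ : `|2| = 2); last by rewrite ger0_norm.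
    have -> : dl / 2 = c * d1 by rewrite /d1; field; rewrite gt_eqF.
    rewrite ler_pM// ?mulr_ge0// /c (@le_trans _ _ (2 * `|z| * `|S|))//; last by rewrite lerDl.
    by rewrite ler_wpM2l ?mulr_ge0// (le_trans (sS T (ltW aT)))// ler_norm.
  have H2 : 0 <= z ^+ 2 * th T by rewrite mulr_ge0 ?sqr_ge0// th0// ltW.
  have H3 : - (2 * z * s T * f T) >= - (dl / 2).
    by rewrite lerN2 (le_trans (ler_norm _) H1).
  have -> : - 2 * z * s T * f T = - (2 * z * s T * f T) by ring.
  lra.
Qed.

End one_mode.
End energy.

(** * Weights for the trace *)

Section trace.
Context {R : realType}.
Local Notation leb := (@lebesgue_measure R).
Implicit Types (f p : R -> R) (a b x t : R) (m n k : nat).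
Local Notation "'I[ a ,oo]" := (`]a, +oo[%classic : set R) (at level 0, format "''I[' a ,oo]").

Definition expS n t : R := \sum_(j < n.+1) t ^+ j / j`!%:R.

Lemma fact_neq0 n : n`!%:R != 0 :> R.
Proof. by rewrite pnatr_eq0 -lt0n fact_gt0. Qed.

Lemma expSS n t : expS n.+1 t = expS n t + t ^+ n.+1 / n.+1`!%:R.
Proof. by rewrite /expS big_ord_recr. Qed.

Lemma expS0 t : expS 0 t = 1.
Proof. by rewrite /expS big_ord1 expr0 fact0 divr1. Qed.

(** Only the top term is lost, so the derivative of e^(- t) [expS n t] is - e^(- t) t^n / n!: small
    near 0 to the order n. *)
Lemma der_expS n t : is_derive t 1 (expS n) (expS n t - t ^+ n / n`!%:R).
Proof.
elim: n => [|n IH].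
  have -> : expS 0 = fun=> 1 by apply/funext; exact: expS0.
  by rewrite expr0 fact0 divr1 subrr; exact: der_cst.
have E : expS n.+1 = fun t => expS n t + t ^+ n.+1 / n.+1`!%:R by apply/funext; exact: expSS.
rewrite [X in is_derive _ _ X]E.
apply: (is_derive_congr (der_add IH (der_scaler (n.+1`!%:R)^-1 (der_expn n.+1 (der_id t))))).
rewrite expSS addrK /= factS natrM; field.
by rewrite fact_neq0 addrC natr1 pnatr_eq0.
Qed.

Lemma expS_ge1 n t : 0 <= t -> 1 <= expS n t.
Proof.
move=> t0; rewrite /expS big_ord_recl expr0 fact0 divr1 lerDl.
by apply: sumr_ge0 => j _; rewrite divr_ge0// exprn_ge0.
Qed.

Lemma expS_le n t : 0 <= t -> expS n t <= expR t.
Proof.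
move=> t0; have nd : nondecreasing_seq (series (exp_coeff t)).
  by apply: nondecreasing_series => k _ _; exact: exp_coeff_ge0.
have := nondecreasing_cvgn_le nd (is_cvg_series_exp_coeff t) n.+1.
by rewrite {1}/series/= big_mkord.
Qed.

Lemma pow_le_expR n t : 0 <= t -> t ^+ n <= n`!%:R * expR t.
Proof.
move=> t0; rewrite mulrC -ler_pdivrMr ?ltr0n ?fact_gt0//.
apply: le_trans (expS_le n t0); rewrite /expS big_ord_recr/= lerDr.
by apply: sumr_ge0 => j _; rewrite divr_ge0// exprn_ge0.
Qed.

(** For t <= 1 the left side is at most e^(2 t); for t > 1 the partial sum is at most 2^n e^(t / 2),
    so the left side is bounded and sqrt t is at least 1. A bound linear in t would cost a full
    power of x, and (a / x)^m / x times x is not integrable for m = 1; the square root costs only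
    half a power. This is the origin of the extra sqrt b in the error. *)
Lemma expS_sqr n : exists2 C : R, 0 < C & forall t0 t, 0 < t0 -> t0 <= 1 -> t0 <= t ->
  expR (t0 - t) * expS n t ^+ 2 <= 1 + C * Num.sqrt t.
Proof.
exists (2 * expR 2 + expR 1 * (2 ^+ n) ^+ 2).
  by rewrite addr_gt0// mulr_gt0// ?expR_gt0// !exprn_gt0.
move=> t0 t t00 t01 t0t; have tp : 0 < t := lt_le_trans t00 t0t; have tl := ltW tp.
have S0 : 0 <= expS n t by rewrite (le_trans _ (expS_ge1 n (ltW tp))).
have sq0 := sqrtr_ge0 t.
have e0 := expR_gt0 (t0 - t).
rewrite mulrDl; have [t1|t1] := leP t 1.
  have tsq : t <= Num.sqrt t.
    rewrite -[leLHS](sqr_sqrtr (ltW tp)) expr2 ler_piMl// -[leRHS]sqrtr1.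
    by rewrite ler_sqrt.
  apply: (@le_trans _ _ (1 + 2 * expR 2 * Num.sqrt t)); last first.
    by rewrite addrA lerDl !mulr_ge0 ?expR_ge0// !exprn_ge0.
  apply: (@le_trans _ _ (expR (2 * t))).
    apply: (@le_trans _ _ (expR (t0 - t) * expR t ^+ 2)).
      apply: ler_wpM2l; first exact: ltW.
      by rewrite ler_sqr ?nnegrE ?expR_ge0// expS_le// ltW.
    by rewrite -expRM_natl -expRD ler_expR; lra.
  have := expR_ge1Dx (- (2 * t)); rewrite expRN => H.
  have E0 := expR_gt0 (2 * t).
  have H1 : expR (2 * t) - 1 <= 2 * t * expR (2 * t).
    have : (1 + - (2 * t)) * expR (2 * t) <= 1.
      by rewrite -ler_pdivlMr ?expR_gt0// div1r.
    by rewrite mulrDl mul1r mulNr; lra.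
  have H2 : 2 * t * expR (2 * t) <= 2 * Num.sqrt t * expR 2.
    have E2 : expR (2 * t) <= expR 2 by rewrite ler_expR; lra.
    by apply: ler_pM => //; first [lra | exact: ltW].
  by lra.
have t1' := ltW t1; have sq1 : 1 <= Num.sqrt t by rewrite -[leLHS]sqrtr1 ler_sqrt// ltW.
have S2 : expS n t <= 2 ^+ n * expR (t / 2).
  apply: (@le_trans _ _ (2 ^+ n * expS n (t / 2))); last first.
    by rewrite ler_wpM2l ?exprn_ge0// expS_le// divr_ge0// ltW.
  rewrite /expS mulr_sumr; apply: ler_sum => j _.
  rewrite expr_div_n mulrA ler_wpM2r ?invr_ge0 ?ler0n// mulrCA ler_peMr ?exprn_ge0//.
  rewrite ler_pdivlMr ?exprn_gt0// mul1r ler_weXn2l ?ler1n// -ltnS; exact: ltn_ord.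
apply: (@le_trans _ _ (expR 1 * (2 ^+ n) ^+ 2 * Num.sqrt t)); last first.
  by rewrite addrA lerDr addr_ge0// !mulr_ge0 ?expR_ge0.
apply: (@le_trans _ _ (expR 1 * (2 ^+ n) ^+ 2)); last first.
  by rewrite ler_peMr// mulr_ge0 ?expR_ge0// !exprn_ge0.
apply: (@le_trans _ _ (expR (t0 - t) * (2 ^+ n * expR (t / 2)) ^+ 2)).
  apply: ler_wpM2l; first exact: ltW.
  by rewrite ler_sqr ?nnegrE ?mulr_ge0 ?exprn_ge0 ?expR_ge0.
rewrite exprMn -expRM_natl mulrCA mulrA -mulrA -expRD mulrC.
by rewrite ler_wpM2r ?exprn_ge0// ler_expR; lra.
Qed.

(** One half power of t is split off and the rest is dominated by e^t. It serves the modes above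
    [k], where again only half a power of x can be spent. *)
Lemma pow_sqrt k : (0 < k)%N -> exists2 C : R, 0 < C & forall t0 t, 0 < t0 -> t0 <= 1 -> t0 <= t ->
  expR (t0 - t) * t ^+ k.+1 <= C * Num.sqrt t.
Proof.
move=> k0; exists (expR 1 * (k`!%:R + k.+1`!%:R)).
  by rewrite mulr_gt0 ?expR_gt0// addr_gt0// ltr0n fact_gt0.
move=> t0 t t00 t01 t0t; have tp : 0 < t := lt_le_trans t00 t0t; have tl := ltW tp.
have sq0 := sqrtr_ge0 t.
have H : t ^+ k.+1 <= Num.sqrt t * (t ^+ k + t ^+ k.+1).
  have E : t ^+ k.+1 = Num.sqrt t * (t ^+ k * Num.sqrt t).
    by rewrite mulrCA -expr2 (sqr_sqrtr (ltW tp)) exprSr.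
  rewrite [leLHS]E ler_wpM2l//.
  have [t1|t1] := leP t 1.
    rewrite (@le_trans _ _ (t ^+ k))// ?lerDl ?exprn_ge0//.
    apply: ler_piMr; first by rewrite exprn_ge0.
    by rewrite -[leRHS]sqrtr1 ler_sqrt.
  rewrite (@le_trans _ _ (t ^+ k.+1))// ?lerDr ?exprn_ge0//.
  rewrite exprSr ler_wpM2l ?exprn_ge0//.
  rewrite -[leRHS](sqr_sqrtr (ltW tp)) expr2 ler_peMl//.
  by rewrite -[leLHS]sqrtr1 ler_sqrt// ltW.
have e0 := expR_gt0 (t0 - t).
apply: (@le_trans _ _ (expR (t0 - t) * (Num.sqrt t * (t ^+ k + t ^+ k.+1)))).
  by rewrite ler_wpM2l// ltW.
apply: (@le_trans _ _ (expR (t0 - t) * (Num.sqrt t * ((k`!%:R + k.+1`!%:R) * expR t)))).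
  apply: ler_wpM2l; first exact: ltW.
  by rewrite ler_wpM2l// mulrDl lerD// pow_le_expR// ltW.
have -> : expR (t0 - t) * (Num.sqrt t * ((k`!%:R + k.+1`!%:R) * expR t)) =
  expR t0 * (k`!%:R + k.+1`!%:R) * Num.sqrt t.
  by rewrite expRD expRN; field; rewrite gt_eqF// expR_gt0.
by rewrite ler_wpM2r// ler_wpM2r ?addr_ge0// ler_expR.
Qed.

Section weights.
Variable a : R.
Hypothesis a0 : 0 < a.

(** The weight (a / x)^al e^(be (x - a)), normalised at [a]. Products add the exponents, so
    identities between weights become identities between exponents. *)
Definition pexp (al be x : R) := expR (al * (ln a - ln x) + be * (x - a)).

Lemma pexp_gt0 al be x : 0 < pexp al be x. Proof. exact: expR_gt0. Qed.

Lemma pexp_a al be : pexp al be a = 1.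
Proof. by rewrite /pexp !subrr !mulr0 addr0 expR0. Qed.

Lemma pexp_eq al al' be be' x : al = al' -> be = be' -> pexp al be x = pexp al' be' x.
Proof. by move=> -> ->. Qed.

Lemma pexpM al be al' be' x : pexp al be x * pexp al' be' x = pexp (al + al') (be + be') x.
Proof. by rewrite /pexp -expRD; congr expR; ring. Qed.

Lemma der_pexp al be x : 0 < x -> is_derive x 1 (pexp al be) ((be - al / x) * pexp al be x).
Proof.
move=> x0; apply: (is_derive_congr (der_expR (der_add
  (der_scale al (der_sub (der_cst (ln a) x) (der_ln x0 (der_id x))))
  (der_scale be (der_sub (der_id x) (der_cst a x)))))).
by rewrite /pexp; field; rewrite gt_eqF.
Qed.

Lemma continuous_pexp al be x : 0 < x -> {for x, continuous (pexp al be)}.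
Proof. by move=> x0; exact: is_derive_continuous (der_pexp al be x0). Qed.

Lemma pexp_le1 al x : 0 <= al -> a <= x -> pexp al 0 x <= 1.
Proof.
move=> al0 ax; rewrite /pexp mul0r addr0 -expR0 ler_expR mulr_ge0_le0// subr_le0.
by rewrite ler_ln ?posrE// (lt_le_trans a0).
Qed.

Lemma pexpN n x : 0 < x -> pexp (- n%:R) 0 x = (x / a) ^+ n.
Proof.
move=> x0; rewrite /pexp mul0r addr0 mulNr -mulrN opprB expRM_natl expRB !lnK ?posrE//.
Qed.

Lemma pexp_sqrt x : 0 < x -> Num.sqrt a * pexp (- (1 / 2)) 0 x = Num.sqrt x.
Proof.
move=> x0; have p0 := ltW (pexp_gt0 (- (1 / 2)) 0 x).
rewrite -[RHS](@divfK _ a) ?gt_eqF//.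
have -> : pexp (- (1 / 2)) 0 x = Num.sqrt (x / a).
  rewrite -[LHS]ger0_norm// -sqrtr_sqr expr2 pexpM addr0.
  by rewrite (_ : _ + _ = - 1%:R) ?pexpN ?expr1//; lra.
by rewrite divfK ?gt_eqF// -sqrtrM ?ltW// mulrC divfK ?gt_eqF.
Qed.

End weights.

Lemma sqrt_pexp a b x : 0 < a -> 0 < b -> 0 < x ->
  Num.sqrt (b * x / 2) = Num.sqrt (b * a / 2) * pexp a (- (1 / 2)) 0 x.
Proof.
move=> a0 b0 x0; rewrite (_ : b * x / 2 = b / 2 * x); last by ring.
rewrite (_ : b * a / 2 = b / 2 * a); last by ring.
rewrite !sqrtrM ?divr_ge0 ?ltW//.
by rewrite -[in LHS](pexp_sqrt a0 x0) mulrA.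
Qed.

Lemma pow_pexp a b x k : 0 < a -> 0 < x ->
  (b * x / 2) ^+ k = (b * a / 2) ^+ k * pexp a (- k%:R) 0 x.
Proof.
move=> a0 x0; rewrite pexpN// -exprMn; congr (_ ^+ _); field.
by rewrite gt_eqF.
Qed.

Section trace_data.
Variables (a b : R) (m n : nat).
Hypotheses (a0 : 0 < a) (b0 : 0 < b) (m0 : (0 < m)%N) (t01 : b * a / 2 <= 1).
Local Notation t0 := (b * a / 2).
Local Notation t x := (b * x / 2).

(* [trs] turns the trace into an integral, [f a = - \int (f * trs)']. The
   truncated exponential makes [trw] of order [t ^+ n], which produces the power
   of [b] in the eigenvalue asymptotics. *)
Definition trPi x := pexp a 0 (- b / 2) x * expS n (t x) / expS n t0.
Definition trPi' x := - (b / 2) * pexp a 0 (- b / 2) x * (t x ^+ n / n`!%:R) / expS n t0.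
Definition trs x := pexp a (m%:R / 2) (b / 4) x * trPi x.
Definition trw x := pexp a (m%:R / 2) (b / 4) x * trPi' x.
Definition trs' x := trw x - (m%:R - t x) / (2 * x) * trs x.

Let t00 : 0 < t0. Proof. by rewrite divr_gt0// mulr_gt0. Qed.
Let S01 : 1 <= expS n t0. Proof. by apply: expS_ge1; exact: ltW. Qed.
Let S00 : expS n t0 != 0. Proof. by rewrite gt_eqF// (lt_le_trans ltr01). Qed.
Let pos x : a <= x -> 0 < x. Proof. exact: lt_le_trans. Qed.
Let tge x : a <= x -> t0 <= t x.
Proof. by move=> ax; rewrite ler_wpM2r// ler_wpM2l// ltW. Qed.
Let expt x : expR (t0 - t x) = pexp a 0 (- b / 2) x.
Proof. by rewrite /pexp; congr expR; field. Qed.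

Lemma der_trPi x : a <= x -> is_derive x 1 trPi (trPi' x).
Proof.
move=> ax; have x0 := pos ax.
have dt : is_derive x 1 (fun x => t x) (b / 2).
  by apply: (is_derive_congr (der_scaler 2^-1 (der_scale b (der_id x)))); rewrite mulr1.
apply: (is_derive_congr (der_scaler (expS n t0)^-1
  (der_mul (der_pexp a 0 (- b / 2) x0) (der_comp dt (der_expS n (t x)))))).
by rewrite /trPi'; field; rewrite S00 fact_neq0 gt_eqF.
Qed.

Lemma der_trs x : a <= x -> is_derive x 1 trs (trs' x).
Proof.
move=> ax; have x0 := pos ax.
apply: (is_derive_congr (der_mul (der_pexp a (m%:R / 2) (b / 4) x0) (der_trPi ax))).
by rewrite /trs' /trw /trs; field; rewrite gt_eqF.
Qed.

Lemma continuous_tx k x : {for x, continuous (fun x : R => t x ^+ k)}.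
Proof.
exact: is_derive_continuous (der_expn k (der_scaler 2^-1 (der_scale b (der_id x)))).
Qed.

Lemma continuous_trPi' x : a <= x -> {for x, continuous trPi'}.
Proof.
move=> ax; have x0 := pos ax.
rewrite /trPi'; apply: cvgM; last exact: cvg_cst.
apply: cvgM; last by apply: cvgM; [exact: continuous_tx|exact: cvg_cst].
by apply: cvgM; [exact: cvg_cst|exact: continuous_pexp].
Qed.

Lemma continuous_trs' x : a <= x -> {for x, continuous trs'}.
Proof.
move=> ax; have x0 := pos ax.
rewrite /trs'; apply: cvgB.
  by apply: cvgM; [exact: continuous_pexp|exact: continuous_trPi'].
apply: cvgM; last exact: is_derive_continuous (der_trs ax).
apply: cvgM.
  by apply: cvgB; [exact: cvg_cst|have := @continuous_tx 1 x; exact].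
apply: cvgV; first by rewrite gt_eqF// mulr_gt0.
by apply: cvgM; [exact: cvg_cst|exact: cvg_id].
Qed.

Lemma trs_a : trs a = 1.
Proof. by rewrite /trs /trPi !pexp_a !mul1r mulfV. Qed.

(** The factor [pexp a (m / 2) (b / 4)] is the reciprocal of the Landau state and solves the
    homogeneous first-order equation, so only the derivative of [trPi] survives on the right. *)
Lemma trs_eq x : a < x -> trs' x + (m%:R - t x) / (2 * x) * trs x = trw x.
Proof. by rewrite /trs' subrK. Qed.

(** The exponentials in the square combine to e^(t0 - t), which [HC] balances against the squared
    partial sum. What remains is (a / x)^m and, from sqrt t, the same weight with half a power
    less. *)
Lemma trs_sqr C x : a <= x ->
  (forall t0 t, 0 < t0 -> t0 <= 1 -> t0 <= t ->
     expR (t0 - t) * expS n t ^+ 2 <= 1 + C * Num.sqrt t) ->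
  trs x ^+ 2 <= pexp a m%:R 0 x + C * Num.sqrt t0 * pexp a (m%:R - 1 / 2) 0 x.
Proof.
move=> ax HC; have x0 := pos ax; have tx := tge ax.
have -> : trs x ^+ 2 = pexp a m%:R 0 x * (expR (t0 - t x) * expS n (t x) ^+ 2) / expS n t0 ^+ 2.
  have -> : pexp a m%:R 0 x = pexp a (m%:R / 2) (b / 4) x * pexp a (m%:R / 2) (b / 4) x * pexp a 0 (- b / 2) x.
    by rewrite !pexpM; apply: pexp_eq; field.
  by rewrite expt /trs /trPi; field.
have Hp := HC _ _ t00 t01 tx.
have E0 := expR_gt0 (t0 - t x).
have p0 := pexp_gt0 a m%:R 0 x.
rewrite ler_pdivrMr; last by rewrite exprn_gt0// (lt_le_trans ltr01).
have Cx : 0 <= 1 + C * Num.sqrt (t x).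
  by apply: le_trans Hp; rewrite mulr_ge0 ?sqr_ge0// ltW.
have -> : pexp a m%:R 0 x + C * Num.sqrt t0 * pexp a (m%:R - 1 / 2) 0 x =
   pexp a m%:R 0 x * (1 + C * Num.sqrt (t x)).
  rewrite (sqrt_pexp a0 b0 x0) -[m%:R - 1 / 2]/(m%:R + - (1 / 2)).
  by rewrite -[X in pexp a (m%:R - 1 / 2) X](addr0 0) -pexpM; ring.
apply: (@le_trans _ _ (pexp a m%:R 0 x * (1 + C * Num.sqrt (t x)))).
  by rewrite ler_wpM2l// ltW.
apply: ler_peMr; last by rewrite exprn_ege1.
by apply: mulr_ge0 => //; exact: ltW.
Qed.

(** Of the two factors t^n one becomes [t0 ^+ n] times a power of x / a, which displays the
    smallness in [b]; the other is kept together with its exponential. *)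
Lemma trw_sqr x : a <= x ->
  trw x ^+ 2 <= (b / 2) ^+ 2 * t0 ^+ n * pexp a (m%:R - n%:R) 0 x *
    (expR (t0 - t x) * t x ^+ n / (n`!%:R ^+ 2)) / expS n t0.
Proof.
move=> ax; have x0 := pos ax; have tx := tge ax.
have -> : trw x ^+ 2 = (b / 2) ^+ 2 * t0 ^+ n * pexp a (m%:R - n%:R) 0 x *
    (expR (t0 - t x) * t x ^+ n / (n`!%:R ^+ 2)) / expS n t0 / expS n t0.
  have H : pexp a (m%:R / 2) (b / 4) x ^+ 2 * pexp a 0 (- b / 2) x ^+ 2 * t x ^+ n =
      t0 ^+ n * pexp a (m%:R - n%:R) 0 x * expR (t0 - t x).
    rewrite expt (pow_pexp b n a0 x0) !expr2 !pexpM mulrCA pexpM -[RHS]mulrA pexpM.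
    by congr (_ * _); apply: pexp_eq; [field|field].
  rewrite /trw /trPi'.
  transitivity ((b / 2) ^+ 2 * (pexp a (m%:R / 2) (b / 4) x ^+ 2 * pexp a 0 (- b / 2) x ^+ 2 * t x ^+ n)
    * t x ^+ n / n`!%:R ^+ 2 / expS n t0 / expS n t0).
    by field; rewrite S00 fact_neq0.
  by rewrite H; field; rewrite S00 fact_neq0.
rewrite ler_pdivrMr ?(lt_le_trans ltr01)// ler_peMr//.
have tx0 : 0 <= t x by exact: le_trans (ltW t00) tx.
rewrite divr_ge0//; last by rewrite (le_trans ler01).
apply: mulr_ge0; last by rewrite divr_ge0 ?sqr_ge0// mulr_ge0 ?exprn_ge0// expR_ge0.
by rewrite mulr_ge0 ?(ltW (pexp_gt0 _ _ _ _))// mulr_ge0 ?sqr_ge0// exprn_ge0// ltW.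
Qed.

End trace_data.

End trace.

(** * The trace inequality for all positive angular momenta *)

Section trace_bound.
Context {R : realType}.
Local Notation leb := (@lebesgue_measure R).
Implicit Types (f p : R -> R) (a b x t : R) (m n k : nat).
Local Notation "'I[ a ,oo]" := (`]a, +oo[%classic : set R) (at level 0, format "''I[' a ,oo]").

Lemma expS_homo n k t : 0 <= t -> (n <= k)%N -> expS n t <= expS k t.
Proof.
move=> t0; elim: k => [|k IH]; first by rewrite leqn0 => /eqP ->.
rewrite leq_eqVlt => /predU1P[-> //|nk]; rewrite expSS.
by rewrite (le_trans (IH nk))// lerDl divr_ge0// exprn_ge0.
Qed.

(** The price of the square is paid by the explicit majorant [t1], with 2 m [t1 a] = 1 / 2 + C q for
    q = sqrt t0. The last hypothesis thus leaves the other half of the budget, reduced by this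
    error, to the majorant [th] of [w2 ^+ 2 / eps]. *)
Lemma trace_aux a b (eps C : R) m n f p (w1 w2 th th' : R -> R) : 0 < a -> 0 < b ->
  (0 < m)%N -> b * a / 2 <= 1 -> 0 < C -> 0 < eps ->
  (forall t0 t, 0 < t0 -> t0 <= 1 -> t0 <= t ->
     expR (t0 - t) * expS n t ^+ 2 <= 1 + C * Num.sqrt t) ->
  ac a f p -> itg leb 'I[a,oo] (fun x => f x ^+ 2) ->
  itg leb 'I[a,oo] (edens b m%:R f p) ->
  (forall x, a <= x -> is_derive x 1 th (th' x)) ->
  (forall x, a <= x -> {for x, continuous th'}) -> (forall x, a <= x -> 0 <= th x) ->
  (forall x, a < x -> trw a b m n x = w1 x + w2 x) ->
  itg leb 'I[a,oo] (fun x => w1 x * f x) ->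
  \int[leb]_(x in 'I[a,oo]) (w1 x * f x) = 0 ->
  (forall x, a < x -> w2 x ^+ 2 / eps <= - th' x) ->
  C * Num.sqrt (b * a / 2) + 2 * m%:R * th a <= 1 / 2 ->
  (b - eps) * \int[leb]_(x in 'I[a,oo]) (f x ^+ 2) <=
    \int[leb]_(x in 'I[a,oo]) edens b m%:R f p x.
Proof.
move=> a0 b0 m0 t01 C0 eps0 HC acf if2 ie dth cth th0 we iw Iw w2e etath.
have m1 : 1 <= m%:R :> R by rewrite ler1n.
have mp : 0 < m%:R :> R by rewrite ltr0n.
set t0 := b * a / 2 in t01 etath *.
have t00 : 0 < t0 by rewrite /t0 divr_gt0// mulr_gt0.
have sq0 := sqrtr_ge0 t0; set q := Num.sqrt t0 in sq0 etath *.
(* The factor 2 compensates (m - 1 / 2) / m >= 1 / 2, which differentiating the weight with exponent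
   m - 1 / 2 produces. *)
pose B : R := 2 * C * q.
have B0 : 0 <= B by rewrite /B mulr_ge0// mulr_ge0// ltW.
pose t1 x := (4 * m%:R)^-1 * (pexp a m%:R 0 x + B * pexp a (m%:R - 1 / 2) 0 x).
pose t1' x := (4 * m%:R)^-1 * ((0 - m%:R / x) * pexp a m%:R 0 x
   + B * ((0 - (m%:R - 1 / 2) / x) * pexp a (m%:R - 1 / 2) 0 x)).
have pos x : a <= x -> 0 < x by exact: lt_le_trans.
have dt1 x : a <= x -> is_derive x 1 t1 (t1' x).
  move=> /pos x0; exact: (der_scale _ (der_add (der_pexp _ _ _ x0) (der_scale _ (der_pexp _ _ _ x0)))).
have ct1 x : a <= x -> {for x, continuous t1'}.
  move=> /pos x0; rewrite /t1'.
  have cV (c : R) : {for x, continuous (fun x => 0 - c / x)}.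
    apply: cvgB; first exact: cvg_cst.
    by apply: cvgM; [exact: cvg_cst|apply: cvgV; [rewrite gt_eqF|exact: cvg_id]].
  apply: cvgM; first exact: cvg_cst.
  apply: cvgD; first by apply: cvgM; [exact: cV|exact: continuous_pexp].
  apply: cvgM; first exact: cvg_cst.
  by apply: cvgM; [exact: cV|exact: continuous_pexp].
have t1E x : a <= x -> trs a b m n x ^+ 2 / (4 * x) <= - t1' x.
  move=> ax; have x0 := pos _ ax.
  have H := trs_sqr m a0 b0 t01 ax HC.
  rewrite ler_pdivrMr ?mulr_gt0//; apply: le_trans H _.
  rewrite -/t0 -/q.
  have -> : - t1' x * (4 * x) = pexp a m%:R 0 x + (2 * (m%:R - 1 / 2) / m%:R) * (C * q * pexp a (m%:R - 1 / 2) 0 x).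
    by rewrite /t1' /B; field; rewrite !gt_eqF.
  rewrite lerD2l ler_peMl//.
    by apply: mulr_ge0; [apply: mulr_ge0 => //; exact: ltW|exact: ltW (pexp_gt0 _ _ _ _)].
  by rewrite ler_pdivlMr// mul1r; lra.
have sb x : a <= x -> `|trs a b m n x| <= 2 + C * q.
  move=> ax; have := trs_sqr m a0 b0 t01 ax HC; rewrite -/t0 -/q.
  have p1 := pexp_le1 a0 (ler0n R m) ax.
  have p2 : pexp a (m%:R - 1 / 2) 0 x <= 1 by apply: pexp_le1 => //; lra.
  have : C * q * pexp a (m%:R - 1 / 2) 0 x <= C * q.
    by rewrite ler_piMr// mulr_ge0// ltW.
  have := sqr_ge0 (`|trs a b m n x| - 1 / 2).
  rewrite sqrrB real_normK ?num_real//; lra.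
apply: (@mode_energy_gt R a b m%:R f p a0 b0 acf if2 ie eps (2 + C * q)
   (trs a b m n) (trs' a b m n) w1 w2 (fun x => t1 x + th x) (fun x => t1' x + th' x)).
- by rewrite -/t0 (le_trans t01).
- exact: eps0.
- by move=> x ax; exact: der_trs.
- by move=> x ax; exact: continuous_trs'.
- by move=> x ax; apply: der_add; [exact: dt1|exact: dth].
- by move=> x ax; apply: cvgD; [exact: ct1|exact: cth].
- exact: trs_a.
- exact: sb.
- move=> x ax; rewrite addr_ge0 ?th0// mulr_ge0 ?invr_ge0 ?mulr_ge0 ?ler0n//.
  by rewrite addr_ge0 ?mulr_ge0// ltW// pexp_gt0.
- by move=> x ax; rewrite -we//; exact: trs_eq.
- exact: iw.
- exact: Iw.
- by move=> x ax; rewrite opprD lerD ?t1E ?w2e// ltW.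
- rewrite -/t0.
  have -> : t1 a + th a = (4 * m%:R)^-1 * (1 + B) + th a.
    by rewrite /t1 !pexp_a mulr1.
  have X0 : 0 <= (4 * m%:R)^-1 * (1 + B) + th a.
    by rewrite addr_ge0 ?th0// mulr_ge0 ?invr_ge0 ?mulr_ge0 ?ler0n ?addr_ge0.
  apply: (@le_trans _ _ (2 * m%:R * ((4 * m%:R)^-1 * (1 + B) + th a))).
    by rewrite ler_wpM2r// ler_wpM2l// gerBl ltW.
  have -> : 2 * m%:R * ((4 * m%:R)^-1 * (1 + B) + th a) = 1 / 2 + (C * q + 2 * m%:R * th a).
    by rewrite /B; field; rewrite gt_eqF.
  lra.
Qed.

Definition tr_eps a b C k := 2 * b * (b * a / 2) ^+ k / k.-1`!%:R * (1 + C * Num.sqrt (b * a / 2)).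

(** The series in the weight is truncated at the smaller of [m] and [k]. For [m < k] the defect is
    the Landau state itself and orthogonality removes it; for [m = k] it determines [tr_eps]; for
    [m > k] the additional decay makes it negligible. *)
Lemma trace_bound k : (0 < k)%N -> exists2 C : R, 0 < C & exists2 dl : R, 0 < dl &
  forall a b m f p, 0 < a -> 0 < b -> b * a / 2 <= dl -> (0 < m)%N ->
  ac a f p -> itg leb 'I[a,oo] (fun x => f x ^+ 2) ->
  itg leb 'I[a,oo] (edens b m%:R f p) ->
  ((m < k)%N -> itg leb 'I[a,oo] (fun x => pexp a (- (m%:R / 2)) (- (b / 4)) x * f x) /\
     \int[leb]_(x in 'I[a,oo]) (pexp a (- (m%:R / 2)) (- (b / 4)) x * f x) = 0) ->
  (b - tr_eps a b C k) * \int[leb]_(x in 'I[a,oo]) (f x ^+ 2) <=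
    \int[leb]_(x in 'I[a,oo]) edens b m%:R f p x.
Proof.
move=> k0; have [C C0 HCk] := @expS_sqr R k; have [C2 C20 HC2] := @pow_sqrt R k k0.
have HC n : (n <= k)%N -> forall t0 t, 0 < t0 -> t0 <= 1 -> t0 <= t ->
     expR (t0 - t) * expS n t ^+ 2 <= 1 + C * Num.sqrt t.
  move=> nk t0 t t00 t01 t0t; apply: le_trans (HCk _ _ t00 t01 t0t).
  have tp : 0 <= t by apply: le_trans t0t; exact: ltW.
  rewrite ler_wpM2l ?expR_ge0// ler_sqr ?nnegrE ?expS_homo//.
    by rewrite (le_trans _ (expS_ge1 n tp)).
  by rewrite (le_trans _ (expS_ge1 k tp)).
(* [X] bounds the cost of the modes above [k], where m / (m - k) is at most k + 1. The smallness
   condition on t0 gives [D * q <= 1] for q = sqrt t0, so that all error terms fit into the second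
   half of the budget. *)
pose X : R := (k%:R + 1) * k.-1`!%:R * C2.
have X0 : 0 < X by rewrite !mulr_gt0// ?ltr_wpDl ?ler0n// ltr0n fact_gt0.
pose D := 4 * C + 4 * X.
have D0 : 0 < D by rewrite addr_gt0// mulr_gt0.
exists (4 * C); first by rewrite mulr_gt0.
exists (Num.min 1 (D ^- 2)); first by rewrite lt_min ltr01 invr_gt0 exprn_gt0.
move=> a b m f p a0 b0; rewrite le_min => /andP[t01 t0D] m0 acf if2 ie cstr.
have m1 : 1 <= m%:R :> R by rewrite ler1n.
have mp : 0 < m%:R :> R by rewrite ltr0n.
set t0 := b * a / 2 in t01 t0D *.
have t00 : 0 < t0 by rewrite /t0 divr_gt0// mulr_gt0.
have sq0 := sqrtr_ge0 t0; set q := Num.sqrt t0 in sq0 *.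
have Dq : D * q <= 1.
  rewrite -[leRHS](mulfV (x := D)) ?gt_eqF// ler_wpM2l ?(ltW D0)//.
  rewrite -ler_sqr ?nnegrE ?invr_ge0 ?(ltW D0)//.
  by rewrite /q sqr_sqrtr ?(ltW t00)// exprVn.
have Cq0 : 0 <= C * q by rewrite mulr_ge0// ltW.
have Xq0 : 0 <= X * q by rewrite mulr_ge0// ltW.
have Dq' : 4 * (C * q) + 4 * (X * q) <= 1 by move: Dq; rewrite /D; lra.
have F0 : 0 < k.-1`!%:R :> R by rewrite ltr0n fact_gt0.
set e0 := 2 * b * t0 ^+ k / k.-1`!%:R.
have e00 : 0 < e0 by rewrite divr_gt0// !mulr_gt0// exprn_gt0.
have -> : tr_eps a b (4 * C) k = e0 * (1 + 4 * C * q) by [].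
set eps := e0 * (1 + 4 * C * q).
have y0 : 0 <= 4 * C * q by rewrite -mulrA mulr_ge0.
have eps0 : 0 < eps by rewrite mulr_gt0// ltr_wpDr.
have eps1 : e0 <= eps by rewrite ler_peMr ?(ltW e00)// lerDl.
have pos x : a <= x -> 0 < x by exact: lt_le_trans.
have tge x : a < x -> t0 <= b * x / 2.
  by move=> /ltW ax; rewrite ler_wpM2r// ler_wpM2l// ltW.
have [mk|km|mk] := ltngtP m k.
(* With [n = m] the power of x in [trw] makes it a multiple of the Landau weight, so all of it can
   be taken as [w1], and the second half of the budget pays only the error [C * q]. *)
- have [ic Ic] := cstr mk.
  pose c0 := - (b / 2) * t0 ^+ m / m`!%:R / expS m t0.
  have wE x : a < x -> trw a b m m x = c0 * pexp a (- (m%:R / 2)) (- (b / 4)) x + 0.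
    move=> ax; have x0 : 0 < x by exact: lt_trans ax.
    rewrite /trw /trPi' (pow_pexp b m a0 x0) -/t0 addr0.
    have -> : pexp a (- (m%:R / 2)) (- (b / 4)) x =
      pexp a (m%:R / 2) (b / 4) x * pexp a 0 (- b / 2) x * pexp a (- m%:R) 0 x.
      by rewrite !pexpM; apply: pexp_eq; field.
    by rewrite /c0; ring.
  apply: (@trace_aux a b eps C m m f p (fun x => c0 * pexp a (- (m%:R / 2)) (- (b / 4)) x) (fun=> 0) (fun=> 0) (fun=> 0)) => //.
  + by apply: HC; exact: ltnW.
  + by move=> x _; exact: cst_continuous.
  + by apply: itg_ext (itgZ c0 ic) => x _; rewrite mulrA.
  + rewrite -[RHS](mulr0 c0) -Ic -RintZ//.
    by apply: Rint_ext => x _; rewrite mulrA.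
  + by move=> x _; rewrite expr0n mul0r oppr0.
  + by rewrite mulr0 addr0 -/t0 -/q; lra.
(* Here [trw] carries the factor (a / x)^j with j >= 1, from which half a power can be spent on sqrt
   t. The coefficient [d] is of relative size sqrt t0, so it costs only an error term. *)
- pose j := (m - k)%N.
  have mE : m%:R = k%:R + j%:R :> R by rewrite -natrD /j subnKC// ltnW.
  have j1 : 1 <= j%:R :> R by rewrite ler1n subn_gt0.
  have jp : 0 < j%:R :> R by exact: lt_le_trans j1.
  pose d := b * t0 ^+ k * C2 * q / (j%:R * eps).
  have dp : 0 <= d.
    apply: divr_ge0; last by rewrite mulr_ge0 ?(ltW eps0)// ltW.
    by rewrite !mulr_ge0 ?exprn_ge0 ?(ltW b0) ?(ltW t00) ?(ltW C20).
  apply: (@trace_aux a b eps C m k f p (fun=> 0) (trw a b m k) (fun x => d * pexp a (j%:R - 1 / 2) 0 x)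
    (fun x => d * ((0 - (j%:R - 1 / 2) / x) * pexp a (j%:R - 1 / 2) 0 x)) a0 b0 m0 t01 C0 eps0
    (HC k (leqnn k)) acf if2 ie).
  + by move=> x /pos x0; exact: (der_scale d (der_pexp a _ _ x0)).
  + move=> x /pos x0; apply: cvgM; first exact: cvg_cst.
    apply: cvgM; last exact: continuous_pexp.
    apply: cvgB; first exact: cvg_cst.
    by apply: cvgM; [exact: cvg_cst|apply: cvgV; [rewrite gt_eqF|exact: cvg_id]].
  + by move=> x ax; rewrite mulr_ge0// ltW// pexp_gt0.
  + by move=> x ax; rewrite add0r.
  + by apply: itg_ext (itg0 leb (measurable_itv `]a, +oo[)) => x _; rewrite mul0r.
  + by rewrite -[RHS](@Rint0 _ _ _ leb 'I[a,oo]); apply: Rint_ext => x _; rewrite mul0r.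
  + move=> x ax; have x0 := pos x (ltW ax); have tx := tge _ ax.
    have tx0 : 0 < b * x / 2 by exact: lt_le_trans tx.
    have H := @trw_sqr R a b m k a0 b0 x (ltW ax); rewrite -/t0 in H.
    have H2 := HC2 _ _ t00 t01 tx.
    rewrite ler_pdivrMr//.
    have -> : - (d * ((0 - (j%:R - 1 / 2) / x) * pexp a (j%:R - 1 / 2) 0 x)) * eps =
      (j%:R - 1 / 2) / j%:R * (b / x * t0 ^+ k * pexp a j%:R 0 x * (C2 * Num.sqrt (b * x / 2))).
      rewrite (sqrt_pexp a0 b0 x0) -/t0 -/q.
      have -> : pexp a (j%:R - 1 / 2) 0 x = pexp a j%:R 0 x * pexp a (- (1 / 2)) 0 x.
        by rewrite pexpM; apply: pexp_eq => //; rewrite addr0.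
      by rewrite /d; field; rewrite !gt_eqF.
    apply: (@le_trans _ _ (1 / 2 * (b / x * t0 ^+ k * pexp a j%:R 0 x * (C2 * Num.sqrt (b * x / 2))))); last first.
      rewrite ler_wpM2r//.
        by rewrite !mulr_ge0 ?invr_ge0 ?exprn_ge0 ?sqrtr_ge0 ?(ltW (pexp_gt0 _ _ _ _)) ?(ltW x0) ?(ltW b0) ?(ltW t00) ?(ltW C20).
      by rewrite ler_pdivlMr//; lra.
    apply: (@le_trans _ _ (1 / 2 * (b / x * t0 ^+ k * pexp a j%:R 0 x * (expR (t0 - b * x / 2) * (b * x / 2) ^+ k.+1)))); last first.
      rewrite ler_wpM2l// ler_wpM2l//.
      by rewrite !mulr_ge0 ?invr_ge0 ?exprn_ge0 ?(ltW (pexp_gt0 _ _ _ _)) ?(ltW x0) ?(ltW b0) ?(ltW t00).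
    apply: le_trans H _.
    have Z0 : 0 <= (b / 2) ^+ 2 * t0 ^+ k * pexp a (m%:R - k%:R) 0 x * (expR (t0 - b * x / 2) * (b * x / 2) ^+ k).
      apply: mulr_ge0; last by apply: mulr_ge0; [exact: expR_ge0|apply: exprn_ge0; exact: ltW].
      apply: mulr_ge0; last exact: ltW (pexp_gt0 _ _ _ _).
      by apply: mulr_ge0; [exact: sqr_ge0|apply: exprn_ge0; exact: ltW].
    have F1 : 1 <= (k`!%:R ^+ 2) * expS k t0.
      by rewrite -[leLHS]mulr1 ler_pM ?expS_ge1 ?(ltW t00)// exprn_ege1// ler1n fact_gt0.
    have F2 : 0 < (k`!%:R ^+ 2) * expS k t0 by exact: lt_le_trans F1.
    have -> : (b / 2) ^+ 2 * t0 ^+ k * pexp a (m%:R - k%:R) 0 x * (expR (t0 - b * x / 2) * (b * x / 2) ^+ k / k`!%:R ^+ 2) / expS k t0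
      = (b / 2) ^+ 2 * t0 ^+ k * pexp a (m%:R - k%:R) 0 x * (expR (t0 - b * x / 2) * (b * x / 2) ^+ k) / (k`!%:R ^+ 2 * expS k t0).
      by rewrite (invfM (k`!%:R ^+ 2)) !mulrA.
    rewrite ler_pdivrMr//.
    have -> : 1 / 2 * (b / x * t0 ^+ k * pexp a j%:R 0 x * (expR (t0 - b * x / 2) * (b * x / 2) ^+ k.+1)) =
       (b / 2) ^+ 2 * t0 ^+ k * pexp a (m%:R - k%:R) 0 x * (expR (t0 - b * x / 2) * (b * x / 2) ^+ k).
      rewrite (_ : m%:R - k%:R = j%:R); last by rewrite mE; ring.
      rewrite exprS; move: (_ ^+ k) (pexp _ _ _ _) (expR _) (t0 ^+ k) => Y1 Y2 Y3 Y4.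
      by field; rewrite gt_eqF.
    by rewrite ler_peMr.
  + rewrite pexp_a mulr1 -/t0 -/q.
    have : 2 * m%:R * d <= 2 * (X * q).
      have -> : 2 * m%:R * d = (m%:R / j%:R) * (2 * b * t0 ^+ k * C2 * q / eps).
        by rewrite /d; field; rewrite !gt_eqF.
      have -> : 2 * (X * q) = (k%:R + 1) * (2 * b * t0 ^+ k * C2 * q / (b * t0 ^+ k / k.-1`!%:R)).
        by rewrite /X; field; rewrite !gt_eqF// exprn_gt0.
      apply: ler_pM; rewrite ?divr_ge0 ?ler0n//.
      * by rewrite !mulr_ge0 ?exprn_ge0 ?(ltW b0) ?(ltW t00) ?(ltW C20).
      * exact: ltW.
      * rewrite mE ler_pdivrMr// mulrDl mul1r lerD2r ler_peMr ?ler0n//.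
      * rewrite ler_wpM2l//; first by rewrite !mulr_ge0 ?exprn_ge0 ?(ltW b0) ?(ltW t00) ?(ltW C20).
        have b1 : 0 < b * t0 ^+ k / k.-1`!%:R by rewrite divr_gt0// mulr_gt0// exprn_gt0.
        rewrite lef_pV2 ?posrE//; apply: le_trans eps1.
        rewrite /e0 -!mulrA ler_peMl//; last by rewrite ler1n.
        by rewrite mulrA ltW.
    lra.
(* The square of [trw] is now at most a constant multiple of [- trPi'], so [trPi] itself is the
   majorant, with value 1 at [a]. Its cost 2 k d equals (1 / 2) / (1 + 4 C q), which is what fixes
   the leading constant of [tr_eps]. *)
- pose d := b * t0 ^+ k / (2 * k`!%:R * eps).
  have kf : 0 < k`!%:R :> R by rewrite ltr0n fact_gt0.
  have dp : 0 <= d.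
    apply: divr_ge0; first by rewrite mulr_ge0 ?exprn_ge0 ?(ltW b0) ?(ltW t00).
    by apply: mulr_ge0; [rewrite mulr_ge0// ltW|exact: ltW].
  have S1 := expS_ge1 k (ltW t00).
  have S0 : 0 < expS k t0 by exact: lt_le_trans S1.
  apply: (@trace_aux a b eps C m k f p (fun=> 0) (trw a b m k) (fun x => d * trPi a b k x)
    (fun x => d * trPi' a b k x) a0 b0 m0 t01 C0 eps0 (HC k (leqnn k)) acf if2 ie).
  + by move=> x ax; exact: (der_scale d (der_trPi _ a0 b0 ax)).
  + by move=> x ax; apply: cvgM; [exact: cvg_cst|exact: continuous_trPi'].
  + move=> x ax; have x0 := pos _ ax.
    rewrite mulr_ge0// divr_ge0 ?(ltW S0)// mulr_ge0 ?(ltW (pexp_gt0 _ _ _ _))//.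
    by rewrite (le_trans ler01)// expS_ge1// divr_ge0// mulr_ge0 ?(ltW x0) ?(ltW b0).
  + by move=> x ax; rewrite add0r.
  + by apply: itg_ext (itg0 leb (measurable_itv `]a, +oo[)) => x _; rewrite mul0r.
  + by rewrite -[RHS](@Rint0 _ _ _ leb 'I[a,oo]); apply: Rint_ext => x _; rewrite mul0r.
  + move=> x ax; have x0 := pos x (ltW ax).
    have H := @trw_sqr R a b m k a0 b0 x (ltW ax); rewrite -/t0 in H.
    rewrite ler_pdivrMr//; apply: le_trans H _.
    rewrite mk subrr /trPi' -/t0 le_eqVlt; apply/orP; left; apply/eqP.
    have -> : pexp a 0 (- b / 2) x = expR (t0 - b * x / 2).
      by rewrite /pexp; congr expR; rewrite /t0; field.
    have -> : pexp a 0 0 x = 1 by rewrite /pexp !mul0r addr0 expR0.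
    by rewrite /d; field; rewrite !gt_eqF.
  + rewrite /trPi pexp_a mul1r mulfV ?gt_eqF// mulr1 -/t0 -/q mk.
    have -> : 2 * k%:R * d = (1 / 2) / (1 + 4 * C * q).
      have E : k`!%:R = k%:R * k.-1`!%:R :> R by rewrite -natrM -(prednK k0) factS.
      rewrite /d /eps /e0 E; field.
      rewrite !gt_eqF// ?exprn_gt0 ?ltr_wpDr ?ltr0n//.
    have : (1 / 2) / (1 + 4 * C * q) <= 1 / 2 - C * q.
      rewrite ler_pdivrMr ?ltr_wpDr//.
      have : 0 <= (C * q) * (1 - 4 * (C * q)).
        by rewrite mulr_ge0// subr_ge0; lra.
      by rewrite !mulrDr !mulrN; lra.
    by lra.
Qed.

End trace_bound.

(** * The exterior domain and its test functions *)

Section plane.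
Context {R : realType}.
Local Notation pt := (R * R)%type.
Implicit Types (f g h : pt -> R) (x z : pt) (n m : nat) (j : 'I_2).

(** The measurable sets of the plane are generated by rectangles; an open set is a countable union
    of boxes with rational centres and radii 1 / (n + 1). *)
Lemma open_measurable2 (U : set pt) : open U -> measurable U.
Proof.
move=> oU; pose r (n : nat) : R := n.+1%:R^-1.
pose box (i : rat * rat * nat) : set pt :=
  ball (ratr i.1.1 : R) (r i.2) `*` ball (ratr i.1.2 : R) (r i.2).
pose F i : set pt := if `[< box i `<=` U >] then box i else set0.
have -> : U = \bigcup_i F i.
  apply/seteqP; split => [z Uz|z [i _]]; last by rewrite /F; case: asboolP => // sub /sub.
  have /nbhs_ballP[e /= e0 zU] : nbhs z U by exact: open_nbhs_nbhs.
  have e20 : 0 < e / 2 by rewrite divr_gt0.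
  have [N _ /(_ N (leqnn N)) Ne] := near_infty_natSinv_lt (PosNum e20).
  have rN : r N < e / 2 by [].
  have rN0 : 0 < r N by rewrite invr_gt0.
  have [p] := @rat_in_itvoo R (z.1 - r N) (z.1 + r N) ltac:(lra).
  rewrite in_itv/= => /andP[p1 p2].
  have [q] := @rat_in_itvoo R (z.2 - r N) (z.2 + r N) ltac:(lra).
  rewrite in_itv/= => /andP[q1 q2].
  exists (p, q, N) => //.
  have sub : box (p, q, N) `<=` U.
    move=> w [/= w1 w2]; apply: zU; rewrite /ball/= in w1 w2 *.
    move: w1 w2; rewrite /ball_/= !ltr_norml => /andP[a1 a2] /andP[b1 b2].
    split; rewrite /ball/= ltr_norml; apply/andP; split; lra.
  have -> : F (p, q, N) = box (p, q, N) by rewrite /F; case: asboolP.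
  by split => /=; rewrite /ball/= ltr_norml; apply/andP; split; lra.
apply: countable_bigcupT_measurable => // i; rewrite /F; case: asboolP => // _.
by apply: measurableX; exact: measurable_ball.
Qed.

Lemma continuous_measurable2 f : continuous f -> measurable_fun setT f.
Proof.
move=> /continuousP cf; apply: (measurability _ (RGenOInfty.measurableE R)).
move=> _ [_ [y ->] <-]; rewrite setTI; apply: open_measurable2; exact: cf.
Qed.

Definition coord j x : R := if j == 0 then x.1 else x.2.
Definition line j f x (t : R) : R := if j == 0 then f (t, x.2) else f (x.1, t).

Lemma line_coord j f x : line j f x (coord j x) = f x.
Proof. by case: x => x1 x2; rewrite /line /coord; case: (j == 0). Qed.

(** Carries the one-variable rules over to derivatives along the coordinate axes. *)
Lemma is_derive_line j f x d :
  is_derive x (basis_vec R j) f d <-> is_derive (coord j x) 1 (line j f x) d.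
Proof.
have E : (fun h : R => h^-1 *: ((f \o shift x) (h *: basis_vec R j) - f x)) =
    (fun h : R => h^-1 *: ((line j f x \o shift (coord j x)) (h *: 1) - line j f x (coord j x))).
  apply/funext => h; rewrite line_coord; congr (_ *: (_ - _)).
  case: x => x1 x2; rewrite /line /coord /basis_vec /=; case: (j == 0) => /=.
    by congr f; apply/pair_equal_spec; split; rewrite //= /GRing.scale/= mulr0 add0r.
  by congr f; apply/pair_equal_spec; split; rewrite //= /GRing.scale/= mulr0 add0r.
split=> -[].
  by rewrite /derivable /derive E => D1 D2; apply: DeriveDef.
by rewrite /derivable /derive -E => D1 D2; apply: DeriveDef.
Qed.

Lemma pd_mul j f g x a b : is_derive x (basis_vec R j) f a ->
  is_derive x (basis_vec R j) g b -> is_derive x (basis_vec R j) (fun z => f z * g z) (a * g x + f x * b).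
Proof.
move=> /is_derive_line df /is_derive_line dg; apply/is_derive_line.
have := der_mul df dg; rewrite !line_coord; congr (is_derive _ _ _ _).
by apply/funext => t; rewrite /line; case: ifP.
Qed.

Lemma pd_add j f g x a b : is_derive x (basis_vec R j) f a ->
  is_derive x (basis_vec R j) g b -> is_derive x (basis_vec R j) (fun z => f z + g z) (a + b).
Proof.
move=> /is_derive_line df /is_derive_line dg; apply/is_derive_line.
have := der_add df dg; congr (is_derive _ _ _ _).
by apply/funext => t; rewrite /line; case: ifP.
Qed.

Lemma pd_cst j (c : R) x : is_derive x (basis_vec R j) (fun=> c) 0.
Proof.
apply/is_derive_line; have := der_cst c (coord j x); congr (is_derive _ _ _ _).
by apply/funext => t; rewrite /line; case: ifP.
Qed.

Lemma pd_comp j f x a (eta : R -> R) b : is_derive x (basis_vec R j) f a ->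
  is_derive (f x) 1 eta b -> is_derive x (basis_vec R j) (fun z => eta (f z)) (a * b).
Proof.
move=> /is_derive_line df de; apply/is_derive_line.
rewrite -(line_coord j f x) in de.
have := der_comp df de; congr (is_derive _ _ _ _).
by apply/funext => t; rewrite /line; case: ifP.
Qed.

Lemma pd_coord j i x : is_derive x (basis_vec R j) (coord i) (i == j)%:R.
Proof.
apply/is_derive_line; have [->|ij] := eqVneq i j.
  have := der_id (coord j x); congr (is_derive _ _ _ _).
  by apply/funext => t; rewrite /line /coord; case: (j == 0).
have := der_cst (coord i x) (coord j x); congr (is_derive _ _ _ _).
apply/funext => t; rewrite /line /coord; move: i j ij.
by case=> [[|[|i]]] ? [[|[|j]]] ?.
Qed.

Lemma continuous_coord i : continuous (coord i).
Proof.
by move=> x; rewrite /coord; case: (i == 0); [exact: cvg_fst|exact: cvg_snd].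
Qed.

(** Continuity is demanded at every level, because in the plane it does not follow from the
    existence of partial derivatives. *)
Fixpoint sm2 n f : Prop := if n is n'.+1 then
  continuous f /\ exists F : 'I_2 -> pt -> R,
    forall j, (forall x, is_derive x (basis_vec R j) f (F j x)) /\ sm2 n' (F j)
  else continuous f.

Lemma sm2_continuous n f : sm2 n f -> continuous f.
Proof. by case: n => // n []. Qed.

Lemma sm2W n f : sm2 n.+1 f -> sm2 n f.
Proof.
elim: n f => [|n IH] f; first exact: (@sm2_continuous 1).
move=> [cf [F FP]]; split => //; exists F => j; have [dF sF] := FP j; split => //.
exact: IH.
Qed.

Lemma sm2_cst n (c : R) : sm2 n (fun=> c).
Proof.
elim: n c => [|n IH] c; first exact: cst_continuous.
split; first exact: cst_continuous.
by exists (fun _ _ => 0) => j; split => // x; exact: pd_cst.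
Qed.

Lemma sm2D n f g : sm2 n f -> sm2 n g -> sm2 n (fun x => f x + g x).
Proof.
elim: n f g => [|n IH] f g; first by move=> cf cg x; apply: cvgD; [exact: cf|exact: cg].
move=> [cf [F FP]] [cg [G GP]]; split.
  by move=> x; apply: cvgD; [exact: cf|exact: cg].
exists (fun j x => F j x + G j x) => j; have [dF sF] := FP j; have [dG sG] := GP j.
by split; [move=> x; exact: pd_add|exact: IH].
Qed.

Lemma sm2M n f g : sm2 n f -> sm2 n g -> sm2 n (fun x => f x * g x).
Proof.
elim: n f g => [|n IH] f g; first by move=> cf cg x; apply: cvgM; [exact: cf|exact: cg].
move=> sf sg; have [cf [F FP]] := sf; have [cg [G GP]] := sg; split.
  by move=> x; apply: cvgM; [exact: cf|exact: cg].
exists (fun j x => F j x * g x + f x * G j x) => j.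
have [dF sF] := FP j; have [dG sG] := GP j.
split; first by move=> x; exact: pd_mul.
by apply: sm2D; apply: IH => //; exact: sm2W.
Qed.

Lemma sm2Z n c f : sm2 n f -> sm2 n (fun x => c * f x).
Proof. by move=> sf; apply: sm2M => //; exact: sm2_cst. Qed.

Lemma sm2_coord n i : sm2 n (coord i).
Proof.
case: n => [|n]; first exact: continuous_coord.
split; first exact: continuous_coord.
exists (fun j _ => (i == j)%:R) => j; split; first by move=> x; exact: pd_coord.
exact: sm2_cst.
Qed.

Lemma sm2_comp n f (eta : R -> R) : sm n eta -> sm2 n f -> sm2 n (fun x => eta (f x)).
Proof.
elim: n f eta => [|n IH] f eta.
  by move=> ce cf x; apply: (continuous_comp (f := f)); [exact: cf|exact: ce].
move=> se sf; have [eta' [de se']] := se; have [cf [F FP]] := sf; split.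
  move=> x; apply: (continuous_comp (f := f)); first exact: cf.
  exact: (sm_continuous se).
exists (fun j x => F j x * eta' (f x)) => j; have [dF sF] := FP j; split.
  by move=> x; apply: pd_comp.
by apply: sm2M => //; apply: IH => //; exact: sm2W.
Qed.

Lemma smooth_sm2 f : (forall n, sm2 n f) -> smooth f.
Proof.
move=> sf w.
have pdE g F j : (forall x, is_derive x (basis_vec R j) g (F x)) -> pderiv j g = F.
  by move=> dF; apply/funext => x; have [_ <-] := dF x.
have sw : forall n, sm2 n (foldr (@pderiv R) f w).
  elim: w => [|j w IH] n //=.
  have [_ [F /(_ j)[dF sF]]] := IH n.+1.
  by rewrite (pdE _ _ _ dF).
split; first exact: (sm2_continuous (sw 0%N)).
by move=> j x; have [_ [F /(_ j)[dF _]]] := sw 1%N; have [] := dF x.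
Qed.

Lemma pderivE j f x d : is_derive x (basis_vec R j) f d -> pderiv j f x = d.
Proof. by move=> [_ <-]. Qed.

Definition nsq x : R := x.1 ^+ 2 + x.2 ^+ 2.

Lemma pd_nsq j x : is_derive x (basis_vec R j) nsq (2 * coord j x).
Proof.
have := pd_add (pd_mul (pd_coord j 0 x) (pd_coord j 0 x)) (pd_mul (pd_coord j 1 x) (pd_coord j 1 x)).
have -> : (fun z : pt => coord 0 z * coord 0 z + coord 1 z * coord 1 z) = nsq.
  by apply/funext => z; rewrite /nsq /coord !expr2.
congr (is_derive _ _ _ _).
move: j; case=> [[|[|j]]] // ?; rewrite /coord/=; ring.
Qed.

Lemma sm2_nsq n : sm2 n nsq.
Proof.
have -> : nsq = (fun z : pt => coord 0 z * coord 0 z + coord 1 z * coord 1 z).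
  by apply/funext => z; rewrite /nsq /coord !expr2.
by apply: sm2D; apply: sm2M; exact: sm2_coord.
Qed.

Lemma continuous_nsq : continuous nsq.
Proof. exact: (sm2_continuous (sm2_nsq 0)). Qed.

(** The real and imaginary parts of (x_1 + i x_2)^m. As polynomials they are smooth across the
    origin, unlike cos (m t) and sin (m t), to which they are proportional on each circle. *)
Fixpoint zc m x : R := if m is m'.+1 then x.1 * zc m' x - x.2 * zs m' x else 1
with zs m x : R := if m is m'.+1 then x.1 * zs m' x + x.2 * zc m' x else 0.

Lemma sm2_zcs m n : sm2 n (zc m) /\ sm2 n (zs m).
Proof.
elim: m => [|m [IHc IHs]]; first by split; exact: sm2_cst.
have s1 : sm2 n (fun x => x.1) := sm2_coord n 0.
have s2 : sm2 n (fun x => x.2) := sm2_coord n 1.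
split => /=; last by apply: sm2D; exact: sm2M.
have := sm2D (sm2M s1 IHc) (sm2Z (-1) (sm2M s2 IHs)).
by under eq_fun do rewrite mulN1r.
Qed.

Definition grad f (F : 'I_2 -> pt -> R) := forall j x, is_derive x (basis_vec R j) f (F j x).

(** The gradients of [zc m] and [zs m], from d(z^m) = m z^(m - 1) dz. At [m = 0] the predecessor is
    harmless because of the factor [m]. *)
Definition Czc m j x : R := if j == 0 then m%:R * zc m.-1 x else - (m%:R * zs m.-1 x).
Definition Czs m j x : R := if j == 0 then m%:R * zs m.-1 x else m%:R * zc m.-1 x.

Lemma grad_zcs m : grad (zc m) (Czc m) /\ grad (zs m) (Czs m).
Proof.
elim: m => [|m [IHc IHs]].
  by split => j x; [have := pd_cst j 1 x|have := pd_cst j 0 x]; congr (is_derive _ _ _ _);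
    rewrite /Czc /Czs !mul0r ?oppr0 if_same.
have E : m%:R * zc m.-1.+1 = m%:R * zc m :> (pt -> R).
  by case: m {IHc IHs} => [|m] //; apply/funext => x; rewrite /= mulrfctE !mul0r.
have mzc x : m%:R * (x.1 * zc m.-1 x - x.2 * zs m.-1 x) = m%:R * zc m x.
  by case: m {IHc IHs E} => [|m] //; rewrite !mul0r.
have mzs x : m%:R * (x.1 * zs m.-1 x + x.2 * zc m.-1 x) = m%:R * zs m x.
  by case: m {IHc IHs E mzc} => [|m] //; rewrite !mul0r.
have N1 x j : is_derive x (basis_vec R j) (fun z => - z.2) (- (1 == j :> 'I_2)%:R).
  have := pd_mul (pd_cst j (-1) x) (pd_coord j 1 x).
  have -> : (fun z : pt => -1 * coord 1 z) = (fun z => - z.2) by apply/funext => z; rewrite mulN1r.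
  by rewrite mul0r add0r mulN1r.
split => j x.
  have := pd_add (pd_mul (pd_coord j 0 x) (IHc j x)) (pd_mul (N1 x j) (IHs j x)).
  have -> : (fun z : pt => coord 0 z * zc m z + - z.2 * zs m z) = zc m.+1.
    by apply/funext => z; rewrite mulNr.
  congr (is_derive _ _ _ _); rewrite /Czc /Czs /coord -natr1; move: (mzc x) (mzs x).
  move: j; case=> [[|[|j]]] // ? H1 H2 /=; rewrite mulrDl mul1r -?H1 -?H2; ring.
have := pd_add (pd_mul (pd_coord j 0 x) (IHs j x)) (pd_mul (pd_coord j 1 x) (IHc j x)).
have -> : (fun z : pt => coord 0 z * zs m z + coord 1 z * zc m z) = zs m.+1 by [].
congr (is_derive _ _ _ _); rewrite /Czc /Czs /coord -natr1; move: (mzc x) (mzs x).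
move: j; case=> [[|[|j]]] // ? H1 H2 /=; rewrite mulrDl mul1r -?H1 -?H2; ring.
Qed.

Lemma zcs_polar m (s th : R) : zc m (polar_map (s, th)) = Num.sqrt s ^+ m * cos (m%:R * th) /\
  zs m (polar_map (s, th)) = Num.sqrt s ^+ m * sin (m%:R * th).
Proof.
elim: m => [|m [IHc IHs]] /=; first by rewrite mul0r cos0 sin0 expr0 mulr1 mulr0.
rewrite IHc IHs /= -natr1 mulrDl mul1r cosD sinD exprS; split; ring.
Qed.

Lemma nsq_polar (s th : R) : 0 <= s -> nsq (polar_map (s, th)) = s.
Proof. by move=> s0; rewrite /nsq polar_map_normsq. Qed.

End plane.

(** * The exterior domain, compact supports and weak momenta in real form *)

Section planar_domain.
Context {R : realType}.
Local Notation pt := (R * R)%type.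
Local Notation leb := (@lebesgue_measure R).
Local Notation leb2 := (leb \x leb)%E.
Local Notation J := (`](- (pi / 2)), (3 * pi / 2)[%classic : set R).
Local Notation "'I[ a ,oo]" := (`]a, +oo[%classic : set R) (at level 0, format "''I[' a ,oo]").
Implicit Types (f g h phi : pt -> R) (x z : pt) (n m : nat) (j : 'I_2) (a b : R).

Definition dom a : set pt := [set z | a < nsq z].

Lemma open_dom a : open (dom a).
Proof.
have -> : dom a = nsq @^-1` `]a, +oo[%classic.
  by apply/seteqP; split => z; rewrite /dom/= in_itv/= andbT.
by move/continuousP : (@continuous_nsq R); apply.
Qed.

Lemma measurable_dom a : measurable (dom a).
Proof. by apply: open_measurable2; exact: open_dom. Qed.

(** The closure of the open disk is the closed disk: a point with |z| <= r is a limit of multiples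
    of itself by factors below 1, and the closed disk is closed because the complement is open. *)
Lemma exterior_disk (r : R) : 0 < r -> exterior (disk r) = dom (r ^+ 2).
Proof.
move=> r0; have dE (z : pt) : enorm z < r <-> nsq z < r ^+ 2.
  rewrite -ltr_sqr ?nnegrE ?sqrtr_ge0 ?ltW// sqr_sqrtr//.
  by rewrite addr_ge0 ?sqr_ge0.
rewrite /exterior; apply/seteqP; split => z /=.
  apply: contra_notP; rewrite /dom/= => /negP; rewrite -leNgt => zr.
  (* The index starts at 2, so that the factor stays strictly between 0 and 1. *)
  have H (c : R) : (1 - n.+2%:R^-1) * c @[n --> \oo] --> c.
    rewrite -[X in _ --> X]mul1r -[X in X * _]subr0; apply: cvgM; last exact: cvg_cst.
    apply: cvgB; first exact: cvg_cst.
    by have := @cvg_harmonic R; rewrite -cvg_shiftS.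
  move=> B /nbhs_ballP[e /= e0 zB].
  have [N _ HN] : \forall n \near \oo, ball z.1 e ((1 - n.+2%:R^-1) * z.1) /\
                                      ball z.2 e ((1 - n.+2%:R^-1) * z.2).
    by near=> n; split; near: n; apply: H; exact: nbhsx_ballx.
  exists ((1 - N.+2%:R^-1) * z.1, (1 - N.+2%:R^-1) * z.2); split; last first.
    by apply: zB; exact: HN (leqnn N).
  apply/dE; rewrite /nsq/= !exprMn -mulrDr -/(nsq z).
  have N2 : 0 < (N.+2%:R^-1 : R) < 1.
    by rewrite invr_gt0 ltr0n/= invf_lt1// ltr1n.
  have nz0 : 0 <= nsq z by rewrite addr_ge0 ?sqr_ge0.
  have : (1 - N.+2%:R^-1 : R) ^+ 2 < 1.
    move: N2; move: (N.+2%:R^-1 : R) => t /andP[t0 t1].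
    by rewrite expr_lt1// ?subr_ge0 ?gtrBl// ltW.
  move: nz0; rewrite le_eqVlt => /predU1P[<-|nz0 H1]; first by rewrite mulr0 exprn_gt0.
  by apply: lt_le_trans zr; rewrite gtr_pMl.
move=> az; have cl : closed [set z : pt | nsq z <= r ^+ 2].
  have -> : [set z : pt | nsq z <= r ^+ 2] = ~` dom (r ^+ 2).
    by apply/seteqP; split => w /=; rewrite /dom/= leNgt => /negP.
  exact/open_closedC/open_dom.
move=> zc; have : [set z : pt | nsq z <= r ^+ 2] z.
  move/closure_id: cl => ->; apply: (closure_subset _ zc) => w /dE/ltW; exact.
by rewrite /= leNgt az.
Unshelve. all: by end_near. Qed.

Definition csupp h := continuous h /\
  exists B : R, forall z, ~ (`|z.1| <= B /\ `|z.2| <= B) -> h z = 0.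

Lemma compact_box (B : R) : compact [set z : pt | `|z.1| <= B /\ `|z.2| <= B].
Proof.
have -> : [set z : pt | `|z.1| <= B /\ `|z.2| <= B] = `[-B, B]%classic `*` `[-B, B]%classic.
  by apply/seteqP; split => z /=; rewrite !in_itv/= !ler_norml.
by apply: compact_setX; exact: segment_compact.
Qed.

Lemma csupp_bounded h : csupp h -> exists2 M : R, 0 <= M & forall z, `|h z| <= M.
Proof.
move=> [ch [B hB]].
have : compact (h @` [set z : pt | `|z.1| <= B /\ `|z.2| <= B]).
  apply: continuous_compact; last exact: compact_box.
  exact: continuous_subspaceT.
move=> /compact_bounded [M [Mr HM]].
exists (`|M| + 1) => [|z]; first by rewrite addr_ge0.
have [zB|zB] := pselect (`|z.1| <= B /\ `|z.2| <= B); last by rewrite hB// normr0 addr_ge0.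
apply: (HM (`|M| + 1)); last by exists z.
by rewrite (le_lt_trans (ler_norm M))// ltrDl.
Qed.

Lemma csuppM h (k : pt -> R) : csupp h -> continuous k -> csupp (fun z => k z * h z).
Proof.
move=> [ch [B hB]] ck; split; first by move=> z; apply: cvgM; [exact: ck|exact: ch].
by exists B => z /hB ->; rewrite mulr0.
Qed.

Lemma csuppD h (k : pt -> R) : csupp h -> csupp k -> csupp (fun z => h z + k z).
Proof.
move=> [ch [B hB]] [ck [C kC]]; split; first by move=> z; apply: cvgD; [exact: ch|exact: ck].
exists (Num.max B C) => z zz; rewrite hB ?kC ?addr0// => -[z1 z2]; apply: zz;
  by rewrite !le_max z1 z2 ?orbT.
Qed.

Lemma test_grad (D : set pt) phi j x : test_function D phi ->
  is_derive x (basis_vec R j) phi (pderiv j phi x).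
Proof. by move=> [sphi _ _]; have [_ /(_ j x) d] := sphi [::]; exact: DeriveDef. Qed.

Lemma pderiv_off phi x j : ~ closure [set z | phi z != 0] x ->
  is_derive x (basis_vec R j) phi 0.
Proof.
move=> xs; have : \forall z \near x, phi z = 0.
  have N : nbhs x (~` closure [set z | phi z != 0]).
    by apply: open_nbhs_nbhs; split => //; apply: closed_openC; exact: closed_closure.
  by apply: filterS N => z; apply: contra_notP => /eqP zn; exact: subset_closure.
move=> n0; apply/is_derive_line; apply: (@is_derive_near _ (fun=> 0)).
have /nbhs_ballP[e /= e0 xe] := n0; apply/nbhs_ballP; exists e => //= t te.
apply/esym; rewrite /line; move: te; rewrite /coord; case: (j == 0) => te; apply: xe.
  by split => //=; exact: ballxx.
by split => //=; exact: ballxx.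
Qed.

Lemma csupp_test (D : set pt) phi : test_function D phi ->
  csupp phi /\ forall j, csupp (pderiv j phi).
Proof.
move=> tp; have [sphi cs sD] := tp.
have /compact_bounded [M [Mr HM]] := cs.
have bnd z : ~ (`|z.1| <= `|M| + 1 /\ `|z.2| <= `|M| + 1) -> ~ closure [set z | phi z != 0] z.
  apply: contra_not => zs; have := HM (`|M| + 1).
  rewrite (le_lt_trans (ler_norm M)) ?ltrDl// => /(_ isT _ zs).
  by rewrite /= prod_normE ge_max => /andP.
split; last first.
  move=> j; have [cj _] := sphi [:: j]; split; first exact: cj.
  exists (`|M| + 1) => z /bnd zs; exact: pderivE (pderiv_off _ zs).
have [c _] := sphi [::]; split; first exact: c.
exists (`|M| + 1) => z /bnd zs; apply/eqP/negPn/negP => zn; apply: zs.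
exact: subset_closure.
Qed.

(** These products probe the weak momentum one angular mode at a time, with [k] carrying the angle
    and [eta] the radius. *)
Lemma test2 a k (eta : R -> R) : (forall n, sm2 n k) -> test1 a eta ->
  test_function (dom a) (fun z => k z * eta (nsq z)).
Proof.
move=> sk [se [c [d [ac cd e0]]]].
have sub : closure [set z | k z * eta (nsq z) != 0] `<=` [set z | c <= nsq z <= d].
  have cl : closed [set z : pt | c <= nsq z <= d].
    have -> : [set z : pt | c <= nsq z <= d] = nsq @^-1` `[c, d]%classic.
      by apply/seteqP; split => z /=; rewrite in_itv.
    by apply: closed_comp => [z _|]; [exact: continuous_nsq|exact: itv_closed].
  rewrite [X in _ `<=` X](closure_id _).1//; apply: closure_subset => z /=.
  by apply: contraNT => /negP /e0 ->; rewrite mulr0.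
split.
- apply: smooth_sm2 => n; apply: sm2M; first exact: sk.
  by apply: sm2_comp; [exact: se|exact: sm2_nsq].
- have H1 := @compact_box (`|d| + 1).
  have H2 := @closed_closure _ [set x | k x * eta (nsq x) != 0].
  apply: (subclosed_compact H2 H1).
  move=> z /sub /= /andP[_ zd].
  have H (t : R) : t ^+ 2 <= d -> `|t| <= `|d| + 1.
    move=> td; rewrite -ler_sqr ?nnegrE ?addr_ge0// real_normK ?num_real//.
    have := ler_norm d; have := normr_ge0 d; rewrite sqrrD => ? ?.
    have := sqr_ge0 `|d|; lra.
  have := sqr_ge0 z.1; have := sqr_ge0 z.2; move: zd; rewrite /nsq => ? ? ?.
  by split; apply: H; lra.
- by move=> z /sub /= /andP[cz _]; exact: lt_le_trans ac cz.
Qed.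

Lemma itg_box (B : R) : itg leb2 setT
  (fun z : pt => (\1_(`]- (B + 1), B]%classic : set R) z.1 : R) * (\1_(`]- (B + 1), B]%classic : set R) z.2 : R)).
Proof.
have H : itg leb setT (\1_(`]- (B + 1), B]%classic : set R) : R -> R).
  apply: itg_ext ((itg_mkcond leb (fun=> 1) (measurable_oc _ _)).1 (itg_oc_cst (- (B + 1)) B 1)) => x _.
  by rewrite patchE indicE; case: (_ \in _).
exact: (itg_prod H H).
Qed.

Lemma itg_csupp (D : set pt) g h : measurable D -> measurable_fun D g ->
  itg leb2 D (fun z => g z ^+ 2) -> csupp h -> itg leb2 D (fun z => g z * h z).
Proof.
move=> mD mg g2 sh; have [ch [B hB]] := sh; have [M M0 hM] := csupp_bounded sh.
apply: (itg_le _ (itgD g2 (itgZ (M ^+ 2) (itgS (itg_box B) (@subsetT _ D) mD)))).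
  apply: measurable_funM => //; apply: measurable_funTS.
  exact: continuous_measurable2.
move=> z Dz; rewrite normrM -[g z ^+ 2]real_normK ?num_real//.
have [zB|zB] := pselect (`|z.1| <= B /\ `|z.2| <= B); last first.
  rewrite hB// normr0 mulr0 addr_ge0 ?sqr_ge0// mulr_ge0 ?sqr_ge0//.
have bx (t : R) : `|t| <= B -> `]- (B + 1), B]%classic t.
  rewrite ler_norml /= in_itv/= => /andP[t1 ->]; rewrite andbT; lra.
rewrite !indicE !mem_set ?mulr1/=; try by apply: bx; case: zB.
have H := hM z; have := normr_ge0 (h z).
have := sqr_ge0 (`|g z| - `|h z|); rewrite sqrrB => H1 H2.
have H3 : `|h z| ^+ 2 <= M ^+ 2 by rewrite ler_sqr ?nnegrE.
have := sqr_ge0 `|g z|; have := mulr_ge0 (normr_ge0 (g z)) H2; lra.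
Qed.

(* Real part of [weak_momentum]; its imaginary part is [rweak] for [- i u], whose
   components are [u2] and [- u1]. *)
Definition rweak a b j (u1 u2 p : pt -> R) := forall phi, test_function (dom a) phi ->
  \int[leb2]_(z in dom a) (p z * phi z) =
  \int[leb2]_(z in dom a) (- (u2 z * pderiv j phi z) - b * vecpot j z * phi z * u1 z).

Lemma weak_rweak a b j (u v : pt -> R[i]) : weak_momentum (dom a) b j u v ->
  rweak a b j (fun z => complex.Re (u z)) (fun z => complex.Im (u z)) (fun z => complex.Re (v z)) /\
  rweak a b j (fun z => complex.Im (u z)) (fun z => - complex.Re (u z)) (fun z => complex.Im (v z)).
Proof.
move=> w; split => phi tp; have := w phi tp; rewrite /cintegral => -[E1 E2].
  transitivity (\int[leb2]_(z in dom a) complex.Re (v z * (phi z)%:C)%C).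
    by apply: Rint_ext => z _; case: (v z) => ? ? /=; rewrite mulr0 subr0.
  rewrite -E1; apply: Rint_ext => z _; case: (u z) => ? ? /=; ring.
transitivity (\int[leb2]_(z in dom a) complex.Im (v z * (phi z)%:C)%C).
  by apply: Rint_ext => z _; case: (v z) => ? ? /=; rewrite mulr0 add0r.
rewrite -E2; apply: Rint_ext => z _; case: (u z) => ? ? /=; ring.
Qed.

Lemma rweak_weak a b j (u v : pt -> R[i]) :
  rweak a b j (fun z => complex.Re (u z)) (fun z => complex.Im (u z)) (fun z => complex.Re (v z)) ->
  rweak a b j (fun z => complex.Im (u z)) (fun z => - complex.Re (u z)) (fun z => complex.Im (v z)) ->
  weak_momentum (dom a) b j u v.
Proof.
move=> w1 w2 phi tp; have E1 := w1 phi tp; have E2 := w2 phi tp.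
rewrite /cintegral; congr Complex.
  transitivity (\int[leb2]_(z in dom a) (complex.Re (v z) * phi z)).
    by rewrite E1; apply: Rint_ext => z _; case: (u z) => ? ? /=; ring.
  by apply: Rint_ext => z _; case: (v z) => ? ? /=; rewrite mulr0 subr0.
transitivity (\int[leb2]_(z in dom a) (complex.Im (v z) * phi z)).
  by rewrite E2; apply: Rint_ext => z _; case: (u z) => ? ? /=; ring.
by apply: Rint_ext => z _; case: (v z) => ? ? /=; rewrite mulr0 add0r.
Qed.

End planar_domain.

Section ae_comparison.
Context d (T : measurableType d) (R : realType) (mu : {measure set T -> \bar R}).
Implicit Types (D : set T) (f g : T -> R).

Lemma Rint_le_ae D f g : itg mu D f -> itg mu D g -> (forall x, D x -> 0 <= f x) ->
  (forall x, D x -> 0 <= g x) -> {ae mu, forall x, D x -> f x <= g x} ->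
  \int[mu]_(x in D) f x <= \int[mu]_(x in D) g x.
Proof.
move=> fi gi f0 g0 fg; rewrite -lee_fin !EFin_Rint//; have [mD _] := fi.
apply: ae_ge0_le_integral => //.
- by apply/measurable_EFinP; exact: itg_measurable fi.
- by apply/measurable_EFinP; exact: itg_measurable gi.
Qed.

Lemma itg_le_ae D f g : measurable_fun D f -> itg mu D g -> (forall x, D x -> 0 <= g x) ->
  {ae mu, forall x, D x -> `|f x| <= g x} -> itg mu D f.
Proof.
move=> mf gi g0 fg; have [mD /integrableP[mg ig]] := gi; split => //.
apply/integrableP; split; first exact/measurable_EFinP.
apply: le_lt_trans ig; apply: ae_ge0_le_integral => //.
- by apply/measurable_EFinP; exact: measurableT_comp mf.
- by apply: measurableT_comp mg.
- by apply: ae_imp fg => x H Dx; rewrite /= lee_fin (ger0_norm (g0 x Dx)) H.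
Qed.

Lemma ae_and (P Q S : T -> Prop) : {ae mu, forall x, P x -> Q x} ->
  {ae mu, forall x, P x -> S x} -> {ae mu, forall x, P x -> Q x /\ S x}.
Proof. by apply: ae_imp2 => x H H' Px; split; [exact: H|exact: H']. Qed.

Lemma itg_ae D f g : itg mu D f -> measurable_fun D g ->
  {ae mu, forall t, D t -> f t = g t} -> itg mu D g.
Proof.
move=> fi mg fg; apply: (itg_le_ae mg (itg_norm fi)) => //.
by apply: ae_imp fg => t H /H ->.
Qed.

Lemma Rint_ae_sum4 D f1 f2 f3 f4 g (c : R) : itg mu D f1 -> itg mu D f2 -> itg mu D f3 ->
  itg mu D f4 -> itg mu D g ->
  {ae mu, forall x, D x -> f1 x + f2 x + (f3 x + f4 x) = c * g x} ->
  \int[mu]_(x in D) f1 x + \int[mu]_(x in D) f2 x +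
  (\int[mu]_(x in D) f3 x + \int[mu]_(x in D) f4 x) = c * \int[mu]_(x in D) g x.
Proof.
move=> i1 i2 i3 i4 ig E.
rewrite -(RintD i1 i2) -(RintD i3 i4) -(RintD (itgD i1 i2) (itgD i3 i4)) -(RintZ c ig).
apply: Rint_ae E; first by have [] := i1.
- exact: itg_measurable (itgD (itgD i1 i2) (itgD i3 i4)).
- exact: itg_measurable (itgZ c ig).
Qed.

End ae_comparison.

(** Tonelli's theorem applies to the positive and negative parts separately, so measurability alone
    is enough. *)
Lemma measurable_Rint_slice d1 d2 (T1 : measurableType d1) (T2 : measurableType d2)
  (R : realType) (m2 : {sigma_finite_measure set T2 -> \bar R}) (f : T1 * T2 -> R) :
  measurable_fun setT f -> measurable_fun setT (fun x : T1 => \int[m2]_y f (x, y)).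
Proof.
move=> mf; apply: measurableT_comp => //.
have mE : measurable_fun setT (EFin \o f) by exact/measurable_EFinP.
have -> : (fun x : T1 => \int[m2]_y (f (x, y))%:E)%E =
    (fun x : T1 => \int[m2]_y ((EFin \o f)^\+ (x, y)) - \int[m2]_y ((EFin \o f)^\- (x, y)))%E.
  apply/funext => x; rewrite [LHS]integralE; congr (_ - _)%E; apply: eq_integral => y _;
    by rewrite ?funeposE ?funenegE.
apply: emeasurable_funB.
  change (measurable_fun setT (fubini_F m2 ((EFin \o f)^\+)%E)).
  apply: measurable_fun_fubini_tonelli_F => //; exact: measurable_funepos.
change (measurable_fun setT (fubini_F m2 ((EFin \o f)^\-)%E)).
apply: measurable_fun_fubini_tonelli_F => //; exact: measurable_funeneg.
Qed.

(** * Functions restricted to circles *)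

Section polar_slices.
Context {R : realType}.
Local Notation pt := (R * R)%type.
Local Notation leb := (@lebesgue_measure R).
Local Notation leb2 := (leb \x leb)%E.
Local Notation J := (`](- (pi / 2)), (3 * pi / 2)[%classic : set R).
Local Notation "'I[ a ,oo]" := (`]a, +oo[%classic : set R) (at level 0, format "''I[' a ,oo]").
Implicit Types (f g G H : pt -> R) (x z : pt) (n m : nat) (a s : R).

Section fixed_radius.
Variable a : R.
Hypothesis a0 : 0 <= a.
Local Notation D := (dom a).
Local Notation K := ('I[a,oo] `*` J).

Lemma polar_dom s th : a < s -> D (polar_map (s, th)).
Proof. by move=> as1; rewrite /dom/= nsq_polar// (le_trans a0 (ltW as1)). Qed.

Lemma measurable_patch g : measurable_fun D g -> measurable_fun setT (g \_ D).
Proof. exact: (measurable_restrictT g (measurable_dom a)).1. Qed.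

Let mK : measurable K.
Proof. by apply: measurableX; exact: measurable_itv. Qed.

Let polar_ge0 H : measurable_fun setT H -> (forall z, 0 <= H z) -> itg leb2 D H ->
  itg leb2 K (fun z => H (polar_map z)) /\
  \int[leb2]_(z in D) H z = 2^-1 * \int[leb2]_(z in K) H (polar_map z).
Proof.
move=> mH H0 iH; have mHP : measurable_fun setT (fun z : pt => H (polar_map z)).
  exact: (measurableT_comp mH (@measurable_polar_map R)).
have E : (\int[leb2]_(z in D) (H z)%:E =
    \int[leb2]_(z in K) (H (polar_map z) * 2^-1)%:E)%E.
  rewrite (ge0_polar a0 (F := EFin \o H)).
  - by apply: eq_integral => z _; rewrite EFinM.
  - exact/measurable_EFinP.
  - by move=> z; rewrite lee_fin.
have i1 : itg leb2 K (fun z => H (polar_map z) * 2^-1).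
  apply: itg_ge0P => //.
  - by apply: measurable_funTS; exact: measurable_funM.
  - by move=> z _; rewrite mulr_ge0.
  - by rewrite -E -EFin_Rint// ltry.
have i2 : itg leb2 K (fun z => H (polar_map z)).
  by apply: itg_ext (itgZ 2 i1) => z _; rewrite mulrC divfK.
split => //; apply/EFin_inj; rewrite -RintZ// EFin_Rint// E EFin_Rint; last exact: itgZ.
by apply: eq_integral => z _; rewrite mulrC.
Qed.

Let polarK G : itg leb2 D G ->
  itg leb2 K (fun z => G (polar_map z)) /\
  \int[leb2]_(z in D) G z = 2^-1 * \int[leb2]_(z in K) G (polar_map z).
Proof.
move=> iG; have mG1 := measurable_patch (itg_measurable iG); set G1 := G \_ D in mG1.
pose Gp z := Num.max (G1 z) 0; pose Gn z := Num.max (- G1 z) 0.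
have iG1 : itg leb2 D G1 by apply: itg_ext iG => z Dz; rewrite /G1 patchE mem_set.
have mGp : measurable_fun setT Gp by apply: measurable_maxr.
have mGn : measurable_fun setT Gn by apply: measurable_maxr => //; exact: measurableT_comp.
have p0 z : 0 <= Gp z by rewrite le_max lexx orbT.
have n0 z : 0 <= Gn z by rewrite le_max lexx orbT.
have iGp : itg leb2 D Gp.
  apply: (itg_le _ (itg_norm iG1)); first exact: measurable_funTS.
  by move=> z _; rewrite ger0_norm// ge_max ler_norm normr_ge0.
have iGn : itg leb2 D Gn.
  apply: (itg_le _ (itg_norm iG1)); first exact: measurable_funTS.
  by move=> z _; rewrite ger0_norm// ge_max -normrN ler_norm normr_ge0.
have [i1 E1] := polar_ge0 mGp p0 iGp; have [i2 E2] := polar_ge0 mGn n0 iGn.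
have GE z : G1 z = Gp z - Gn z.
  by rewrite /Gp /Gn; have [h|h] := leP (G1 z) 0;
    have [h'|h'] := leP (- G1 z) 0; lra.
have GK z : K z -> G (polar_map z) = Gp (polar_map z) - Gn (polar_map z).
  case: z => s th [/= + _]; rewrite in_itv/= andbT => as1.
  by rewrite -GE /G1 patchE mem_set//; exact: polar_dom.
split; first by apply: itg_ext (itgB i1 i2) => z Kz; rewrite GK.
transitivity (\int[leb2]_(z in D) (Gp z - Gn z)).
  by apply: Rint_ext => z Dz; rewrite -GE /G1 patchE mem_set.
rewrite RintB// E1 E2 -mulrBr -RintB//; congr (_ * _).
by apply: Rint_ext => z Kz; rewrite GK.
Qed.

Lemma polar_Rint G : itg leb2 D G ->
  [/\ itg leb 'I[a,oo] (fun s => \int[leb]_(th in J) G (polar_map (s, th))),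
      {ae leb, forall s, a < s -> itg leb J (fun th => G (polar_map (s, th)))} &
      \int[leb2]_(z in D) G z =
      2^-1 * \int[leb]_(s in 'I[a,oo]) \int[leb]_(th in J) G (polar_map (s, th))].
Proof.
move=> iG; have [iK E] := polarK iG.
have mI : measurable 'I[a,oo] by exact: measurable_itv.
have i1 := (itg_mkcond leb2 _ mK).1 iK.
have [H1 _ E1 _] := Rint_Fubini i1.
have [_ i1'] := i1.
have Eth s th : ((fun z => G (polar_map z)) \_ K) (s, th) =
    if s \in 'I[a,oo] then ((fun th => G (polar_map (s, th))) \_ J) th else 0.
  rewrite !patchE in_setX /=; case: (s \in _) => //=.
have Es s : \int[leb]_th ((fun z => G (polar_map z)) \_ K) (s, th) =
    ((fun s => \int[leb]_(th in J) G (polar_map (s, th))) \_ 'I[a,oo]) s.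
  rewrite patchE; have := Eth s; case: (s \in _) => {}Eth.
    by rewrite [RHS]Rintegral_mkcond; apply: Rint_ext => th _.
  by rewrite -[RHS](@Rint0 _ _ _ leb setT); apply: Rint_ext => th _.
split.
- by apply: (itg_mkcond leb _ mI).2; apply: itg_ext H1 => s _; exact: Es.
- have := ae_integrable1 i1'; apply: ae_imp => s is1 as1.
  apply: (itg_mkcond leb _ (@measurable_J R)).2; split => //.
  apply: eq_integrable is1 => // th _ /=; rewrite Eth mem_set//.
  by rewrite /= in_itv/= as1.
- rewrite E; congr (_ * _); rewrite Rintegral_mkcond E1 [RHS]Rintegral_mkcond.
  by apply: Rint_ext => s _; exact: Es.
Qed.

Definition sl g s : R -> R := fun th => g (polar_map (s, th)).

Definition L2r g := measurable_fun D g /\ itg leb2 D (fun z => g z ^+ 2).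

Lemma slice_measurable g s : measurable_fun D g -> a < s -> measurable_fun J (sl g s).
Proof.
move=> mg as1; have m1 := measurable_patch mg.
have : measurable_fun setT (fun th => (g \_ D) (polar_map (s, th))).
  apply: (measurableT_comp m1).
  exact: (measurableT_comp (@measurable_polar_map R) (pair1_measurable s)).
move=> /(@measurable_funTS _ _ _ _ J); apply: eq_measurable_fun => th _.
by rewrite patchE mem_set//; exact: polar_dom.
Qed.

Lemma itg_sqr_J (h : R -> R) : measurable_fun J h -> itg leb J (fun t => h t ^+ 2) -> itg leb J h.
Proof.
move=> mh ih; have i1 : itg leb J (fun=> 1 : R).
  by apply: continuous_integrable_J; exact: cst_continuous.
apply: (itg_le _ (itgD i1 ih)) => [|t _]; first exact: mh.
rewrite -[h t ^+ 2]real_normK ?num_real//.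
have := sqr_ge0 (`|h t| - 1 / 2); rewrite sqrrB; lra.
Qed.

Lemma slice_L2 g : L2r g -> {ae leb, forall s, a < s ->
  itg leb J (sl g s) /\ itg leb J (fun th => sl g s th ^+ 2)}.
Proof.
move=> [mg ig]; have [_ + _] := polar_Rint ig; apply: ae_imp => s H as1.
have i2 := H as1; split => //; apply: itg_sqr_J => //.
exact: slice_measurable.
Qed.

Lemma measurable_slint g (w : R -> R) : measurable_fun D g -> continuous w ->
  measurable_fun 'I[a,oo] (fun s => \int[leb]_(th in J) (sl g s th * w th)).
Proof.
move=> mg cw; have m1 := measurable_patch mg.
pose f (z : pt) := (g \_ D) (polar_map z) * (w \_ J) z.2.
have mw : measurable_fun setT (w \_ J).
  apply: (measurable_restrictT w (@measurable_J R)).1.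
  by apply: measurable_funTS; exact: continuous_measurable_fun.
have mf : measurable_fun setT f.
  apply: measurable_funM; first exact: (measurableT_comp m1 (@measurable_polar_map R)).
  exact: (measurableT_comp mw).
have := @measurable_funTS _ _ _ _ 'I[a,oo] _ (@measurable_Rint_slice _ _ _ _ _ leb _ mf).
apply: eq_measurable_fun => s /set_mem; rewrite /= in_itv/= andbT => as1.
rewrite [RHS]Rintegral_mkcond; apply: Rint_ext => th _.
have Dp : polar_map (s, th) \in D by apply/mem_set; exact: polar_dom.
by rewrite /f/= patchE Dp !patchE; case: ifP => _; rewrite ?mulr0.
Qed.

Lemma measurable_fcs g m : measurable_fun D g ->
  measurable_fun 'I[a,oo] (fun s => fc (sl g s) m) /\
  measurable_fun 'I[a,oo] (fun s => fs (sl g s) m).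
Proof.
by move=> mg; split; apply: measurable_slint => //; [exact: continuous_cosM|exact: continuous_sinM].
Qed.

Lemma measurable_fE g m : measurable_fun D g ->
  measurable_fun 'I[a,oo] (fun s => fE (sl g s) m).
Proof.
move=> mg; elim: m => [|m IH].
  rewrite (_ : (fun s => fE (sl g s) 0) = fun=> 0); first exact: measurable_cst.
  by apply/funext => s; rewrite /fE big_ord0.
rewrite (_ : (fun s => fE (sl g s) m.+1) = fun s => fE (sl g s) m +
    (wc m)^-1 * (fc (sl g s) m ^+ 2 + fs (sl g s) m ^+ 2)); last first.
  by apply/funext => s; rewrite /fE big_ord_recr.
apply: measurable_funD => //.
have [mc ms] := measurable_fcs m mg.
by apply: measurable_funM => //; apply: measurable_funD; exact: measurable_funX.
Qed.

Lemma fE_ge0 (h : R -> R) m : 0 <= fE h m.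
Proof.
by apply: sumr_ge0 => j _; rewrite mulr_ge0 ?invr_ge0 ?addr_ge0 ?sqr_ge0// ltW// wc_gt0.
Qed.

Lemma fE_homo (h : R -> R) : {homo fE h : m n / (m <= n)%N >-> m <= n}.
Proof.
move=> m n /subnKC <-; elim: (n - m)%N => [|k IH]; first by rewrite addn0.
rewrite addnS /fE big_ord_recr /=; apply: le_trans IH _; rewrite lerDl.
by rewrite mulr_ge0 ?invr_ge0 ?addr_ge0 ?sqr_ge0// ltW// wc_gt0.
Qed.

Lemma slice_bessel g m : L2r g -> {ae leb, forall s, a < s ->
  fE (sl g s) m <= \int[leb]_(th in J) (sl g s th ^+ 2)}.
Proof.
move=> Lg; have := slice_L2 Lg; apply: ae_imp => s H as1.
by have [i1 i2] := H as1; exact: bessel.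
Qed.

Lemma fE_term (h : R -> R) m : (wc m)^-1 * (fc h m ^+ 2 + fs h m ^+ 2) <= fE h m.+1.
Proof.
rewrite /fE big_ord_recr /= lerDr.
by apply: sumr_ge0 => j _; rewrite mulr_ge0 ?invr_ge0 ?addr_ge0 ?sqr_ge0// ltW// wc_gt0.
Qed.

Lemma itg_fE g m : L2r g -> itg leb 'I[a,oo] (fun s => fE (sl g s) m) /\
  \int[leb]_(s in 'I[a,oo]) fE (sl g s) m <= 2 * \int[leb2]_(z in D) (g z ^+ 2).
Proof.
move=> Lg; have [mg ig] := Lg; have [i1 _ E] := polar_Rint ig.
have sq0 s : 0 <= \int[leb]_(th in J) (g (polar_map (s, th)) ^+ 2).
  by apply: Rint_ge0 => th _; exact: sqr_ge0.
have B : {ae leb, forall s, 'I[a,oo] s ->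
    fE (sl g s) m <= \int[leb]_(th in J) (g (polar_map (s, th)) ^+ 2)}.
  have := slice_bessel m Lg; apply: ae_imp => s H; rewrite /= in_itv/= andbT; exact: H.
have i2 : itg leb 'I[a,oo] (fun s => fE (sl g s) m).
  apply: (itg_le_ae _ i1) => //; first exact: measurable_fE.
  by apply: ae_imp B => s H Is; rewrite ger0_norm ?fE_ge0// H.
split => //; rewrite E mulrA mulfV// mul1r.
by apply: Rint_le_ae => // s _; exact: fE_ge0.
Qed.

Lemma itg_fcs_sqr g m : L2r g -> itg leb 'I[a,oo] (fun s => fc (sl g s) m ^+ 2) /\
  itg leb 'I[a,oo] (fun s => fs (sl g s) m ^+ 2).
Proof.
move=> Lg; have [mg _] := Lg; have [mc ms] := measurable_fcs m mg.
have [i1 _] := itg_fE m.+1 Lg; have w0 := @wc_gt0 R m.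
have B s : fc (sl g s) m ^+ 2 + fs (sl g s) m ^+ 2 <= wc m * fE (sl g s) m.+1.
  by rewrite -ler_pdivrMl// fE_term.
have c0 s := sqr_ge0 (fc (sl g s) m); have s0 s := sqr_ge0 (fs (sl g s) m).
by split; (apply: (itg_le _ (itgZ (wc m) i1)); first exact: measurable_funX);
  move=> s _; rewrite ger0_norm//; have := B s; have := c0 s; have := s0 s; lra.
Qed.

Lemma itg_L2_loc1 (h : R -> R) : measurable_fun 'I[a,oo] h ->
  itg leb 'I[a,oo] (fun s => h s ^+ 2) -> loc1 a h.
Proof.
move=> mh ih T; have sub : `]a, T]%classic `<=` 'I[a,oo].
  by move=> x; rewrite /= !in_itv/= => /andP[->].
apply: (itg_le _ (itgD (itg_oc_cst a T 1) (itgS ih sub (measurable_oc a T)))).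
  by apply: measurable_funS mh => //; exact: measurable_itv.
move=> t _; rewrite -[h t ^+ 2]real_normK ?num_real//.
have := sqr_ge0 (`|h t| - 1 / 2); rewrite sqrrB; lra.
Qed.

(** The partial sums increase; Bessel's inequality bounds their limit from above and
    [bessel_parseval] from below. *)
Lemma fE_cvg (h : R -> R) : itg leb J h -> itg leb J (fun t => h t ^+ 2) ->
  fE h n @[n --> \oo] --> \int[leb]_(t in J) (h t ^+ 2).
Proof.
move=> ih ih2; set S := \int[leb]_(t in J) _.
have ub n : fE h n <= S by exact: bessel.
have cv : cvgn (fE h).
  apply: nondecreasing_is_cvgn; first exact: fE_homo.
  by exists S => _ [n _ <-].
have le n : fE h n <= limn (fE h).
  by apply: nondecreasing_cvgn_le => //; exact: fE_homo.
have : S <= limn (fE h).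
  by rewrite -lee_fin /S EFin_Rint//; apply/(bessel_parseval _ ih).
have : limn (fE h) <= S by apply: limr_le => //; exact: nearW.
by move=> h1 h2; rewrite (_ : S = limn (fE h))//; apply/eqP; rewrite eq_le h1 h2.
Qed.

(** A bound that is uniform in the number of modes passes to the full norms. Square roots are taken
    because [fatou_sqr] speaks of squares, and the final 1 / 2 is the Jacobian of polar
    coordinates. *)
Lemma parseval_le g h (C : R) : L2r g -> L2r h ->
  (forall n, \int[leb]_(s in 'I[a,oo]) (fE (sl g s) n + fE (sl h s) n) <= C) ->
  \int[leb2]_(z in D) (g z ^+ 2) + \int[leb2]_(z in D) (h z ^+ 2) <= C / 2.
Proof.
move=> Lg Lh HC; have [mg ig] := Lg; have [mh ih] := Lh.
have [i1 _ E1] := polar_Rint ig; have [i2 _ E2] := polar_Rint ih.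
have sq0 (f : pt -> R) s : 0 <= \int[leb]_(th in J) (f (polar_map (s, th)) ^+ 2).
  by apply: Rint_ge0 => th _; exact: sqr_ge0.
rewrite E1 E2 -mulrDr mulrC ler_wpM2r// -RintD//.
pose q s := Num.sqrt (\int[leb]_(th in J) (g (polar_map (s, th)) ^+ 2) +
                      \int[leb]_(th in J) (h (polar_map (s, th)) ^+ 2)).
pose p n s := Num.sqrt (fE (sl g s) n + fE (sl h s) n).
have mp n : measurable_fun 'I[a,oo] (p n).
  apply: (measurableT_comp (@measurable_sqrt R)).
  by apply: measurable_funD; exact: measurable_fE.
have mq : measurable_fun 'I[a,oo] q.
  apply: (measurableT_comp (@measurable_sqrt R)).
  by apply: measurable_funD; [exact: itg_measurable i1|exact: itg_measurable i2].
have := @fatou_sqr R 'I[a,oo] p q C (measurable_itv _) mp mq.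
rewrite -lee_fin EFin_Rint; last exact: itgD.
have -> : (\int[leb]_(s in 'I[a,oo]) (q s ^+ 2)%:E =
   \int[leb]_(s in 'I[a,oo]) (\int[leb]_(th in J) g (polar_map (s, th)) ^+ 2 +
                     \int[leb]_(th in J) h (polar_map (s, th)) ^+ 2)%:E)%E.
  by apply: eq_integral => s _; rewrite sqr_sqrtr// addr_ge0.
apply.
- have := slice_L2 Lg; have := slice_L2 Lh; apply: ae_imp2 => s H1 H2.
  rewrite /= in_itv/= andbT => as1; have [h1 h2] := H1 as1; have [g1 g2] := H2 as1.
  apply: continuous_cvg; first exact: sqrt_continuous.
  by apply: cvgD; exact: fE_cvg.
- move=> n; have [j1 _] := itg_fE n Lg; have [j2 _] := itg_fE n Lh.
  have := HC n; rewrite -lee_fin EFin_Rint; last exact: itgD.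
  apply: le_trans; apply: ge0_le_integral.
  + exact: measurable_itv.
  + by move=> s _; rewrite lee_fin sqr_ge0.
  + by apply/measurable_EFinP; apply: measurable_funX; exact: mp.
  + by apply/measurable_EFinP; exact: itg_measurable (itgD j1 j2).
  + by move=> s _; rewrite lee_fin sqr_sqrtr// addr_ge0// fE_ge0.
Qed.

End fixed_radius.
End polar_slices.

(** * Angular modes and lower bounds *)

Section modes.
Context {R : realType}.
Local Notation pt := (R * R)%type.
Local Notation leb := (@lebesgue_measure R).
Local Notation leb2 := (leb \x leb)%E.
Local Notation J := (`](- (pi / 2)), (3 * pi / 2)[%classic : set R).
Local Notation "'I[ a , T ]" := (`]a, T]%classic : set R) (at level 0, format "''I[' a ,  T ]").
Local Notation "'I[ a ,oo]" := (`]a, +oo[%classic : set R) (at level 0, format "''I[' a ,oo]").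
Implicit Types (f g h : pt -> R) (x z : pt) (n m : nat) (s : R).

Variables (a b : R).
Hypotheses (a0 : 0 < a).
Local Notation D := (dom a).
Let a0' : 0 <= a := ltW a0.

(** The components of a vector field along the unit radial vector and, for [ang], along the unit
    tangential vector. *)
Definition rad (p0 p1 : pt -> R) z := (z.1 * p0 z + z.2 * p1 z) / Num.sqrt (nsq z).
Definition ang (p0 p1 : pt -> R) z := (z.1 * p1 z - z.2 * p0 z) / Num.sqrt (nsq z).

Lemma rad_ang_sqr p0 p1 z : D z ->
  rad p0 p1 z ^+ 2 + ang p0 p1 z ^+ 2 = p0 z ^+ 2 + p1 z ^+ 2.
Proof.
rewrite /dom/= => az; have z0 : 0 < nsq z by exact: lt_trans az.
rewrite /rad /ang !expr_div_n sqr_sqrtr ?ltW// /nsq.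
by field; rewrite gt_eqF.
Qed.

Let m1 : measurable_fun setT (fun z : pt => z.1).
Proof. exact: (continuous_measurable2 (@continuous_coord R 0)). Qed.
Let m2 : measurable_fun setT (fun z : pt => z.2).
Proof. exact: (continuous_measurable2 (@continuous_coord R 1)). Qed.

Lemma measurable_rsqrt : measurable_fun setT (fun z : pt => (Num.sqrt (nsq z))^-1).
Proof.
apply: (measurableT_comp (@measurable_invr R)).
apply: (measurableT_comp (@measurable_sqrt R)).
exact: (continuous_measurable2 (@continuous_nsq R)).
Qed.

Lemma L2r_rad_ang p0 p1 : L2r a p0 -> L2r a p1 -> L2r a (rad p0 p1) /\ L2r a (ang p0 p1).
Proof.
move=> [mp0 i0] [mp1 i1].
have mr : measurable_fun D (rad p0 p1).
  apply: measurable_funM; last by apply: measurable_funTS; exact: measurable_rsqrt.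
  by apply: measurable_funD; apply: measurable_funM => //; apply: measurable_funTS.
have ma : measurable_fun D (ang p0 p1).
  apply: measurable_funM; last by apply: measurable_funTS; exact: measurable_rsqrt.
  by apply: measurable_funB; apply: measurable_funM => //; apply: measurable_funTS.
split; (split => //; apply: (itg_le _ (itgD i0 i1)); first exact: measurable_funX);
  move=> z Dz; rewrite ger0_norm ?sqr_ge0// -(rad_ang_sqr _ _ Dz).
  by rewrite lerDl sqr_ge0.
by rewrite lerDr sqr_ge0.
Qed.

Lemma itg_test2d g phi : L2r a g -> csupp phi -> itg leb2 D (fun z => g z * phi z).
Proof. by move=> [mg ig] cp; apply: itg_csupp => //; exact: measurable_dom. Qed.

Lemma continuous_vecpot j : continuous (@vecpot R j).
Proof.
move=> z; rewrite /vecpot; case: (j == 0).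
  apply: cvgM; last exact: cvg_cst.
  by apply: cvgN; exact: (@continuous_coord R 1).
by apply: cvgM; [exact: (@continuous_coord R 0)|exact: cvg_cst].
Qed.

Lemma rweak_csupp j u1 u2 phi : test_function D phi -> L2r a u1 -> L2r a u2 ->
  itg leb2 D (fun z => - (u2 z * pderiv j phi z) - b * vecpot j z * phi z * u1 z).
Proof.
move=> tp L1 L2; have [cp cd] := csupp_test tp.
apply: itgB; first by apply: itgN; apply: itg_test2d.
have := itgZ b (itg_test2d L1 (csuppM cp (@continuous_vecpot j))).
by apply: itg_ext => z _; ring.
Qed.

Lemma rweak_pair u1 u2 p0 p1 phi0 phi1 : L2r a u1 -> L2r a u2 -> L2r a p0 -> L2r a p1 ->
  rweak a b 0 u1 u2 p0 -> rweak a b 1 u1 u2 p1 ->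
  test_function D phi0 -> test_function D phi1 ->
  \int[leb2]_(z in D) (p0 z * phi0 z + p1 z * phi1 z) =
  \int[leb2]_(z in D) (- (u2 z * (pderiv 0 phi0 z + pderiv 1 phi1 z))
     - b / 2 * (z.1 * phi1 z - z.2 * phi0 z) * u1 z).
Proof.
move=> L1 L2 P0 P1 w0 w1 t0 t1.
have [c0 _] := csupp_test t0; have [c1 _] := csupp_test t1.
rewrite RintD; [|exact: itg_test2d|exact: itg_test2d].
rewrite (w0 _ t0) (w1 _ t1) -RintD; try exact: rweak_csupp.
by apply: Rint_ext => z _; rewrite /vecpot/=; field.
Qed.

(** Euler's identity for degree [m], and [gt] as the derivative of [g] under rotations. Together
    with smoothness this is all that testing with [zc m] and [zs m] requires. *)
Definition homog m g (gt : pt -> R) := [/\ forall n, sm2 n g, continuous gt & exists2 F, grad g F &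
  forall x, x.1 * F 0 x + x.2 * F 1 x = m%:R * g x /\ x.1 * F 1 x - x.2 * F 0 x = gt x].

Lemma homog_zc m : homog m (zc m) (fun x => - m%:R * zs m x).
Proof.
have mzc x : m%:R * (x.1 * zc m.-1 x - x.2 * zs m.-1 x) = m%:R * zc m x :> R.
  by case: m => [|m] //; rewrite !mul0r.
have mzs x : m%:R * (x.1 * zs m.-1 x + x.2 * zc m.-1 x) = m%:R * zs m x :> R.
  by case: m {mzc} => [|m] //; rewrite !mul0r.
split; first by move=> n; have [] := @sm2_zcs R m n.
  by move=> z; apply: cvgM; [exact: cvg_cst|have [_ s] := @sm2_zcs R m 0; exact: s].
exists (Czc m); first by have [] := @grad_zcs R m.
by move=> x; rewrite -mzc mulNr -mzs /Czc/=; split; ring.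
Qed.

Lemma homog_zs m : homog m (zs m) (fun x => m%:R * zc m x).
Proof.
have mzc x : m%:R * (x.1 * zc m.-1 x - x.2 * zs m.-1 x) = m%:R * zc m x :> R.
  by case: m => [|m] //; rewrite !mul0r.
have mzs x : m%:R * (x.1 * zs m.-1 x + x.2 * zc m.-1 x) = m%:R * zs m x :> R.
  by case: m {mzc} => [|m] //; rewrite !mul0r.
split; first by move=> n; have [] := @sm2_zcs R m n.
  by move=> z; apply: cvgM; [exact: cvg_cst|have [s _] := @sm2_zcs R m 0; exact: s].
exists (Czs m); first by have [] := @grad_zcs R m.
by move=> x; rewrite -mzc -mzs /Czs/=; split; ring.
Qed.

Section radial_angular.
Variables (u1 u2 p0 p1 : pt -> R).
Hypotheses (L1 : L2r a u1) (L2 : L2r a u2) (P0 : L2r a p0) (P1 : L2r a p1).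
Hypotheses (w0 : rweak a b 0 u1 u2 p0) (w1 : rweak a b 1 u1 u2 p1).

(** The test field is x g(x) [be] (|x|^2). Its divergence is computed by Euler's identity, and the
    vector potential drops out because it is tangential. *)
Lemma radial_weak m g (gt : pt -> R) (be be' : R -> R) : homog m g gt -> test1 a be ->
  (forall t : R, is_derive t (1 : R) be (be' t)) ->
  \int[leb2]_(z in D) ((z.1 * p0 z + z.2 * p1 z) * (g z * be (nsq z))) =
  \int[leb2]_(z in D) (- (u2 z * (g z * ((m%:R + 2) * be (nsq z) + 2 * nsq z * be' (nsq z))))).
Proof.
move=> [sg _ [F dF Fm]] tb db.
have tc j : test_function D (fun z => coord j z * g z * be (nsq z)).
  by apply: test2 => // n; apply: sm2M => //; exact: sm2_coord.
have dc j z : pderiv j (fun z => coord j z * g z * be (nsq z)) z =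
   (1 * g z + coord j z * F j z) * be (nsq z) + coord j z * g z * (2 * coord j z * be' (nsq z)).
  apply: pderivE; have H := pd_coord j j z; rewrite eqxx in H.
  exact: (pd_mul (pd_mul H (dF j z)) (pd_comp (pd_nsq j z) (db (nsq z)))).
have := rweak_pair L1 L2 P0 P1 w0 w1 (tc 0) (tc 1).
move=> H; transitivity (\int[leb2]_(z in D)
    (p0 z * (coord 0 z * g z * be (nsq z)) + p1 z * (coord 1 z * g z * be (nsq z)))).
  by apply: Rint_ext => z _; rewrite /coord/=; ring.
rewrite H; apply: Rint_ext => z _; rewrite !dc; have [E _] := Fm z.
rewrite /coord/= /nsq; rewrite /nsq in E *.
transitivity (- (u2 z * ((z.1 * F 0 z + z.2 * F 1 z + 2 * g z) * be (z.1 ^+ 2 + z.2 ^+ 2) +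
   2 * (z.1 ^+ 2 + z.2 ^+ 2) * g z * be' (z.1 ^+ 2 + z.2 ^+ 2)))); first by ring.
by rewrite E; ring.
Qed.

(** The test field is tangential. Its divergence differentiates [g] only, since [be] is constant on
    circles, and the potential contributes b |x|^2 / 2. *)
Lemma angular_weak m g (gt : pt -> R) (be : R -> R) : homog m g gt -> test1 a be ->
  \int[leb2]_(z in D) ((z.1 * p1 z - z.2 * p0 z) * (g z * be (nsq z))) =
  \int[leb2]_(z in D) (- (u2 z * (gt z * be (nsq z)))
     - b / 2 * (nsq z * (u1 z * (g z * be (nsq z))))).
Proof.
move=> [sg _ [F dF Fm]] tb; have [be' [_ db _]] := test1_derive tb.
have tc : test_function D (fun z => coord 0 z * g z * be (nsq z)).
  by apply: test2 => // n; apply: sm2M => //; exact: sm2_coord.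
have tn : test_function D (fun z => (-1 * coord 1 z) * g z * be (nsq z)).
  by apply: test2 => // n; apply: sm2M => //; apply: sm2Z; exact: sm2_coord.
have dc z : pderiv 1 (fun z => coord 0 z * g z * be (nsq z)) z =
   (0 * g z + coord 0 z * F 1 z) * be (nsq z) + coord 0 z * g z * (2 * coord 1 z * be' (nsq z)).
  apply: pderivE; have H := pd_coord 1 0 z.
  exact: (pd_mul (pd_mul H (dF 1 z)) (pd_comp (pd_nsq 1 z) (db (nsq z)))).
have dn z : pderiv 0 (fun z => (-1 * coord 1 z) * g z * be (nsq z)) z =
   ((0 * coord 1 z + -1 * 0) * g z + (-1 * coord 1 z) * F 0 z) * be (nsq z)
     + (-1 * coord 1 z) * g z * (2 * coord 0 z * be' (nsq z)).
  apply: pderivE; have H := pd_coord 0 1 z.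
  exact: (pd_mul (pd_mul (pd_mul (pd_cst 0 (-1) z) H) (dF 0 z)) (pd_comp (pd_nsq 0 z) (db (nsq z)))).
have H := rweak_pair L1 L2 P0 P1 w0 w1 tn tc.
transitivity (\int[leb2]_(z in D)
    (p0 z * (-1 * coord 1 z * g z * be (nsq z)) + p1 z * (coord 0 z * g z * be (nsq z)))).
  by apply: Rint_ext => z _; rewrite /coord/=; ring.
rewrite H; apply: Rint_ext => z _; rewrite dc dn; have [_ <-] := Fm z.
by rewrite /coord/= /nsq; ring.
Qed.

Definition pw s (k : R) := expR (k * ln s).

Lemma sqrt_pw s n : 0 < s -> Num.sqrt s ^+ n = pw s (n%:R / 2).
Proof.
move=> s0; have -> : Num.sqrt s = pw s (1 / 2).
  rewrite -[RHS]ger0_norm ?expR_ge0// -sqrtr_sqr; congr Num.sqrt.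
  rewrite /pw -expRM_natl mulrA (_ : 2%:R * (1 / 2) = 1) ?mul1r ?lnK//.
  by field.
by rewrite /pw -expRM_natl; congr expR; field.
Qed.

Lemma pwM s k l : pw s k * pw s l = pw s (k + l).
Proof. by rewrite /pw -expRD mulrDl. Qed.

Lemma pw0 s : pw s 0 = 1. Proof. by rewrite /pw mul0r expR0. Qed.

Lemma pw1 s : 0 < s -> pw s 1 = s. Proof. by move=> s0; rewrite /pw mul1r lnK. Qed.

Lemma pw_half s : 0 < s -> pw s (1 / 2) = Num.sqrt s.
Proof. by move=> s0; rewrite -(sqrt_pw 1 s0) expr1. Qed.

Lemma sqrt_pwM s n (k l x : R) : 0 < s -> n%:R / 2 + k = l ->
  Num.sqrt s ^+ n * (pw s k * x) = pw s l * x.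
Proof. by move=> s0 <-; rewrite mulrA (sqrt_pw n s0) pwM. Qed.

Definition wint h (v : R -> R) s := \int[leb]_(th in J) (sl h s th * v th).

Lemma csupp_be (k : pt -> R) (be : R -> R) : continuous k -> test1 a be ->
  csupp (fun z => k z * be (nsq z)).
Proof.
move=> ck tb; apply: csuppM ck.
have H : test_function D (fun z => 1 * be (nsq z)) by apply: test2 => // n; exact: sm2_cst.
have [+ _] := csupp_test H; by under eq_fun do rewrite mul1r.
Qed.

Lemma polar_weight m h k (v be : R -> R) : L2r a h -> continuous v -> measurable_fun setT be ->
  itg leb2 D (fun z => h z * (k z * be (nsq z))) ->
  (forall s th, k (polar_map (s, th)) = Num.sqrt s ^+ m * v th) ->
  \int[leb2]_(z in D) (h z * (k z * be (nsq z))) =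
  2^-1 * \int[leb]_(s in 'I[a,oo]) (wint h v s * (Num.sqrt s ^+ m * be s)) /\
  itg leb 'I[a,oo] (fun s => wint h v s * (Num.sqrt s ^+ m * be s)).
Proof.
move=> Lh cv mb ih kv; have [i1 _ E] := polar_Rint a0' ih.
have ae1 := slice_L2 a0' Lh.
have E1 s : a < s -> itg leb J (sl h s) ->
    \int[leb]_(th in J) (h (polar_map (s, th)) * (k (polar_map (s, th)) * be (nsq (polar_map (s, th))))) =
    wint h v s * (Num.sqrt s ^+ m * be s).
  move=> as1 is1; rewrite /wint [RHS]mulrC -RintZ; last exact: integrable_J_mul.
  apply: Rint_ext => th _; rewrite kv nsq_polar ?(ltW (lt_trans a0 as1))// /sl; ring.
have mE : {ae leb, forall s, 'I[a,oo] s ->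
    \int[leb]_(th in J) (h (polar_map (s, th)) * (k (polar_map (s, th)) * be (nsq (polar_map (s, th))))) =
    wint h v s * (Num.sqrt s ^+ m * be s)}.
  apply: ae_imp ae1 => s H; rewrite /= in_itv/= andbT => as1.
  by apply: E1 => //; have [] := H as1.
have ms : measurable_fun 'I[a,oo] (fun s => wint h v s * (Num.sqrt s ^+ m * be s)).
  have [mh _] := Lh; apply: measurable_funM; first exact: measurable_slint.
  apply: measurable_funTS; apply: measurable_funM.
    by apply: measurable_funX; exact: measurable_sqrt.
  exact: mb.
have i2 := itg_ae i1 ms mE.
split => //; rewrite E; congr (_ * _); apply: Rint_ae => //.
exact: itg_measurable i1.
Qed.

Lemma polar_w m h k (v be : R -> R) : L2r a h -> continuous v -> continuous k ->
  test1 a be -> (forall s th, k (polar_map (s, th)) = Num.sqrt s ^+ m * v th) ->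
  \int[leb2]_(z in D) (h z * (k z * be (nsq z))) =
  2^-1 * \int[leb]_(s in 'I[a,oo]) (wint h v s * (Num.sqrt s ^+ m * be s)) /\
  itg leb 'I[a,oo] (fun s => wint h v s * (Num.sqrt s ^+ m * be s)).
Proof.
move=> Lh cv ck tb kv; apply: polar_weight => //.
  by apply: continuous_measurable_fun; exact: test1_continuous tb.
exact: itg_test2d Lh (csupp_be ck tb).
Qed.

Section with_weight.
Variables (m : nat) (g gt : pt -> R) (w wt : R -> R).
Hypotheses (hg : homog m g gt).
Hypotheses (gw : forall s th, g (polar_map (s, th)) = Num.sqrt s ^+ m * w th).
Hypotheses (gtw : forall s th, gt (polar_map (s, th)) = Num.sqrt s ^+ m * wt th).
Hypotheses (cw : continuous w) (cwt : continuous wt).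

(** The weak derivative in s of a mode of [u2] is the corresponding mode of the radial momentum
    divided by 2 sqrt s. *)
Lemma mode_radial (eta eta' : R -> R) : test1 a eta -> (forall t : R, is_derive t (1 : R) eta (eta' t)) ->
  \int[leb]_(s in 'I[a,oo]) (wint u2 w s * eta' s) =
  - \int[leb]_(s in 'I[a,oo]) (wint (rad p0 p1) w s / (2 * Num.sqrt s) * eta s).
Proof.
move=> te de; have [sg cgt _] := hg; have cg := sm2_continuous (sg 0%N).
have [Lr _] := L2r_rad_ang P0 P1.
have te' : test1 a eta'.
  have [e' [te' de' _]] := test1_derive te.
  suff -> : eta' = e' by [].
  by apply/funext => t; have [_ <-] := de t; have [_ <-] := de' t.
(* With this exponent the undifferentiated term in [radial_weak] cancels: m + 2 + 2 k = 0. *)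
pose k : R := - (1 + m%:R / 2).
have tb : test1 a (fun t => pw t k * eta t) by exact: test1_pow.
have [be' [_ db _]] := test1_derive tb.
have beE t : 0 < t -> be' t = k / t * pw t k * eta t + pw t k * eta' t.
  move=> t0; have [_ <-] := db t.
  have [_ ->] := der_mul (der_expR (der_scale k (der_ln t0 (der_id t)))) (de t).
  by rewrite /pw; ring.
have H := radial_weak hg tb db.
have t2 : test1 a (fun t => pw t (- ((1 + m%:R) / 2)) * eta t) by exact: test1_pow.
have t3 : test1 a (fun t => pw t (- (m%:R / 2)) * eta' t) by exact: test1_pow.
have [E2 I2] := polar_w Lr cw cg t2 gw.
have [E3 I3] := polar_w L2 cw cg t3 gw.
have pos z : D z -> 0 < nsq z by exact: lt_trans.
have F2 : \int[leb2]_(z in D) ((z.1 * p0 z + z.2 * p1 z) * (g z * (pw (nsq z) k * eta (nsq z)))) =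
    \int[leb2]_(z in D) (rad p0 p1 z * (g z * (pw (nsq z) (- ((1 + m%:R) / 2)) * eta (nsq z)))).
  apply: Rint_ext => z /pos z0.
  have -> : pw (nsq z) (- ((1 + m%:R) / 2)) = Num.sqrt (nsq z) * pw (nsq z) k.
    by rewrite -[Num.sqrt _]expr1 sqrt_pw// pwM; congr pw; rewrite /k; field.
  have q0 : Num.sqrt (nsq z) != 0 by rewrite gt_eqF// sqrtr_gt0.
  by rewrite /rad; field; rewrite ?q0.
have F3 : \int[leb2]_(z in D) (- (u2 z * (g z * ((m%:R + 2) * (pw (nsq z) k * eta (nsq z)) + 2 * nsq z * be' (nsq z))))) =
    - (2 * \int[leb2]_(z in D) (u2 z * (g z * (pw (nsq z) (- (m%:R / 2)) * eta' (nsq z))))).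
  have i3 := itg_test2d L2 (csupp_be cg t3).
  rewrite -(RintZ 2 i3) -(RintN (itgZ 2 i3)).
  apply: Rint_ext => z /pos z0; rewrite (beE _ z0).
  have -> : pw (nsq z) (- (m%:R / 2)) = nsq z * pw (nsq z) k.
    have {2}-> : nsq z = pw (nsq z) 1 by rewrite /pw mul1r lnK.
    by rewrite pwM; congr pw; rewrite /k; field.
  by rewrite /k; field; rewrite gt_eqF.
have sqE s : 'I[a,oo] s -> Num.sqrt s ^+ m * (pw s (- ((1 + m%:R) / 2)) * eta s) = (Num.sqrt s)^-1 * eta s.
  rewrite /= in_itv/= andbT => as1; have s0 : 0 < s := lt_trans a0 as1.
  rewrite (sqrt_pwM (l := - (1 / 2)) _ s0); last by field.
  by rewrite -(pw_half s0) /pw -expRN mulNr.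
have sqE' s : 'I[a,oo] s -> Num.sqrt s ^+ m * (pw s (- (m%:R / 2)) * eta' s) = eta' s.
  rewrite /= in_itv/= andbT => as1; have s0 : 0 < s := lt_trans a0 as1.
  by rewrite (sqrt_pwM _ s0 (subrr _)) pw0 mul1r.
rewrite F2 F3 E2 E3 in H.
have E4 : \int[leb]_(s in 'I[a,oo]) (wint u2 w s * (Num.sqrt s ^+ m * (pw s (- (m%:R / 2)) * eta' s))) =
    \int[leb]_(s in 'I[a,oo]) (wint u2 w s * eta' s).
  by apply: Rint_ext => s Is; rewrite sqE'.
have E5 : 2^-1 * \int[leb]_(s in 'I[a,oo]) (wint (rad p0 p1) w s * (Num.sqrt s ^+ m * (pw s (- ((1 + m%:R) / 2)) * eta s))) =
    \int[leb]_(s in 'I[a,oo]) (wint (rad p0 p1) w s / (2 * Num.sqrt s) * eta s).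
  rewrite -(RintZ _ I2); apply: Rint_ext => s Is; rewrite (sqE s Is) invfM.
  by move: (wint _ _ _) (Num.sqrt s)^-1 (eta s) => X Y Z; ring.
by rewrite E4 E5 in H; rewrite H; field.
Qed.

Hypotheses (lw : forall h, L2r a h -> loc1 a (wint h w)) (lwt : forall h, L2r a h -> loc1 a (wint h wt)).

(** No derivative falls on the modes here, so the weak identity becomes an almost everywhere one by
    [dbr0]. *)
Lemma mode_angular : {ae leb, forall s, a < s ->
  Num.sqrt s * wint (ang p0 p1) w s = - wint u2 wt s - b / 2 * (s * wint u1 w s)}.
Proof.
have [sg cgt _] := hg; have cg := sm2_continuous (sg 0%N).
have [_ La] := L2r_rad_ang P0 P1.
pose f s := wint (ang p0 p1) w s * Num.sqrt s + wint u2 wt s + b / 2 * (wint u1 w s * s).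
have lf : loc1 a f.
  move=> T; apply: itgD; last by apply: itgZ; apply: loc1_continuousM; [exact: lw|move=> x; exact: cvg_id].
  apply: itgD; last exact: lwt.
  by apply: loc1_continuousM; [exact: lw|exact: sqrt_continuous].
have := dbr0 lf; move=> H; apply: ae_imp (H _) => [s Hs as1|eta te].
  have := Hs as1; rewrite /f => E.
  have -> : Num.sqrt s * wint (ang p0 p1) w s = wint (ang p0 p1) w s * Num.sqrt s + wint u2 wt s
    + b / 2 * (wint u1 w s * s) - wint u2 wt s - b / 2 * (s * wint u1 w s) by ring.
  by rewrite E; ring.
(* The exponent [- m / 2] cancels the growth of the homogeneous factor on circles; [t1] and [t2]
   carry the additional factors sqrt s and s. *)
have tb : test1 a (fun t => pw t (- (m%:R / 2)) * eta t) by exact: test1_pow.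
have t1 : test1 a (fun t => pw t ((1 - m%:R) / 2) * eta t) by exact: test1_pow.
have t2 : test1 a (fun t => pw t (1 - m%:R / 2) * eta t) by exact: test1_pow.
have K := angular_weak hg tb.
have [E1 I1] := polar_w La cw cg t1 gw.
have [E2 I2] := polar_w L2 cwt cgt tb gtw.
have [E3 I3] := polar_w L1 cw cg t2 gw.
have pos z : D z -> 0 < nsq z by exact: lt_trans.
have F1 : \int[leb2]_(z in D) ((z.1 * p1 z - z.2 * p0 z) * (g z * (pw (nsq z) (- (m%:R / 2)) * eta (nsq z)))) =
    \int[leb2]_(z in D) (ang p0 p1 z * (g z * (pw (nsq z) ((1 - m%:R) / 2) * eta (nsq z)))).
  apply: Rint_ext => z /pos z0.
  have -> : pw (nsq z) ((1 - m%:R) / 2) = Num.sqrt (nsq z) * pw (nsq z) (- (m%:R / 2)).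
    by rewrite -[Num.sqrt _]expr1 sqrt_pw// pwM; congr pw; field.
  by rewrite /ang; field; rewrite gt_eqF// sqrtr_gt0.
have F2 : \int[leb2]_(z in D) (- (u2 z * (gt z * (pw (nsq z) (- (m%:R / 2)) * eta (nsq z))))
     - b / 2 * (nsq z * (u1 z * (g z * (pw (nsq z) (- (m%:R / 2)) * eta (nsq z)))))) =
    (- \int[leb2]_(z in D) (u2 z * (gt z * (pw (nsq z) (- (m%:R / 2)) * eta (nsq z)))))
    - b / 2 * \int[leb2]_(z in D) (u1 z * (g z * (pw (nsq z) (1 - m%:R / 2) * eta (nsq z)))).
  have i2 := itg_test2d L2 (csupp_be cgt tb).
  have i3 := itg_test2d L1 (csupp_be cg t2).
  rewrite -(RintZ _ i3) -(RintN i2) -(RintB (itgN i2) (itgZ _ i3)).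
  apply: Rint_ext => z /pos z0.
  have -> : pw (nsq z) (1 - m%:R / 2) = nsq z * pw (nsq z) (- (m%:R / 2)).
    have {2}-> : nsq z = pw (nsq z) 1 by rewrite /pw mul1r lnK.
    by rewrite pwM.
  by ring.
rewrite F1 F2 E1 E2 E3 in K.
have sqE s : 'I[a,oo] s -> [/\ Num.sqrt s ^+ m * (pw s ((1 - m%:R) / 2) * eta s) = Num.sqrt s * eta s,
   Num.sqrt s ^+ m * (pw s (- (m%:R / 2)) * eta s) = eta s &
   Num.sqrt s ^+ m * (pw s (1 - m%:R / 2) * eta s) = s * eta s].
  rewrite /= in_itv/= andbT => as1; have s0 : 0 < s := lt_trans a0 as1.
  split; first by rewrite -[in RHS](pw_half s0); apply: (sqrt_pwM _ s0); field.
    by rewrite (sqrt_pwM _ s0 (subrr _)) pw0 mul1r.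
  by rewrite (sqrt_pwM (l := 1) _ s0); [rewrite (pw1 s0)|ring].
transitivity (\int[leb]_(s in 'I[a,oo]) (wint (ang p0 p1) w s * (Num.sqrt s ^+ m * (pw s ((1 - m%:R) / 2) * eta s))
   + wint u2 wt s * (Num.sqrt s ^+ m * (pw s (- (m%:R / 2)) * eta s))
   + b / 2 * (wint u1 w s * (Num.sqrt s ^+ m * (pw s (1 - m%:R / 2) * eta s))))).
  by apply: Rint_ext => s /sqE[-> -> ->]; rewrite /f; ring.
rewrite (RintD (itgD I1 I2) (itgZ _ I3)) (RintD I1 I2) (RintZ _ I3).
move: K; set A1 := Rintegral _ _ _; set A2 := Rintegral _ _ _; set A3 := Rintegral _ _ _.
move: A1 A2 A3 => A1 A2 A3 K.
have -> : A1 + A2 + b / 2 * A3 = 2 * (2^-1 * A1 + 2^-1 * A2 + b / 2 * (2^-1 * A3)) by field.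
by rewrite K; ring.
Qed.

End with_weight.

Lemma fcs_loc1 h m : L2r a h -> loc1 a (fun s => fc (sl h s) m) /\ loc1 a (fun s => fs (sl h s) m).
Proof.
move=> Lh; have [mh _] := Lh; have [mc ms] := measurable_fcs a0' m mh.
have [ic is1] := itg_fcs_sqr a0' m Lh.
by split; exact: itg_L2_loc1.
Qed.

Lemma mode_cos m :
  (forall eta eta' : R -> R, test1 a eta -> (forall t : R, is_derive t (1 : R) eta (eta' t)) ->
    \int[leb]_(s in 'I[a,oo]) (fc (sl u2 s) m * eta' s) =
    - \int[leb]_(s in 'I[a,oo]) (fc (sl (rad p0 p1) s) m / (2 * Num.sqrt s) * eta s)) /\
  {ae leb, forall s, a < s -> Num.sqrt s * fc (sl (ang p0 p1) s) m =
    m%:R * fs (sl u2 s) m - b / 2 * (s * fc (sl u1 s) m)}.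
Proof.
have cw := @continuous_cosM R m%:R.
have cwt : continuous (fun th : R => - m%:R * sin (m%:R * th)).
  by move=> t; apply: cvgM; [exact: cvg_cst|exact: continuous_sinM].
have wtE h s : itg leb J (sl h s) -> \int[leb]_(th in J) (sl h s th * (- m%:R * sin (m%:R * th))) = - m%:R * fs (sl h s) m.
  move=> ih; rewrite /fs -RintZ; last by apply: integrable_J_mul => //; exact: continuous_sinM.
  by apply: Rint_ext => th _; ring.
have gw s th : zc m (polar_map (s, th)) = Num.sqrt s ^+ m * cos (m%:R * th) by have [] := zcs_polar m s th.
have gtw s th : - m%:R * zs m (polar_map (s, th)) = Num.sqrt s ^+ m * (- m%:R * sin (m%:R * th)).
  by have [_ ->] := zcs_polar m s th; ring.
have lwt h : L2r a h -> loc1 a (fun s => \int[leb]_(th in J) (sl h s th * (- m%:R * sin (m%:R * th)))).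
  move=> Lh T; have [_ ls] := fcs_loc1 m Lh; have [mh _] := Lh.
  apply: (itg_ae (itgZ (- m%:R) (ls T))).
    by apply: measurable_funS (measurable_slint a0' mh cwt) => // x;
      rewrite /= !in_itv/= => /andP[->].
  have := slice_L2 a0' Lh; apply: ae_imp => s H; rewrite /= in_itv/= => /andP[as1 _].
  by rewrite wtE//; have [] := H as1.
split; first by move=> eta eta' te de; exact: (mode_radial (homog_zc m) gw cw te de).
have := mode_angular (homog_zc m) gw gtw cw cwt (fun h Lh => proj1 (fcs_loc1 m Lh)) lwt.
have := slice_L2 a0' L2; apply: ae_imp2 => s H1 H2 as1.
have [i2 _] := H1 as1; have := H2 as1; rewrite /wint wtE// => E.
by rewrite /fc E /fc mulNr opprK.
Qed.

Lemma mode_sin m :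
  (forall eta eta' : R -> R, test1 a eta -> (forall t : R, is_derive t (1 : R) eta (eta' t)) ->
    \int[leb]_(s in 'I[a,oo]) (fs (sl u2 s) m * eta' s) =
    - \int[leb]_(s in 'I[a,oo]) (fs (sl (rad p0 p1) s) m / (2 * Num.sqrt s) * eta s)) /\
  {ae leb, forall s, a < s -> Num.sqrt s * fs (sl (ang p0 p1) s) m =
    - (m%:R * fc (sl u2 s) m) - b / 2 * (s * fs (sl u1 s) m)}.
Proof.
have cw := @continuous_sinM R m%:R.
have cwt : continuous (fun th : R => m%:R * cos (m%:R * th)).
  by move=> t; apply: cvgM; [exact: cvg_cst|exact: continuous_cosM].
have wtE h s : itg leb J (sl h s) -> \int[leb]_(th in J) (sl h s th * (m%:R * cos (m%:R * th))) = m%:R * fc (sl h s) m.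
  move=> ih; rewrite /fc -RintZ; last by apply: integrable_J_mul => //; exact: continuous_cosM.
  by apply: Rint_ext => th _; ring.
have gw s th : zs m (polar_map (s, th)) = Num.sqrt s ^+ m * sin (m%:R * th) by have [] := zcs_polar m s th.
have gtw s th : m%:R * zc m (polar_map (s, th)) = Num.sqrt s ^+ m * (m%:R * cos (m%:R * th)).
  by have [-> _] := zcs_polar m s th; ring.
have lwt h : L2r a h -> loc1 a (fun s => \int[leb]_(th in J) (sl h s th * (m%:R * cos (m%:R * th)))).
  move=> Lh T; have [lc _] := fcs_loc1 m Lh; have [mh _] := Lh.
  apply: (itg_ae (itgZ m%:R (lc T))).
    by apply: measurable_funS (measurable_slint a0' mh cwt) => // x;
      rewrite /= !in_itv/= => /andP[->].
  have := slice_L2 a0' Lh; apply: ae_imp => s H; rewrite /= in_itv/= => /andP[as1 _].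
  by rewrite wtE//; have [] := H as1.
split; first by move=> eta eta' te de; exact: (mode_radial (homog_zs m) gw cw te de).
have := mode_angular (homog_zs m) gw gtw cw cwt (fun h Lh => proj2 (fcs_loc1 m Lh)) lwt.
have := slice_L2 a0' L2; apply: ae_imp2 => s H1 H2 as1.
by have [i2 _] := H1 as1; have := H2 as1; rewrite /wint wtE.
Qed.

End radial_angular.

(** The form domain in real terms: [p0], [p1] and [q0], [q1] are the real and imaginary parts of the
    momentum of [u1] + i [u2]. *)
Definition mom (u1 u2 p0 p1 q0 q1 : pt -> R) :=
  [/\ L2r a u1, L2r a u2, [/\ L2r a p0, L2r a p1, L2r a q0 & L2r a q1],
      rweak a b 0 u1 u2 p0 /\ rweak a b 1 u1 u2 p1 &
      rweak a b 0 u2 (fun z => - u1 z) q0 /\ rweak a b 1 u2 (fun z => - u1 z) q1].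

Lemma L2rN h : L2r a h -> L2r a (fun z => - h z).
Proof.
move=> [mh ih]; split; first exact: measurableT_comp mh.
by apply: itg_ext ih => z _; rewrite sqrrN.
Qed.

Lemma rweakN j u1 u2 p : L2r a u1 -> L2r a u2 -> L2r a p -> rweak a b j u1 u2 p ->
  rweak a b j (fun z => - u1 z) (fun z => - u2 z) (fun z => - p z).
Proof.
move=> L1 L2 Lp w phi tp; have [cp _] := csupp_test tp.
transitivity (- \int[leb2]_(z in D) (p z * phi z)).
  rewrite -RintN; last exact: itg_test2d.
  by apply: Rint_ext => z _; rewrite mulNr.
rewrite (w _ tp) -RintN; last exact: rweak_csupp.
by apply: Rint_ext => z _; ring.
Qed.

(* Multiplication of [u] by [- i]. *)
Lemma mom_rot u1 u2 p0 p1 q0 q1 : mom u1 u2 p0 p1 q0 q1 ->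
  mom u2 (fun z => - u1 z) q0 q1 (fun z => - p0 z) (fun z => - p1 z).
Proof.
move=> [L1 L2 [P0 P1 Q0 Q1] [w0 w1] [v0 v1]]; split => //; first exact: L2rN.
  by split => //; exact: L2rN.
by split; exact: rweakN.
Qed.

End modes.

(** * Comparison of each mode with its one-dimensional energy, and summation over the modes *)

Section lower_bound.
Context {R : realType}.
Local Notation pt := (R * R)%type.
Local Notation leb := (@lebesgue_measure R).
Local Notation leb2 := (leb \x leb)%E.
Local Notation J := (`](- (pi / 2)), (3 * pi / 2)[%classic : set R).
Local Notation "'I[ a , T ]" := (`]a, T]%classic : set R) (at level 0, format "''I[' a ,  T ]").
Local Notation "'I[ a ,oo]" := (`]a, +oo[%classic : set R) (at level 0, format "''I[' a ,oo]").
Implicit Types (g h : pt -> R) (z : pt) (n m : nat) (s : R).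

Lemma measurable_y (a : R) (f : R -> R) : (forall T, measurable_fun 'I[a, T] f) ->
  measurable_fun 'I[a,oo] f.
Proof.
move=> mf; have -> : 'I[a,oo] = \bigcup_n 'I[a, n%:R].
  apply/seteqP; split => [x|x [n _]]; rewrite /= !in_itv/= ?andbT.
    move=> ax; exists (Num.bound `|x|) => //; rewrite /= in_itv/= ax/=.
    by rewrite (le_trans (ler_norm x))// ltW// archi_boundP.
  by move=> /andP[].
by apply/measurable_fun_bigcup => [n|n]; [exact: measurable_itv|exact: mf].
Qed.

Lemma sum4_le (x1 x2 x3 x4 y1 y2 y3 y4 : R) : x1 <= 2 * y1 -> x2 <= 2 * y2 ->
  x3 <= 2 * y3 -> x4 <= 2 * y4 -> x1 + x2 + x3 + x4 <= 2 * (y1 + y3 + (y2 + y4)).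
Proof. by lra. Qed.

Lemma sum4_scale (B x1 x2 x3 x4 y1 y2 y3 y4 X Y : R) : B * x1 <= y1 -> B * x2 <= y2 ->
  B * x3 <= y3 -> B * x4 <= y4 -> x1 + x2 + (x3 + x4) = 2 * X -> y1 + y2 + (y3 + y4) = 2 * Y ->
  B * X <= Y.
Proof.
move=> H1 H2 H3 H4 EX EY; rewrite -(ler_pM2l (ltr0Sn R 1)) -EY mulrCA -EX !mulrDr.
by apply: lerD; apply: lerD.
Qed.

Lemma itg_sqrD (D : set R) (f g : R -> R) : measurable_fun D f -> measurable_fun D g ->
  itg leb D (fun x => f x ^+ 2) -> itg leb D (fun x => g x ^+ 2) ->
  itg leb D (fun x => (f x + g x) ^+ 2).
Proof.
move=> mf mg i1 i2; apply: (itg_le _ (itgZ 2 (itgD i1 i2))).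
  by apply: measurable_funX; exact: measurable_funD.
move=> x _; rewrite ger0_norm ?sqr_ge0//.
have := sqr_ge0 (f x - g x); rewrite sqrrB sqrrD; lra.
Qed.

Variables (a b : R).
Hypotheses (a0 : 0 < a).
Local Notation D := (dom a).
Let a0' : 0 <= a := ltW a0.

Lemma fcsN_ae h m : L2r a h -> {ae leb, forall s, a < s ->
  fc (sl (fun z => - h z) s) m = - fc (sl h s) m /\
  fs (sl (fun z => - h z) s) m = - fs (sl h s) m}.
Proof.
move=> Lh; have := slice_L2 a0' Lh; apply: ae_imp => s H as1; have [ih _] := H as1.
split; rewrite /fc /fs -RintN; try (by apply: Rint_ext => t _; rewrite /sl mulNr).
  by apply: integrable_J_mul => //; exact: continuous_cosM.
by apply: integrable_J_mul => //; exact: continuous_sinM.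
Qed.

Lemma radN (p0 p1 : pt -> R) : rad (fun z => - p0 z) (fun z => - p1 z) = (fun z => - rad p0 p1 z).
Proof. by apply/funext => z; rewrite /rad !mulrN -opprD mulNr. Qed.

Lemma angN (p0 p1 : pt -> R) : ang (fun z => - p0 z) (fun z => - p1 z) = (fun z => - ang p0 p1 z).
Proof. by apply/funext => z; rewrite /ang !mulrN -opprD mulNr. Qed.

Lemma loc1_div_sqrt (h : R -> R) : loc1 a h -> loc1 a (fun s => h s / (2 * Num.sqrt s)).
Proof.
move=> lh T; apply: (itg_bounded (M := (2 * Num.sqrt a)^-1) (lh T)).
  apply: measurable_funTS; apply: (measurableT_comp (@measurable_invr R)).
  by apply: measurable_funM => //; exact: measurable_sqrt.
move=> x; rewrite /= in_itv/= => /andP[ax _].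
have x0 := lt_trans a0 ax.
have sa : 0 < Num.sqrt a by rewrite sqrtr_gt0.
have sx : 0 < Num.sqrt x by rewrite sqrtr_gt0.
rewrite ger0_norm ?invr_ge0 ?mulr_ge0 ?(ltW sx)//.
by rewrite lef_pV2 ?posrE ?mulr_gt0// ler_wpM2l// ler_wsqrtr// ltW.
Qed.

Let sqI (h : R -> R) : measurable_fun 'I[a,oo] h -> measurable_fun 'I[a,oo] (fun s => h s ^+ 2).
Proof. by move=> mh; apply: measurable_funX. Qed.

(* For [e = 1], resp. [e = -1], the real part of the coefficient of [u] at the
   angular momentum [m], resp. [- m]. *)
Definition mode_fun (e : R) m (u1 u2 : pt -> R) s := fc (sl u1 s) m + e * fs (sl u2 s) m.

(** The energy of the same mode, read from the momentum. The radial momentum is - i times the radial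
    derivative, so the real part of that derivative comes from - q and the imaginary part from p;
    this explains the signs in the first square. *)
Definition mode_dens (e : R) m (p0 p1 q0 q1 : pt -> R) s :=
  (- fc (sl (rad q0 q1) s) m + e * fs (sl (rad p0 p1) s) m) ^+ 2 +
  (fc (sl (ang p0 p1) s) m + e * fs (sl (ang q0 q1) s) m) ^+ 2.

Section one_mode_plane.
Variables (u1 u2 p0 p1 q0 q1 : pt -> R).
Hypothesis (mu : mom a b u1 u2 p0 p1 q0 q1).

Lemma mode_fun_props e m : [/\ measurable_fun 'I[a,oo] (mode_fun e m u1 u2),
   itg leb 'I[a,oo] (fun s => mode_fun e m u1 u2 s ^+ 2) &
   itg leb 'I[a,oo] (mode_dens e m p0 p1 q0 q1)].
Proof.
have [L1 L2 [P0 P1 Q0 Q1] _ _] := mu.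
have [X1 Y1] := L2r_rad_ang a0 P0 P1; have [X2 Y2] := L2r_rad_ang a0 Q0 Q1.
have M h : L2r a h -> [/\ measurable_fun 'I[a,oo] (fun s => fc (sl h s) m),
   measurable_fun 'I[a,oo] (fun s => fs (sl h s) m),
   itg leb 'I[a,oo] (fun s => fc (sl h s) m ^+ 2) &
   itg leb 'I[a,oo] (fun s => fs (sl h s) m ^+ 2)].
  move=> Lh; have [mh _] := Lh; have [mc ms] := measurable_fcs a0' m mh.
  by have [ic is1] := itg_fcs_sqr a0' m Lh.
have comb h k (e1 e2 : R) : L2r a h -> L2r a k ->
    measurable_fun 'I[a,oo] (fun s => e1 * fc (sl h s) m + e2 * fs (sl k s) m) /\
    itg leb 'I[a,oo] (fun s => (e1 * fc (sl h s) m + e2 * fs (sl k s) m) ^+ 2).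
  move=> /M[mc _ ic _] /M[_ ms _ is1]; split.
    by apply: measurable_funD; apply: measurable_funM.
  apply: itg_sqrD; try exact: measurable_funM.
    by apply: itg_ext (itgZ (e1 ^+ 2) ic) => s _; rewrite exprMn.
  by apply: itg_ext (itgZ (e2 ^+ 2) is1) => s _; rewrite exprMn.
have [m1 i1] := comb _ _ 1 e L1 L2.
have [_ i2] := comb _ _ (-1) e X2 X1.
have [_ i3] := comb _ _ 1 e Y1 Y2.
split.
- by apply: eq_measurable_fun m1 => s _; rewrite /mode_fun mul1r.
- by apply: itg_ext i1 => s _; rewrite /mode_fun mul1r.
- by apply: itg_ext (itgD i2 i3) => s _; rewrite /mode_dens mul1r mulN1r.
Qed.

(** The mode function is replaced by its absolutely continuous representative, for which [mode_dens]
    coincides almost everywhere with [edens]; a one-dimensional inequality then transfers. *)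
Lemma mode_bound e m (B : R) : e ^+ 2 = 1 ->
  (forall F p, ac a F p -> itg leb 'I[a,oo] (fun s => F s ^+ 2) ->
     itg leb 'I[a,oo] (edens b (e * m%:R) F p) ->
     {ae leb, forall s, a < s -> mode_fun e m u1 u2 s = F s} ->
     B * \int[leb]_(s in 'I[a,oo]) (F s ^+ 2) <= \int[leb]_(s in 'I[a,oo]) edens b (e * m%:R) F p s) ->
  B * \int[leb]_(s in 'I[a,oo]) (mode_fun e m u1 u2 s ^+ 2) <=
    \int[leb]_(s in 'I[a,oo]) mode_dens e m p0 p1 q0 q1 s.
Proof.
move=> e1 HB; have [L1 L2 [P0 P1 Q0 Q1] [w0 w1] [v0 v1]] := mu.
have [X1 Y1] := L2r_rad_ang a0 P0 P1; have [X2 Y2] := L2r_rad_ang a0 Q0 Q1.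
have [mf if2 ie] := mode_fun_props e m.
have LN1 := L2rN L1.
pose p s := (- fc (sl (rad q0 q1) s) m + e * fs (sl (rad p0 p1) s) m) / (2 * Num.sqrt s).
have [lX2 _] := fcs_loc1 a0 m X2; have [_ lX1] := fcs_loc1 a0 m X1.
have [l1 _] := fcs_loc1 a0 m L1; have [_ l2] := fcs_loc1 a0 m L2.
have [lN1 _] := fcs_loc1 a0 m LN1.
have lf : loc1 a (mode_fun e m u1 u2).
  by move=> T; apply: itgD; [exact: l1|apply: itgZ; exact: l2].
have lp : loc1 a p.
  apply: loc1_div_sqrt => T; apply: itgD; first by apply: itgN; exact: lX2.
  by apply: itgZ; exact: lX1.
(* Each radial identity differentiates the second component of its pair. The sine coefficient of
   [u2] thus comes from the pair [u1], [u2], and the cosine coefficient of [u1], up to sign, from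
   the rotated pair [u2], [- u1]. *)
have [S1 S2] := mode_sin a0 L1 L2 P0 P1 w0 w1 m.
have [C1 C2] := mode_cos a0 L1 L2 P0 P1 w0 w1 m.
have [S3 S4] := mode_sin a0 L2 LN1 Q0 Q1 v0 v1 m.
have [C3 C4] := mode_cos a0 L2 LN1 Q0 Q1 v0 v1 m.
have aeN := fcsN_ae m L1.
have wd eta eta' : test1 a eta -> (forall x : R, is_derive x (1 : R) eta (eta' x)) ->
    \int[leb]_(x in 'I[a,oo]) (mode_fun e m u1 u2 x * eta' x) = - \int[leb]_(x in 'I[a,oo]) (p x * eta x).
  move=> te de; have te' : test1 a eta'.
    have [e' [te' de' _]] := test1_derive te.
    suff -> : eta' = e' by [].
    by apply/funext => t; have [_ <-] := de t; have [_ <-] := de' t.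
  have j1 := itg_test l1 te'; have j2 := itg_test l2 te'; have j3 := itg_test lN1 te'.
  have N1 : \int[leb]_(s in 'I[a,oo]) (fc (sl (fun z => - u1 z) s) m * eta' s) =
      - \int[leb]_(s in 'I[a,oo]) (fc (sl u1 s) m * eta' s).
    rewrite -RintN//; apply: Rint_ae.
    - by have [] := j3.
    - exact: itg_measurable j3.
    - exact: itg_measurable (itgN j1).
    - apply: ae_imp aeN => s H; rewrite /= in_itv/= andbT => as1.
      by have [-> _] := H as1; rewrite mulNr.
  have lX2' := loc1_div_sqrt lX2; have lX1' := loc1_div_sqrt lX1.
  have k1 := itg_test lX2' te; have k2 := itg_test lX1' te.
  transitivity (\int[leb]_(x in 'I[a,oo]) (fc (sl u1 x) m * eta' x + e * (fs (sl u2 x) m * eta' x))).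
    by apply: Rint_ext => x _; rewrite /mode_fun; ring.
  rewrite RintD//; last exact: itgZ.
  rewrite RintZ// (S1 _ _ te de) -[X in X + _]opprK -N1 (C3 _ _ te de) opprK.
  transitivity (- \int[leb]_(x in 'I[a,oo]) (- (fc (sl (rad q0 q1) x) m / (2 * Num.sqrt x) * eta x) +
     e * (fs (sl (rad p0 p1) x) m / (2 * Num.sqrt x) * eta x))).
    exact: (@RintN_lin _ _ _ leb _ e _ _ k1 k2).
  by congr (- _); apply: Rint_ext => x _; rewrite /p; ring.
have [C HC] := ac_rep lf lp wd.
pose F x := C + prim p a x.
have Fa : F a = C by rewrite /F primaa addr0.
have acF : ac a F p by split => // x ax; rewrite Fa.
have mp : measurable_fun 'I[a,oo] p by apply: measurable_y => T; exact: itg_measurable (lp T).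
have mF : measurable_fun 'I[a,oo] F.
  by apply: measurable_y => T; apply: measurable_funD => //; exact: measurable_prim.
have aeF : {ae leb, forall s, a < s -> mode_fun e m u1 u2 s = F s} by exact: HC.
have aeI (P : R -> Prop) : {ae leb, forall s, a < s -> P s} -> {ae leb, forall s, 'I[a,oo] s -> P s}.
  by apply: ae_imp => s H; rewrite /= in_itv/= andbT; exact: H.
have iF : itg leb 'I[a,oo] (fun s => F s ^+ 2).
  apply: (itg_ae if2); first exact: sqI.
  by apply: aeI; apply: ae_imp aeF => s H as1; rewrite H.
have aeE : {ae leb, forall s, a < s -> mode_dens e m p0 p1 q0 q1 s = edens b (e * m%:R) F p s}.
  have A1 := ae_and C2 S4.
  have A2 := ae_and aeN aeF.
  apply: ae_imp2 A1 A2 => s H H' as1.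
  have [E1 E2] := H as1; have [[E3 _] E4] := H' as1.
  have s0 := lt_trans a0 as1.
  have q1s : 0 < Num.sqrt s by rewrite sqrtr_gt0.
  have sq : Num.sqrt s ^+ 2 = s by rewrite sqr_sqrtr// ltW.
  rewrite E3 in E2; rewrite /edens -E4 /mode_dens; congr (_ + _).
    rewrite /p expr_div_n exprMn sq; field.
    by rewrite gt_eqF.
  have E5 : Num.sqrt s * (fc (sl (ang p0 p1) s) m + e * fs (sl (ang q0 q1) s) m) =
      (e * m%:R - b * s / 2) * mode_fun e m u1 u2 s.
    rewrite mulrDr E1 (mulrCA _ e) E2 /mode_fun.
    transitivity (e * m%:R * fc (sl u1 s) m + 1 * (m%:R * fs (sl u2 s) m)
      - b * s / 2 * (fc (sl u1 s) m + e * fs (sl u2 s) m)); first by field.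
    by rewrite -e1; ring.
  rewrite mulrAC -exprMn -E5 exprMn sq; field.
  by rewrite gt_eqF.
have iE : itg leb 'I[a,oo] (edens b (e * m%:R) F p).
  apply: (itg_ae ie); last exact: aeI.
  apply: measurable_funD.
    apply: measurable_funM; last exact: sqI.
    by apply: measurable_funTS; apply: measurable_funM.
  apply: measurable_funM; last exact: sqI.
  apply: measurable_funTS; apply: measurable_funM; last exact: measurable_invr.
  apply: measurable_funX; apply: measurable_funB => //.
  by apply: measurable_funM => //; apply: measurable_funM.
have -> : \int[leb]_(s in 'I[a,oo]) (mode_fun e m u1 u2 s ^+ 2) = \int[leb]_(s in 'I[a,oo]) (F s ^+ 2).
  apply: Rint_ae; [by have [] := iF|exact: itg_measurable if2|exact: itg_measurable iF|].
  by apply: aeI; apply: ae_imp aeF => s H as1; rewrite H.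
have -> : \int[leb]_(s in 'I[a,oo]) mode_dens e m p0 p1 q0 q1 s = \int[leb]_(s in 'I[a,oo]) edens b (e * m%:R) F p s.
  apply: Rint_ae; [by have [] := iE|exact: itg_measurable ie|exact: itg_measurable iE|].
  exact: aeI.
exact: HB.
Qed.

End one_mode_plane.

Section sum_of_modes.
Variables (u1 u2 p0 p1 q0 q1 : pt -> R) (B : R).
Hypotheses (mu : mom a b u1 u2 p0 p1 q0 q1) (B0 : 0 < B).
Local Notation n1 := (fun z => - u1 z).
Local Notation np0 := (fun z => - p0 z).
Local Notation np1 := (fun z => - p1 z).
Hypotheses (HB : forall m (e : R), e = 1 \/ e = -1 ->
  B * \int[leb]_(s in 'I[a,oo]) (mode_fun e m u1 u2 s ^+ 2) <=
    \int[leb]_(s in 'I[a,oo]) mode_dens e m p0 p1 q0 q1 s /\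
  B * \int[leb]_(s in 'I[a,oo]) (mode_fun e m u2 n1 s ^+ 2) <=
    \int[leb]_(s in 'I[a,oo]) mode_dens e m q0 q1 np0 np1 s).

Let Sq h m s := fc (sl h s) m ^+ 2 + fs (sl h s) m ^+ 2.

Let iSq h m : L2r a h -> itg leb 'I[a,oo] (Sq h m).
Proof. by move=> Lh; have [i1 i2] := itg_fcs_sqr a0' m Lh; exact: itgD. Qed.

(** The two signs of the angular momentum, for [u] and for - i u, give four squares in which the
    mixed products cancel; this leaves twice the sum of all squared coefficients. *)
Lemma mode_sum m :
  B * \int[leb]_(s in 'I[a,oo]) (Sq u1 m s + Sq u2 m s) <=
  \int[leb]_(s in 'I[a,oo]) (Sq (rad p0 p1) m s + Sq (rad q0 q1) m s + Sq (ang p0 p1) m s + Sq (ang q0 q1) m s).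
Proof.
have [L1 L2 [P0 P1 Q0 Q1] _ _] := mu.
have [X1 Y1] := L2r_rad_ang a0 P0 P1; have [X2 Y2] := L2r_rad_ang a0 Q0 Q1.
have mu' := mom_rot mu.
have [H1 H2] := HB m (or_introl erefl); have [H3 H4] := HB m (or_intror erefl).
have [_ i1 d1] := mode_fun_props mu 1 m; have [_ i3 d3] := mode_fun_props mu (-1) m.
have [_ i2 d2] := mode_fun_props mu' 1 m; have [_ i4 d4] := mode_fun_props mu' (-1) m.
have aeI (P : R -> Prop) : {ae leb, forall s, a < s -> P s} -> {ae leb, forall s, 'I[a,oo] s -> P s}.
  by apply: ae_imp => s H; rewrite /= in_itv/= andbT; exact: H.
have E1 : \int[leb]_(s in 'I[a,oo]) (mode_fun 1 m u1 u2 s ^+ 2) + \int[leb]_(s in 'I[a,oo]) (mode_fun (-1) m u1 u2 s ^+ 2) +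
   (\int[leb]_(s in 'I[a,oo]) (mode_fun 1 m u2 n1 s ^+ 2) + \int[leb]_(s in 'I[a,oo]) (mode_fun (-1) m u2 n1 s ^+ 2)) =
   2 * \int[leb]_(s in 'I[a,oo]) (Sq u1 m s + Sq u2 m s).
  have iS : itg leb 'I[a,oo] (fun s => Sq u1 m s + Sq u2 m s) by apply: itgD; exact: iSq.
  apply: (@Rint_ae_sum4 _ _ _ leb _ _ _ _ _ _ 2 i1 i3 i2 i4 iS); apply: aeI; apply: ae_imp (fcsN_ae m L1) => s H as1.
    by have [_ E] := H as1; rewrite /mode_fun /Sq E; ring.
have E2 : \int[leb]_(s in 'I[a,oo]) mode_dens 1 m p0 p1 q0 q1 s + \int[leb]_(s in 'I[a,oo]) mode_dens (-1) m p0 p1 q0 q1 s +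
   (\int[leb]_(s in 'I[a,oo]) mode_dens 1 m q0 q1 np0 np1 s + \int[leb]_(s in 'I[a,oo]) mode_dens (-1) m q0 q1 np0 np1 s) =
   2 * \int[leb]_(s in 'I[a,oo]) (Sq (rad p0 p1) m s + Sq (rad q0 q1) m s + Sq (ang p0 p1) m s + Sq (ang q0 q1) m s).
  have iS : itg leb 'I[a,oo] (fun s => Sq (rad p0 p1) m s + Sq (rad q0 q1) m s + Sq (ang p0 p1) m s + Sq (ang q0 q1) m s).
    by apply: itgD; [apply: itgD; [apply: itgD|]|]; exact: iSq.
  apply: (@Rint_ae_sum4 _ _ _ leb _ _ _ _ _ _ 2 d1 d3 d2 d4 iS); apply: aeI.
    have A := ae_and (fcsN_ae m X1) (fcsN_ae m Y1).
    apply: ae_imp A => s H as1; have [[E _] [_ E']] := H as1.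
    by rewrite /mode_dens radN angN /Sq E E'; ring.
exact: (sum4_scale H1 H3 H2 H4 E1 E2).
Qed.

(** Parseval's identity is needed only for [u1] and [u2]; for the momenta, which stand on the larger
    side, Bessel's inequality is enough. *)
Lemma lower_bound :
  B * (\int[leb2]_(z in D) (u1 z ^+ 2) + \int[leb2]_(z in D) (u2 z ^+ 2)) <=
  \int[leb2]_(z in D) (p0 z ^+ 2) + \int[leb2]_(z in D) (p1 z ^+ 2) +
  (\int[leb2]_(z in D) (q0 z ^+ 2) + \int[leb2]_(z in D) (q1 z ^+ 2)).
Proof.
have [L1 L2 [P0 P1 Q0 Q1] _ _] := mu.
have [X1 Y1] := L2r_rad_ang a0 P0 P1; have [X2 Y2] := L2r_rad_ang a0 Q0 Q1.
set S := (X in _ <= X).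
have SE : S = (\int[leb2]_(z in D) (rad p0 p1 z ^+ 2) + \int[leb2]_(z in D) (ang p0 p1 z ^+ 2)) +
   (\int[leb2]_(z in D) (rad q0 q1 z ^+ 2) + \int[leb2]_(z in D) (ang q0 q1 z ^+ 2)).
  move: P0 P1 Q0 Q1 X1 Y1 X2 Y2 => [_ P0] [_ P1] [_ Q0] [_ Q1] [_ X1] [_ Y1] [_ X2] [_ Y2].
  rewrite /S -(RintD P0 P1) -(RintD Q0 Q1) -(RintD X1 Y1) -(RintD X2 Y2).
  by congr (_ + _); apply: Rint_ext => z Dz; rewrite (rad_ang_sqr a0 _ _ Dz).
rewrite mulrC -ler_pdivlMr//.
have -> : S / B = (2 * S / B) / 2 by field; rewrite gt_eqF.
apply: (parseval_le a0' L1 L2) => n.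
rewrite ler_pdivlMr// mulrC.
have [j1 B1] := itg_fE a0' n X1; have [j2 B2] := itg_fE a0' n X2.
have [j3 B3] := itg_fE a0' n Y1; have [j4 B4] := itg_fE a0' n Y2.
apply: (@le_trans _ _ (\int[leb]_(s in 'I[a,oo]) (fE (sl (rad p0 p1) s) n + fE (sl (rad q0 q1) s) n +
   fE (sl (ang p0 p1) s) n + fE (sl (ang q0 q1) s) n))); last first.
  rewrite (RintD (itgD (itgD j1 j2) j3) j4) (RintD (itgD j1 j2) j3) (RintD j1 j2) SE.
  exact: sum4_le B1 B2 B3 B4.
have fEE h s : fE (sl h s) n = \sum_(j < n) (wc j)^-1 * Sq h j s by [].
have mI : measurable 'I[a,oo] by exact: measurable_itv.
have -> : \int[leb]_(s in 'I[a,oo]) (fE (sl u1 s) n + fE (sl u2 s) n) =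
    \sum_(j < n) (wc j)^-1 * \int[leb]_(s in 'I[a,oo]) (Sq u1 j s + Sq u2 j s).
  transitivity (\int[leb]_(s in 'I[a,oo]) \sum_(j < n) (wc j)^-1 * (Sq u1 j s + Sq u2 j s)).
    apply: Rint_ext => s _; rewrite !fEE -big_split /=.
    by apply: eq_bigr => j _; rewrite -mulrDr.
  have iS (j : 'I_n) : itg leb 'I[a,oo] (fun s => Sq u1 j s + Sq u2 j s) by apply: itgD; exact: iSq.
  transitivity (\sum_(j < n) \int[leb]_(s in 'I[a,oo]) ((wc j)^-1 * (Sq u1 j s + Sq u2 j s))).
    exact: (@Rint_sum _ _ _ leb _ _ (fun (j : 'I_n) s => (wc j)^-1 * (Sq u1 j s + Sq u2 j s)) mI (fun j => itgZ _ (iS j))).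
  by apply: eq_bigr => j _; rewrite (RintZ _ (iS j)).
have -> : \int[leb]_(s in 'I[a,oo]) (fE (sl (rad p0 p1) s) n + fE (sl (rad q0 q1) s) n +
   fE (sl (ang p0 p1) s) n + fE (sl (ang q0 q1) s) n) =
    \sum_(j < n) (wc j)^-1 * \int[leb]_(s in 'I[a,oo]) (Sq (rad p0 p1) j s + Sq (rad q0 q1) j s + Sq (ang p0 p1) j s + Sq (ang q0 q1) j s).
  transitivity (\int[leb]_(s in 'I[a,oo]) \sum_(j < n) (wc j)^-1 * (Sq (rad p0 p1) j s + Sq (rad q0 q1) j s + Sq (ang p0 p1) j s + Sq (ang q0 q1) j s)).
    apply: Rint_ext => s _; rewrite !fEE -!big_split /=.
    by apply: eq_bigr => j _; rewrite -!mulrDr.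
  have iS (j : 'I_n) : itg leb 'I[a,oo] (fun s => Sq (rad p0 p1) j s + Sq (rad q0 q1) j s + Sq (ang p0 p1) j s + Sq (ang q0 q1) j s).
    by apply: itgD; [apply: itgD; [apply: itgD|]|]; exact: iSq.
  transitivity (\sum_(j < n) \int[leb]_(s in 'I[a,oo]) ((wc j)^-1 * (Sq (rad p0 p1) j s + Sq (rad q0 q1) j s + Sq (ang p0 p1) j s + Sq (ang q0 q1) j s))).
    exact: (@Rint_sum _ _ _ leb _ _ (fun (j : 'I_n) s => (wc j)^-1 * (Sq (rad p0 p1) j s + Sq (rad q0 q1) j s + Sq (ang p0 p1) j s + Sq (ang q0 q1) j s)) mI (fun j => itgZ _ (iS j))).
  by apply: eq_bigr => j _; rewrite (RintZ _ (iS j)).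
rewrite mulr_sumr; apply: ler_sum => j _; rewrite mulrCA ler_wpM2l//.
  by rewrite invr_ge0 ltW// wc_gt0.
exact: mode_sum.
Qed.

End sum_of_modes.
End lower_bound.

(** * Radial majorants and Gaussian integrals *)

Section polar_integrability.
Context {R : realType}.
Local Notation pt := (R * R)%type.
Local Notation leb := (@lebesgue_measure R).
Local Notation leb2 := (leb \x leb)%E.
Local Notation J := (`](- (pi / 2)), (3 * pi / 2)[%classic : set R).
Local Notation "'I[ a , T ]" := (`]a, T]%classic : set R) (at level 0, format "''I[' a ,  T ]").
Local Notation "'I[ a ,oo]" := (`]a, +oo[%classic : set R) (at level 0, format "''I[' a ,oo]").
Implicit Types (f g h : pt -> R) (z : pt) (n m : nat) (a c s : R).

Lemma itg_radial a (h : R -> R) : 0 <= a -> itg leb 'I[a,oo] h -> (forall s, a < s -> 0 <= h s) ->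
  itg leb2 (dom a) (fun z => h (nsq z)).
Proof.
move=> a0 ih h0; have mI : measurable 'I[a,oo] by exact: measurable_itv.
pose h1 := h \_ 'I[a,oo].
have ih1 : itg leb setT h1 := (itg_mkcond leb h mI).1 ih.
have h10 s : 0 <= h1 s.
  by rewrite /h1 patchE; case: ifPn => // /set_mem; rewrite /= in_itv/= andbT; exact: h0.
pose cJ : R -> R := (fun=> 2^-1 : R) \_ J.
have iJ : itg leb setT cJ.
  apply: (itg_mkcond leb _ (@measurable_J R)).1; apply: continuous_integrable_J; exact: cst_continuous.
have iP := itg_prod ih1 iJ.
have mh : measurable_fun setT (fun z : pt => h1 (nsq z)).
  exact: (measurableT_comp (itg_measurable ih1) (continuous_measurable2 (@continuous_nsq R))).
suff H : itg leb2 (dom a) (fun z => h1 (nsq z)).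
  by apply: itg_ext H => z Dz; rewrite /h1 patchE mem_set//= in_itv/= andbT.
apply: itg_ge0P; first exact: measurable_dom.
- exact: measurable_funTS.
- by move=> z _; exact: h10.
- rewrite (ge0_polar a0 (F := fun z => (h1 (nsq z))%:E)); last 2 first.
  + exact/measurable_EFinP.
  + by move=> z; rewrite lee_fin.
  have iK := itgS iP (@subsetT _ ('I[a,oo] `*` J)) (measurableX mI (@measurable_J R)).
  have := ltry (\int[leb2]_(z in 'I[a,oo] `*` J) (h1 z.1 * cJ z.2)); rewrite (EFin_Rint iK).
  apply: le_lt_trans; rewrite le_eqVlt; apply/orP; left; apply/eqP; apply: eq_integral => z /set_mem [/= + Jz].
  rewrite in_itv/= andbT => az; case: z az Jz => s th /= az Jz.
  by rewrite /cJ patchE mem_set//= nsq_polar// (le_trans a0)// ltW.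
Qed.

Lemma L2r_radial a g (h : R -> R) : 0 <= a -> measurable_fun (dom a) g -> itg leb 'I[a,oo] h ->
  (forall z, dom a z -> g z ^+ 2 <= h (nsq z)) -> (forall s, a < s -> 0 <= h s) -> L2r a g.
Proof.
move=> a0 mg ih gh h0; split => //.
apply: (itg_le _ (itg_radial a0 ih h0)); first exact: measurable_funX.
by move=> z Dz; rewrite ger0_norm ?sqr_ge0//; exact: gh.
Qed.

(** [fatou_sqr] is applied to the square roots of [f] cut off at [n]. *)
Lemma itg_y_bound a (f : R -> R) M : measurable_fun 'I[a,oo] f -> (forall s, a < s -> 0 <= f s) ->
  (forall T, itg leb 'I[a, T] f) -> (forall n, \int[leb]_(s in 'I[a, n%:R]) f s <= M) ->
  itg leb 'I[a,oo] f /\ \int[leb]_(s in 'I[a,oo]) f s <= M.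
Proof.
move=> mf f0 lf fM; have mI : measurable 'I[a,oo] by exact: measurable_itv.
have sub n : 'I[a, n%:R] `<=` 'I[a,oo].
  by move=> s; rewrite /= !in_itv/= => /andP[->].
have If s : 'I[a,oo] s -> 0 <= f s by rewrite /= in_itv/= andbT; exact: f0.
have mq : measurable_fun 'I[a,oo] (fun s => Num.sqrt (f s)).
  exact: (measurableT_comp (@measurable_sqrt R) mf).
have mp n : measurable_fun 'I[a,oo] ((fun s => Num.sqrt (f s)) \_ 'I[a, n%:R]).
  apply: measurable_funTS; apply/(measurable_restrictT _ (measurable_oc _ _)).
  by apply: measurable_funS mq => //; exact: sub.
have lt_oo : (\int[leb]_(s in 'I[a,oo]) (f s)%:E <= M%:E)%E.
  have -> : (\int[leb]_(s in 'I[a,oo]) (f s)%:E = \int[leb]_(s in 'I[a,oo]) (Num.sqrt (f s) ^+ 2)%:E)%E.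
    by apply: eq_integral => s /set_mem /If fs; rewrite sqr_sqrtr.
  apply: (@fatou_sqr R 'I[a,oo] (fun n => (fun s => Num.sqrt (f s)) \_ 'I[a, n%:R]) _ M mI mp mq).
    apply: aeW => s Is; apply: cvg_near_cst; near=> n.
    rewrite patchE mem_set//=; move: Is; rewrite /= !in_itv/= andbT => ->/=.
    by near: n; exact: nbhs_infty_ger.
  move=> n; rewrite (_ : (\int[leb]_(x in _) _)%E = (\int[leb]_(s in 'I[a, n%:R]) (f s)%:E)%E).
    by rewrite -EFin_Rint// lee_fin.
  rewrite [LHS]integral_mkcond [RHS]integral_mkcond; apply: eq_integral => s _.
  rewrite !patchE; have [sn|sn] := boolP (s \in 'I[a, n%:R]).
    by rewrite mem_set; [rewrite sqr_sqrtr// If//|]; apply: (@sub n); exact: set_mem.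
  by rewrite expr0n /=; case: ifP.
have fi : itg leb 'I[a,oo] f by apply: itg_ge0P => //; apply: le_lt_trans lt_oo (ltry _).
by split => //; rewrite -lee_fin EFin_Rint.
Unshelve. all: by end_near. Qed.

Lemma itg_y_deriv a (G f : R -> R) M : (forall x, a <= x -> is_derive x 1 G (f x)) ->
  (forall x, a <= x -> {for x, continuous f}) -> (forall x, a < x -> 0 <= f x) ->
  (forall x, a <= x -> G x <= M) ->
  itg leb 'I[a,oo] f /\ \int[leb]_(s in 'I[a,oo]) f s <= M - G a.
Proof.
move=> dG cf f0 GM; have acG := ac_C1 dG cf; have [lf _] := acG.
apply: itg_y_bound => //; first by apply: measurable_y => T; exact: itg_measurable (lf T).
move=> n; have [an|na] := leP a n%:R; first by rewrite (ac_int acG an) lerD2r GM.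
have -> : 'I[a, n%:R] = set0 :> set R.
  by rewrite set_itv_ge// -leNgt bnd_simp ltW.
by rewrite Rintegral_set0 subr_ge0 GM.
Qed.

Lemma gauss_itg a c m : 0 <= a -> 0 < c ->
  itg leb 'I[a,oo] (fun s => s ^+ m * expR (- (c * s))) /\
  \int[leb]_(s in 'I[a,oo]) (s ^+ m * expR (- (c * s))) <= m`!%:R / c ^+ m.+1.
Proof.
move=> a0 c0; pose K : R := m`!%:R / c ^+ m.+1.
have K0 : 0 < K by rewrite divr_gt0 ?exprn_gt0// ltr0n fact_gt0.
have ex (x : R) : is_derive x 1 (fun s : R => expR (- (c * s))) (- c * expR (- (c * x))).
  apply: (is_derive_congr (der_expR (der_opp (der_scale c (der_id x))))); ring.
have dG (x : R) : is_derive x 1 (fun s => - K * (expR (- (c * s)) * expS m (c * s)))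
    (x ^+ m * expR (- (c * x))).
  apply: (is_derive_congr (der_scale (- K) (der_mul (ex x)
     (der_comp (der_scale c (der_id x)) (der_expS m (c * x)))))).
  have fm := @fact_neq0 R m; have cm : c ^+ m != 0 by rewrite expf_neq0// gt_eqF.
  rewrite exprMn /K exprS; move: (x ^+ m) (c ^+ m) cm => X C C0.
  by field; rewrite fm C0 gt_eqF.
have [] := @itg_y_deriv a (fun s => - K * (expR (- (c * s)) * expS m (c * s)))
    (fun s => s ^+ m * expR (- (c * s))) 0 _ _ _ _ => //.
- move=> x _; apply: cvgM; first exact: exprn_continuous.
  exact: is_derive_continuous (ex x).
- by move=> x ax; rewrite mulr_ge0 ?expR_ge0// exprn_ge0// (le_trans a0 (ltW ax)).
- move=> x ax; rewrite mulNr oppr_le0 mulr_ge0 ?(ltW K0)// mulr_ge0 ?expR_ge0//.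
  by rewrite (le_trans ler01)// expS_ge1// mulr_ge0 ?(ltW c0)// (le_trans a0).
- move=> i1 B; split => //; apply: le_trans B _; rewrite sub0r mulNr opprK ler_piMr ?(ltW K0)//.
  have ca : 0 <= c * a by rewrite mulr_ge0 ?(ltW c0).
  rewrite expRN mulrC ler_pdivrMr ?expR_gt0// mul1r; exact: expS_le.
Qed.

End polar_integrability.

(** * From mode inequalities to the quadratic form *)

Section form_bounds.
Context {R : realType}.
Local Notation pt := (R * R)%type.
Local Notation leb := (@lebesgue_measure R).
Local Notation leb2 := (leb \x leb)%E.
Local Notation J := (`](- (pi / 2)), (3 * pi / 2)[%classic : set R).
Local Notation "'I[ a ,oo]" := (`]a, +oo[%classic : set R) (at level 0, format "''I[' a ,oo]").
Local Notation cRe u := (fun z => complex.Re (u z)).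
Local Notation cIm u := (fun z => complex.Im (u z)).
Implicit Types (g h : pt -> R) (u v : pt -> R[i]) (z : pt) (n m k : nat) (a b c s : R).

Lemma L2_L2r a u : L2 (dom a) u <-> L2r a (cRe u) /\ L2r a (cIm u).
Proof.
split=> [[mr mi iu]|[[mr ir] [mi ii]]].
  have iS : itg leb2 (dom a) (fun z => sqnormC (u z)) by split => //; exact: measurable_dom.
  split; split => //; apply: (itg_le _ iS); try exact: measurable_funX.
    by move=> z _; rewrite ger0_norm ?sqr_ge0// lerDl sqr_ge0.
  by move=> z _; rewrite ger0_norm ?sqr_ge0// lerDr sqr_ge0.
by split => //; have [_] := itgD ir ii.
Qed.

Lemma L2sqnormE a u : L2 (dom a) u -> L2sqnorm (dom a) u =
  \int[leb2]_(z in dom a) (cRe u z ^+ 2) + \int[leb2]_(z in dom a) (cIm u z ^+ 2).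
Proof. by move=> /L2_L2r[[_ ir] [_ ii]]; rewrite -(RintD ir ii). Qed.

Lemma L2sqnorm_ge0 a u : 0 <= L2sqnorm (dom a) u.
Proof. by apply: Rint_ge0 => z _; rewrite addr_ge0 ?sqr_ge0. Qed.

Lemma qform_ge0 a b u : 0 <= qform (dom a) b u.
Proof. by apply: sumr_ge0 => j _; exact: L2sqnorm_ge0. Qed.

Lemma momentumP a b u j : H1A (dom a) b u ->
  L2 (dom a) (momentum (dom a) b j u) /\ weak_momentum (dom a) b j u (momentum (dom a) b j u).
Proof. by move=> [_ /(_ j) ex]; exact: (xgetPex _ ex). Qed.

Lemma H1A_mom a b u : H1A (dom a) b u -> mom a b (cRe u) (cIm u)
  (cRe (momentum (dom a) b 0 u)) (cRe (momentum (dom a) b 1 u))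
  (cIm (momentum (dom a) b 0 u)) (cIm (momentum (dom a) b 1 u)).
Proof.
move=> Hu; have [Lu _] := Hu; have [L0 w0] := momentumP 0 Hu; have [L1 w1] := momentumP 1 Hu.
have [Lu1 Lu2] := (L2_L2r a u).1 Lu.
have [P0 Q0] := (L2_L2r a _).1 L0; have [P1 Q1] := (L2_L2r a _).1 L1.
have [r0 i0] := weak_rweak w0; have [r1 i1] := weak_rweak w1.
by split.
Qed.

Lemma qformE a b u : H1A (dom a) b u -> qform (dom a) b u =
  \int[leb2]_(z in dom a) (cRe (momentum (dom a) b 0 u) z ^+ 2) +
  \int[leb2]_(z in dom a) (cRe (momentum (dom a) b 1 u) z ^+ 2) +
  (\int[leb2]_(z in dom a) (cIm (momentum (dom a) b 0 u) z ^+ 2) +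
   \int[leb2]_(z in dom a) (cIm (momentum (dom a) b 1 u) z ^+ 2)).
Proof.
move=> Hu; have [L0 _] := momentumP 0 Hu; have [L1 _] := momentumP 1 Hu.
have -> : qform (dom a) b u = L2sqnorm (dom a) (momentum (dom a) b 0 u) +
    L2sqnorm (dom a) (momentum (dom a) b 1 u).
  rewrite /qform big_ord_recl big_ord1; congr (L2sqnorm _ (momentum _ _ _ _) + L2sqnorm _ (momentum _ _ _ _));
    exact: val_inj.
move: (momentum _ b 0 u) (momentum _ b 1 u) L0 L1 => v0 v1 L0 L1.
rewrite (L2sqnormE L0) (L2sqnormE L1); exact: addrACA.
Qed.

(** The hypothesis covers [u] and - i u, whose mode functions are the real and imaginary parts of
    the same coefficient. *)
Lemma form_lower_bound a b B u : 0 < a -> 0 < b -> 0 < B -> H1A (dom a) b u ->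
  (forall m (e : R) (u1 u2 p0 p1 q0 q1 : pt -> R), e = 1 \/ e = -1 -> mom a b u1 u2 p0 p1 q0 q1 ->
     (u1 = cRe u /\ u2 = cIm u) \/ (u1 = cIm u /\ u2 = fun z => - cRe u z) ->
     B * \int[leb]_(s in 'I[a,oo]) (mode_fun e m u1 u2 s ^+ 2) <=
       \int[leb]_(s in 'I[a,oo]) mode_dens e m p0 p1 q0 q1 s) ->
  B * L2sqnorm (dom a) u <= qform (dom a) b u.
Proof.
move=> a0 b0 B0 Hu HB; have [Lu _] := Hu; have M := H1A_mom Hu.
rewrite (qformE Hu) (L2sqnormE Lu); apply: (lower_bound a0 M B0) => m e e1; split.
  by apply: HB e1 M _; left.
by apply: HB e1 (mom_rot M) _; right.
Qed.

Lemma mode_dens_ge0 (e : R) m (p0 p1 q0 q1 : pt -> R) s : 0 <= mode_dens e m p0 p1 q0 q1 s.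
Proof. by rewrite addr_ge0 ?sqr_ge0. Qed.

Lemma sign_sqr (e : R) : e = 1 \/ e = -1 -> e ^+ 2 = 1.
Proof. by move=> [] ->; rewrite ?sqrrN expr1n. Qed.

Lemma mode_energy_sign a b (e : R) m (u1 u2 p0 p1 q0 q1 : pt -> R) : 0 < a -> 0 < b ->
  mom a b u1 u2 p0 p1 q0 q1 -> e = 1 \/ e = -1 -> e * m%:R <= b * a / 2 ->
  b * \int[leb]_(s in 'I[a,oo]) (mode_fun e m u1 u2 s ^+ 2) <=
    \int[leb]_(s in 'I[a,oo]) mode_dens e m p0 p1 q0 q1 s.
Proof.
move=> a0 b0 M e1 em; apply: (mode_bound a0 M (sign_sqr e1)) => F p acF iF iE _.
exact: mode_energy_le.
Qed.

(** The indicator of the exceptional set has integral zero; in polar coordinates, its integral over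
    almost every circle vanishes. *)
Lemma ae_polar a (P : pt -> Prop) : 0 <= a -> {ae leb2, forall z, dom a z -> P z} ->
  {ae leb, forall s, a < s -> {ae leb, forall th, J th -> P (polar_map (s, th))}}.
Proof.
move=> a0 [N [mN N0 sub]]; pose G z : R := \1_N z.
have mG : measurable_fun setT G by exact: measurable_indic.
have G0 z : 0 <= G z by rewrite /G /= indicE ler0n.
have mND : measurable (N `&` dom a) by apply: measurableI => //; exact: measurable_dom.
have ND0 : leb2 (N `&` dom a) = 0%E := subset_measure0 mND mN (@subIsetl _ _ _) N0.
have EG : (\int[leb2]_(z in dom a) (G z)%:E = 0)%E.
  by rewrite -ND0; exact: (@integral_indic _ _ _ leb2 _ (measurable_dom a) _ mN).
have iG : itg leb2 (dom a) G.
  by apply: itg_ge0P; [exact: measurable_dom|exact: measurable_funTS|by []|rewrite EG ltry].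
have E0 : \int[leb2]_(z in dom a) G z = 0 by rewrite /Rintegral EG.
have [i1 ae1 E1] := polar_Rint a0 iG; rewrite E0 in E1.
have I0 : \int[leb]_(s in 'I[a,oo]) \int[leb]_(th in J) G (polar_map (s, th)) = 0.
  by apply/eqP; rewrite -(mulrI_eq0 _ (lregP (_ : 2^-1 != 0 :> R))) ?invr_eq0 ?pnatr_eq0// -E1.
have H : {ae leb, forall s, 'I[a,oo] s -> \int[leb]_(th in J) G (polar_map (s, th)) = 0}.
  by apply: Rint_eq0_ae i1 _ I0 => s _; exact: Rint_ge0.
apply: ae_imp2 H ae1 => s H1 H2 as1.
have Hs : \int[leb]_(th in J) G (polar_map (s, th)) = 0 by apply: H1; rewrite /= in_itv/= as1.
have : {ae leb, forall th, J th -> G (polar_map (s, th)) = 0}.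
  by apply: Rint_eq0_ae (H2 as1) _ Hs => th _; exact: G0.
move=> H3; apply: ae_imp H3 => th H3 Jth; have := H3 Jth; rewrite /G /= indicE.
have [//|nN _] := boolP (polar_map (s, th) \in N); first by move=> _ /eqP; rewrite oner_eq0.
apply: contrapT => nP; move/negP: nN; apply; apply/mem_set; apply: sub => /= K.
by apply: nP; apply: K; exact: polar_dom.
Qed.

End form_bounds.

(** * Lower bounds for radial functions and under orthogonality constraints *)

Section spectral_lower_bounds.
Context {R : realType}.
Local Notation pt := (R * R)%type.
Local Notation leb := (@lebesgue_measure R).
Local Notation leb2 := (leb \x leb)%E.
Local Notation J := (`](- (pi / 2)), (3 * pi / 2)[%classic : set R).
Local Notation "'I[ a ,oo]" := (`]a, +oo[%classic : set R) (at level 0, format "''I[' a ,oo]").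
Local Notation cRe u := (fun z => complex.Re (u z)).
Local Notation cIm u := (fun z => complex.Im (u z)).
Implicit Types (g h : pt -> R) (u v : pt -> R[i]) (z : pt) (n m k : nat) (a b c s : R).

Lemma fcs_const (c : R) m : (0 < m)%N -> fc (fun=> c) m = 0 /\ fs (fun=> c) m = 0.
Proof.
move=> m0; have E : (fun=> c) = trigp 1 (fun=> c) (fun=> 0) :> (R -> R).
  by apply/funext => t; rewrite /trigp big_ord1 mul0r cos0 mulr1 mul0r addr0.
by rewrite E fc_trigp fs_trigp ltnNge m0.
Qed.

Lemma radial_modes a u : 0 <= a -> L2 (dom a) u -> radial (dom a) u -> forall m, (0 < m)%N ->
  {ae leb, forall s, a < s -> [/\ fc (sl (cRe u) s) m = 0, fs (sl (cRe u) s) m = 0,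
    fc (sl (cIm u) s) m = 0 & fs (sl (cIm u) s) m = 0]}.
Proof.
move=> a0 /L2_L2r[[mr _] [mi _]] [g gu] m m0.
have := ae_polar a0 gu; apply: ae_imp => s H as1.
have {}H := H as1; have s0 : 0 <= s := le_trans a0 (ltW as1).
have en th : enorm (polar_map (s, th)) = Num.sqrt s by rewrite /enorm -/(nsq _) nsq_polar.
have [cr0 sr0] := fcs_const (complex.Re (g (Num.sqrt s))) m0.
have [ci0 si0] := fcs_const (complex.Im (g (Num.sqrt s))) m0.
have mJ := @measurable_J R.
have mc : measurable_fun J (fun th : R => cos (m%:R * th)).
  by apply: measurable_funTS; apply: continuous_measurable_fun; exact: continuous_cosM.
have ms : measurable_fun J (fun th : R => sin (m%:R * th)).
  by apply: measurable_funTS; apply: continuous_measurable_fun; exact: continuous_sinM.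
have mr' := slice_measurable a0 mr as1; have mi' := slice_measurable a0 mi as1.
split; [rewrite -cr0|rewrite -sr0|rewrite -ci0|rewrite -si0]; rewrite /fc /fs; apply: Rint_ae => //;
  try (by apply: measurable_funM); apply: ae_imp H => th H Jth; by rewrite /sl (H Jth) en.
Qed.

(** Every mode with [m > 0] vanishes, and the mode 0 has a boundary term of favourable sign for
    every positive [b]. *)
Lemma radial_lower a b u : 0 < a -> 0 < b -> H1A (dom a) b u -> radial (dom a) u ->
  b * L2sqnorm (dom a) u <= qform (dom a) b u.
Proof.
move=> a0 b0 Hu ru; have [Lu _] := Hu; have a0' := ltW a0.
apply: form_lower_bound => // m e u1 u2 p0 p1 q0 q1 e1 M uE.
case: (posnP m) => [m0|m0].
  by apply: mode_energy_sign => //; rewrite m0 mulr0 divr_ge0// mulr_ge0// ltW.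
have [mf if2 _] := mode_fun_props a0 M e m.
have [[mr _] [mi _]] := (L2_L2r a u).1 Lu.
have -> : \int[leb]_(s in 'I[a,oo]) (mode_fun e m u1 u2 s ^+ 2) = 0.
  rewrite -(@Rint0 _ _ _ leb 'I[a,oo]); apply: Rint_ae.
  - by have [] := if2.
  - exact: itg_measurable if2.
  - exact: measurable_cst.
  have := radial_modes a0' Lu ru m0; have N := fcsN_ae a0 m ((L2_L2r a u).1 Lu).1.
  apply: (ae_imp2 _ N) => s H1 H2; rewrite /= in_itv/= andbT => as1.
  have [E1 E2] := H1 as1; have [r1 r2 i1 i2] := H2 as1.
  case: uE => -[-> ->]; rewrite /mode_fun.
    by rewrite r1 i2 mulr0 addr0 expr0n.
  by rewrite E2 i1 r2 oppr0 mulr0 addr0 expr0n.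
by rewrite mulr0; apply: Rint_ge0 => s _; exact: mode_dens_ge0.
Qed.

Definition gweight b s := expR (- (b / 4 * s)).

Lemma measurable_gweight b : measurable_fun setT (gweight b).
Proof.
apply: continuous_measurable_fun => s.
exact: is_derive_continuous (der_expR (der_opp (der_scale (b / 4) (der_id s)))).
Qed.

Lemma zcs_sqr m z : zc m z ^+ 2 + zs m z ^+ 2 = nsq z ^+ m.
Proof.
elim: m => [|m IH] /=; first by rewrite expr1n expr0n addr0 expr0.
by rewrite [RHS]exprS -IH /nsq; ring.
Qed.

Lemma L2r_weight a b m (k : pt -> R) : 0 <= a -> 0 < b -> (k = zc m \/ k = zs m) ->
  L2r a (fun z => k z * gweight b (nsq z)).
Proof.
move=> a0 b0 kE; have b2 : 0 < b / 2 by rewrite divr_gt0.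
have [ih _] := gauss_itg m a0 b2.
have mk : measurable_fun setT k.
  by case: kE => ->; apply: continuous_measurable2; [have [H _] := @sm2_zcs R m 0|have [_ H] := @sm2_zcs R m 0].
have k2 z : k z ^+ 2 <= nsq z ^+ m.
  by rewrite -zcs_sqr; case: kE => ->; rewrite ?lerDl ?lerDr sqr_ge0.
apply: (L2r_radial a0 _ ih).
- apply: measurable_funTS; apply: measurable_funM => //.
  exact: (measurableT_comp (measurable_gweight b) (continuous_measurable2 (@continuous_nsq R))).
- move=> z _; rewrite exprMn /gweight -expRM_natl.
  rewrite (_ : 2%:R * - (b / 4 * nsq z) = - (b / 2 * nsq z)); last by field.
  by rewrite ler_wpM2r// expR_ge0.
- by move=> s as1; rewrite mulr_ge0 ?expR_ge0// exprn_ge0// (le_trans a0 (ltW as1)).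
Qed.

(** The inner product of [u] with the Landau state z^m e^(- b |z|^2 / 4), split into real integrals
    so that it can be compared with [mode_fun] for [u] and for - i u. *)
Definition moment a b m u : R[i] := Complex
  (\int[leb2]_(z in dom a) (cRe u z * (zc m z * gweight b (nsq z)) + cIm u z * (zs m z * gweight b (nsq z))))
  (\int[leb2]_(z in dom a) (cIm u z * (zc m z * gweight b (nsq z)) + - cRe u z * (zs m z * gweight b (nsq z)))).

(** On circles the Landau state is s^(m / 2) e^(- b s / 4) times e^(i m t). The constant [K] only
    normalises this weight at [a], in agreement with [pexp]. *)
Lemma moment_mode a b m (u1 u2 : pt -> R) : 0 < a -> 0 < b -> L2r a u1 -> L2r a u2 ->
  \int[leb2]_(z in dom a) (u1 z * (zc m z * gweight b (nsq z)) + u2 z * (zs m z * gweight b (nsq z))) = 0 ->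
  let w := pexp a (- (m%:R / 2)) (- (b / 4)) in
  itg leb 'I[a,oo] (fun s => w s * mode_fun 1 m u1 u2 s) /\
  \int[leb]_(s in 'I[a,oo]) (w s * mode_fun 1 m u1 u2 s) = 0.
Proof.
move=> a0 b0 L1 L2 E w; have a0' := ltW a0.
have W1 := L2r_weight a0' b0 (or_introl erefl : zc m = zc m \/ zc m = zs m).
have W2 := L2r_weight a0' b0 (or_intror erefl : zs m = zc m \/ zs m = zs m).
have mg := measurable_gweight b.
have i1 : itg leb2 (dom a) (fun z => u1 z * (zc m z * gweight b (nsq z))).
  by have [m1 j1] := L1; have [m2 j2] := W1; exact: itg_mul.
have i2 : itg leb2 (dom a) (fun z => u2 z * (zs m z * gweight b (nsq z))).
  by have [m1 j1] := L2; have [m2 j2] := W2; exact: itg_mul.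
have [E1 I1] := polar_weight a0 L1 (@continuous_cosM R m%:R) mg i1 (fun s th => (zcs_polar m s th).1).
have [E2 I2] := polar_weight a0 L2 (@continuous_sinM R m%:R) mg i2 (fun s th => (zcs_polar m s th).2).
rewrite (RintD i1 i2) E1 E2 -mulrDr -(RintD I1 I2) in E.
have {}E : \int[leb]_(s in 'I[a,oo]) (wint u1 (fun th => cos (m%:R * th)) s * (Num.sqrt s ^+ m * gweight b s) +
     wint u2 (fun th => sin (m%:R * th)) s * (Num.sqrt s ^+ m * gweight b s)) = 0.
  by apply/eqP; have /eqP := E; rewrite mulf_eq0 invr_eq0 pnatr_eq0.
pose K : R := expR (- (m%:R / 2 * ln a) + b / 4 * a).
have wE s : 'I[a,oo] s -> K * (wint u1 (fun th => cos (m%:R * th)) s * (Num.sqrt s ^+ m * gweight b s) +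
     wint u2 (fun th => sin (m%:R * th)) s * (Num.sqrt s ^+ m * gweight b s)) = w s * mode_fun 1 m u1 u2 s.
  rewrite /= in_itv/= andbT => as1.
  rewrite -mulrDl mulrA mulrAC /mode_fun mul1r; congr (_ * _).
  rewrite sqrt_pw ?(lt_trans a0)// /pw /gweight /K /w /pexp -!expRD; congr expR; ring.
split; first exact: (@itg_ext _ _ _ leb _ _ _ wE (itgZ K (itgD I1 I2))).
transitivity (\int[leb]_(s in 'I[a,oo]) (K * (wint u1 (fun th => cos (m%:R * th)) s * (Num.sqrt s ^+ m * gweight b s) +
     wint u2 (fun th => sin (m%:R * th)) s * (Num.sqrt s ^+ m * gweight b s)))).
  by apply: Rint_ext => s Is; rewrite wE.
by rewrite (RintZ _ (itgD I1 I2)) E mulr0.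
Qed.

(** Negative and small angular momenta satisfy the inequality with the full [b]. For the others the
    vanishing moments are the orthogonality that [trace_bound] asks for when [m < k]. *)
Lemma constrained_lower k : (0 < k)%N -> exists2 C : R, 0 < C & exists2 dl : R, 0 < dl &
  forall a b u, 0 < a -> 0 < b -> b * a / 2 <= dl -> H1A (dom a) b u ->
  (forall m, (0 < m < k)%N -> moment a b m u = 0) ->
  (b - tr_eps a b C k) * L2sqnorm (dom a) u <= qform (dom a) b u.
Proof.
move=> k0; have [C C0 [dl dl0 HT]] := @trace_bound R k k0.
exists C => //; exists dl => // a b u a0 b0 badl Hu mom0.
(* A nonpositive constant makes the claim trivial; [form_lower_bound] is stated for positive
   ones. *)
have [B0|B0] := leP (b - tr_eps a b C k) 0.
  by apply: le_trans (qform_ge0 a b u); rewrite mulr_le0_ge0// L2sqnorm_ge0.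
have a0' := ltW a0; have ba0 : 0 <= b * a / 2 by rewrite divr_ge0// mulr_ge0// ltW.
have e0 : 0 <= tr_eps a b C k.
  rewrite /tr_eps; apply: mulr_ge0; last by rewrite addr_ge0// mulr_ge0 ?sqrtr_ge0// ltW.
  by rewrite divr_ge0// mulr_ge0 ?exprn_ge0// mulr_ge0// ltW.
apply: form_lower_bound => // m e u1 u2 p0 p1 q0 q1 e1 M uE.
have [LM1 LM2 _ _ _] := M.
have [em|em] := leP (e * m%:R) (b * a / 2).
  apply: le_trans (mode_energy_sign a0 b0 M e1 em).
  by rewrite ler_wpM2r ?gerBl//; apply: Rint_ge0 => s _; exact: sqr_ge0.
have m0 : (0 < m)%N by rewrite lt0n; apply/eqP => m0; move: em; rewrite m0 mulr0 ltNge ba0.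
have e1' : e = 1.
  case: e1 => // eN; move: em; rewrite eN mulN1r ltNge (le_trans _ ba0)// oppr_le0//.
rewrite e1' in em *; apply: (mode_bound a0 M (expr1n _ _)) => F p acF iF iE aeF.
rewrite mul1r in iE *; apply: HT => // mk.
have E0 : \int[leb2]_(z in dom a) (u1 z * (zc m z * gweight b (nsq z)) + u2 z * (zs m z * gweight b (nsq z))) = 0.
  have [r i] : complex.Re (moment a b m u) = 0 /\ complex.Im (moment a b m u) = 0.
    by rewrite mom0 ?m0.
  by case: uE => -[-> ->].
have [i1 I1] := moment_mode a0 b0 LM1 LM2 E0.
have mI : measurable 'I[a,oo] by exact: measurable_itv.
have mw : measurable_fun 'I[a,oo] (fun s => pexp a (- (m%:R / 2)) (- (b / 4)) s * F s).
  have [lF _] := acF; apply: measurable_y => T.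
  apply: measurable_funM; last first.
    have FE x : 'I[a,oo] x -> F x = F a + prim p a x.
      by rewrite /= in_itv/= andbT => /ltW; have [_] := acF; apply.
    apply: (@eq_measurable_fun _ _ _ _ _ (fun x => F a + prim p a x)).
      by move=> x /set_mem; rewrite /= in_itv/= => /andP[ax _]; rewrite -FE//= in_itv/= ax.
    by apply: measurable_funD => //; exact: measurable_prim.
  apply: measurable_funTS; apply: (measurableT_comp (@measurable_expR R)).
  apply: measurable_funD; last by apply: measurable_funM => //; exact: measurable_funB.
  by apply: measurable_funM => //; apply: measurable_funB => //; exact: measurable_ln.
have aeE : {ae leb, forall s, 'I[a,oo] s -> pexp a (- (m%:R / 2)) (- (b / 4)) s * mode_fun 1 m u1 u2 s =
    pexp a (- (m%:R / 2)) (- (b / 4)) s * F s}.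
  by apply: ae_imp aeF => s H; rewrite /= in_itv/= andbT => as1; rewrite H.
split; first exact: itg_ae i1 mw aeE.
rewrite -[RHS]I1; apply/esym; apply: Rint_ae => //; exact: itg_measurable i1.
Qed.

End spectral_lower_bounds.

(** * Weak momenta and trial functions *)

Section weak_momentum_calculus.
Context {R : realType}.
Local Notation pt := (R * R)%type.
Local Notation leb := (@lebesgue_measure R).
Local Notation leb2 := (leb \x leb)%E.
Local Notation "'I[ a ,oo]" := (`]a, +oo[%classic : set R) (at level 0, format "''I[' a ,oo]").
Local Notation cRe u := (fun z => complex.Re (u z)).
Local Notation cIm u := (fun z => complex.Im (u z)).
Implicit Types (g h p : pt -> R) (z : pt) (n m k : nat) (a b s : R) (j : 'I_2).

(** The products from [test2] already determine every Fourier coefficient on almost every circle,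
    and Parseval's identity does the rest. No density theorem for test functions is invoked. *)
Lemma L2r_test0 a g : 0 < a -> L2r a g ->
  (forall phi, test_function (dom a) phi -> \int[leb2]_(z in dom a) (g z * phi z) = 0) ->
  \int[leb2]_(z in dom a) (g z ^+ 2) = 0.
Proof.
move=> a0 Lg H; have a0' := ltW a0.
have mode m (k : pt -> R) (w : R -> R) : (forall n, sm2 n k) -> continuous w ->
    (forall s th, k (polar_map (s, th)) = Num.sqrt s ^+ m * w th) -> loc1 a (wint g w) ->
    {ae leb, forall s, a < s -> wint g w s = 0}.
  move=> sk cw kw lw; apply: dbr0 => // eta te.
  have t2 : test1 a (fun t => pw t (- (m%:R / 2)) * eta t) by exact: test1_pow.
  have [E _] := polar_w a0 Lg cw (sm2_continuous (sk 0%N)) t2 kw.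
  have {}E : 2^-1 * \int[leb]_(s in 'I[a,oo]) (wint g w s * (Num.sqrt s ^+ m * (pw s (- (m%:R / 2)) * eta s))) = 0.
    have tf := test2 sk t2.
    by rewrite -E; exact: (H _ tf).
  transitivity (\int[leb]_(s in 'I[a,oo]) (wint g w s * (Num.sqrt s ^+ m * (pw s (- (m%:R / 2)) * eta s)))).
    apply: Rint_ext => s; rewrite /= in_itv/= andbT => as1; congr (_ * _).
    by rewrite mulrA sqrt_pw ?(lt_trans a0)// pwM subrr pw0 mul1r.
  by apply/eqP; have /eqP := E; rewrite mulf_eq0 invr_eq0 pnatr_eq0.
have zero m : {ae leb, forall s, a < s -> fc (sl g s) m = 0 /\ fs (sl g s) m = 0}.
  have [l1 l2] := fcs_loc1 a0 m Lg.
  apply: ae_and.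
    apply: (mode m (zc m) (fun th => cos (m%:R * th))) => //.
    - by move=> n; have [] := @sm2_zcs R m n.
    - exact: continuous_cosM.
    - by move=> s th; have [] := zcs_polar m s th.
  apply: (mode m (zs m) (fun th => sin (m%:R * th))) => //.
  - by move=> n; have [] := @sm2_zcs R m n.
  - exact: continuous_sinM.
  - by move=> s th; have [] := zcs_polar m s th.
have I0 n : \int[leb]_(s in 'I[a,oo]) (fE (sl g s) n + fE (sl g s) n) <= 0.
  have [i1 _] := itg_fE a0' n Lg.
  rewrite -[X in _ <= X](@Rint0 _ _ _ leb 'I[a,oo]).
  have -> // : \int[leb]_(s in 'I[a,oo]) (fE (sl g s) n + fE (sl g s) n) = \int[leb]_(s in 'I[a,oo]) (0 : R).
  apply: Rint_ae; [by have [] := i1|exact: itg_measurable (itgD i1 i1)|exact: measurable_cst|].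
  have := ae_forall zero; apply: ae_imp => s Hs; rewrite /= in_itv/= andbT => as1.
  rewrite /fE big1 ?addr0// => i _; have [-> ->] := Hs i as1.
  by rewrite expr0n addr0 mulr0.
have := parseval_le a0' Lg Lg I0; rewrite mul0r => H0.
have g0 : 0 <= \int[leb2]_(z in dom a) (g z ^+ 2) by apply: Rint_ge0 => z _; exact: sqr_ge0.
by apply/le_anti/andP; split => //; apply: le_trans H0; rewrite lerDl.
Qed.

Lemma L2r_lin a (x y : R) g h : L2r a g -> L2r a h -> L2r a (fun z => x * g z + y * h z).
Proof.
move=> [mg ig] [mh ih]; have m1 : measurable_fun (dom a) (fun z => x * g z + y * h z).
  by apply: measurable_funD; apply: measurable_funM.
split => //; apply: (itg_le _ (itgD (itgZ (2 * x ^+ 2) ig) (itgZ (2 * y ^+ 2) ih))).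
  exact: measurable_funX.
move=> z _; rewrite ger0_norm ?sqr_ge0//.
have := sqr_ge0 (x * g z - y * h z); rewrite sqrrB sqrrD !exprMn; lra.
Qed.

Lemma rweak_ext a b j (u1 u2 p u1' u2' p' : pt -> R) : u1 =1 u1' -> u2 =1 u2' -> p =1 p' ->
  rweak a b j u1 u2 p -> rweak a b j u1' u2' p'.
Proof. by move=> /funext <- /funext <- /funext <-. Qed.

Lemma rweak_lin a b j (x y : R) (u1 u2 p u1' u2' p' : pt -> R) :
  L2r a u1 -> L2r a u2 -> L2r a p -> L2r a u1' -> L2r a u2' -> L2r a p' ->
  rweak a b j u1 u2 p -> rweak a b j u1' u2' p' ->
  rweak a b j (fun z => x * u1 z + y * u1' z) (fun z => x * u2 z + y * u2' z) (fun z => x * p z + y * p' z).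
Proof.
move=> L1 L2 Lp L1' L2' Lp' w w' phi tp; have [cp _] := csupp_test tp.
have i1 := itg_test2d Lp cp; have i2 := itg_test2d Lp' cp.
have i3 := rweak_csupp b j tp L1 L2; have i4 := rweak_csupp b j tp L1' L2'.
transitivity (\int[leb2]_(z in dom a) (x * (p z * phi z) + y * (p' z * phi z))).
  by apply: Rint_ext => z _; ring.
rewrite (RintD (itgZ x i1) (itgZ y i2)) (RintZ x i1) (RintZ y i2) (w phi tp) (w' phi tp).
rewrite -(RintZ x i3) -(RintZ y i4) -(RintD (itgZ x i3) (itgZ y i4)).
by apply: Rint_ext => z _; ring.
Qed.

Lemma L2r_eq a g h : g =1 h -> L2r a g -> L2r a h.
Proof. by move=> /funext <-. Qed.

Lemma L2Z a (c : R[i]) (u : pt -> R[i]) : L2 (dom a) u -> L2 (dom a) (fun z => c * u z).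
Proof.
case: c => x y /L2_L2r[ur ui]; apply/L2_L2r; split.
  by apply: (L2r_eq _ (L2r_lin x (- y) ur ui)) => z; case: (u z) => ? ? /=; ring.
by apply: (L2r_eq _ (L2r_lin y x ur ui)) => z; case: (u z) => ? ? /=; ring.
Qed.

Lemma L2D a (u v : pt -> R[i]) : L2 (dom a) u -> L2 (dom a) v -> L2 (dom a) (fun z => u z + v z).
Proof.
move=> /L2_L2r[ur ui] /L2_L2r[vr vi]; apply/L2_L2r; split.
  by apply: (L2r_eq _ (L2r_lin 1 1 ur vr)) => z; case: (u z) (v z) => ? ? [? ?] /=; ring.
by apply: (L2r_eq _ (L2r_lin 1 1 ui vi)) => z; case: (u z) (v z) => ? ? [? ?] /=; ring.
Qed.

Lemma L20 a : L2 (dom a) (fun=> 0 : R[i]).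
Proof.
have L0 : L2r a (fun=> 0).
  split; first exact: measurable_cst.
  by apply: itg_ext (itg0 leb2 (measurable_dom a)) => z _; rewrite expr0n.
exact/L2_L2r.
Qed.

Lemma L2_sum a n (u : 'I_n -> pt -> R[i]) : (forall i, L2 (dom a) (u i)) ->
  L2 (dom a) (fun z => \sum_(i < n) u i z).
Proof.
elim: n u => [|n IH] u H; first by under eq_fun do rewrite big_ord0; exact: L20.
by under eq_fun do rewrite big_ord_recr /=; apply: L2D => //; exact: IH.
Qed.

Definition wmom a b j (u v : pt -> R[i]) := [/\ L2 (dom a) u, L2 (dom a) v & weak_momentum (dom a) b j u v].

Lemma wmomZ a b j (c : R[i]) (u v : pt -> R[i]) : wmom a b j u v -> wmom a b j (fun z => c * u z) (fun z => c * v z).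
Proof.
move=> [Lu Lv /weak_rweak[w1 w2]].
have [ur ui] := (L2_L2r a u).1 Lu; have [vr vi] := (L2_L2r a v).1 Lv; case: c => x y.
have LN := L2rN ur.
have ReE (w : pt -> R[i]) z : complex.Re (Complex x y * w z) = x * complex.Re (w z) + - y * complex.Im (w z).
  by case: (w z) => ? ? /=; ring.
have ImE (w : pt -> R[i]) z : complex.Im (Complex x y * w z) = y * complex.Re (w z) + x * complex.Im (w z).
  by case: (w z) => ? ? /=; ring.
split; [exact: L2Z|exact: L2Z|].
apply: rweak_weak.
  apply: rweak_ext (rweak_lin x (- y) ur ui vr ui LN vi w1 w2) => z; rewrite ?ReE ?ImE//.
  by rewrite mulrNN addrC.
apply: rweak_ext (rweak_lin y x ur ui vr ui LN vi w1 w2) => z; rewrite ?ReE ?ImE//; ring.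
Qed.

Lemma wmomD a b j (u v u' v' : pt -> R[i]) : wmom a b j u v -> wmom a b j u' v' ->
  wmom a b j (fun z => u z + u' z) (fun z => v z + v' z).
Proof.
move=> [Lu Lv /weak_rweak[w1 w2]] [Lu' Lv' /weak_rweak[w1' w2']].
have [ur ui] := (L2_L2r a u).1 Lu; have [vr vi] := (L2_L2r a v).1 Lv.
have [ur' ui'] := (L2_L2r a u').1 Lu'; have [vr' vi'] := (L2_L2r a v').1 Lv'.
have ReE (w w' : pt -> R[i]) z : complex.Re (w z + w' z) = 1 * complex.Re (w z) + 1 * complex.Re (w' z).
  by case: (w z) (w' z) => ? ? [? ?] /=; ring.
have ImE (w w' : pt -> R[i]) z : complex.Im (w z + w' z) = 1 * complex.Im (w z) + 1 * complex.Im (w' z).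
  by case: (w z) (w' z) => ? ? [? ?] /=; ring.
split; [exact: L2D|exact: L2D|].
apply: rweak_weak.
  by apply: rweak_ext (rweak_lin 1 1 ur ui vr ur' ui' vr' w1 w1') => z; rewrite ?ReE ?ImE.
apply: rweak_ext (rweak_lin 1 1 ui (L2rN ur) vi ui' (L2rN ur') vi' w2 w2') => z; rewrite ?ReE ?ImE//.
ring.
Qed.

Lemma wmom0 a b j : wmom a b j (fun=> 0) (fun=> 0).
Proof.
split; [exact: L20|exact: L20|] => phi tp; rewrite /cintegral; congr Complex; apply: Rint_ext => z _ /=; ring.
Qed.

Lemma wmom_sum a b j n (c : 'I_n -> R[i]) (u v : 'I_n -> pt -> R[i]) :
  (forall i, wmom a b j (u i) (v i)) ->
  wmom a b j (fun z => \sum_(i < n) c i * u i z) (fun z => \sum_(i < n) c i * v i z).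
Proof.
elim: n c u v => [|n IH] c u v H.
  under eq_fun do rewrite big_ord0.
  under [X in wmom _ _ _ _ X]eq_fun do rewrite big_ord0.
  exact: wmom0.
under eq_fun do rewrite big_ord_recr /=.
under [X in wmom _ _ _ _ X]eq_fun do rewrite big_ord_recr /=.
by apply: wmomD; [exact: IH|exact: wmomZ].
Qed.

Lemma momentum_wmom a b (u : pt -> R[i]) j : H1A (dom a) b u -> wmom a b j u (momentum (dom a) b j u).
Proof. by move=> Hu; have [Lu _] := Hu; have [Lv w] := momentumP j Hu. Qed.

(** [momentum] is picked by choice. Two weak momenta of the same function agree almost everywhere,
    so any explicit one may be used to compute the form. *)
Lemma L2sqnorm_momentum a b j (u v : pt -> R[i]) : 0 < a -> wmom a b j u v -> H1A (dom a) b u ->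
  L2sqnorm (dom a) (momentum (dom a) b j u) = L2sqnorm (dom a) v.
Proof.
move=> a0 [Lu Lv wv] Hu; have [Lm wm] := momentumP j Hu.
move: (momentum _ _ _ _) Lm wm => v' Lm wm.
rewrite (L2sqnormE Lm) (L2sqnormE Lv).
have [vr vi] := (L2_L2r a v).1 Lv; have [vr' vi'] := (L2_L2r a v').1 Lm.
have [r1 i1] := weak_rweak wv; have [r2 i2] := weak_rweak wm.
have eqI (u1 u2 p p' : pt -> R) : L2r a p -> L2r a p' -> rweak a b j u1 u2 p -> rweak a b j u1 u2 p' ->
    \int[leb2]_(z in dom a) (p' z ^+ 2) = \int[leb2]_(z in dom a) (p z ^+ 2).
  move=> Lp Lp' w w'; have Ld := L2r_lin 1 (-1) Lp Lp'.
  have /Rint_eq0_ae H : \int[leb2]_(z in dom a) ((1 * p z + -1 * p' z) ^+ 2) = 0.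
    apply: L2r_test0 => // phi tp; have [cp _] := csupp_test tp.
    have j1 := itg_test2d Lp cp; have j2 := itg_test2d Lp' cp.
    transitivity (\int[leb2]_(z in dom a) (p z * phi z - p' z * phi z)).
      by apply: Rint_ext => z _; ring.
    by rewrite (RintB j1 j2) (w phi tp) (w' phi tp) subrr.
  have {H} := H Ld.2 (fun z _ => sqr_ge0 _).
  move: Lp Lp' => [mp ip] [mp' ip'] H; apply: Rint_ae.
  - exact: measurable_dom.
  - exact: itg_measurable ip'.
  - exact: itg_measurable ip.
  apply: ae_imp H => z H Dz; have /eqP := H Dz.
  by rewrite sqrf_eq0 mul1r mulN1r subr_eq0 => /eqP ->.
by rewrite (eqI _ _ _ _ vr vr' r1 r2) (eqI _ _ _ _ vi vi' i1 i2).
Qed.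

Lemma wmom_qform a b (u : pt -> R[i]) (v : 'I_2 -> pt -> R[i]) : 0 < a -> (forall j, wmom a b j u (v j)) ->
  H1A (dom a) b u /\ qform (dom a) b u = L2sqnorm (dom a) (v 0) + L2sqnorm (dom a) (v 1).
Proof.
move=> a0 H; have Hu : H1A (dom a) b u.
  by split; [have [] := H 0|move=> j; have [_ Lv w] := H j; exists (v j)].
split => //; transitivity (\sum_(j < 2) L2sqnorm (dom a) (v j)).
  by apply: eq_bigr => j _; exact: L2sqnorm_momentum a0 (H j) Hu.
rewrite big_ord_recl big_ord1.
congr (L2sqnorm _ (v _) + L2sqnorm _ (v _)); exact: val_inj.
Qed.

End weak_momentum_calculus.

(** * Integration by parts against test functions of the exterior domain *)

Section integration_by_parts.
Context {R : realType}.
Local Notation pt := (R * R)%type.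
Local Notation leb := (@lebesgue_measure R).
Local Notation leb2 := (leb \x leb)%E.
Local Notation "'I[ a ,oo]" := (`]a, +oo[%classic : set R) (at level 0, format "''I[' a ,oo]").
Implicit Types (f g h p phi : pt -> R) (x z : pt) (n m k : nat) (a b s : R) (j : 'I_2).

Lemma pd_near j f g x d : (\forall z \near x, f z = g z) ->
  is_derive x (basis_vec R j) f d -> is_derive x (basis_vec R j) g d.
Proof.
move=> n0 /is_derive_line df; apply/is_derive_line; apply: is_derive_near df.
have /nbhs_ballP[e /= e0 xe] := n0; apply/nbhs_ballP; exists e => //= t te.
rewrite /line; move: te; rewrite /coord; case: (j == 0) => te; apply: xe.
  by split => //=; exact: ballxx.
by split => //=; exact: ballxx.
Qed.

Lemma near_dom a z : dom a z -> \forall x \near z, dom a x.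
Proof. by move=> Dz; apply: open_nbhs_nbhs; split => //; exact: open_dom. Qed.

Lemma near_off phi z : ~ closure [set x | phi x != 0] z ->
  \forall x \near z, ~ closure [set x | phi x != 0] x.
Proof.
by move=> xs; apply: open_nbhs_nbhs; split => //; apply: closed_openC; exact: closed_closure.
Qed.

Lemma itg_csuppT g : csupp g -> itg leb2 setT g.
Proof.
move=> cg; have [ctg [C gC]] := cg; have [M M0 gM] := csupp_bounded cg.
apply: (itg_le _ (itgZ M (itg_box C))); first exact: continuous_measurable2.
move=> z _; have [zC|zC] := pselect (`|z.1| <= C /\ `|z.2| <= C); last first.
  by rewrite gC// normr0 mulr_ge0// mulr_ge0// indicE ler0n.
have bx (t : R) : `|t| <= C -> `]- (C + 1), C]%classic t.
  rewrite ler_norml /= in_itv/= => /andP[t1 ->]; rewrite andbT; lra.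
by rewrite !indicE !mem_set ?mulr1 ?gM//; apply: bx; case: zC.
Qed.

(** Fubini's theorem with the differentiated variable innermost, and the fundamental theorem of
    calculus on each line. *)
Lemma Rint_pderiv0 j f g : (forall x, is_derive x (basis_vec R j) f (g x)) -> csupp g ->
  (exists B : R, forall z, ~ (`|z.1| <= B /\ `|z.2| <= B) -> f z = 0) ->
  \int[leb2]_(z in setT) g z = 0.
Proof.
move=> df cg [B fB]; have [ctg [C gC]] := cg.
have [_ _ E1 E2] := Rint_Fubini (itg_csuppT cg).
have line0 (F G : R -> R) (A : R) : (forall t : R, is_derive t (1 : R) F (G t)) -> continuous G ->
    (forall t, A < `|t| -> F t = 0) -> (forall t, A < `|t| -> G t = 0) -> \int[leb]_t G t = 0.
  move=> dF cG F0 G0; pose T := `|A| + 1.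
  have AT : A < T by rewrite (le_lt_trans (ler_norm A))// ltrDl.
  have T0 : 0 < T by rewrite ltr_wpDl.
  have TT : - T <= T by rewrite ge0_cp// ltW.
  have -> : \int[leb]_t G t = \int[leb]_(t in `]- T, T]) G t.
    rewrite [RHS]Rintegral_mkcond; apply: Rint_ext => t _; rewrite patchE; case: ifPn => // tT.
    apply: G0; rewrite ltNge; apply/negP => tA; move/negP: tT; apply; apply/mem_set.
    have : `|t| < T := le_lt_trans tA AT.
    by rewrite ltr_norml /= in_itv/= => /andP[-> /ltW].
  rewrite /Rintegral (FTC2_oc TT (fun t _ => dF t) (fun t _ => cG t)) /=.
  by rewrite !F0 ?subrr// ?normrN ger0_norm// ltW.
pose M := Num.max B C.
have out (t r : R) : M < `|t| -> (~ (`|t| <= B /\ `|r| <= B) /\ ~ (`|r| <= B /\ `|t| <= B)) /\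
     (~ (`|t| <= C /\ `|r| <= C) /\ ~ (`|r| <= C /\ `|t| <= C)).
  rewrite gt_max => /andP[tB tC].
  by split; split => -[h1 h2]; move: tB tC; rewrite !ltNge ?h1 ?h2.
have [j0|j1] := eqVneq j 0.
  rewrite E2 -[RHS](@Rint0 _ _ _ leb setT); apply: Rint_ext => y _.
  apply: (line0 (fun t => f (t, y)) (fun t => g (t, y)) M).
  - by move=> t; have /is_derive_line := df (t, y); rewrite /line /coord j0.
  - move=> t; apply: (continuous_comp (f := fun t : R => (t, y))); last exact: ctg.
    move=> A /nbhs_ballP[e e0 eA]; apply/nbhs_ballP; exists e => // t' tt'; apply: eA.
    by split => //=; exact: ballxx.
  - by move=> t tM; have [[h _] _] := out t y tM; exact: fB (t, y) h.
  - by move=> t tM; have [_ [h _]] := out t y tM; exact: gC (t, y) h.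
rewrite E1 -[RHS](@Rint0 _ _ _ leb setT); apply: Rint_ext => y _.
apply: (line0 (fun t => f (y, t)) (fun t => g (y, t)) M).
- by move=> t; have /is_derive_line := df (y, t); rewrite /line /coord (negbTE j1).
- move=> t; apply: (continuous_comp (f := fun t : R => (y, t))); last exact: ctg.
  move=> A /nbhs_ballP[e e0 eA]; apply/nbhs_ballP; exists e => // t' tt'; apply: eA.
  by split => //=; exact: ballxx.
- by move=> t tM; have [[_ h] _] := out t y tM; exact: fB (y, t) h.
- by move=> t tM; have [_ [_ h]] := out t y tM; exact: gC (y, t) h.
Qed.

(** The support of [phi] is a closed set inside the open domain, so near a point outside the domain
    the product is zero and its extension by zero is continuous. *)
Lemma csupp_cut a phi f g : test_function (dom a) phi -> csupp f ->
  (forall z, ~ closure [set x | phi x != 0] z -> f z = 0) ->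
  (forall z, dom a z -> {for z, continuous g}) -> csupp ((fun z => g z * f z) \_ (dom a)).
Proof.
move=> [_ _ sD] [cf [B fB]] f0 cg; split; last first.
  by exists B => z /fB fz; rewrite patchE fz mulr0; case: ifP.
move=> z; have [Dz|nDz] := pselect (dom a z).
  have H : (fun z => g z * f z) x @[x --> z] --> ((fun z => g z * f z) \_ (dom a)) z.
    by rewrite patchE mem_set//; apply: cvgM; [exact: cg|exact: cf].
  apply: cvg_trans H; apply: near_eq_cvg; apply: filterS (near_dom Dz) => x Dx.
  by rewrite patchE mem_set.
rewrite /continuous_at /prop_for patchE memNset//; apply: cvg_near_cst.
have zs : ~ closure [set x | phi x != 0] z by move=> /sD.
by apply: filterS (near_off zs) => x xs; rewrite patchE f0// mulr0; case: ifP.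
Qed.

Lemma ibp_test a j phi f g : test_function (dom a) phi ->
  (forall z, dom a z -> is_derive z (basis_vec R j) f (g z)) ->
  (forall z, dom a z -> {for z, continuous f}) -> (forall z, dom a z -> {for z, continuous g}) ->
  itg leb2 (dom a) (fun z => g z * phi z + f z * pderiv j phi z) /\
  \int[leb2]_(z in dom a) (g z * phi z + f z * pderiv j phi z) = 0.
Proof.
move=> tp df cf cg; have [cp cdp] := csupp_test tp; have [_ _ sD] := tp.
have p0 z : ~ closure [set x | phi x != 0] z -> phi z = 0.
  move=> zs; apply/eqP/negPn/negP => zn; apply: zs; exact: subset_closure.
have dp0 z : ~ closure [set x | phi x != 0] z -> pderiv j phi z = 0.
  by move=> zs; exact: pderivE (pderiv_off _ zs).
have c1 := csupp_cut tp cp p0 cg; have c2 := csupp_cut tp (cdp j) dp0 cf.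
pose G := (fun z => g z * phi z + f z * pderiv j phi z) \_ (dom a).
have cG : csupp G.
  have -> : G = (fun z => ((fun z => g z * phi z) \_ (dom a)) z + ((fun z => f z * pderiv j phi z) \_ (dom a)) z).
    by apply/funext => z; rewrite /G !patchE; case: ifP => _; rewrite ?addr0.
  exact: csuppD.
have iG : itg leb2 setT G := itg_csuppT cG.
split; first exact: (itg_mkcond leb2 _ (@measurable_dom R a)).2.
rewrite Rintegral_mkcond -/G.
apply: (Rint_pderiv0 (j := j) (f := (fun z => f z * phi z) \_ (dom a))) => //; last first.
  by have [_ [B pB]] := cp; exists B => z /pB pz; rewrite patchE pz mulr0; case: ifP.
move=> z; have [Dz|nDz] := pselect (dom a z).
  rewrite /G patchE mem_set//; apply: (pd_near (f := fun z => f z * phi z)).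
    by apply: filterS (near_dom Dz) => x Dx; rewrite patchE mem_set.
  exact: pd_mul (df z Dz) (test_grad j z tp).
rewrite /G patchE memNset//.
have d0 : is_derive z (basis_vec R j) (fun=> 0 : R) 0 by exact: pd_cst.
apply: pd_near d0.
have zs : ~ closure [set x | phi x != 0] z by move=> /sD.
by apply: filterS (near_off zs) => x xs; rewrite patchE p0// mulr0; case: ifP.
Qed.

(** The real part of the momentum is d_j [u2] - b A_j [u1], so only the second component has to be
    differentiable. *)
Lemma rweak_C1 a b j (u1 u2 p du2 : pt -> R) : 0 < a -> L2r a u1 -> L2r a u2 ->
  (forall z, dom a z -> is_derive z (basis_vec R j) u2 (du2 z)) ->
  (forall z, dom a z -> {for z, continuous u2}) -> (forall z, dom a z -> {for z, continuous du2}) ->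
  (forall z, dom a z -> p z = du2 z - b * vecpot j z * u1 z) -> rweak a b j u1 u2 p.
Proof.
move=> a0 L1 L2 du cu cdu pE phi tp.
have [i1 I1] := ibp_test tp du cu cdu.
have i2 := rweak_csupp b j tp L1 L2.
transitivity (\int[leb2]_(z in dom a) ((du2 z * phi z + u2 z * pderiv j phi z) +
   (- (u2 z * pderiv j phi z) - b * vecpot j z * phi z * u1 z))).
  by apply: Rint_ext => z Dz; rewrite pE//; ring.
by rewrite (RintD i1 i2) I1 add0r.
Qed.

End integration_by_parts.

(** * Trial functions with finitely many angular modes *)

Section trial_modes.
Context {R : realType}.
Local Notation pt := (R * R)%type.
Local Notation leb := (@lebesgue_measure R).
Local Notation leb2 := (leb \x leb)%E.
Local Notation J := (`](- (pi / 2)), (3 * pi / 2)[%classic : set R).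
Local Notation "'I[ a ,oo]" := (`]a, +oo[%classic : set R) (at level 0, format "''I[' a ,oo]").
Local Notation cRe u := (fun z => complex.Re (u z)).
Local Notation cIm u := (fun z => complex.Im (u z)).
Implicit Types (x z : pt) (n m k : nat) (a b s t : R) (j : 'I_2) (h : R -> R).

Definition modef m h z : R[i] := Complex (zc m z * h (nsq z)) (zs m z * h (nsq z)).

Lemma measurable_nsq_comp h : measurable_fun setT h -> measurable_fun setT (fun z : pt => h (nsq z)).
Proof. by move=> mh; exact: (measurableT_comp mh (continuous_measurable2 (@continuous_nsq R))). Qed.

Lemma continuous_zcs m : continuous (@zc R m) /\ continuous (@zs R m).
Proof. by have [s1 s2] := @sm2_zcs R m 0. Qed.

Lemma modef_L2 a m h : 0 <= a -> measurable_fun setT h ->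
  itg leb 'I[a,oo] (fun s => s ^+ m * h s ^+ 2) -> L2 (dom a) (modef m h).
Proof.
move=> a0 mh ih; have [cc cs] := continuous_zcs m.
have h0 s : a < s -> 0 <= s ^+ m * h s ^+ 2.
  by move=> as1; rewrite mulr_ge0 ?sqr_ge0// exprn_ge0// (le_trans a0 (ltW as1)).
have mk (k : pt -> R) : continuous k -> measurable_fun (dom a) (fun z => k z * h (nsq z)).
  move=> ck; apply: measurable_funTS; apply: measurable_funM; first exact: continuous_measurable2.
  exact: measurable_nsq_comp.
apply/L2_L2r; split.
  apply: (L2r_radial a0 (mk _ cc) ih) => // z _.
  by rewrite exprMn ler_wpM2r ?sqr_ge0// -zcs_sqr lerDl sqr_ge0.
apply: (L2r_radial a0 (mk _ cs) ih) => // z _.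
by rewrite exprMn ler_wpM2r ?sqr_ge0// -zcs_sqr lerDr sqr_ge0.
Qed.

(** Places the coefficients at the frequencies m0, m0 + 1 and so on. When m0 > 0 the constant mode
    is avoided, and cosines and sines all have squared norm pi. *)
Definition shift_coef m0 (al : nat -> R) n := if (n < m0)%N then 0 else al (n - m0)%N.

Lemma trigp_shift k m0 (al be : nat -> R) t :
  trigp (m0 + k) (shift_coef m0 al) (shift_coef m0 be) t =
  \sum_(i < k) (al i * cos ((m0 + i)%:R * t) + be i * sin ((m0 + i)%:R * t)).
Proof.
rewrite /trigp big_split_ord /= big1 ?add0r => [|i _].
  by apply: eq_bigr => i _; rewrite /shift_coef ltnNge leq_addr /= addKn.
by rewrite /shift_coef ltn_ord !mul0r addr0.
Qed.

Lemma Rint_J_modes k m0 (al be : nat -> R) : (0 < m0)%N ->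
  \int[leb]_(t in J) (trigp (m0 + k) (shift_coef m0 al) (shift_coef m0 be) t ^+ 2) =
  pi * \sum_(i < k) (al i ^+ 2 + be i ^+ 2).
Proof.
move=> m00; rewrite Rintegral_J_trigp_sqr big_split_ord /= big1 ?add0r => [|i _]; last first.
  by rewrite /shift_coef ltn_ord expr0n !mul0r addr0.
rewrite mulr_sumr; apply: eq_bigr => i _.
rewrite /shift_coef ltnNge leq_addr /= addKn /wc /ws addn_eq0 (gtn_eqF m00) /=; ring.
Qed.

Lemma Re_sum n (F : 'I_n -> R[i]) : complex.Re (\sum_(i < n) F i) = \sum_(i < n) complex.Re (F i).
Proof. by apply: (big_morph (@complex.Re R)) => // -[? ?] [? ?]. Qed.

Lemma Im_sum n (F : 'I_n -> R[i]) : complex.Im (\sum_(i < n) F i) = \sum_(i < n) complex.Im (F i).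
Proof. by apply: (big_morph (@complex.Im R)) => // -[? ?] [? ?]. Qed.

Lemma L2_itg a (u : pt -> R[i]) : L2 (dom a) u -> itg leb2 (dom a) (fun z => sqnormC (u z)).
Proof. by move=> [_ _ iu]; split => //; exact: measurable_dom. Qed.

(** Different frequencies are orthogonal on every circle, so the norm is diagonal in the
    coefficients. The factor pi is the Jacobian 1 / 2 times the squared norm 2 pi of e^(i m t). *)
Lemma modes_sqnorm a k m0 (h : nat -> R -> R) (c : nat -> R[i]) : 0 <= a -> (0 < m0)%N ->
  (forall i, measurable_fun setT (h i)) ->
  (forall i, itg leb 'I[a,oo] (fun s => s ^+ (m0 + i) * h i s ^+ 2)) ->
  let u z := \sum_(i < k) c i * modef (m0 + i) (h i) z in
  L2 (dom a) u /\ L2sqnorm (dom a) u =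
    pi * \sum_(i < k) sqnormC (c i) * \int[leb]_(s in 'I[a,oo]) (s ^+ (m0 + i) * h i s ^+ 2).
Proof.
move=> a0 m00 mh ih u.
have Lu : L2 (dom a) u by apply: L2_sum => i; apply: L2Z; exact: modef_L2.
split => //; rewrite /L2sqnorm; have [_ _ ->] := polar_Rint a0 (L2_itg Lu).
have mI : measurable 'I[a,oo] by exact: measurable_itv.
transitivity (2^-1 * \int[leb]_(s in 'I[a,oo]) \sum_(i < k) (2 * pi * sqnormC (c i)) * (s ^+ (m0 + i) * h i s ^+ 2)).
  congr (_ * _); apply: Rint_ext => s; rewrite /= in_itv/= andbT => as1.
  have s0 : 0 <= s := le_trans a0 (ltW as1).
  pose g i := Num.sqrt s ^+ (m0 + i) * h i s.
  pose x i := complex.Re (c i); pose y i := complex.Im (c i).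
  pose P := trigp (m0 + k) (shift_coef m0 (fun i => g i * x i)) (shift_coef m0 (fun i => - (g i * y i))).
  pose Q := trigp (m0 + k) (shift_coef m0 (fun i => g i * y i)) (shift_coef m0 (fun i => g i * x i)).
  have iJ A B : itg leb J (fun t => trigp (m0 + k) A B t ^+ 2).
    by apply: continuous_integrable_J => t; apply: cvgM; exact: continuous_trigp.
  transitivity (\int[leb]_(t in J) (P t ^+ 2 + Q t ^+ 2)).
    apply: Rint_ext => t _; rewrite /sqnormC /u Re_sum Im_sum /P /Q !trigp_shift.
    congr (_ ^+ 2 + _ ^+ 2); apply: eq_bigr => i _; rewrite /modef nsq_polar//;
    have [-> ->] := zcs_polar (m0 + i) s t; rewrite /x /y /g; case: (c i) => cx cy /=; ring.
  rewrite (RintD (iJ _ _) (iJ _ _)) !Rint_J_modes// -mulrDr -big_split /= mulr_sumr.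
  apply: eq_bigr => i _; rewrite /sqnormC -/(x i) -/(y i).
  have -> : s ^+ (m0 + i) * h i s ^+ 2 = g i ^+ 2.
    by rewrite /g exprMn -exprM mulnC exprM sqr_sqrtr.
  by move: (g i) (x i) (y i) => G X Y; ring.
have -> : \int[leb]_(s in 'I[a,oo]) \sum_(i < k) (2 * pi * sqnormC (c i)) * (s ^+ (m0 + i) * h i s ^+ 2) =
    \sum_(i < k) \int[leb]_(s in 'I[a,oo]) ((2 * pi * sqnormC (c i)) * (s ^+ (m0 + i) * h i s ^+ 2)).
  exact: (@Rint_sum _ _ _ leb _ _ (fun (i : 'I_k) s => (2 * pi * sqnormC (c i)) * (s ^+ (m0 + i) * h i s ^+ 2)) mI
    (fun i => itgZ _ (ih i))).
rewrite !mulr_sumr; apply: eq_bigr => i _; rewrite (RintZ _ (ih i)).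
move: (\int[_]_(_ in _) _) (sqnormC _) => X Y.
by rewrite -!mulrA mulKf ?pnatr_eq0.
Qed.

(** The classical value of (- i d_j - b A_j) applied to z^m [h] (|z|^2); [wmom_modef] shows that it
    is the weak one. *)
Definition momf b m h h' j z : R[i] := Complex
  (Czs m j z * h (nsq z) + zs m z * (2 * coord j z * h' (nsq z)) - b * vecpot j z * (zc m z * h (nsq z)))
  (- (Czc m j z * h (nsq z) + zc m z * (2 * coord j z * h' (nsq z))) - b * vecpot j z * (zs m z * h (nsq z))).

(** The profiles that result from z^m h(|z|^2) under r d_r and, for [ang_profile], under the angular
    component of the momentum times r. Both operators keep the factor z^m. *)
Definition rad_profile m h h' s := m%:R * h s + 2 * s * h' s.
Definition ang_profile b m h s := (m%:R - b * s / 2) * h s.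

Lemma Czcs_euler m z :
  [/\ z.1 * Czc m 0 z + z.2 * Czc m 1 z = m%:R * zc m z,
      z.1 * Czc m 1 z - z.2 * Czc m 0 z = - (m%:R * zs m z),
      z.1 * Czs m 0 z + z.2 * Czs m 1 z = m%:R * zs m z &
      z.1 * Czs m 1 z - z.2 * Czs m 0 z = m%:R * zc m z].
Proof.
rewrite /Czc /Czs /=; case: m => [|m]; first by rewrite !(mul0r, oppr0, mulr0, addr0).
rewrite /=; split; ring.
Qed.

Lemma momf_polar b m h h' z :
  z.1%:C%C * momf b m h h' 0 z + z.2%:C%C * momf b m h h' 1 z = - 'i * modef m (rad_profile m h h') z /\
  z.1%:C%C * momf b m h h' 1 z - z.2%:C%C * momf b m h h' 0 z = modef m (ang_profile b m h) z.
Proof.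
have [c1 c2 s1 s2] := Czcs_euler m z.
rewrite /momf /modef /rad_profile /ang_profile /vecpot /coord /=.
move: (Czc m 0 z) (Czc m 1 z) (Czs m 0 z) (Czs m 1 z) c1 c2 s1 s2 => C0 C1 S0 S1 c1 c2 s1 s2.
have nE : nsq z = z.1 * z.1 + z.2 * z.2 by rewrite /nsq !expr2.
move: (zc m z) (zs m z) (h (nsq z)) (h' (nsq z)) c1 c2 s1 s2 => c s' H H' c1 c2 s1 s2; rewrite nE.
split; congr Complex.
- transitivity ((z.1 * S0 + z.2 * S1) * H + s' * 2 * (z.1 * z.1 + z.2 * z.2) * H'); first by field.
  by rewrite s1; ring.
- transitivity (- ((z.1 * C0 + z.2 * C1) * H + c * 2 * (z.1 * z.1 + z.2 * z.2) * H')); first by field.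
  by rewrite c1; ring.
- transitivity ((z.1 * S1 - z.2 * S0) * H - b / 2 * (z.1 * z.1 + z.2 * z.2) * (c * H)); first by field.
  by rewrite s2; field.
- transitivity (- (z.1 * C1 - z.2 * C0) * H - b / 2 * (z.1 * z.1 + z.2 * z.2) * (s' * H)); first by field.
  by rewrite c2; field.
Qed.

Lemma sqnormC_rot (v0 v1 : R[i]) z : 0 < nsq z ->
  sqnormC v0 + sqnormC v1 = (sqnormC (z.1%:C%C * v0 + z.2%:C%C * v1) + sqnormC (z.1%:C%C * v1 - z.2%:C%C * v0)) / nsq z.
Proof.
move=> z0; have z1 : nsq z != 0 by rewrite gt_eqF.
apply: (mulIf z1); rewrite divfK// /sqnormC /nsq.
by case: v0 v1 => p0 q0 [p1 q1] /=; ring.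
Qed.

Lemma sqnormC_modef m h z : sqnormC (modef m h z) = nsq z ^+ m * h (nsq z) ^+ 2.
Proof. by rewrite /sqnormC /modef /= !exprMn -mulrDl zcs_sqr. Qed.

Lemma sqnormCM (v w : R[i]) : sqnormC (v * w) = sqnormC v * sqnormC w.
Proof. by case: v w => ? ? [? ?]; rewrite /sqnormC /=; ring. Qed.

Definition mode_energy b m h h' s :=
  s ^+ m / s * (rad_profile m h h' s ^+ 2 + ang_profile b m h s ^+ 2).

Section C1_profile.
Variables (a b : R) (m : nat) (h h' : R -> R).
Hypotheses (a0 : 0 < a) (mh : measurable_fun setT h) (mh' : measurable_fun setT h').
Hypotheses (dh : forall s, 0 < s -> is_derive s 1 h (h' s)).
Hypotheses (ch' : forall s, 0 < s -> {for s, continuous h'}).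
Hypotheses (ih : itg leb 'I[a,oo] (fun s => s ^+ m * h s ^+ 2)).
Hypotheses (ie : itg leb 'I[a,oo] (mode_energy b m h h')).

Lemma measurable_coord j : measurable_fun setT (@coord R j).
Proof. by apply: continuous_measurable2; exact: continuous_coord. Qed.

Lemma continuous_Czcs j : continuous (@Czc R m j) /\ continuous (@Czs R m j).
Proof.
have [cc cs] := continuous_zcs m.-1; rewrite /Czc /Czs; case: (j == 0); split => z.
- by apply: cvgM; [exact: cvg_cst|exact: cc].
- by apply: cvgM; [exact: cvg_cst|exact: cs].
- by apply: cvgN; apply: cvgM; [exact: cvg_cst|exact: cs].
- by apply: cvgM; [exact: cvg_cst|exact: cc].
Qed.

Lemma momf_L2 j : L2 (dom a) (momf b m h h' j).
Proof.
have [cc cs] := continuous_zcs m; have [cCc cCs] := continuous_Czcs j.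
have m1 := measurable_nsq_comp mh; have m2 := measurable_nsq_comp mh'.
have mc := continuous_measurable2 cc; have ms := continuous_measurable2 cs.
have mCc := continuous_measurable2 cCc; have mCs := continuous_measurable2 cCs.
have mv := continuous_measurable2 (@continuous_vecpot R j).
have mj : measurable_fun setT (fun z => 2 * coord j z * h' (nsq z)).
  by apply: measurable_funM => //; apply: measurable_funM => //; exact: measurable_coord.
have e0 s : a < s -> 0 <= mode_energy b m h h' s.
  move=> as1; have s0 := ltW (lt_trans a0 as1).
  by rewrite mulr_ge0 ?divr_ge0 ?exprn_ge0// addr_ge0 ?sqr_ge0.
have bnd z : dom a z -> complex.Re (momf b m h h' j z) ^+ 2 + complex.Im (momf b m h h' j z) ^+ 2
    <= mode_energy b m h h' (nsq z).
  move=> Dz; have z0 : 0 < nsq z := lt_trans a0 Dz.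
  apply: (@le_trans _ _ (sqnormC (momf b m h h' 0 z) + sqnormC (momf b m h h' 1 z))).
    have [-> |j1] := eqVneq j 0; first by rewrite lerDl addr_ge0 ?sqr_ge0.
    have -> : j = 1 by clear -j1; apply/val_inj; case: j j1 => -[|[|]].
    by rewrite lerDr addr_ge0 ?sqr_ge0.
  rewrite (sqnormC_rot _ _ z0); have [-> ->] := momf_polar b m h h' z.
  rewrite sqnormCM !sqnormC_modef /mode_energy.
  rewrite (_ : sqnormC (- 'i)%C = 1); last by rewrite /sqnormC /= oppr0 expr0n add0r sqrrN expr1n.
  by rewrite mul1r -mulrDr mulrAC.
apply/L2_L2r; split.
- apply: (L2r_radial (ltW a0) _ ie) => //.
    apply: measurable_funTS; apply: measurable_funB; last by apply: measurable_funM; apply: measurable_funM.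
    by apply: measurable_funD; apply: measurable_funM.
  by move=> z /bnd; apply: le_trans; rewrite lerDl sqr_ge0.
- apply: (L2r_radial (ltW a0) _ ie) => //.
    apply: measurable_funTS; apply: measurable_funB; last by apply: measurable_funM; apply: measurable_funM.
    by apply: measurableT_comp => //; apply: measurable_funD; apply: measurable_funM.
  by move=> z /bnd; apply: le_trans; rewrite lerDr sqr_ge0.
Qed.

Let cts (k : pt -> R) (g : R -> R) z : continuous k -> {for nsq z, continuous g} ->
  {for z, continuous (fun z => k z * g (nsq z))}.
Proof.
move=> ck cg; apply: cvgM; first exact: ck.
apply: (continuous_comp (f := nsq) (g := g)) => //; exact: continuous_nsq.
Qed.

Lemma wmom_modef j : wmom a b j (modef m h) (momf b m h h' j).
Proof.
have Lu := modef_L2 (ltW a0) mh ih; have Lv := momf_L2 j.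
have [ur ui] := (L2_L2r a _).1 Lu; have [vr vi] := (L2_L2r a _).1 Lv.
have [cc cs] := continuous_zcs m; have [cCc cCs] := continuous_Czcs j.
have [gc gs] := @grad_zcs R m.
have pos z : dom a z -> 0 < nsq z by exact: lt_trans.
have ch z : dom a z -> {for nsq z, continuous h} by move=> /pos z0; exact: is_derive_continuous (dh z0).
have dU (k Ck : pt -> R) z : (forall x, is_derive x (basis_vec R j) k (Ck x)) -> dom a z ->
    is_derive z (basis_vec R j) (fun z => k z * h (nsq z))
      (Ck z * h (nsq z) + k z * (2 * coord j z * h' (nsq z))).
  by move=> dk /pos z0; exact: pd_mul (dk z) (pd_comp (pd_nsq j z) (dh z0)).
have cdU (k Ck : pt -> R) z : continuous k -> continuous Ck -> dom a z ->
    {for z, continuous (fun z => Ck z * h (nsq z) + k z * (2 * coord j z * h' (nsq z)))}.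
  move=> ck cCk Dz; apply: cvgD; first by apply: cts => //; exact: ch.
  apply: cvgM; first exact: ck.
  apply: cts; last exact: ch' (pos _ Dz).
  by move=> x; apply: cvgM; [exact: cvg_cst|exact: continuous_coord].
split => //; apply: rweak_weak.
  apply: (rweak_C1 (du2 := fun z => Czs m j z * h (nsq z) + zs m z * (2 * coord j z * h' (nsq z))) a0 ur ui).
  - by move=> z Dz; exact: dU (gs j) Dz.
  - by move=> z Dz; apply: cts => //; exact: ch.
  - by move=> z Dz; exact: cdU.
  - by [].
have L1 := L2rN ur.
apply: (rweak_C1 (du2 := fun z => - (Czc m j z * h (nsq z) + zc m z * (2 * coord j z * h' (nsq z)))) a0 ui L1).
- move=> z Dz; have d := pd_mul (pd_cst j (-1) z) (dU _ _ _ (gc j) Dz).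
  rewrite mul0r add0r mulN1r in d.
  have E : (fun z => -1 * (zc m z * h (nsq z))) = (fun z => - complex.Re (modef m h z)).
    by apply/funext => x; rewrite mulN1r.
  by rewrite E in d.
- by move=> z Dz; apply: cvgN; apply: cts => //; exact: ch.
- by move=> z Dz; apply: cvgN; exact: cdU.
- by [].
Qed.

End C1_profile.

(** In the radial frame both components of the momentum are again sums of single modes, so the form
    is diagonal together with the norm. The division of the profiles by sqrt s accounts for the
    normalisation of the frame. *)
Lemma trial_form a b k m0 (h h' : nat -> R -> R) (c : nat -> R[i]) : 0 < a -> (0 < m0)%N ->
  (forall i, measurable_fun setT (h i)) -> (forall i, measurable_fun setT (h' i)) ->
  (forall i s, 0 < s -> is_derive s 1 (h i) (h' i s)) ->
  (forall i s, 0 < s -> {for s, continuous (h' i)}) ->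
  (forall i, itg leb 'I[a,oo] (fun s => s ^+ (m0 + i) * h i s ^+ 2)) ->
  (forall i, itg leb 'I[a,oo] (mode_energy b (m0 + i) (h i) (h' i))) ->
  let u z := \sum_(i < k) c i * modef (m0 + i) (h i) z in
  [/\ H1A (dom a) b u,
    L2sqnorm (dom a) u = pi * \sum_(i < k) sqnormC (c i) * \int[leb]_(s in 'I[a,oo]) (s ^+ (m0 + i) * h i s ^+ 2) &
    qform (dom a) b u = pi * \sum_(i < k) sqnormC (c i) * \int[leb]_(s in 'I[a,oo]) mode_energy b (m0 + i) (h i) (h' i) s].
Proof.
move=> a0 m00 mh mh' dh ch' ih ie u; have a0' := ltW a0.
pose v j z := \sum_(i < k) c i * momf b (m0 + i) (h i) (h' i) j z.
have W j : wmom a b j u (v j).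
  apply: (wmom_sum (fun i : 'I_k => c i) (u := fun i : 'I_k => modef (m0 + i) (h i))
    (v := fun i : 'I_k => momf b (m0 + i) (h i) (h' i) j)) => i.
  exact: (wmom_modef a0 (mh i) (mh' i) (dh i) (ch' i) (ih i) (ie i)).
have [Hu ->] := wmom_qform a0 W.
have [_ Nu] := modes_sqnorm k c a0' m00 mh ih; split => //.
pose hr i s := rad_profile (m0 + i) (h i) (h' i) s / Num.sqrt s.
pose ha i s := ang_profile b (m0 + i) (h i) s / Num.sqrt s.
have msq : measurable_fun setT (fun s : R => (Num.sqrt s)^-1).
  by apply: (measurableT_comp (@measurable_invr R)); exact: measurable_sqrt.
have mhr i : measurable_fun setT (hr i).
  apply: measurable_funM => //; apply: measurable_funD.
    by apply: measurable_funM; [exact: measurable_cst|exact: mh].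
  apply: measurable_funM; last exact: mh'.
  by apply: measurable_funM.
have mha i : measurable_fun setT (ha i).
  apply: measurable_funM => //; apply: measurable_funM => //; apply: measurable_funB => //.
  by do 2?apply: measurable_funM => //.
have eE i s : 'I[a,oo] s -> s ^+ (m0 + i) * hr i s ^+ 2 + s ^+ (m0 + i) * ha i s ^+ 2 =
    mode_energy b (m0 + i) (h i) (h' i) s.
  rewrite /= in_itv/= andbT => as1; have s0 := lt_trans a0 as1.
  rewrite /hr /ha !expr_div_n sqr_sqrtr ?ltW// /mode_energy.
  by move: (rad_profile _ _ _ _) (ang_profile _ _ _ _) (s ^+ _) => A B S; field; rewrite gt_eqF.
have pos s : 'I[a,oo] s -> 0 <= s by rewrite /= in_itv/= andbT => as1; exact: ltW (lt_trans a0 as1).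
have mIh (g : R -> R) n : measurable_fun setT g -> measurable_fun 'I[a,oo] (fun s => s ^+ n * g s ^+ 2).
  by move=> mg; apply: measurable_funTS; apply: measurable_funM => //; exact: measurable_funX.
have nn (g : R -> R) n s : 'I[a,oo] s -> 0 <= s ^+ n * g s ^+ 2.
  by move=> Is; exact: mulr_ge0 (exprn_ge0 _ (pos s Is)) (sqr_ge0 _).
have ihr i : itg leb 'I[a,oo] (fun s => s ^+ (m0 + i) * hr i s ^+ 2).
  apply: (@itg_le _ _ _ leb _ _ _ (mIh _ _ (mhr i)) (ie i)) => s Is.
  rewrite (ger0_norm (nn (hr i) (m0 + i)%N s Is)).
  by rewrite -(eE i s Is) lerDl; exact: nn (ha i) _ _ Is.
have iha i : itg leb 'I[a,oo] (fun s => s ^+ (m0 + i) * ha i s ^+ 2).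
  apply: (@itg_le _ _ _ leb _ _ _ (mIh _ _ (mha i)) (ie i)) => s Is.
  rewrite (ger0_norm (nn (ha i) (m0 + i)%N s Is)).
  by rewrite -(eE i s Is) lerDr; exact: nn (hr i) _ _ Is.
have [Lr Nr] := modes_sqnorm k c a0' m00 mhr ihr.
have [La Na] := modes_sqnorm k c a0' m00 mha iha.
have [_ Lv0 _] := W 0; have [_ Lv1 _] := W 1.
have scale (H : nat -> R -> R) z : dom a z ->
    sqnormC (\sum_(i < k) c i * modef (m0 + i) (fun s => H i s / Num.sqrt s) z) =
    sqnormC (\sum_(i < k) c i * modef (m0 + i) (H i) z) / nsq z.
  move=> Dz; have z0 : 0 < nsq z := lt_trans a0 Dz.
  have -> : \sum_(i < k) c i * modef (m0 + i) (fun s => H i s / Num.sqrt s) z =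
      ((Num.sqrt (nsq z))^-1)%:C%C * \sum_(i < k) c i * modef (m0 + i) (H i) z.
    rewrite mulr_sumr; apply: eq_bigr => i _; rewrite /modef; case: (c i) => cx cy.
    by congr Complex; rewrite /=; ring.
  rewrite sqnormCM mulrC; congr (_ * _).
  by rewrite /sqnormC /= expr0n addr0 exprVn sqr_sqrtr// ltW.
transitivity (L2sqnorm (dom a) (fun z => \sum_(i < k) c i * modef (m0 + i) (hr i) z) +
              L2sqnorm (dom a) (fun z => \sum_(i < k) c i * modef (m0 + i) (ha i) z)).
  rewrite /L2sqnorm -(RintD (L2_itg Lv0) (L2_itg Lv1)) -(RintD (L2_itg Lr) (L2_itg La)).
  apply: Rint_ext => z Dz; rewrite (sqnormC_rot _ _ (lt_trans a0 Dz)).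
  rewrite (scale (fun i => rad_profile (m0 + i) (h i) (h' i)) z Dz).
  rewrite (scale (fun i => ang_profile b (m0 + i) (h i)) z Dz) -mulrDl.
  congr ((_ + _) / _).
    have -> : z.1%:C%C * v 0 z + z.2%:C%C * v 1 z =
       - 'i * \sum_(i < k) c i * modef (m0 + i) (rad_profile (m0 + i) (h i) (h' i)) z.
      rewrite /v !mulr_sumr -big_split /=; apply: eq_bigr => i _.
      rewrite (mulrCA (- 'i)%R); have [<- _] := momf_polar b (m0 + i) (h i) (h' i) z.
      by rewrite mulrDr !(mulrCA (c i)).
    rewrite sqnormCM (_ : sqnormC (- 'i)%R = 1) ?mul1r//.
    by rewrite /sqnormC /= oppr0 expr0n add0r sqrrN expr1n.
  congr sqnormC; rewrite /v !mulr_sumr -sumrB; apply: eq_bigr => i _.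
  have [_ <-] := momf_polar b (m0 + i) (h i) (h' i) z.
  by rewrite mulrBr !(mulrCA (c i)).
rewrite Nr Na -mulrDr -big_split /=; congr (_ * _); apply: eq_bigr => i _.
rewrite -mulrDr -(RintD (ihr i) (iha i)); congr (_ * _); apply: Rint_ext => s; exact: eE.
Qed.

End trial_modes.

(** * Radial profiles of the trial functions and their energies *)

Section trial_profile.
Context {R : realType}.
Local Notation leb := (@lebesgue_measure R).
Local Notation "'I[ a , T ]" := (`]a, T]%classic : set R) (at level 0, format "''I[' a ,  T ]").
Local Notation "'I[ a ,oo]" := (`]a, +oo[%classic : set R) (at level 0, format "''I[' a ,oo]").
Implicit Types (n m k : nat) (a b s t : R) (h : R -> R).

(* With [g = a ^+ m] the function [z ^ m * (1 + g / s ^+ m)] satisfies the Neumann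
   condition at [s = a]. *)
Definition tprof (g b : R) m s := (1 + g / s ^+ m) * gweight b s.
Definition tprof' (g b : R) m s :=
  (- (m%:R * g / (s ^+ m * s)) - b / 4 * (1 + g / s ^+ m)) * gweight b s.

Lemma der_gweight b s : is_derive s 1 (gweight b) (- (b / 4) * gweight b s).
Proof.
apply: (is_derive_congr (der_expR (der_opp (der_scale (b / 4) (der_id s))))).
by rewrite mulr1.
Qed.

Lemma der_invX m s : 0 < s -> is_derive s 1 (fun t => (t ^+ m)^-1) (- (m%:R / (s ^+ m * s))).
Proof.
move=> s0; have sm : s ^+ m != 0 by rewrite expf_neq0// gt_eqF.
apply: (is_derive_congr (der_inv (f := fun t => t ^+ m) sm (der_expn m (der_id s)))).
case: m sm => [|m] sm; first by rewrite !mul0r oppr0 mul0r.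
rewrite /= mulr1 mulNr; congr (- _); move: sm; rewrite exprS => sm.
have [s1 s2] : s != 0 /\ s ^+ m != 0 by apply/andP; rewrite -negb_or -mulf_eq0.
by move: (s ^+ m) s2 => S S0; field; rewrite S0 s1.
Qed.

Lemma continuous_invX m s : 0 < s -> {for s, continuous (fun t => (t ^+ m)^-1)} /\
  {for s, continuous (fun t => (t ^+ m * t)^-1)}.
Proof.
move=> s0; have c n := is_derive_continuous (der_invX n s0); split; first exact: c.
rewrite (_ : (fun t => (t ^+ m * t)^-1) = (fun t => (t ^+ m.+1)^-1)); first exact: c.
by apply/funext => t; rewrite exprSr.
Qed.

Lemma der_tprof (g b : R) m s : 0 < s -> is_derive s 1 (tprof g b m) (tprof' g b m s).
Proof.
move=> s0; apply: (is_derive_congr (der_mul (der_add (der_cst 1 s) (der_scale g (der_invX m s0))) (der_gweight b s))).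
by rewrite /tprof'; move: (gweight b s) (s ^+ m)^-1 (s ^+ m * s)^-1 => X Y Z; ring.
Qed.

Lemma continuous_tprof' (g b : R) m s : 0 < s -> {for s, continuous (tprof' g b m)}.
Proof.
move=> s0; apply: cvgM; last exact: is_derive_continuous (der_gweight b s).
have [c1 c2] := continuous_invX m s0.
apply: cvgB.
  apply: cvgN; apply: cvgM; first exact: cvg_cst.
  exact: c2.
apply: cvgM; first exact: cvg_cst.
apply: cvgD; first exact: cvg_cst.
by apply: cvgM; [exact: cvg_cst|exact: c1].
Qed.

Lemma measurable_invX m : measurable_fun setT (fun s : R => (s ^+ m)^-1).
Proof. by apply: (measurableT_comp (@measurable_invr R)); exact: measurable_funX. Qed.

Lemma measurable_tprof (g b : R) m : measurable_fun setT (tprof g b m) /\ measurable_fun setT (tprof' g b m).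
Proof.
have mw := @measurable_gweight R b; have mi := @measurable_invX.
have m1 : measurable_fun setT (fun s : R => 1 + g / s ^+ m).
  by apply: measurable_funD => //; exact: measurable_funM.
split; apply: measurable_funM => //; apply: measurable_funB; last exact: measurable_funM.
apply: measurableT_comp => //; apply: measurable_funM => //.
by have := mi m.+1; under eq_fun do rewrite exprSr.
Qed.

Lemma gweight_sqr b s : gweight b s ^+ 2 = expR (- (b / 2 * s)).
Proof. by rewrite /gweight -expRM_natl; congr expR; field. Qed.

(** The completed square of the one-mode energy, now for f = s^(m / 2) h. The last bracket is the
    derivative of s^m h^2 times 2 (m - b s / 2). *)
Lemma mode_energyE b m h h' s : 0 < s -> mode_energy b m h h' s = b * (s ^+ m * h s ^+ 2) +
  s ^+ m / s * (b * s / 2 * h s + 2 * s * h' s) ^+ 2 +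
  (2 * (- (b / 2)) * (s ^+ m * h s ^+ 2) +
   (m%:R * s ^+ m.-1 * h s ^+ 2 + s ^+ m * (2 * h s * h' s)) * (2 * (m%:R - b / 2 * s))).
Proof.
move=> s0; have sn : s != 0 by rewrite gt_eqF.
have -> : m%:R * s ^+ m.-1 = m%:R * s ^+ m / s.
  by case: m => [|m]; [rewrite !mul0r|rewrite /= exprS mulrA mulrAC mulfK].
rewrite /mode_energy /rad_profile /ang_profile.
move: (s ^+ m) (h s) (h' s) (m%:R : R) => S H H' M; field; exact: sn.
Qed.

Section energy.
Variables (a b g : R) (m : nat).
Hypotheses (a0 : 0 < a) (b0 : 0 < b) (g0 : 0 <= g).
Local Notation h := (tprof g b m).
Local Notation h' := (tprof' g b m).
Let G s := s ^+ m * h s ^+ 2 * (2 * (m%:R - b / 2 * s)).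
Let G' s := 2 * (- (b / 2)) * (s ^+ m * h s ^+ 2) +
   (m%:R * s ^+ m.-1 * h s ^+ 2 + s ^+ m * (2 * h s * h' s)) * (2 * (m%:R - b / 2 * s)).
Let W s := 4 * m%:R ^+ 2 * g ^+ 2 / (s ^+ m * s).

Let pos s : a <= s -> 0 < s. Proof. exact: lt_le_trans. Qed.

Let b2 : 0 < b / 2. Proof. by rewrite divr_gt0. Qed.

Lemma tprof_ge1 s : 0 < s -> 1 <= 1 + g / s ^+ m.
Proof. by move=> s0; rewrite lerDl divr_ge0// exprn_ge0// ltW. Qed.

Lemma tprof_sqr_le s : a <= s -> h s ^+ 2 <= (1 + g / a ^+ m) ^+ 2 * expR (- (b / 2 * s)).
Proof.
move=> as1; have s0 := pos as1; have h1 := tprof_ge1 s0; have h2 := tprof_ge1 a0.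
rewrite [X in X <= _](_ : _ = (1 + g / s ^+ m) ^+ 2 * expR (- (b / 2 * s))); last first.
  by rewrite -gweight_sqr -exprMn.
apply: (ler_wpM2r (expR_ge0 _)); rewrite lerXn2r ?nnegrE ?(le_trans ler01)//.
rewrite lerD2l; apply: (ler_wpM2l g0); rewrite lef_pV2 ?posrE ?exprn_gt0//.
by apply: lerXn2r => //; rewrite nnegrE ltW.
Qed.

Lemma itg_trial_norm : itg leb 'I[a,oo] (fun s => s ^+ m * h s ^+ 2).
Proof.
have [i1 _] := gauss_itg m (ltW a0) b2; have [mh _] := measurable_tprof g b m.
apply: (@itg_le _ _ _ leb _ _ _ _ (itgZ ((1 + g / a ^+ m) ^+ 2) i1)).
  by apply: measurable_funTS; apply: measurable_funM => //; exact: measurable_funX.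
move=> s; rewrite /= in_itv/= andbT => as1; have s0 := lt_trans a0 as1.
have sm : 0 <= s ^+ m by rewrite exprn_ge0// ltW.
rewrite (ger0_norm (mulr_ge0 sm (sqr_ge0 _))) [X in _ <= X]mulrCA.
by apply: (ler_wpM2l sm); apply: tprof_sqr_le; exact: ltW.
Qed.

Let dG s : 0 < s -> is_derive s 1 G (G' s).
Proof.
move=> s0; have dh := der_tprof g b m s0.
apply: (is_derive_congr (der_mul (der_mul (der_expn m (der_id s)) (der_expn 2 dh))
   (der_scale 2 (der_sub (der_cst m%:R s) (der_scale (b / 2) (der_id s)))))).
rewrite /G' /= expr1 mulr1.
by move: (h s) (h' s) (s ^+ m.-1) (s ^+ m) (m%:R : R) (b / 2) => H H' S1 S M B; ring.
Qed.

Let cG' s : 0 < s -> {for s, continuous G'}.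
Proof.
move=> s0; have ch := is_derive_continuous (der_tprof g b m s0).
have ch' := @continuous_tprof' g b m s s0.
have cX n : {for s, continuous (fun t : R => t ^+ n)} by exact: exprn_continuous.
have ch2 : {for s, continuous (fun t => h t ^+ 2)}.
  rewrite (_ : (fun t => h t ^+ 2) = (fun t => h t * h t)); first exact: cvgM.
  by apply/funext => t; rewrite expr2.
apply: cvgD; first by apply: cvgM; [exact: cvg_cst|apply: cvgM; [exact: cX|exact: ch2]].
apply: cvgM; last first.
  by apply: cvgM; [exact: cvg_cst|apply: cvgB; [exact: cvg_cst|apply: cvgM; [exact: cvg_cst|exact: cvg_id]]].
apply: cvgD; apply: cvgM.
- by apply: cvgM; [exact: cvg_cst|exact: cX].
- exact: ch2.
- exact: cX.
- by apply: cvgM; [apply: cvgM; [exact: cvg_cst|exact: ch]|exact: ch'].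
Qed.

Let W_ge0 s : 0 < s -> 0 <= W s.
Proof.
move=> s0; rewrite /W; apply: divr_ge0; last by rewrite mulr_ge0 ?exprn_ge0// ltW.
by rewrite mulr_ge0 ?sqr_ge0// mulr_ge0 ?sqr_ge0.
Qed.

Let W_itg : itg leb 'I[a,oo] W /\ \int[leb]_(s in 'I[a,oo]) W s <= 4 * m%:R * g ^+ 2 / a ^+ m.
Proof.
have [] := @itg_y_deriv R a (fun s => (- (4 * m%:R * g ^+ 2)) * (s ^+ m)^-1) W 0 _ _ _ _.
- move=> s /pos s0; apply: (is_derive_congr (der_scale _ (der_invX m s0))).
  by rewrite /W; move: (s ^+ m * s)^-1 => S; ring.
- by move=> s /pos s0; apply: cvgM; [exact: cvg_cst|have [_ c2] := continuous_invX m s0; exact: c2].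
- by move=> s as1; apply: W_ge0; exact: lt_trans as1.
- move=> s /pos s0; rewrite mulNr oppr_le0 mulr_ge0 ?invr_ge0 ?exprn_ge0 ?(ltW s0)//.
  by rewrite mulr_ge0 ?sqr_ge0// mulr_ge0.
by move=> i1 B; split => //; move: B; rewrite mulNr sub0r opprK.
Qed.

(** The first-order operator in the square annihilates the Gaussian, so only the correction
    [g / s ^+ m] contributes. *)
Let bracket s : 0 < s -> s ^+ m / s * (b * s / 2 * h s + 2 * s * h' s) ^+ 2 <= W s.
Proof.
move=> s0; have sm : 0 < s ^+ m by rewrite exprn_gt0.
have -> : b * s / 2 * h s + 2 * s * h' s = - (2 * m%:R * g / s ^+ m) * gweight b s.
  rewrite /tprof /tprof'; move: (s ^+ m) sm (gweight b s) => S S0 X; field.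
  by rewrite !gt_eqF.
rewrite exprMn sqrrN gweight_sqr /W.
have -> : s ^+ m / s * ((2 * m%:R * g / s ^+ m) ^+ 2 * expR (- (b / 2 * s))) =
    4 * m%:R ^+ 2 * g ^+ 2 / (s ^+ m * s) * expR (- (b / 2 * s)).
  move: (s ^+ m) sm (expR _) => S S0 X; field.
  by rewrite !gt_eqF.
rewrite -[X in _ <= X]mulr1; apply: ler_wpM2l; first exact: W_ge0.
by rewrite -[X in _ <= X]expR0 ler_expR oppr_le0; exact: mulr_ge0 (ltW b2) (ltW s0).
Qed.

Lemma trial_energy : itg leb 'I[a,oo] (mode_energy b m h h') /\
  \int[leb]_(s in 'I[a,oo]) mode_energy b m h h' s <=
  b * \int[leb]_(s in 'I[a,oo]) (s ^+ m * h s ^+ 2) + 4 * m%:R * g ^+ 2 / a ^+ m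
  - a ^+ m * h a ^+ 2 * (2 * (m%:R - b / 2 * a)).
Proof.
have acG := ac_C1 (fun s H => dG (pos H)) (fun s H => cG' (pos H)).
have [lG' _] := acG; have [iW BW] := W_itg; have iN := itg_trial_norm.
have [mh mh'] := measurable_tprof g b m.
have me : measurable_fun setT (mode_energy b m h h').
  apply: measurable_funM; first by apply: measurable_funM; [exact: measurable_funX|exact: measurable_invr].
  apply: measurable_funD; apply: measurable_funX.
    apply: measurable_funD; first by apply: measurable_funM; [exact: measurable_cst|].
    by apply: measurable_funM => //; apply: measurable_funM.
  apply: measurable_funM => //; apply: measurable_funB => //.
  by do 2?apply: measurable_funM => //.
have e0 s : a < s -> 0 <= mode_energy b m h h' s.
  move=> as1; have s0 := ltW (lt_trans a0 as1).
  by rewrite mulr_ge0 ?divr_ge0 ?exprn_ge0// addr_ge0 ?sqr_ge0.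
have N0 s : 'I[a,oo] s -> 0 <= s ^+ m * h s ^+ 2.
  by rewrite /= in_itv/= andbT => as1; rewrite mulr_ge0 ?sqr_ge0// exprn_ge0// ltW// (lt_trans a0).
have ub s : a < s -> mode_energy b m h h' s <= b * (s ^+ m * h s ^+ 2) + W s + G' s.
  move=> as1; have s0 := lt_trans a0 as1; rewrite mode_energyE// /G' lerD2r lerD2l; exact: bracket.
have sub T : 'I[a, T] `<=` 'I[a,oo] by move=> s; rewrite /= !in_itv/= => /andP[->].
have iU T : itg leb 'I[a, T] (fun s => b * (s ^+ m * h s ^+ 2) + W s + G' s).
  apply: itgD; last exact: lG'.
  apply: itgD; last exact: itgS iW (sub T) (measurable_oc a T).
  exact: itgS (itgZ b iN) (sub T) (measurable_oc a T).
have ieT T : itg leb 'I[a, T] (mode_energy b m h h').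
  apply: (@itg_le _ _ _ leb _ _ _ _ (iU T)); first exact: measurable_funTS.
  by move=> s; rewrite /= in_itv/= => /andP[as1 _]; rewrite ger0_norm ?e0// ub.
apply: itg_y_bound; [exact: measurable_funTS|exact: e0|exact: ieT|] => n.
pose T := Num.max a (Num.max n%:R (m%:R / (b / 2))).
have nT : n%:R <= T by rewrite !le_max lexx orbT.
have aT : a <= T by rewrite le_max lexx.
have T0 := pos aT.
have GT : G T <= 0.
  rewrite /G; apply: mulr_ge0_le0; first by rewrite mulr_ge0 ?sqr_ge0// exprn_ge0// ltW.
  rewrite pmulr_rle0// subr_le0 -ler_pdivrMl// mulrC.
  by rewrite !le_max lexx !orbT.
apply: (@le_trans _ _ (\int[leb]_(s in 'I[a, T]) mode_energy b m h h' s)).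
  have snT : 'I[a, n%:R] `<=` 'I[a, T].
    by move=> s; rewrite /= !in_itv/= => /andP[-> sn]; exact: le_trans nT.
  apply: (@Rint_subset _ _ _ leb _ _ _ (measurable_oc a n%:R) snT (ieT T)).
  by move=> s; rewrite /= in_itv/= => /andP[as1 _]; exact: e0.
apply: (@le_trans _ _ (\int[leb]_(s in 'I[a, T]) (b * (s ^+ m * h s ^+ 2) + W s + G' s))).
  by apply: Rint_le => // s; rewrite /= in_itv/= => /andP[as1 _]; exact: ub.
have i1 := itgS (itgZ b iN) (sub T) (measurable_oc a T).
have i2 := itgS iW (sub T) (measurable_oc a T).
rewrite (RintD (itgD i1 i2) (lG' T)) (RintD i1 i2) (ac_int acG aT).
apply: lerD; last first.
  by rewrite -/(G a) -[X in _ <= X]add0r; apply: lerD.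
apply: lerD.
  rewrite -(RintZ b iN); apply: (@Rint_subset _ _ _ leb _ _ _ (measurable_oc a T) (sub T) (itgZ b iN)).
  by move=> s /N0; apply: mulr_ge0; exact: ltW.
apply: le_trans BW; apply: (@Rint_subset _ _ _ leb _ _ _ (measurable_oc a T) (sub T) iW).
by move=> s; rewrite /= in_itv/= andbT => as1; apply: W_ge0; exact: lt_trans as1.
Qed.

Lemma trial_norm_gt0 : 0 < \int[leb]_(s in 'I[a,oo]) (s ^+ m * h s ^+ 2).
Proof.
pose c := a ^+ m * expR (- (b / 2 * (a + 1))).
have c0 : 0 < c by rewrite mulr_gt0 ?exprn_gt0 ?expR_gt0.
have sub : 'I[a, (a + 1)] `<=` 'I[a,oo] by move=> s; rewrite /= !in_itv/= => /andP[->].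
have iN := itg_trial_norm.
have N0 s : 'I[a,oo] s -> 0 <= s ^+ m * h s ^+ 2.
  by rewrite /= in_itv/= andbT => as1; rewrite mulr_ge0 ?sqr_ge0// exprn_ge0// ltW// (lt_trans a0).
apply: (@lt_le_trans _ _ (\int[leb]_(s in 'I[a, (a + 1)]) c)).
  rewrite Rintegral_cst ?measurable_oc// mulr_gt0//=.
  by rewrite lebesgue_measure_itv/= lte_fin ltrDl ltr01 -EFinD/= addrC addKr.
apply: (@le_trans _ _ (\int[leb]_(s in 'I[a, (a + 1)]) (s ^+ m * h s ^+ 2))); last first.
  exact: (@Rint_subset _ _ _ leb _ _ _ (measurable_oc a (a + 1)) sub iN N0).
apply: Rint_le; [exact: itg_oc_cst|exact: itgS iN sub (measurable_oc _ _)|].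
move=> s; rewrite /= in_itv/= => /andP[as1 s1]; have s0 := lt_trans a0 as1.
rewrite /tprof exprMn gweight_sqr /c; apply: ler_pM; rewrite ?exprn_ge0 ?expR_ge0 ?(ltW a0)//.
  by rewrite lerXn2r ?nnegrE ?ltW.
rewrite -[X in X <= _]mul1r; apply: ler_pM; rewrite ?expR_ge0//.
  by apply: exprn_ege1; exact: tprof_ge1.
by rewrite ler_expR lerN2 ler_wpM2l// ltW.
Qed.

End energy.

Section asymptotics.
Variables (a b : R).
Hypotheses (a0 : 0 < a) (b0 : 0 < b).
Let t0 := b * a / 2.

(** The constant 7 is 3 + 4: the relative error of the norm contributes 3, and that of the boundary
    term 4, its worst case being m = 1. *)
Definition tr_lam m := b - 2 * b * t0 ^+ m / m.-1`!%:R * (1 - 7 * t0).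

Let t00 : 0 < t0. Proof. by rewrite divr_gt0// mulr_gt0. Qed.

(** On the span of several modes the largest bound decides. It belongs to the highest mode, because
    t0^m / (m - 1)! decreases with m. *)
Lemma tr_lam_homo m k : t0 <= 1 / 7 -> (0 < m <= k)%N -> tr_lam m <= tr_lam k.
Proof.
move=> t7 /andP[m0 mk]; rewrite lerD2l lerN2.
have c0 : 0 <= 1 - 7 * t0 by lra.
have t1 : t0 <= 1 by lra.
apply: (ler_wpM2r c0); rewrite -!mulrA !ler_pM2l//.
apply: ler_pM; rewrite ?invr_ge0 ?exprn_ge0 ?(ltW t00)//.
  by apply: ler_wiXn2l => //; rewrite ltW.
rewrite lef_pV2 ?posrE ?ltr0n ?fact_gt0// ler_nat.
case: k m mk m0 => [|k] [|m]//= mk _; elim: k mk => [|k IH]; first by case: m.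
rewrite ltnS leq_eqVlt => /predU1P[->//|mk]; apply: leq_trans (IH mk) _.
by rewrite factS leq_pmull.
Qed.

(** To leading order in units of a^m, the boundary term gains 2 m (1 + 1)^2 = 8 m and the correction
    costs 4 m, a net gain of 4 m. Without the correction the gain would be 2 m, half of what the
    asymptotics require; among all multiples of a^m the chosen one maximises 2 m (1 + y)^2 - 4 m
    y^2, at y = 1. *)
Lemma trial_asym m : (0 < m)%N -> t0 <= 1 / 7 ->
  \int[leb]_(s in 'I[a,oo]) mode_energy b m (tprof (a ^+ m) b m) (tprof' (a ^+ m) b m) s <=
  tr_lam m * \int[leb]_(s in 'I[a,oo]) (s ^+ m * tprof (a ^+ m) b m s ^+ 2).
Proof.
move=> m0 t7; have am : 0 < a ^+ m by rewrite exprn_gt0.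
have [_] := trial_energy m a0 b0 (ltW am).
have iN := itg_trial_norm m a0 b0 (ltW am).
set E := (X in X <= _ -> _); set N := (X in b * X) => HE.
have b2 : 0 < b / 2 by rewrite divr_gt0.
have B0 : b / 2 != 0 by rewrite gt_eqF.
have [im Bm] := gauss_itg m (ltW a0) b2; have [i0 B0'] := gauss_itg 0 (ltW a0) b2.
have NB : N <= m`!%:R / (b / 2) ^+ m.+1 + 3 * a ^+ m / (b / 2).
  apply: (@le_trans _ _ (\int[leb]_(s in 'I[a,oo]) (s ^+ m * expR (- (b / 2 * s)) + 3 * a ^+ m * (s ^+ 0 * expR (- (b / 2 * s)))))).
    apply: Rint_le => //; first by apply: itgD => //; exact: itgZ.
    move=> s; rewrite /= in_itv/= andbT => as1; have s0 := lt_trans a0 as1.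
    have sm : 0 < s ^+ m by rewrite exprn_gt0.
    have asm : a ^+ m <= s ^+ m by apply: lerXn2r; rewrite ?nnegrE ?ltW.
    rewrite /tprof exprMn gweight_sqr expr0 mul1r mulrA -mulrDl; apply: (ler_wpM2r (expR_ge0 _)).
    move: (s ^+ m) (a ^+ m) am sm asm => S A A0 S0 AS.
    have -> : S * (1 + A / S) ^+ 2 = S + 2 * A + A * (A / S) by field; rewrite gt_eqF.
    have : A * (A / S) <= A * 1 by rewrite ler_pM2l// ler_pdivrMr// mul1r.
    by lra.
  rewrite (RintD im (itgZ _ i0)) (RintZ _ i0); apply: lerD => //.
  apply: ler_wpM2l; first by rewrite mulr_ge0// ltW.
  by apply: le_trans B0' _; rewrite fact0 expr1 mul1r.
apply: le_trans HE _; rewrite /tr_lam mulrBl -addrA lerD2l -opprB lerN2.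
have hE : a ^+ m * tprof (a ^+ m) b m a ^+ 2 = 4 * a ^+ m * expR (- t0).
  rewrite /tprof exprMn gweight_sqr divff ?gt_eqF// /t0.
  rewrite (_ : - (b / 2 * a) = - (b * a / 2)); last by ring.
  by move: (expR _) => X; ring.
have -> : 4 * m%:R * (a ^+ m) ^+ 2 / a ^+ m = 4 * m%:R * a ^+ m.
  by move: (a ^+ m) am => A A0; field; rewrite gt_eqF.
rewrite hE; have -> : b / 2 * a = t0 by rewrite /t0; ring.
have m1 : 1 <= m%:R :> R by rewrite ler1n.
have ex : 1 - t0 <= expR (- t0) by have := expR_ge1Dx (- t0).
have f1 : 1 <= m.-1`!%:R :> R by rewrite ler1n fact_gt0.
have key : 2 * b * t0 ^+ m / m.-1`!%:R * N <= 4 * a ^+ m * m%:R * (1 + 3 * t0).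
  have k0 : 0 <= 2 * b * t0 ^+ m / m.-1`!%:R.
    by rewrite divr_ge0// mulr_ge0 ?exprn_ge0 ?(ltW t00)// mulr_ge0// ltW.
  apply: le_trans (ler_wpM2l k0 NB) _.
  have -> : m`!%:R = m%:R * m.-1`!%:R :> R by rewrite -natrM -[in RHS](prednK m0) -factS prednK.
  have tE : t0 ^+ m = (b / 2) ^+ m * a ^+ m by rewrite -exprMn /t0; congr (_ ^+ _); ring.
  have bm : (b / 2) ^+ m != 0 by rewrite expf_neq0.
  have -> : 2 * b * t0 ^+ m / m.-1`!%:R * (m%:R * m.-1`!%:R / (b / 2) ^+ m.+1 + 3 * a ^+ m / (b / 2)) =
      4 * a ^+ m * (m%:R + 3 * (t0 ^+ m / m.-1`!%:R)).
    rewrite exprS tE; have fm : m.-1`!%:R != 0 :> R := fact_neq0 _.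
    have bn : b != 0 by rewrite gt_eqF.
    move: ((b / 2) ^+ m) bm (a ^+ m) (m.-1`!%:R) fm (m%:R) => X X0 A F F0 M.
    by field; rewrite X0 F0 bn.
  rewrite -[X in _ <= X]mulrA; apply: ler_wpM2l; first by rewrite mulr_ge0// ltW.
  have : t0 ^+ m / m.-1`!%:R <= t0 * m%:R.
    apply: (@le_trans _ _ (t0 * 1)); last by rewrite ler_pM2l.
    rewrite mulr1 ler_pdivrMr ?(lt_le_trans ltr01 f1)//.
    apply: (@le_trans _ _ t0); last by rewrite ler_peMr// ltW.
    by rewrite -[X in _ <= X]expr1; apply: ler_wiXn2l => //; rewrite ?(ltW t00)//; lra.
  by lra.
have c0 : 0 <= 1 - 7 * t0 by lra.
have -> : 2 * b * t0 ^+ m / m.-1`!%:R * (1 - 7 * t0) * N = 2 * b * t0 ^+ m / m.-1`!%:R * N * (1 - 7 * t0) by rewrite mulrAC.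
apply: le_trans (ler_wpM2r c0 key) _.
have mt : 0 <= m%:R - t0 by lra.
have H1 : (m%:R - t0) * (1 - t0) <= (m%:R - t0) * expR (- t0) by rewrite ler_wpM2l.
have H2 : 4 * m%:R * (1 + 3 * t0) * (1 - 7 * t0) <= 8 * ((m%:R - t0) * expR (- t0)) - 4 * m%:R.
  have : 0 <= t0 ^+ 2 by exact: sqr_ge0.
  have : t0 <= t0 * m%:R by rewrite ler_peMr// ltW.
  have : 0 <= m%:R * t0 ^+ 2 by rewrite mulr_ge0 ?sqr_ge0.
  by move: H1; rewrite !expr2; lra.
have := ler_wpM2l (ltW am) H2.
move: (a ^+ m) (expR _) (m%:R : R) => A X M.
have -> : A * (4 * M * (1 + 3 * t0) * (1 - 7 * t0)) = 4 * A * M * (1 + 3 * t0) * (1 - 7 * t0) by ring.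
by have -> : A * (8 * ((M - t0) * X) - 4 * M) = 4 * A * X * (2 * (M - t0)) - 4 * M * A by ring.
Qed.

(** With [g = 0] the square vanishes identically and only the negative boundary term is left, so no
    smallness of [b] is involved. *)
Lemma trial_strict m : (0 < m)%N -> t0 < m%:R -> exists2 e : R, 0 < e &
  \int[leb]_(s in 'I[a,oo]) mode_energy b m (tprof 0 b m) (tprof' 0 b m) s <=
  (b - e) * \int[leb]_(s in 'I[a,oo]) (s ^+ m * tprof 0 b m s ^+ 2).
Proof.
move=> m0 tm; have [_] := trial_energy m a0 b0 (lexx 0).
have N0 := trial_norm_gt0 m a0 b0 (lexx 0).
set E := (X in X <= _ -> _); set N := (X in b * X) => HE.
pose d := a ^+ m * tprof 0 b m a ^+ 2 * (2 * (m%:R - b / 2 * a)).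
have h0 : 0 < tprof 0 b m a by rewrite /tprof mul0r addr0 mul1r expR_gt0.
have d0 : 0 < d.
  have p0 : 0 < m%:R - b / 2 * a by rewrite subr_gt0 (_ : b / 2 * a = t0)// /t0; ring.
  by apply: mulr_gt0; apply: mulr_gt0 => //; exact: exprn_gt0.
exists (d / N); first exact: divr_gt0.
apply: le_trans HE _; rewrite -/d expr0n mulr0 mul0r addr0 mulrBl divfK//.
by rewrite gt_eqF.
Qed.

End asymptotics.
End trial_profile.

(** * Min-max values *)

Section min_max.
Context {R : realType}.
Local Notation pt := (R * R)%type.
Local Notation leb := (@lebesgue_measure R).
Local Notation leb2 := (leb \x leb)%E.
Local Notation "'I[ a ,oo]" := (`]a, +oo[%classic : set R) (at level 0, format "''I[' a ,oo]").
Implicit Types (u v w g : pt -> R[i]) (z : pt) (n m k : nat) (a b : R).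

Lemma sqnormC_ge0 (x : R[i]) : 0 <= sqnormC x.
Proof. by rewrite addr_ge0 ?sqr_ge0. Qed.

Lemma sqnormC_eq0 (x : R[i]) : sqnormC x = 0 -> x = 0.
Proof.
case: x => x y /eqP; rewrite /sqnormC /= paddr_eq0 ?sqr_ge0// !sqrf_eq0.
by move=> /andP[/eqP -> /eqP ->].
Qed.

Lemma sqnormC_le (x y : R[i]) : sqnormC (x + y) <= 2 * sqnormC x + 2 * sqnormC y.
Proof.
case: x y => x1 x2 [y1 y2]; rewrite /sqnormC /=.
have := sqr_ge0 (x1 - y1); have := sqr_ge0 (x2 - y2); rewrite !sqrrB !sqrrD; lra.
Qed.

Lemma sqnormC_sum_le n (x : 'I_n -> R[i]) :
  sqnormC (\sum_(i < n) x i) <= 2 ^+ n * \sum_(i < n) sqnormC (x i).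
Proof.
elim: n x => [|n IH] x; first by rewrite !big_ord0 mulr0 /sqnormC /= expr0n addr0.
rewrite !big_ord_recr /= mulrDr; apply: le_trans (sqnormC_le _ _) _; apply: lerD.
  by rewrite exprS -mulrA ler_wpM2l.
by rewrite ler_wpM2r ?sqnormC_ge0// exprS ler_peMr// exprn_ege1// ler1n.
Qed.

Lemma L2_ae_zero a u : L2 (dom a) u -> (ae_zero (dom a) u <-> L2sqnorm (dom a) u = 0).
Proof.
move=> Lu; have iu := L2_itg Lu; split=> H; last first.
  have := Rint_eq0_ae iu (fun z _ => sqnormC_ge0 _) H.
  by apply: ae_imp => z K /K; exact: sqnormC_eq0.
rewrite /L2sqnorm -(@Rint0 _ _ _ leb2 (dom a)); apply: Rint_ae.
- exact: measurable_dom.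
- exact: itg_measurable iu.
- exact: measurable_cst.
- by apply: ae_imp H => z K /K ->; rewrite /sqnormC /= expr0n addr0.
Qed.

Lemma L2sqnorm_le a n (v : 'I_n -> pt -> R[i]) (c : 'I_n -> R[i]) : (forall i, L2 (dom a) (v i)) ->
  L2sqnorm (dom a) (fun z => \sum_(i < n) c i * v i z) <=
  2 ^+ n * \sum_(i < n) sqnormC (c i) * L2sqnorm (dom a) (v i).
Proof.
move=> Lv; have mD := @measurable_dom R a.
have iv i : itg leb2 (dom a) (fun z => sqnormC (c i) * sqnormC (v i z)) by apply: itgZ; exact: L2_itg.
have -> : 2 ^+ n * \sum_(i < n) sqnormC (c i) * L2sqnorm (dom a) (v i) =
    \int[leb2]_(z in dom a) (2 ^+ n * \sum_(i < n) sqnormC (c i) * sqnormC (v i z)).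
  have iS : itg leb2 (dom a) (fun z => \sum_(i < n) sqnormC (c i) * sqnormC (v i z)).
    exact: (@itg_sum _ _ _ leb2 _ _ (fun i z => sqnormC (c i) * sqnormC (v i z)) mD iv).
  rewrite (RintZ _ iS); congr (_ * _); apply/esym.
  transitivity (\sum_(i < n) \int[leb2]_(z in dom a) (sqnormC (c i) * sqnormC (v i z))).
    exact: (@Rint_sum _ _ _ leb2 _ _ (fun i z => sqnormC (c i) * sqnormC (v i z)) mD iv).
  by apply: eq_bigr => i _; rewrite (RintZ _ (L2_itg (Lv i))).
apply: Rint_le.
- by apply: L2_itg; apply: L2_sum => i; exact: L2Z.
- by apply: itgZ; exact: (@itg_sum _ _ _ leb2 _ _ (fun i z => sqnormC (c i) * sqnormC (v i z)) mD iv).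
- move=> z _; apply: le_trans (sqnormC_sum_le _) _; apply: ler_wpM2l; first exact: exprn_ge0.
  by apply: ler_sum => i _; rewrite sqnormCM.
Qed.

Lemma L2r_mul a (f g : pt -> R) : L2r a f -> L2r a g -> itg leb2 (dom a) (fun z => f z * g z).
Proof. by move=> [mf i1] [mg i2]; exact: itg_mul. Qed.

Lemma cauchy_schwarz a (f g : pt -> R) : L2r a f -> L2r a g ->
  (\int[leb2]_(z in dom a) (f z * g z)) ^+ 2 <=
  \int[leb2]_(z in dom a) (f z ^+ 2) * \int[leb2]_(z in dom a) (g z ^+ 2).
Proof.
move=> Lf Lg; have i3 := L2r_mul Lf Lg; have [_ i1] := Lf; have [_ i2] := Lg.
set A := \int[leb2]_(z in dom a) (f z ^+ 2); set C := \int[leb2]_(z in dom a) (g z ^+ 2); set B := \int[leb2]_(z in dom a) (f z * g z).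
have H t : 0 <= A + 2 * t * B + t ^+ 2 * C.
  rewrite /A /B /C -(RintZ (2 * t) i3) -(RintZ (t ^+ 2) i2) -(RintD i1 (itgZ _ i3)).
  rewrite -(RintD (itgD i1 (itgZ _ i3)) (itgZ _ i2)); apply: Rint_ge0 => z _.
  by have := sqr_ge0 (f z + t * g z); rewrite sqrrD exprMn; lra.
have C0 : 0 <= C by apply: Rint_ge0 => z _; exact: sqr_ge0.
have A0 : 0 <= A by apply: Rint_ge0 => z _; exact: sqr_ge0.
move: A B C H C0 A0 => A B C H C0 A0; have [C1|C1] := ltrP 0 C.
  have := H (- B / C); have -> : A + 2 * (- B / C) * B + (- B / C) ^+ 2 * C = A - B ^+ 2 / C.
    by field; rewrite gt_eqF.
  by rewrite subr_ge0 ler_pdivrMr.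
have C2 : C = 0 by apply/le_anti; rewrite C0 C1.
have B0 : B = 0.
  apply/eqP/negPn/negP => B0; have := H (- (A + 1) / (2 * B)); rewrite C2 mulr0 addr0.
  have -> : A + 2 * (- (A + 1) / (2 * B)) * B = -1 by field.
  by rewrite ler0N1.
by rewrite B0 C2 expr0n mulr0.
Qed.

Lemma L2inner_itg a u v : L2 (dom a) u -> L2 (dom a) v ->
  itg leb2 (dom a) (fun z => complex.Re (u z * (v z)^*%C)) /\
  itg leb2 (dom a) (fun z => complex.Im (u z * (v z)^*%C)).
Proof.
move=> /L2_L2r[u1 u2] /L2_L2r[v1 v2].
have i11 := L2r_mul u1 v1; have i22 := L2r_mul u2 v2.
have i12 := L2r_mul u1 v2; have i21 := L2r_mul u2 v1.
split; [apply: itg_ext (itgD i11 i22) => z _|apply: itg_ext (itgB i21 i12) => z _];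
  case: (u z) (v z) => ? ? [? ?] /=; ring.
Qed.

Lemma L2inner_Z a (c : R[i]) u v : L2 (dom a) u -> L2 (dom a) v ->
  L2inner (dom a) (fun z => c * u z) v = c * L2inner (dom a) u v.
Proof.
move=> Lu Lv; have [i1 i2] := L2inner_itg Lu Lv; case: c => x y.
rewrite /L2inner /cintegral; congr Complex.
  rewrite -(RintZ x i1) -(RintZ y i2) -(RintB (itgZ x i1) (itgZ y i2)); apply: Rint_ext => z _.
  by case: (u z) (v z) => ? ? [? ?] /=; ring.
rewrite -(RintZ x i2) -(RintZ y i1) -(RintD (itgZ x i2) (itgZ y i1)); apply: Rint_ext => z _.
by case: (u z) (v z) => ? ? [? ?] /=; ring.
Qed.

Lemma L2inner_D a u u' v : L2 (dom a) u -> L2 (dom a) u' -> L2 (dom a) v ->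
  L2inner (dom a) (fun z => u z + u' z) v = L2inner (dom a) u v + L2inner (dom a) u' v.
Proof.
move=> Lu Lu' Lv; have [i1 i2] := L2inner_itg Lu Lv; have [j1 j2] := L2inner_itg Lu' Lv.
rewrite /L2inner /cintegral; congr Complex.
  rewrite -(RintD i1 j1); apply: Rint_ext => z _.
  by case: (u z) (u' z) (v z) => ? ? [? ?] [? ?] /=; ring.
rewrite -(RintD i2 j2); apply: Rint_ext => z _.
by case: (u z) (u' z) (v z) => ? ? [? ?] [? ?] /=; ring.
Qed.

Lemma L2inner_sum a n (c : 'I_n -> R[i]) (w : 'I_n -> pt -> R[i]) v :
  (forall i, L2 (dom a) (w i)) -> L2 (dom a) v ->
  L2inner (dom a) (fun z => \sum_(i < n) c i * w i z) v = \sum_(i < n) c i * L2inner (dom a) (w i) v.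
Proof.
move=> Lw Lv; elim: n c w Lw => [|n IH] c w Lw.
  under eq_fun do rewrite big_ord0; rewrite big_ord0 /L2inner /cintegral.
  by congr Complex; rewrite -[RHS](@Rint0 _ _ _ leb2 (dom a)); apply: Rint_ext => z _;
    case: (v z) => ? ? /=; ring.
under eq_fun do rewrite big_ord_recr /=; rewrite big_ord_recr /= -(IH _ _ (fun i => Lw _)).
rewrite -L2inner_Z// -L2inner_D//; [|exact: L2Z].
by apply: L2_sum => i; exact: L2Z.
Qed.

Lemma L2inner_conj a u v : L2inner (dom a) u v = 0 -> L2 (dom a) u -> L2 (dom a) v ->
  L2inner (dom a) v u = 0.
Proof.
move=> E Lu Lv; have [i1 i2] := L2inner_itg Lu Lv.
have [E1 E2] : complex.Re (L2inner (dom a) u v) = 0 /\ complex.Im (L2inner (dom a) u v) = 0 by rewrite E.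
rewrite /L2inner /cintegral; congr Complex.
  by rewrite -E1; apply: Rint_ext => z _; case: (u z) (v z) => ? ? [? ?] /=; ring.
rewrite -oppr0 -E2 -(RintN i2); apply: Rint_ext => z _.
by case: (u z) (v z) => ? ? [? ?] /=; ring.
Qed.

Lemma L2inner_self a u : L2inner (dom a) u u = Complex (L2sqnorm (dom a) u) 0.
Proof.
rewrite /L2inner /cintegral; congr Complex.
  by apply: Rint_ext => z _; case: (u z) => ? ?; rewrite /sqnormC /=; ring.
rewrite -(@Rint0 _ _ _ leb2 (dom a)); apply: Rint_ext => z _.
by case: (u z) => ? ? /=; ring.
Qed.

Lemma cs_algebra (x11 x22 x12 x21 y1 y2 t1 t2 : R) : x11 ^+ 2 <= y1 * t1 -> x22 ^+ 2 <= y2 * t2 ->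
  x12 ^+ 2 <= y1 * t2 -> x21 ^+ 2 <= y2 * t1 ->
  (x11 + x22) ^+ 2 + (x21 - x12) ^+ 2 <= 2 * ((y1 + y2) * (t1 + t2)).
Proof.
have := sqr_ge0 (x11 - x22); have := sqr_ge0 (x21 + x12); rewrite !sqrrB !sqrrD.
by move=> *; lra.
Qed.

(** The factor 2 is not optimal but comes from four real Cauchy-Schwarz inequalities at once; it
    only enters a finiteness argument. *)
Lemma L2inner_sqr_le a u v : L2 (dom a) u -> L2 (dom a) v ->
  sqnormC (L2inner (dom a) u v) <= 2 * (L2sqnorm (dom a) u * L2sqnorm (dom a) v).
Proof.
move=> Lu Lv; rewrite (L2sqnormE Lu) (L2sqnormE Lv).
move: Lu Lv => /L2_L2r[u1 u2] /L2_L2r[v1 v2].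
have i11 := L2r_mul u1 v1; have i22 := L2r_mul u2 v2.
have i12 := L2r_mul u1 v2; have i21 := L2r_mul u2 v1.
have c11 := cauchy_schwarz u1 v1; have c22 := cauchy_schwarz u2 v2.
have c12 := cauchy_schwarz u1 v2; have c21 := cauchy_schwarz u2 v1.
rewrite /sqnormC /L2inner /cintegral /=.
have -> : \int[leb2]_(z in dom a) complex.Re (u z * (v z)^*%C) =
    \int[leb2]_(z in dom a) (complex.Re (u z) * complex.Re (v z)) + \int[leb2]_(z in dom a) (complex.Im (u z) * complex.Im (v z)).
  by rewrite -(RintD i11 i22); apply: Rint_ext => z _; case: (u z) (v z) => ? ? [? ?] /=; ring.
have -> : \int[leb2]_(z in dom a) complex.Im (u z * (v z)^*%C) =
    \int[leb2]_(z in dom a) (complex.Im (u z) * complex.Re (v z)) - \int[leb2]_(z in dom a) (complex.Re (u z) * complex.Im (v z)).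
  by rewrite -(RintB i21 i12); apply: Rint_ext => z _; case: (u z) (v z) => ? ? [? ?] /=; ring.
exact: cs_algebra c11 c22 c12 c21.
Qed.

Lemma moment_L2inner a b m u : moment a b m u = L2inner (dom a) u (modef m (gweight b)).
Proof.
rewrite /moment /L2inner /cintegral; congr Complex; apply: Rint_ext => z _;
  by case: (u z) => ? ? /=; ring.
Qed.

Lemma modef_gweight_L2 a b m : 0 < a -> 0 < b -> L2 (dom a) (modef m (gweight b)).
Proof.
move=> a0 b0; have W := L2r_weight (ltW a0) b0.
by apply/L2_L2r; split; apply: W; [left|right].
Qed.

Section finite_dimensional.
Variables (a b : R) (k : nat) (w : 'I_k -> pt -> R[i]).
Hypotheses (a0 : 0 < a) (b0 : 0 < b).
Hypotheses (Hw : forall i, H1A (dom a) b (w i)).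
Hypotheses (indep : forall c : 'I_k -> R[i],
  ae_zero (dom a) (fun z => \sum_(i < k) c i * w i z) -> forall i, c i = 0).
Let comb (c : 'I_k -> R[i]) z := \sum_(i < k) c i * w i z.

Let Lw i : L2 (dom a) (w i). Proof. by have [] := Hw i. Qed.

Let Lc c : L2 (dom a) (comb c).
Proof. by apply: L2_sum => i; exact: L2Z. Qed.

Let Gram : 'M[R[i]]_k := \matrix_(i, j) L2inner (dom a) (w i) (w j).

Let GramE (c : 'rV[R[i]]_k) j : (c *m Gram) 0 j = L2inner (dom a) (comb (c 0)) (w j).
Proof. by rewrite mxE L2inner_sum//; apply: eq_bigr => i _; rewrite mxE. Qed.

(** A vector in the kernel would give a combination orthogonal to all generators, hence to itself,
    which independence forbids. *)
Lemma Gram_unit : Gram \in unitmx.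
Proof.
rewrite -row_free_unit -kermx_eq0; apply/negPn/negP => /rowV0Pn[v /sub_kermxP vG v0].
have E j : L2inner (dom a) (comb (v 0)) (w j) = 0 by rewrite -GramE vG mxE.
have S0 : L2inner (dom a) (comb (v 0)) (comb (v 0)) = 0.
  rewrite [LHS]L2inner_sum// big1// => i _.
  by rewrite (L2inner_conj (E i) (Lc _) (Lw i)) mulr0.
have N0 : L2sqnorm (dom a) (comb (v 0)) = 0.
  by have := congr1 (@complex.Re R) S0; rewrite L2inner_self.
have vz := indep ((L2_ae_zero (Lc (v 0))).2 N0).
by move/eqP: v0; apply; apply/rowP => i; rewrite mxE vz.
Qed.

(* The coefficients are recovered from the inner products with the generators by
   the inverse Gram matrix. *)
Lemma coef_le : exists2 K : R, 0 <= K & forall c i, sqnormC (c i) <= K * L2sqnorm (dom a) (comb c).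
Proof.
pose Gi := invmx Gram.
pose N : R := \sum_(j < k) L2sqnorm (dom a) (w j).
pose S : R := \sum_(j < k) \sum_(i < k) sqnormC (Gi j i).
have Nj j : L2sqnorm (dom a) (w j) <= N.
  by rewrite /N (bigD1 j)//= lerDl sumr_ge0// => *; exact: L2sqnorm_ge0.
have Sj j i : sqnormC (Gi j i) <= S.
  rewrite /S (bigD1 j)//= (bigD1 i)//= -addrA lerDl.
  by rewrite addr_ge0// sumr_ge0// => *; rewrite ?sumr_ge0// => *; exact: sqnormC_ge0.
have N0 : 0 <= N by apply: sumr_ge0 => *; exact: L2sqnorm_ge0.
have S0 : 0 <= S by apply: sumr_ge0 => *; apply: sumr_ge0 => *; exact: sqnormC_ge0.
exists (2 ^+ k * (k%:R * (2 * N * S))) => [|c i].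
  by rewrite mulr_ge0 ?exprn_ge0// mulr_ge0// mulr_ge0// mulr_ge0.
pose r : 'rV[R[i]]_k := \row_j c j.
have rc : comb (r 0) = comb c by apply/funext => z; apply: eq_bigr => j _; rewrite mxE.
have -> : c i = \sum_(j < k) (r *m Gram) 0 j * Gi j i.
  have : (r *m Gram *m Gi) 0 i = c i by rewrite mulmxK ?Gram_unit// mxE.
  by rewrite mxE => <-.
apply: le_trans (sqnormC_sum_le _) _; rewrite -[X in _ <= X]mulrA.
apply: ler_wpM2l; first exact: exprn_ge0.
apply: (@le_trans _ _ (\sum_(j < k) 2 * N * S * L2sqnorm (dom a) (comb c))); last first.
  by rewrite sumr_const card_ord -[X in X <= _]mulr_natl mulrA.
apply: ler_sum => j _; rewrite sqnormCM GramE rc.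
have H1 := L2inner_sqr_le (Lc c) (Lw j).
apply: (@le_trans _ _ (2 * (L2sqnorm (dom a) (comb c) * N) * S)); last first.
  by rewrite le_eqVlt; apply/orP; left; apply/eqP; ring.
apply: ler_pM; rewrite ?sqnormC_ge0 ?Sj//; apply: le_trans H1 _.
by rewrite ler_wpM2l// ler_wpM2l// ?L2sqnorm_ge0.
Qed.

Lemma comb_wmom c j : wmom a b j (comb c) (fun z => \sum_(i < k) c i * momentum (dom a) b j (w i) z).
Proof. by apply: wmom_sum => i; exact: momentum_wmom. Qed.

Lemma comb_H1A c : H1A (dom a) b (comb c).
Proof. by have [] := wmom_qform a0 (comb_wmom c). Qed.

(** A Rayleigh quotient is bounded by the supremum over the span only if that set is bounded above;
    otherwise [sup] is a default value. *)
Lemma form_bounded : exists2 K : R, 0 <= K & forall c,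
  qform (dom a) b (comb c) <= K * L2sqnorm (dom a) (comb c).
Proof.
have [K0 K00 HK] := coef_le.
have Lm j i : L2 (dom a) (momentum (dom a) b j (w i)) by have [] := momentumP j (Hw i).
pose Q : R := \sum_(j < 2) \sum_(i < k) L2sqnorm (dom a) (momentum (dom a) b j (w i)).
have Q0 : 0 <= Q by apply: sumr_ge0 => *; apply: sumr_ge0 => *; exact: L2sqnorm_ge0.
exists (2 ^+ k * (K0 * Q)) => [|c]; first by rewrite mulr_ge0 ?exprn_ge0// mulr_ge0.
have B j : L2sqnorm (dom a) (momentum (dom a) b j (comb c)) <=
    2 ^+ k * (K0 * L2sqnorm (dom a) (comb c) * \sum_(i < k) L2sqnorm (dom a) (momentum (dom a) b j (w i))).
  rewrite (L2sqnorm_momentum a0 (comb_wmom c j) (comb_H1A c)).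
  apply: le_trans (L2sqnorm_le c (Lm j)) _; apply: ler_wpM2l; first exact: exprn_ge0.
  rewrite mulr_sumr; apply: ler_sum => i _; apply: ler_wpM2r; [exact: L2sqnorm_ge0|exact: HK].
apply: (@le_trans _ _ (\sum_(j < 2) 2 ^+ k * (K0 * L2sqnorm (dom a) (comb c) * \sum_(i < k) L2sqnorm (dom a) (momentum (dom a) b j (w i))))).
  by apply: ler_sum => j _; exact: B.
rewrite -mulr_sumr -mulr_sumr -/Q -!mulrA ler_wpM2l ?exprn_ge0// ler_wpM2l//.
by rewrite mulrC.
Qed.

(** There are [k] coefficients and [k.-1] linear equations, so the moment matrix has a nontrivial
    kernel. *)
Lemma constrained_vector : (0 < k)%N -> exists c : 'I_k -> R[i],
  ~ ae_zero (dom a) (comb c) /\ forall m, (0 < m < k)%N -> moment a b m (comb c) = 0.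
Proof.
move=> k0; pose B : 'M[R[i]]_(k, k.-1) := \matrix_(i, m) moment a b m.+1 (w i).
have : kermx B != 0.
  rewrite kermx_eq0 /row_free; apply/negP => /eqP rB.
  by have := rank_leq_col B; rewrite rB -ltnS prednK// ltnn.
move=> /rowV0Pn[v /sub_kermxP vB v0]; exists (v 0); split.
  move=> /indep vz; move/eqP: v0; apply; apply/rowP => i; by rewrite mxE vz.
move=> m /andP[m0 mk]; have mk' : (m.-1 < k.-1)%N by rewrite -ltnS !prednK.
have := congr1 (fun M : 'rV[R[i]]_k.-1 => M 0 (Ordinal mk')) vB; rewrite !mxE => E.
rewrite moment_L2inner L2inner_sum//; last exact: modef_gweight_L2.
by rewrite -[RHS]E; apply: eq_bigr => i _; rewrite mxE moment_L2inner /= prednK.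
Qed.

Lemma rayleigh_sup_ge (L : R) : (0 < k)%N ->
  (forall u, H1A (dom a) b u -> (forall m, (0 < m < k)%N -> moment a b m u = 0) ->
     L * L2sqnorm (dom a) u <= qform (dom a) b u) ->
  L <= sup [set rayleigh (dom a) b u | u in range comb `\` ae_zero (dom a)].
Proof.
move=> k0 HL; have [K K0 HK] := form_bounded; have [c [c0 cm]] := constrained_vector k0.
have pos c' : ~ ae_zero (dom a) (comb c') -> 0 < L2sqnorm (dom a) (comb c').
  move=> nz; rewrite lt_neqAle L2sqnorm_ge0 andbT; apply/eqP => E; apply: nz.
  by apply/(L2_ae_zero (Lc c')).
have p := pos _ c0.
apply: (@le_trans _ _ (rayleigh (dom a) b (comb c))).
  by rewrite /rayleigh ler_pdivlMr//; apply: HL => //; exact: comb_H1A.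
apply: ub_le_sup; last by exists (comb c) => //; split => //; exists c.
exists K => _ [u [[c' _ <-] nz] <-].
by rewrite /rayleigh ler_pdivrMr ?HK// pos.
Qed.

End finite_dimensional.
End min_max.

(** * Two-sided bounds for the min-max values *)

Section eigenvalue_bounds.
Context {R : realType}.
Local Notation pt := (R * R)%type.
Local Notation leb := (@lebesgue_measure R).
Local Notation "'I[ a ,oo]" := (`]a, +oo[%classic : set R) (at level 0, format "''I[' a ,oo]").
Implicit Types (n m k : nat) (a b : R).

(** A set without supremum has [sup] equal to 0, so the bound holds for every [A]. It makes the set
    in the infimum bounded below. *)
Lemma rayleigh_sup_ge0 a b (A : set (pt -> R[i])) : 0 <= sup [set rayleigh (dom a) b u | u in A].
Proof.
have [hs|hs] := pselect (has_sup [set rayleigh (dom a) b u | u in A]); last by rewrite sup_out.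
have [[_ [u Au _]] ub] := hs.
apply: (@le_trans _ _ (rayleigh (dom a) b u)); last by apply: ub_le_sup => //; exists u.
by rewrite divr_ge0 ?qform_ge0 ?L2sqnorm_ge0.
Qed.

(** Norm and form are diagonal in the same modes, so a bound on each mode is a bound on their span;
    positivity of the mode norms gives independence. *)
Lemma trial_subspace a b k m0 (h h' : nat -> R -> R) (L : R) : 0 < a -> (0 < m0)%N -> (0 < k)%N ->
  (forall i, measurable_fun setT (h i)) -> (forall i, measurable_fun setT (h' i)) ->
  (forall i (s : R), 0 < s -> is_derive s (1 : R) (h i) (h' i s)) ->
  (forall i (s : R), 0 < s -> {for s, continuous (h' i)}) ->
  (forall i, itg leb 'I[a,oo] (fun s => s ^+ (m0 + i) * h i s ^+ 2)) ->
  (forall i, itg leb 'I[a,oo] (mode_energy b (m0 + i) (h i) (h' i))) ->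
  (forall i, 0 < \int[leb]_(s in 'I[a,oo]) (s ^+ (m0 + i) * h i s ^+ 2)) ->
  (forall i, (i < k)%N -> \int[leb]_(s in 'I[a,oo]) mode_energy b (m0 + i) (h i) (h' i) s <=
     L * \int[leb]_(s in 'I[a,oo]) (s ^+ (m0 + i) * h i s ^+ 2)) ->
  exists M, [/\ M `<=` H1A (dom a) b, subspace_of_dim (dom a) k M &
    sup [set rayleigh (dom a) b u | u in M `\` ae_zero (dom a)] <= L].
Proof.
move=> a0 m00 k0 mh mh' dh ch' ih ie N0 EL.
pose w (i : 'I_k) := modef (m0 + i) (h i).
pose comb (c : 'I_k -> R[i]) z := \sum_(i < k) c i * w i z.
pose N i := \int[leb]_(s in 'I[a,oo]) (s ^+ (m0 + i) * h i s ^+ 2).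
have form c : [/\ H1A (dom a) b (comb c), L2sqnorm (dom a) (comb c) = pi * \sum_(i < k) sqnormC (c i) * N i &
    qform (dom a) b (comb c) <= L * L2sqnorm (dom a) (comb c)].
  pose cx n := oapp c 0 (insub n).
  have cxE (i : 'I_k) : cx i = c i by rewrite /cx valK.
  have [] := trial_form k cx a0 m00 mh mh' dh ch' ih ie.
  have -> : (fun z => \sum_(i < k) cx i * modef (m0 + i) (h i) z) = comb c.
    by apply/funext => z; apply: eq_bigr => i _; rewrite cxE.
  move=> Hc Nc Qc; have NE : L2sqnorm (dom a) (comb c) = pi * \sum_(i < k) sqnormC (c i) * N i.
    by rewrite Nc; congr (_ * _); apply: eq_bigr => i _; rewrite cxE.
  split => //; rewrite Qc NE mulrCA; apply: ler_wpM2l; first exact: pi_ge0.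
  rewrite mulr_sumr; apply: ler_sum => i _; rewrite cxE mulrCA.
  by apply: ler_wpM2l; [exact: sqnormC_ge0|exact: EL].
have nz c : ae_zero (dom a) (comb c) -> forall i, c i = 0.
  have [Hc Nc _] := form c; have [Lc _] := Hc => /(L2_ae_zero Lc); rewrite Nc => /eqP.
  rewrite mulf_eq0 gt_eqF ?pi_gt0//= psumr_eq0; last first.
    by move=> i _; rewrite mulr_ge0 ?sqnormC_ge0// ltW// N0.
  move=> /allP H i; have := H i (mem_index_enum i); rewrite /= mulf_eq0 (gt_eqF (N0 i)) orbF.
  by move/eqP; exact: sqnormC_eq0.
exists (range comb); split.
- by move=> _ [c _ <-]; have [] := form c.
- by exists w.
- apply: ge_sup.
    exists (rayleigh (dom a) b (comb (fun=> 1))); exists (comb (fun=> 1)) => //; split; first by exists (fun=> 1).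
    by move=> /nz /(_ (Ordinal k0)) /eqP; rewrite oner_eq0.
  move=> _ [u [[c _ <-] cz] <-]; have [Hc _ Qc] := form c; have [Lc _] := Hc.
  rewrite /rayleigh ler_pdivrMr// lt_neqAle L2sqnorm_ge0 andbT; apply/eqP => E; apply: cz.
  by apply/(L2_ae_zero Lc).
Qed.

Lemma lambda_le a b k (L : R) (M : set (pt -> R[i])) : M `<=` H1A (dom a) b ->
  subspace_of_dim (dom a) k M ->
  sup [set rayleigh (dom a) b u | u in M `\` ae_zero (dom a)] <= L -> lambda (dom a) b k <= L.
Proof.
move=> MH Md; apply: le_trans; apply: ge_inf; last by exists M.
by exists 0 => _ [M' [_ _ ->]]; exact: rayleigh_sup_ge0.
Qed.

(** The trial space shows that the infimum is taken over a nonempty set, as otherwise [inf] would be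
    a default value. Each competing space contains a nonzero vector that meets the constraints. *)
Lemma lambda_ge a b k (L : R) : 0 < a -> 0 < b -> (0 < k)%N ->
  (exists M, M `<=` H1A (dom a) b /\ subspace_of_dim (dom a) k M) ->
  (forall u, H1A (dom a) b u -> (forall m, (0 < m < k)%N -> moment a b m u = 0) ->
     L * L2sqnorm (dom a) u <= qform (dom a) b u) -> L <= lambda (dom a) b k.
Proof.
move=> a0 b0 k0 [M0 [MH0 Md0]] HL; apply: lb_le_inf.
  by exists (sup [set rayleigh (dom a) b u | u in M0 `\` ae_zero (dom a)]); exists M0.
move=> _ [M [MH [w [indep ME]] ->]]; rewrite ME; apply: rayleigh_sup_ge => // i.
apply: MH; rewrite ME; exists (fun j => (j == i)%:R) => //.
apply/funext => z; rewrite (bigD1 i)//= eqxx mul1r big1 ?addr0// => j /negbTE ->.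
by rewrite mul0r.
Qed.

Lemma profile_subspace a b k m0 (g : nat -> R) (L : R) : 0 < a -> 0 < b -> (0 < m0)%N -> (0 < k)%N ->
  (forall i, 0 <= g i) ->
  (forall i, (i < k)%N -> \int[leb]_(s in 'I[a,oo]) mode_energy b (m0 + i) (tprof (g i) b (m0 + i)) (tprof' (g i) b (m0 + i)) s <=
     L * \int[leb]_(s in 'I[a,oo]) (s ^+ (m0 + i) * tprof (g i) b (m0 + i) s ^+ 2)) ->
  exists M, [/\ M `<=` H1A (dom a) b, subspace_of_dim (dom a) k M &
    sup [set rayleigh (dom a) b u | u in M `\` ae_zero (dom a)] <= L].
Proof.
move=> a0 b0 m00 k0 g0 EL.
apply: (trial_subspace (h := fun i => tprof (g i) b (m0 + i)) (h' := fun i => tprof' (g i) b (m0 + i)) a0 m00 k0) => //.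
- by move=> i; have [] := measurable_tprof (g i) b (m0 + i).
- by move=> i; have [] := measurable_tprof (g i) b (m0 + i).
- by move=> i s s0; exact: der_tprof.
- by move=> i s s0; exact: continuous_tprof'.
- by move=> i; exact: itg_trial_norm.
- by move=> i; have [] := trial_energy (m0 + i) a0 b0 (g0 i).
- by move=> i; exact: trial_norm_gt0.
Qed.

Lemma lambda1_lt a b : 0 < a -> 0 < b -> lambda (dom a) b 1 < b.
Proof.
(* Any angular momentum above b a / 2 makes the boundary term favourable, whatever the size of
   [b]. *)
move=> a0 b0; pose m := (Num.bound (b * a / 2)).+1.
have tm : b * a / 2 < m%:R.
  have t0 : 0 <= b * a / 2 by rewrite divr_ge0// mulr_ge0// ltW.
  by apply: (lt_trans (archi_boundP t0)); rewrite ltr_nat.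
have [e e0 He] := trial_strict a0 b0 (ltn0Sn _ : (0 < m)%N) tm.
have [|M [MH Md MS]] := @profile_subspace a b 1 m (fun=> 0) (b - e) a0 b0 isT isT (fun=> lexx 0).
  by case=> // _; rewrite addn0.
by apply: le_lt_trans (lambda_le MH Md MS) _; rewrite ltrBlDr ltrDl.
Qed.

Lemma lambda_two_sided k : (0 < k)%N -> exists2 C : R, 0 < C & exists2 dl : R, 0 < dl &
  forall a b, 0 < a -> 0 < b -> b * a / 2 <= dl ->
  `|lambda (dom a) b k - (b - 2 * b * (b * a / 2) ^+ k / k.-1`!%:R)| <=
  C * (2 * b * (b * a / 2) ^+ k / k.-1`!%:R * Num.sqrt (b * a / 2)).
Proof.
move=> k0; have [C C0 [dl dl0 HC]] := @constrained_lower R k k0.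
(* The lower bound has the error C sqrt t and the upper bound the error 7 t, which is at most 7 sqrt
   t. The threshold 1 / 7 keeps the factor 1 - 7 t nonnegative. *)
exists (C + 7); first by rewrite addr_gt0.
exists (Num.min dl (1 / 7)); first by rewrite lt_min dl0/= divr_gt0.
move=> a b a0 b0; rewrite le_min => /andP[tdl t7]; set t := b * a / 2 in tdl t7 *.
have t0 : 0 < t by rewrite divr_gt0// mulr_gt0.
pose S := 2 * b * t ^+ k / k.-1`!%:R.
have S0 : 0 <= S by rewrite divr_ge0// mulr_ge0 ?exprn_ge0 ?(ltW t0)// mulr_ge0// ltW.
have sq0 : 0 <= Num.sqrt t := sqrtr_ge0 t.
have tsq : t <= Num.sqrt t.
  rewrite -[X in X <= _](sqr_sqrtr (ltW t0)) expr2 ler_piMr// -sqrtr1 ler_wsqrtr//; lra.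
(* The trial space consists of the modes 1, ..., k, and [tr_lam_homo] bounds each of them by the
   value of the last. *)
have [| |M [MH Md MS]] := @profile_subspace a b k 1 (fun i => a ^+ (1 + i)) (tr_lam a b k) a0 b0 isT k0.
- by move=> i; rewrite exprn_ge0// ltW.
- move=> i ik; have m0 : (0 < 1 + i)%N by [].
  apply: le_trans (trial_asym a0 b0 m0 t7) _; apply: ler_wpM2r.
    by apply: ltW; apply: trial_norm_gt0 => //; rewrite exprn_ge0// ltW.
  by apply: tr_lam_homo.
have up := lambda_le MH Md MS.
have lo : b - tr_eps a b C k <= lambda (dom a) b k.
  by apply: lambda_ge => //; [exists M|move=> u Hu; exact: HC].
rewrite -/S; have upE : tr_lam a b k = b - S * (1 - 7 * t) by [].
have loE : tr_eps a b C k = S * (1 + C * Num.sqrt t) by [].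
rewrite upE in up; rewrite loE in lo.
have H1 : S * t <= S * Num.sqrt t by rewrite ler_wpM2l.
have H3 : 0 <= S * Num.sqrt t := mulr_ge0 S0 sq0.
have H2 : 0 <= C * (S * Num.sqrt t) := mulr_ge0 (ltW C0) H3.
rewrite mulrDr mulr1 mulrCA in lo; rewrite mulrBr mulr1 mulrCA in up.
move: (lambda _ _ _) up lo H1 H2 H3 => l up lo H1 H2 H3.
rewrite ler_norml mulrDl; apply/andP; split; lra.
Qed.

(** The eigenvalue equation is tested with [u] itself. *)
Lemma ground_state_qform a b u : ground_state (dom a) b u ->
  qform (dom a) b u = lambda (dom a) b 1 * L2sqnorm (dom a) u.
Proof.
move=> [_ [Hu _ /(_ u Hu) E]]; have [Lu _] := Hu.
have := congr1 (@complex.Re R) E; rewrite L2inner_Z// L2inner_self /= mulr0 subr0 => <-.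
rewrite /qform_polar Re_sum; apply: eq_bigr => j _.
by rewrite L2inner_self.
Qed.

Lemma ground_state_not_radial a b u : 0 < a -> 0 < b -> ground_state (dom a) b u -> ~ radial (dom a) u.
Proof.
move=> a0 b0 gu ru; have E := ground_state_qform gu; have [nz [Hu _ _]] := gu.
have [Lu _] := Hu; have := radial_lower a0 b0 Hu ru; rewrite E.
have N0 : 0 < L2sqnorm (dom a) u.
  rewrite lt_neqAle L2sqnorm_ge0 andbT; apply/eqP => N; apply: nz; exact/(L2_ae_zero Lu).
by rewrite ler_pM2r// leNgt lambda1_lt.
Qed.

End eigenvalue_bounds.

Theorem theorem1p1 (R : realType) (r : R) (hr : 0 < r) :
  (forall b : R, 0 < b ->
     forall u, ground_state (exterior (disk r)) b u ->
       ~ radial (exterior (disk r)) u) /\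
  (forall k : nat, (1 <= k)%N ->
     exists C : R, \forall b \near 0^'+,
       `| lambda (exterior (disk r)) b k
          - (b - r ^+ (2 * k) / (2 ^+ k.-1 * (k.-1)`!%:R) * b ^+ k.+1) |
       <= C * b `^ (k%:R + 3 / 2)).
Proof.
rewrite exterior_disk//; have a0 : 0 < r ^+ 2 by rewrite exprn_gt0.
split=> [b b0 u gu|k k0]; first exact: ground_state_not_radial gu.
have [C C0 [dl dl0 H]] := @lambda_two_sided R k k0.
move: (r ^+ 2) a0 (exprM r 2 k) => a a0 rk.
pose c := a ^+ k / (2 ^+ k.-1 * k.-1`!%:R).
exists (C * (c * Num.sqrt (a / 2))); near=> b.
have b0 : 0 < b by near: b; exact: nbhs_right_gt.
have bdl : b * a / 2 <= dl.
  rewrite -mulrA -ler_pdivlMr ?divr_gt0//; near: b.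
  by apply: nbhs_right_le; rewrite divr_gt0// divr_gt0.
(* With t = a b / 2 the factor 2 t^k leaves 2^(k - 1) in the denominator; the remaining sqrt t in
   the error supplies the half power of [b]. *)
have SE : 2 * b * (b * a / 2) ^+ k / k.-1`!%:R = c * b ^+ k.+1.
  have f0 := @fact_neq0 R k.-1; have kE : (2 : R) ^+ k = 2 * 2 ^+ k.-1 by rewrite -exprS prednK.
  rewrite /c exprMn exprMn exprVn exprS kE.
  have p0 : (2 : R) ^+ k.-1 != 0 by rewrite expf_neq0.
  move: (a ^+ k) (b ^+ k) (2 ^+ k.-1) p0 (k.-1`!%:R) f0 => A B P P0 F F0.
  by field; rewrite P0 F0.
have := H a b a0 b0 bdl; rewrite SE rk -/c => Hb; apply: le_trans Hb _.
rewrite le_eqVlt; apply/orP; left; apply/eqP.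
have -> : b `^ (k%:R + 3 / 2) = b ^+ k.+1 * Num.sqrt b.
  rewrite (_ : k%:R + 3 / 2 = k.+1%:R + 2^-1); last by rewrite -natr1; field.
  by rewrite powRD ?gt_eqF ?implybT// powR_mulrn ?ltW// powR12_sqrt ?ltW.
have -> : Num.sqrt (b * a / 2) = Num.sqrt b * Num.sqrt (a / 2) by rewrite -mulrA sqrtrM// ltW.
by move: (Num.sqrt b) (Num.sqrt _) (b ^+ _) => X Y Z; ring.
Unshelve. all: by end_near. Qed.
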